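(* Let $n\geq 2$. There is a smooth family $U_{\varepsilon}$, $\varepsilon\in(0,1)$, of ellipsoidal shells in $\mathbb{R}^{2n}$ (with the restriction of the standard symplectic form) such that, for the spherical capacity $s$, the function $(0,1)\ni\varepsilon\mapsto s(U_{\varepsilon})$ is not continuous.
   Context: $\mathbb{R}^{2n}$ has coordinates $(x_1,y_1,\ldots,x_n,y_n)$ and standard symplectic form $\omega_{\mathrm{st}}=\sum_j \mathrm{d}x_j\wedge \mathrm{d}y_j$; open subsets of $\mathbb{R}^{2n}$ carry its restriction. $B_r\subset\mathbb{R}^{2n}$ is the open ball of radius $r$ centred at $0$, and $S^{2n-1}_r=\partial B_r$. A symplectic embedding of $S^{2n-1}_r$ into a symplectic manifold $(V,\omega)$ of dimension $2n$ means a symplectic embedding into $(V,\omega)$ of some open neighbourhood of $S^{2n-1}_r$ in $\mathbb{R}^{2n}$. The spherical capacity of a symplectic manifold $(V,\omega)$ of dimension $2n\geq 4$ is $$s(V,\omega)=\sup\{\pi r^2 \mid \text{there is a symplectic embedding } S^{2n-1}_r\hookrightarrow (V,\omega)\}\in[0,\infty].$$ For $r_1,\ldots,r_n>0$ the open ellipsoid with symplectic half axes $r_1,\ldots,r_n$ is $$E(r_1,\ldots,r_n)=\Big\{\tfrac{x_1^2+y_1^2}{r_1^2}+\ldots+\tfrac{x_n^2+y_n^2}{r_n^2}<1\Big\}\subset\mathbb{R}^{2n}.$$ An ellipsoidal shell is a set of the form $aE\setminus\overline{bE}$ with $E=E(r_1,\ldots,r_n)$ an open ellipsoid for some $r_1,\ldots,r_n>0$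 and $0<b<a$; for example $(1+\varepsilon)E\setminus\overline{(1-\varepsilon)E}$ with $\varepsilon\in(0,1)$. A family of such domains with smooth boundary is smooth if the boundaries fit into a smooth isotopy of embeddings (i.e. the boundary hypersurfaces are the images of embeddings of a fixed closed manifold that depend smoothly on the parameter $\varepsilon$). *)

(* Defs.v *)
From HB Require Import structures.
From mathcomp Require Import all_boot all_order all_algebra.
From mathcomp Require Import all_classical all_reals all_analysis.
Set Implicit Arguments.
Unset Strict Implicit.
Unset Printing Implicit Defensive.
Import Order.TTheory GRing.Theory Num.Theory.
Import numFieldNormedType.Exports.
Local Open Scope classical_set_scope.
Local Open Scope ring_scope.

(* For D open and V finite-dimensional, [Ck_on k D f] says that f is k times
   continuously differentiable on D; f is unconstrained outside D. *)
Fixpoint Ck_on (R : realType) (V W : normedModType R) (k : nat) (D : set V)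
    (f : V -> W) : Prop :=
  match k with
  | 0%N => forall x, D x -> {for x, continuous f}
  | k'.+1 => (forall x, D x -> differentiable f x) /\
             (forall v, Ck_on k' D ('D_v f))
  end.

Definition smooth_on (R : realType) (V W : normedModType R) (D : set V)
    (f : V -> W) : Prop := forall k, Ck_on k D f.

Definition immersion_on (R : realType) (V W : normedModType R) (D : set V)
    (f : V -> W) : Prop := forall x v, D x -> 'd f x v = 0 -> v = 0.

(* f restricts to a homeomorphism from D onto f(D), both with the subspace
   topology. *)
Definition topological_embedding_on (S T : topologicalType) (D : set S)
    (f : S -> T) : Prop :=
  [/\ {within D, continuous f},
      set_inj D f &
      forall A, open A -> exists2 B, open B & f @` (D `&` A) = f @` D `&` B].

(* No boundary, not necessarily connected; second countability follows from
   compactness and the existence of charts.  [param i] is the inverse of the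
   chart [chart i], and is relevant only on the image of [chart_dom i]. *)
Record closed_manifold (R : realType) (d : nat) := ClosedManifold {
  carrier :> topologicalType;
  chart_index : Type;
  chart_dom : chart_index -> set carrier;
  chart : chart_index -> carrier -> 'rV[R]_d;
  param : chart_index -> 'rV[R]_d -> carrier;
  manifold_hausdorff : hausdorff_space carrier;
  manifold_compact : compact [set: carrier];
  chart_cover : \bigcup_i chart_dom i = [set: carrier];
  chart_dom_open : forall i, open (chart_dom i);
  chart_cod_open : forall i, open (chart i @` chart_dom i);
  chartK : forall i x, chart_dom i x -> param i (chart i x) = x;
  chart_continuous : forall i x, chart_dom i x -> {for x, continuous (chart i)};
  param_continuous : forall i u, (chart i @` chart_dom i) u ->
    {for u, continuous (param i)};
  transition_smooth : forall i j,
    smooth_on (chart i @` (chart_dom i `&` chart_dom j)) (chart j \o param i) }.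

Definition chart_cod (R : realType) (d : nat) (M : closed_manifold R d)
    (i : chart_index M) : set 'rV[R]_d := chart i @` chart_dom i.

Definition manifold_embedding (R : realType) (d : nat)
    (M : closed_manifold R d) (V : normedModType R) (f : M -> V) : Prop :=
  [/\ forall i, smooth_on (chart_cod i) (f \o param i),
      forall i, immersion_on (chart_cod i) (f \o param i) &
      topological_embedding_on [set: M] f].

Definition smooth_isotopy (R : realType) (d : nat) (M : closed_manifold R d)
    (V : normedModType R) (F : R -> M -> V) : Prop :=
  (forall i : chart_index M,
     @smooth_on R (R^o * 'rV[R]_d)%type V (`]0, 1[%classic `*` chart_cod i)
       (fun p => F p.1 (param i p.2))) /\
  (forall e, 0 < e < 1 -> manifold_embedding (F e)).

Definition frontier (T : topologicalType) (A : set T) : set T :=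
  closure A `\` interior A.

Definition smooth_domain_family (R : realType) (m : nat)
    (U : R -> set 'rV[R]_m) : Prop :=
  exists (M : closed_manifold R m.-1) (F : R -> M -> 'rV[R]_m),
    smooth_isotopy F /\
    (forall e, 0 < e < 1 -> range (F e) = frontier (U e)).

(* [mxvec_index] is row-major, so the coordinates of a vector are ordered as
   (x_1, y_1, ..., x_n, y_n). *)
Definition xc (R : realType) (n : nat) (j : 'I_n) (v : 'rV[R]_(n * 2)) : R :=
  v 0 (mxvec_index j (0 : 'I_2)).
Definition yc (R : realType) (n : nat) (j : 'I_n) (v : 'rV[R]_(n * 2)) : R :=
  v 0 (mxvec_index j (1 : 'I_2)).

Definition omega_st (R : realType) (n : nat) (u v : 'rV[R]_(n * 2)) : R :=
  \sum_(j < n) (xc j u * yc j v - xc j v * yc j u).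

(* The library norm on row vectors is the sup norm, hence the explicit
   Euclidean formula. *)
Definition sphere (R : realType) (n : nat) (r : R) : set 'rV[R]_(n * 2) :=
  [set v | \sum_(j < n) (xc j v ^+ 2 + yc j v ^+ 2) = r ^+ 2].

Definition symplectic_embedding (R : realType) (n : nat)
    (W U : set 'rV[R]_(n * 2)) (f : 'rV[R]_(n * 2) -> 'rV[R]_(n * 2)) : Prop :=
  [/\ smooth_on W f, immersion_on W f, topological_embedding_on W f,
      f @` W `<=` U &
      forall x u v, W x -> omega_st ('d f x u) ('d f x v) = omega_st u v].

Definition sphere_embeds (R : realType) (n : nat) (r : R)
    (U : set 'rV[R]_(n * 2)) : Prop :=
  exists (W : set 'rV[R]_(n * 2)) (f : 'rV[R]_(n * 2) -> 'rV[R]_(n * 2)),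
    [/\ open W, sphere r `<=` W & symplectic_embedding W U f].

(* The spherical capacity of (U, omega_st) for U open in R^(2n).  The element 0
   makes this the supremum in [0, +oo], also when no sphere embeds. *)
Definition spherical_capacity (R : realType) (n : nat)
    (U : set 'rV[R]_(n * 2)) : \bar R :=
  ereal_sup (0%:E |`
    [set (pi * r ^+ 2)%:E | r in [set r : R | 0 < r /\ sphere_embeds r U]]).

Definition ellipsoid (R : realType) (n : nat) (r : 'I_n -> R) :
    set 'rV[R]_(n * 2) :=
  [set v | \sum_(j < n) (xc j v ^+ 2 + yc j v ^+ 2) / r j ^+ 2 < 1].

Definition scale_set (R : realType) (V : lmodType R) (a : R) (A : set V) :
    set V := [set a *: v | v in A].

Definition ellipsoidal_shell (R : realType) (n : nat)
    (U : set 'rV[R]_(n * 2)) : Prop :=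
  exists (r : 'I_n -> R) (a b : R),
    [/\ forall j, 0 < r j, 0 < b < a &
        U = scale_set a (ellipsoid r) `\` closure (scale_set b (ellipsoid r))].

(* Main.v *)
Require Import Defs.
From mathcomp Require Import all_boot all_order all_algebra.
From mathcomp Require Import all_classical all_reals all_analysis.
From mathcomp Require Import fingroup perm ring lra zify.

(** Let [U e] be the image of a thin round annulus [b < |z| < a] under the volume preserving map scaling one
    symplectic plane by [1 / p] and another one by [p], where [p = 1 + 400 e^2].  A sphere of radius [r] embedded
    in [U e] bounds a region with the volume of the ball of radius [r], because the primitive of the symplectic form
    pulls back to the standard one up to an exact form.  If the region does not contain the hole of the shell, it
    lies in the shell, whose volume is tiny, so that [r] is small; otherwise [r] is bounded below.  Hence the
    capacity of [U e] avoids an interval.  For small [e] the shell contains a round sphere of radius about [b], and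
    the capacity lies above that interval.  For [e = 1/2] the shell lies in a cylinder over a small disc, and no
    sphere surrounds the hole: otherwise the Hamiltonian which vanishes on the region, drops the height [pi r^2]
    across the sphere and grows quadratically outside of the cylinder would have, by a minimax argument on discrete
    loops, a closed orbit of positive but small action, while its closed orbits on the collar of the sphere have
    action at least about [pi r^2].  The capacity jumps across the interval, and the parameter interval is connected. *)

Set Implicit Arguments.
Unset Strict Implicit.
Unset Printing Implicit Defensive.
Import Order.TTheory GRing.Theory Num.Theory.
Import numFieldNormedType.Exports.
Local Open Scope classical_set_scope.
Local Open Scope ring_scope.

(** The region bounded by an embedded sphere is built without a separation theorem: the increments
    of a profile dropping from 1 to 0 across the collar, extended by zero, form a cocycle on the
    whole space, and its primitive, truncated to values between 0 and 1, is a smoothed indicator of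
    the region. Volumes are values of a positive translation invariant functional on Lipschitz
    functions of bounded support; that symplectic maps preserve it is deduced from its uniqueness.
    Periodic orbits become loops of [N] points obeying the trapezoidal rule. In discrete Fourier
    modes their action is a quadratic form minus an averaged Hamiltonian, so the minimax takes place
    in finite dimension, with the Poincare-Miranda theorem for the linking. In a cylinder over a
    disc of area [pi C] it yields action at most [18 C], and closed orbits in the collar have action
    above [r ^+ 2]; this explains the flattening to [C = 1 / 400] against the lower bound
    [r ^+ 2 > 1 / 17]. The condition [n >= 2] provides a second plane, through which a Hopf circle
    is contracted inside its sphere; hence its action survives any symplectic embedding of the
    collar. *)

Section Toolkit.
Variable R : realType.

Lemma continuous_eps (V W : normedModType R) (f : V -> W) :
  continuous f <-> forall x (e : R), 0 < e -> exists2 d : R, 0 < d &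
    forall y, `|y - x| < d -> `|f y - f x| < e.
Proof.
split=> [cf x e e0|H x].
  have /cvgrPdist_lt /(_ _ e0) /nbhs_ballP [d /= d0 dP] := cf x.
  exists d => // y yx; rewrite distrC; apply: dP.
  by rewrite -ball_normE /= distrC.
apply/cvgrPdist_lt => e e0; have [d d0 dP] := H x e e0.
apply/nbhs_ballP; exists d => //= y; rewrite -ball_normE /= => yx.
by rewrite distrC; apply: dP; rewrite distrC.
Qed.

Section ContinuousOps.
Variables (T : topologicalType) (V : normedModType R).
Implicit Types (f g : T -> V) (a b : T -> R).

Lemma ctB f g : continuous f -> continuous g -> continuous (fun x => f x - g x).
Proof. by move=> cf cg x; apply: continuousB; [exact: cf|exact: cg]. Qed.

Lemma ctZ a f : continuous a -> continuous f -> continuous (fun x => a x *: f x).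
Proof. by move=> cf cg x; apply: continuousZ; [exact: cf|exact: cg]. Qed.

Lemma ctM a b : continuous a -> continuous b -> continuous (fun x => a x * b x).
Proof. by move=> cf cg x; apply: continuousM; [exact: cf|exact: cg]. Qed.

Lemma ctX a n : continuous a -> continuous (fun x => a x ^+ n).
Proof.
move=> ca; elim: n => [|n IH]; first by move=> x; exact: cst_continuous.
have -> : (fun x => a x ^+ n.+1) = (fun x => a x * a x ^+ n).
  by apply/funext => x; rewrite exprS.
exact: ctM.
Qed.

Lemma ct_sum (I : Type) (r : seq I) (P : pred I) (F : I -> T -> R) :
  (forall i, continuous (F i)) -> continuous (fun x => \sum_(i <- r | P i) F i x).
Proof.
move=> cF; elim: r => [|i r IH].
  have -> : (fun x => \sum_(i <- [::] | P i) F i x) = fun=> 0 by apply/funext => x; rewrite big_nil.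
  by move=> x; exact: cst_continuous.
have -> : (fun x => \sum_(i <- i :: r | P i) F i x) =
    (fun x => (if P i then F i x else 0) + \sum_(i <- r | P i) F i x).
  by apply/funext => x; rewrite big_cons; case: ifP => //; rewrite add0r.
move=> x; apply: continuousD; last exact: IH.
by case: (P i); [exact: cF|exact: cst_continuous].
Qed.

Lemma ct_cst (c : V) : continuous (fun _ : T => c).
Proof. by move=> x; exact: cst_continuous. Qed.

End ContinuousOps.

Lemma ct_comp (T U V : topologicalType) (f : T -> U) (g : U -> V) :
  continuous f -> continuous g -> continuous (fun x => g (f x)).
Proof. by move=> cf cg x; apply: continuous_comp; [exact: cf|exact: cg]. Qed.

Lemma ct_id (T : topologicalType) : continuous (fun x : T => x).
Proof. by move=> x. Qed.

Lemma lipschitz_continuous (V W : normedModType R) (f : V -> W) (k : R) :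
  (forall x y, `|f y - f x| <= k * `|y - x|) -> continuous f.
Proof.
move=> fk; apply/continuous_eps => x e e0.
have k0 : 0 < `|k| + 1 by rewrite ltr_wpDl.
exists (e / (`|k| + 1)); first exact: divr_gt0.
move=> y; rewrite ltr_pdivlMr // => yx.
apply: le_lt_trans yx; apply: le_trans (fk _ _) _.
rewrite mulrC ler_wpM2l //; apply: le_trans (ler_norm k) _.
by rewrite lerDl.
Qed.

Lemma coord_le m (u : 'rV[R]_m) i : `|u 0 i| <= `|u|.
Proof.
by rewrite [leRHS]/Num.norm /= mx_normrE (le_bigmax _ (fun p => `|u p.1 p.2|) (0, i)).
Qed.

Lemma coordB_le m (u v : 'rV[R]_m) i : `|u 0 i - v 0 i| <= `|u - v|.
Proof. by have := coord_le (u - v) i; rewrite !mxE. Qed.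

Lemma norm_rVP m (u : 'rV[R]_m) (c : R) : 0 <= c ->
  (forall i, `|u 0 i| <= c) -> `|u| <= c.
Proof.
move=> c0 H; rewrite [leLHS]/Num.norm /= mx_normrE; apply/bigmax_leP.
by split=> // -[i j] _ /=; rewrite ord1.
Qed.

Lemma coord_continuous_rV m (i : 'I_m) : continuous (fun u : 'rV[R]_m => u 0 i).
Proof.
apply: (@lipschitz_continuous _ _ _ 1) => x y.
by rewrite mul1r; have := coord_le (y - x) i; rewrite !mxE.
Qed.

Lemma bounded_seq_cluster m (u : nat -> 'rV[R]_m) (B : R) :
  (forall k, `|u k| <= B) ->
  exists x, forall e : R, 0 < e -> forall N, exists k, (N <= k)%N /\ `|u k - x| < e.
Proof.
move=> uB.
have cB : compact [set v : 'rV[R]_m | forall i, `[- B, B]%classic (v 0 i)].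
  by apply: (@rV_compact R m (fun=> `[- B, B]%classic)) => i; exact: segment_compact.
have [|x [_ cx]] := cB (u @ \oo) (fmap_proper_filter u _).
  exists 0%N => // k _ i /=; rewrite in_itv /= -ler_norml.
  exact: le_trans (coord_le _ _) (uB k).
exists x => e e0 N.
have [||y [[k Nk <-] /=]] := cx (u @` [set k | (N <= k)%N]) (ball x e).
- by exists N => // k Nk; exists k.
- exact: nbhsx_ballx.
rewrite -ball_normE /= => xy; exists k; split => //; by rewrite distrC.
Qed.

(** * Euclidean geometry of row vectors *)

Definition dot m (u v : 'rV[R]_m) := \sum_i u 0 i * v 0 i.
Definition n2 m (u : 'rV[R]_m) := dot u u.

Lemma dotC m (u v : 'rV[R]_m) : dot u v = dot v u.
Proof. by apply: eq_bigr => i _; rewrite mulrC. Qed.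

Lemma dotDl m (u v w : 'rV[R]_m) : dot (u + v) w = dot u w + dot v w.
Proof. by rewrite -big_split; apply: eq_bigr => i _; rewrite !mxE mulrDl. Qed.

Lemma dotZl m a (u w : 'rV[R]_m) : dot (a *: u) w = a * dot u w.
Proof. by rewrite /dot mulr_sumr; apply: eq_bigr => i _; rewrite !mxE mulrA. Qed.

Lemma dotDr m (u v w : 'rV[R]_m) : dot w (u + v) = dot w u + dot w v.
Proof. by rewrite dotC dotDl !(dotC w). Qed.

Lemma dotZr m a (u w : 'rV[R]_m) : dot w (a *: u) = a * dot w u.
Proof. by rewrite dotC dotZl dotC. Qed.

Lemma dotNl m (u w : 'rV[R]_m) : dot (- u) w = - dot u w.
Proof. by rewrite -scaleN1r dotZl mulN1r. Qed.

Lemma dotNr m (u w : 'rV[R]_m) : dot w (- u) = - dot w u.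
Proof. by rewrite dotC dotNl dotC. Qed.

Lemma dotBl m (u v w : 'rV[R]_m) : dot (u - v) w = dot u w - dot v w.
Proof. by rewrite dotDl dotNl. Qed.

Lemma dotBr m (u v w : 'rV[R]_m) : dot w (u - v) = dot w u - dot w v.
Proof. by rewrite dotDr dotNr. Qed.

Lemma dot0l m (w : 'rV[R]_m) : dot 0 w = 0.
Proof. by rewrite -(scale0r 0) dotZl mul0r. Qed.

Lemma dot0r m (w : 'rV[R]_m) : dot w 0 = 0.
Proof. by rewrite dotC dot0l. Qed.

Lemma dot_suml m (I : finType) (P : pred I) (F : I -> 'rV[R]_m) w :
  dot (\sum_(i | P i) F i) w = \sum_(i | P i) dot (F i) w.
Proof.
by apply: (big_morph (fun u => dot u w)) => [u v|]; rewrite ?dotDl ?dot0l.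
Qed.

Lemma dot_sumr m (I : finType) (P : pred I) (F : I -> 'rV[R]_m) w :
  dot w (\sum_(i | P i) F i) = \sum_(i | P i) dot w (F i).
Proof. by rewrite dotC dot_suml; apply: eq_bigr => i _; rewrite dotC. Qed.

Lemma dot_delta m (u : 'rV[R]_m) i : dot u (delta_mx 0 i) = u 0 i.
Proof.
rewrite /dot (bigD1 i) //= mxE !eqxx mulr1 big1 ?addr0 // => j ji.
by rewrite mxE eqxx (negPf ji) mulr0.
Qed.

Lemma dot_mulmx m p (u : 'rV[R]_m) (v : 'rV[R]_p) (A : 'M[R]_(m, p)) :
  dot (u *m A) v = dot u (v *m A^T).
Proof.
rewrite /dot; under eq_bigr => i _ do rewrite mxE mulr_suml.
rewrite exchange_big; apply: eq_bigr => i _.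
rewrite mxE mulr_sumr; apply: eq_bigr => j _.
by rewrite mxE -mulrA (mulrC (A _ _)).
Qed.

Lemma dot_le m (u v : 'rV[R]_m) : `|dot u v| <= m%:R * (`|u| * `|v|).
Proof.
apply: le_trans (ler_norm_sum _ _ _) _.
rewrite -[m in m%:R]card_ord -sum1_card natr_sum mulr_suml; apply: ler_sum => i _.
by rewrite mul1r normrM ler_pM // coord_le.
Qed.

Lemma n2_ge0 m (u : 'rV[R]_m) : 0 <= n2 u.
Proof. by apply: sumr_ge0 => i _; rewrite -expr2 sqr_ge0. Qed.

Lemma n2_le m (u : 'rV[R]_m) : n2 u <= m%:R * `|u| ^+ 2.
Proof. by have := dot_le u u; rewrite ger0_norm ?n2_ge0 // expr2. Qed.

Lemma coord_sqr_le m (u : 'rV[R]_m) i : u 0 i ^+ 2 <= n2 u.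
Proof.
rewrite /n2 /dot (bigD1 i) //= expr2 lerDl sumr_ge0 // => j _.
by rewrite -expr2 sqr_ge0.
Qed.

Lemma norm_sqr_le m (u : 'rV[R]_m) : `|u| ^+ 2 <= n2 u.
Proof.
have u0 := normr_ge0 u.
rewrite -[leRHS]sqr_sqrtr ?n2_ge0 // ler_pXn2r ?nnegrE ?sqrtr_ge0 //.
apply: norm_rVP => [|i]; first exact: sqrtr_ge0.
by rewrite -sqrtr_sqr ler_wsqrtr // coord_sqr_le.
Qed.

Lemma n2_eq0 m (u : 'rV[R]_m) : (n2 u == 0) = (u == 0).
Proof.
apply/eqP/eqP => [u0|->]; last exact: dot0l.
apply/eqP; rewrite -normr_eq0 -sqrf_eq0; apply/eqP/le_anti.
by rewrite sqr_ge0 andbT -[leRHS]u0 norm_sqr_le.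
Qed.

Lemma n2Z m a (u : 'rV[R]_m) : n2 (a *: u) = a ^+ 2 * n2 u.
Proof. by rewrite /n2 dotZl dotZr mulrA expr2. Qed.

Lemma n2N m (u : 'rV[R]_m) : n2 (- u) = n2 u.
Proof. by rewrite /n2 dotNl dotNr opprK. Qed.

Lemma n2D m (u v : 'rV[R]_m) : n2 (u + v) = n2 u + 2 * dot u v + n2 v.
Proof. by rewrite /n2 dotDl !dotDr (dotC v u); ring. Qed.

Lemma n2B m (u v : 'rV[R]_m) : n2 (u - v) = n2 u - 2 * dot u v + n2 v.
Proof. by rewrite n2D dotNr n2N mulrN. Qed.

Lemma n2D_le m (u v : 'rV[R]_m) : n2 (u + v) <= 2 * n2 u + 2 * n2 v.
Proof. by have := n2_ge0 (u - v); rewrite n2B n2D; lra. Qed.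

Lemma n2_gt0 m (u : 'rV[R]_m) : (0 < n2 u) = (u != 0).
Proof. by rewrite lt_def n2_ge0 andbT n2_eq0. Qed.

Lemma cauchy_schwarz m (u v : 'rV[R]_m) : dot u v ^+ 2 <= n2 u * n2 v.
Proof.
have [->|v0] := eqVneq v 0; first by rewrite dot0r /n2 dot0l expr0n mulr0.
have v2 : 0 < n2 v by rewrite n2_gt0.
have := n2_ge0 (n2 v *: u - dot u v *: v).
rewrite n2B !n2Z dotZl dotZr => H.
have {}H : 0 <= n2 v * (n2 u * n2 v - dot u v ^+ 2).
  by apply: le_trans H _; rewrite le_eqVlt; apply/orP; left; apply/eqP; ring.
by move: H; rewrite pmulr_rge0 // subr_ge0.
Qed.

Lemma mulmx_norm_le m p (A : 'M[R]_(m, p)) : exists2 c, 0 < c &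
  forall u : 'rV[R]_m, `|u *m A| <= c * `|u|.
Proof.
have S0 : 0 <= \sum_i \sum_j `|A i j| by apply: sumr_ge0 => i _; apply: sumr_ge0.
exists (1 + \sum_i \sum_j `|A i j|) => [|u]; first by rewrite ltr_wpDr.
have c0 : 0 <= (1 + \sum_i \sum_j `|A i j|) * `|u|.
  by rewrite mulr_ge0 // addr_ge0.
apply: norm_rVP => // j; rewrite mxE; apply: le_trans (ler_norm_sum _ _ _) _.
apply: (@le_trans _ _ (\sum_i `|A i j| * `|u|)).
  by apply: ler_sum => i _; rewrite normrM mulrC ler_wpM2l // coord_le.
rewrite -mulr_suml ler_wpM2r // ler_wpDl //; apply: ler_sum => i _.
by rewrite (bigD1 j) //= lerDl sumr_ge0.
Qed.

Lemma mulmx_continuous m p (A : 'M[R]_(m, p)) :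
  continuous (fun u : 'rV[R]_m => u *m A).
Proof.
have [c c0 H] := mulmx_norm_le A.
by apply: (@lipschitz_continuous _ _ _ c) => x y; rewrite -mulmxBl.
Qed.

Lemma n2_diff_le m (x y : 'rV[R]_m) :
  `|n2 y - n2 x| <= m%:R * (`|y| + `|x|) * `|y - x|.
Proof.
have -> : n2 y - n2 x = dot (y + x) (y - x).
  by rewrite /n2 dotDl !dotBr (dotC x y); ring.
apply: le_trans (dot_le _ _) _; rewrite -mulrA ler_wpM2l // ler_wpM2r //.
exact: ler_normD.
Qed.

Lemma n2_continuous m : continuous (@n2 m).
Proof.
apply/continuous_eps => x e e0.
set c := m%:R * (2 * `|x| + 1).
have c0 : 0 <= c by rewrite mulr_ge0 // addr_ge0 // mulr_ge0.
exists (Num.min 1 (e / (c + 1))) => [|y].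
  by rewrite lt_min ltr01 divr_gt0 // ltr_wpDl.
rewrite lt_min ltr_pdivlMr ?ltr_wpDl // => /andP[y1 ye].
apply: le_lt_trans (n2_diff_le _ _) _.
apply: le_lt_trans ye; rewrite mulrC ler_wpM2l //.
apply: (@le_trans _ _ c); last by rewrite lerDl.
rewrite ler_wpM2l //.
have : `|y| <= `|x| + 1.
  by rewrite -[y in `|y|](subrKC x); apply: le_trans (ler_normD _ _) _; rewrite lerD2l ltW.
by lra.
Qed.

Lemma min_on_box m (f : 'rV[R]_m -> R) (A : set 'rV[R]_m) (B : R) :
  continuous f -> (exists x, A x) -> (forall x, A x -> `|x| <= B) -> closed A ->
  exists2 x, A x & forall y, A y -> f x <= f y.
Proof.
move=> cf [x0 Ax0] AB cA.
have cpA : compact A.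
  apply: bounded_closed_compact => //; exists B; split; first exact: num_real.
  by move=> M BM x Ax; apply: le_trans (AB _ Ax) (ltW BM).
have cfA : {within A, continuous f} by exact: continuous_subspaceT.
have [c /set_mem Ac H] := @EVT_min_rV R m f A (ex_intro _ x0 Ax0) cpA cfA.
by exists c => // y Ay; apply: H; exact: mem_set.
Qed.

Lemma archi_inv (e : R) : 0 < e -> exists N, forall k, (N < k)%N -> k%:R^-1 < e.
Proof.
move=> e0; exists (Num.trunc e^-1).+1 => k Nk.
have k0 : 0 < k%:R :> R by rewrite ltr0n; apply: leq_ltn_trans Nk.
rewrite -[ltRHS]invrK ltf_pV2 ?posrE ?invr_gt0 //.
apply: lt_le_trans (_ : (Num.trunc e^-1).+1%:R <= _); last by rewrite ler_nat ltnW.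
exact: truncnS_gt.
Qed.

End Toolkit.

(** * Sperner's lemma and the Poincare-Miranda theorem *)

Section Sperner.
Local Close Scope ring_scope.
Local Close Scope classical_set_scope.

(** Points that are not fixed come in pairs [x], [f x]; the induction removes one such pair at a
    time. *)
Lemma odd_card_involution (T : finType) (D : {set T}) (f : T -> T) :
  {in D, forall x, f x \in D} -> {in D, forall x, f (f x) = x} ->
  odd #|D| = odd #|[set x in D | f x == x]|.
Proof.
elim: {D}_.+1 {-2}D (ltnSn #|D|) => // N IH D DN fD ffD.
have [x /andP[xD fx]|Dfix] := pickP [pred x | (x \in D) && (f x != x)]; last first.
  congr (odd #|pred_of_set _|); apply/setP => x; rewrite inE.
  case xD: (x \in D) => //=; have := Dfix x; rewrite /= xD /= => /negbFE ->.
  by [].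
have fxD := fD x xD.
set D' := D :\ x :\ f x.
have cD : #|D| = #|D'|.+2.
  by rewrite (cardsD1 x D) xD (cardsD1 (f x) (D :\ x)) !inE fx fxD.
have D'P y : (y \in D') = [&& y != f x, y != x & y \in D] by rewrite !inE.
have fD' : {in D', forall y, f y \in D'}.
  move=> y; rewrite !D'P => /and3P[yfx yx yD]; rewrite fD // andbT.
  apply/andP; split; apply/eqP => E.
    by move/eqP: yx; apply; rewrite -(ffD _ yD) E ffD.
  by move/eqP: yfx; apply; rewrite -(ffD _ yD) E.
rewrite cD /= negbK (IH D') => [|||y]; first last.
- by rewrite D'P => /and3P[_ _ yD]; exact: ffD.
- exact: fD'.
- by rewrite -ltnS; apply: leq_trans DN; rewrite cD.
congr (odd #|pred_of_set _|); apply/setP => y; rewrite !inE.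
case: (eqVneq y x) => [->|yx]; first by rewrite (negPf fx) !andbF.
case: (eqVneq y (f x)) => [->|//]; by rewrite ffD // eq_sym (negPf fx) !andbF.
Qed.

Section CubicalSperner.
Variables (M k : nat) (u : {ffun 'I_M -> nat} -> 'I_M -> bool).
Hypothesis u_low : forall (x : {ffun 'I_M -> nat}) i, (forall j, x j <= k.+1) -> x i = 0 -> u x i = false.
Hypothesis u_high : forall (x : {ffun 'I_M -> nat}) i, (forall j, x j <= k.+1) -> x i = k.+1 -> u x i = true.

Let point := {ffun 'I_M -> nat}.
Let cell := {ffun 'I_M -> 'I_k.+1}.

(** A simplex whose vertices carry all labels [0, ..., M] shows both values of each [u _ i]: false
    at the vertex labelled [i], true at the one labelled [M], which is what [find] returns when [u]
    is true throughout. *)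
Definition label (x : point) := find (fun i => ~~ u x i) (enum 'I_M).

Lemma label_le x (i : 'I_M) : u x i = false -> label x <= i.
Proof.
move=> ui; rewrite leqNgt; apply/negP => /(before_find i).
by rewrite nth_ord_enum ui.
Qed.

Lemma label_leM x : label x <= M.
Proof. by rewrite -[X in _ <= X](size_enum_ord M); exact: find_size. Qed.

Lemma label_true x (i : 'I_M) : i < label x -> u x i = true.
Proof.
by move/(before_find i); rewrite nth_ord_enum => /negbFE.
Qed.

Lemma label_false x (i : 'I_M) : label x = i -> u x i = false.
Proof.
move=> li; have : has (fun i => ~~ u x i) (enum 'I_M).
  by rewrite has_find -/(label x) li size_enum_ord.
by move/(nth_find i); rewrite -/(label x) li nth_ord_enum => /negbTE.
Qed.

(* The vertices of the Kuhn simplices of a cell: [p j] is the time at which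
   coordinate [j] is increased. *)
Definition vertex (v : cell) (p : {perm 'I_M}) (t : nat) : point :=
  [ffun j => v j + (p j < t)].

Lemma vertex_le v p t j : vertex v p t j <= k.+1.
Proof.
have := ltn_ord (v j); rewrite ltnS ffunE => H.
by apply: leq_trans (leq_add H (leq_b1 _)) _; rewrite addn1.
Qed.

(** Describes the simplices of the face on which the coordinates [j >= d] vanish: these coordinates
    are increased last, at time [j], so the vertices at times [t <= d] stay in the face. *)
Definition in_face d (v : cell) (p : {perm 'I_M}) :=
  [forall j : 'I_M, (d <= j) ==> (p j == j) && (v j == 0 :> nat)].

Lemma in_faceP d (v : cell) (p : {perm 'I_M}) : reflect (forall j : 'I_M, d <= j -> p j = j /\ v j = 0 :> nat)
  (in_face d v p).
Proof.
apply: (iffP forallP) => [H j dj|H j].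
  by have /implyP/(_ dj)/andP[/eqP -> /eqP ->] := H j.
by apply/implyP => /H [-> ->]; rewrite !eqxx.
Qed.

Lemma in_face_label d v p t : in_face d v p -> t <= d -> label (vertex v p t) <= d.
Proof.
move=> /in_faceP F td; case: (leqP M d) => [|dM].
  exact: leq_trans (label_leM _).
apply: (@label_le _ (Ordinal dM)); apply: u_low => [j|]; first exact: vertex_le.
by rewrite ffunE; have [-> ->] := F (Ordinal dM) (leqnn d); rewrite /= ltnNge td.
Qed.

(** The Sperner simplices of the [d]-dimensional face. The parity of their number turns out not to
    depend on [d]. *)
Definition full d (w : cell * {perm 'I_M}) := in_face d w.1 w.2 &&
  [forall i : 'I_M.+1, (i <= d) ==>
    [exists t : 'I_M.+1, (t <= d) && (label (vertex w.1 w.2 t) == i)]].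

Lemma fullP d w : d <= M -> reflect (in_face d w.1 w.2 /\ forall i, i <= d ->
  exists2 t, t <= d & label (vertex w.1 w.2 t) = i) (full d w).
Proof.
move=> dM; apply: (iffP andP) => -[F H]; split=> //.
  move=> i id; have /forallP/(_ (inord i)) := H.
  rewrite inordK; last by rewrite ltnS (leq_trans id).
  by rewrite id => /existsP [t /andP[td /eqP E]]; exists t.
apply/forallP => i; apply/implyP => /H [t td E]; apply/existsP; exists (inord t).
rewrite inordK; last by rewrite ltnS (leq_trans td).
by rewrite td E eqxx.
Qed.

Section Level.
Variables (d : nat) (dM : d < M).

Let state := (cell * {perm 'I_M} * 'I_M.+1)%type.

(** A simplex of dimension [d + 1] with a distinguished vertex [w.2] such that the opposite facet
    carries the labels [0, ..., d]. Two involutions act on doors: [twin] changes the facet within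
    the simplex, [flip] changes the simplex across the facet. *)
Definition door (w : state) := [&& in_face d.+1 w.1.1 w.1.2, w.2 <= d.+1 &
  [forall i : 'I_M.+1, (i <= d) ==>
    [exists t : 'I_M.+1, [&& t <= d.+1, t != w.2 &
       label (vertex w.1.1 w.1.2 t) == i]]]].

Lemma doorP (v : cell) (p : {perm 'I_M}) (t : 'I_M.+1) : reflect [/\ in_face d.+1 v p, t <= d.+1 & forall i, i <= d ->
  exists t' : nat, [/\ t' <= d.+1, t' != t :> nat & label (vertex v p t') = i]] (door (v, p, t)).
Proof.
apply: (iffP and3P) => -[F td H]; split=> //.
  move=> i id; have /forallP/(_ (inord i)) := H.
  rewrite inordK ?ltnS; last by apply: leq_trans id (ltnW dM).
  by rewrite id => /existsP [t' /and3P[td' tt /eqP E]]; exists t'.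
apply/forallP => i; apply/implyP => /H [t' [td' tt E]]; apply/existsP.
exists (inord t'); have t'M : t' < M.+1 by apply: leq_ltn_trans td' _.
rewrite inordK // td' E eqxx andbT /=.
by apply: contraNneq tt => <-; rewrite inordK.
Qed.

Definition doors := [set w | door w].

Let others (t : nat) := [seq t' <- iota 0 d.+2 | t' != t].

(** A facet has [d + 1] vertices, so covering [d + 1] labels forces each of them to occur exactly
    once. *)
Lemma door_labels (v : cell) (p : {perm 'I_M}) (t : 'I_M.+1) : door (v, p, t) ->
  uniq [seq label (vertex v p t') | t' <- others t] /\
  [seq label (vertex v p t') | t' <- others t] =i iota 0 d.+1.
Proof.
move=> /doorP [F td H].
have ss : size (others t) = d.+1.
  rewrite size_filter; have := count_predC (pred1 (t : nat)) (iota 0 d.+2).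
  rewrite size_iota count_uniq_mem ?iota_uniq // mem_iota leq0n add0n ltnS td.
  by move=> /eqP; rewrite add1n eqSS => /eqP E; rewrite -[RHS]E; exact: eq_count.
have sub : {subset iota 0 d.+1 <= [seq label (vertex v p t') | t' <- others t]}.
  move=> i; rewrite mem_iota ltnS => /andP[_ /H [t' [t'd t't <-]]].
  by apply: (map_f (fun t' => label (vertex v p t'))); rewrite mem_filter t't mem_iota ltnS.
have sz : size [seq label (vertex v p t') | t' <- others t] <= size (iota 0 d.+1).
  by rewrite size_map ss size_iota.
split; first exact: leq_size_uniq (iota_uniq _ _) sub sz.
by move=> i; have [_ ->] := uniq_min_size (iota_uniq _ _) sub sz.
Qed.

Lemma door_inj (v : cell) (p : {perm 'I_M}) (t : 'I_M.+1) : door (v, p, t) ->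
  forall t1 t2 : nat, t1 <= d.+1 -> t2 <= d.+1 ->
  t1 != t :> nat -> t2 != t :> nat -> label (vertex v p t1) = label (vertex v p t2) -> t1 = t2.
Proof.
move=> /door_labels [us _] t1 t2 t1d t2d t1t t2t E.
have s1 : t1 \in others t by rewrite mem_filter t1t mem_iota ltnS.
have s2 : t2 \in others t by rewrite mem_filter t2t mem_iota ltnS.
rewrite -(nth_index 0 s1) -(nth_index 0 s2); congr nth; apply/eqP.
rewrite -(nth_uniq 0 _ _ us) ?size_map ?index_mem // !(nth_map 0) ?index_mem //.
by rewrite !nth_index //; exact/eqP.
Qed.

Lemma door_label_le (v : cell) (p : {perm 'I_M}) (t : 'I_M.+1) : door (v, p, t) ->
  forall t1 : nat, t1 <= d.+1 -> t1 != t :> nat -> label (vertex v p t1) <= d.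
Proof.
move=> /door_labels [_ E] t1 t1d t1t; rewrite -ltnS.
have := E (label (vertex v p t1)); rewrite mem_iota add0n leq0n /= => <-.
by apply: (@map_f _ _ (fun t' => label (vertex v p t'))); rewrite mem_filter t1t mem_iota ltnS.
Qed.

(** If the omitted vertex repeats a label of the facet, omitting instead the other vertex of this
    label gives the second door of the simplex; otherwise the simplex is full and its door is
    fixed. *)
Definition twin (w : state) : state := let: (v, p, t) := w in
  if [pick t' : 'I_M.+1 | [&& t' <= d.+1, t' != t & label (vertex v p t') == label (vertex v p t)]]
  is Some t' then (v, p, t') else w.

Lemma twin_door : {in doors, forall w, twin w \in doors}.
Proof.
move=> [[v p] t]; rewrite /doors. rewrite !inE /= => D; case: pickP => [t' /and3P[t'd t't /eqP E]|//].
have /doorP [F td H] := D; apply/doorP; split=> // i /H [t'' [t''d t''t Ei]].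
case: (eqVneq t'' t') => [e|ne]; last by exists t''.
by exists t; split=> //; [rewrite eq_sym|rewrite -E -Ei e].
Qed.

Lemma twinK : {in doors, forall w, twin (twin w) = w}.
Proof.
move=> [[v p] t] D; have := twin_door D; move: D; rewrite /doors !inE /=.
case: pickP => [t' /and3P[t'd t't /eqP E]|H] D D' /=; last first.
  by case: pickP => // t'; rewrite H.
have /doorP [F td H] := D.
case: pickP => [t'' /and3P[t''d t''t /eqP E']|/(_ t)]; last by rewrite td eq_sym t't E eqxx.
congr (_, _); apply: val_inj; apply: (door_inj D') => //; first by rewrite eq_sym.
by rewrite E'.
Qed.

Lemma twin_fixed (v : cell) (p : {perm 'I_M}) (t : 'I_M.+1) : door (v, p, t) ->
  (twin (v, p, t) == (v, p, t)) = (label (vertex v p t) == d.+1).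
Proof.
move=> D; have /doorP [F td H] := D; rewrite /=; case: pickP => [t' /and3P[t'd t't /eqP E]|N].
  have := door_label_le D t'd t't; rewrite E => Hl.
  by rewrite xpair_eqE (negPf t't) andbF; apply/esym/negbTE; rewrite neq_ltn ltnS Hl.
rewrite eqxx; apply/esym/eqP/anti_leq; rewrite in_face_label // ltnNge; apply/negP => /H.
move=> [t' [t'd t't E]]; have t'M : t' < M.+1 by rewrite ltnS (leq_trans t'd).
by have := N (Ordinal t'M); rewrite /= t'd t't E eqxx.
Qed.

Lemma card_twin_fixed :
  #|[set w in doors | twin w == w]| = #|[set w | full d.+1 w]|.
Proof.
have -> : [set w | full d.+1 w] = [set w.1 | w in [set w in doors | twin w == w]].
  apply/setP => -[v p]; rewrite /doors inE; apply/(fullP _ dM)/imsetP => [[F H]|].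
    have [t td Et] := H _ (leqnn _); have tM : t < M.+1 by rewrite ltnS (leq_trans td).
    exists (v, p, Ordinal tM) => //=.
    have D : door (v, p, Ordinal tM).
      apply/doorP; split=> // i id; have [t' t'd E'] := H i (leqW id).
      exists t'; split=> //; apply: contraTneq id => /= e.
      by rewrite -E' e Et ltnn.
    by rewrite /doors !inE D /= -/(twin (v, p, Ordinal tM)) twin_fixed // Et.
  move=> [[[v' p'] t]]; rewrite /doors !inE => /andP[D]; rewrite twin_fixed // => /eqP E /= [-> ->].
  have /doorP [F td H] := D; split=> // i; rewrite leq_eqVlt => /orP[/eqP ->|]; first by exists t.
  by rewrite ltnS => /H [t' [t'd _ <-]]; exists t'.
rewrite card_in_imset // => -[[v p] t] [[v' p'] t']; rewrite /doors !inE => /andP[D].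
rewrite twin_fixed // => /eqP E /andP[D']; rewrite twin_fixed // => /eqP E' /= [ev ep].
rewrite -ev -ep in D' E' *; congr (_, _); apply/eqP/contraT => tt'.
have /doorP [_ t'd _] := D'; rewrite eq_sym in tt'.
by have := door_label_le D t'd tt'; rewrite E' ltnn.
Qed.

Let o0 : 'I_M := Ordinal (leq_ltn_trans (leq0n d) dM).
Let od : 'I_M := Ordinal dM.
Let ins (i : nat) : 'I_M := insubd o0 i.

(** A cyclic shift of the first [d + 1] times. On passing to the adjacent cell, the direction
    increased first becomes the one increased last. *)
Definition shift_down (i : 'I_M) : 'I_M :=
  if i == 0 :> nat then od else if i <= d then ins i.-1 else i.
Definition shift_up (i : 'I_M) : 'I_M :=
  if i == d :> nat then o0 else if i < d then ins i.+1 else i.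

Lemma shift_downE i : shift_down i =
  (if i == 0 :> nat then d else if i <= d then i.-1 else i) :> nat.
Proof.
rewrite /shift_down; case: ifP => // i0; case: ifP => // id.
by rewrite val_insubd ifT //; have := ltn_ord i; lia.
Qed.

Lemma shift_upE i : shift_up i =
  (if i == d :> nat then 0 else if i < d then i.+1 else i) :> nat.
Proof.
rewrite /shift_up; case: ifP => // i0; case: ifP => // id.
by rewrite val_insubd ifT //; have := ltn_ord i; lia.
Qed.

Lemma shift_downK : cancel shift_down shift_up.
Proof.
by move=> i; apply: val_inj; rewrite /= shift_upE shift_downE; repeat case: ifP; lia.
Qed.

Lemma shift_upK : cancel shift_up shift_down.
Proof.
by move=> i; apply: val_inj; rewrite /= shift_downE shift_upE; repeat case: ifP; lia.
Qed.

Definition pdown := perm (can_inj shift_downK).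
Definition pup := perm (can_inj shift_upK).

Let cell_up (v : cell) (p : {perm 'I_M}) : cell := [ffun j => inord (v j + (p j == 0 :> nat))].
Let cell_down (v : cell) (p : {perm 'I_M}) : cell := [ffun j => inord (v j - (p j == d :> nat))].

(** Pivoting across a facet of Kuhn's triangulation: dropping the first vertex moves the cell one
    unit in the first direction, dropping the last vertex moves it back in the last direction, and
    dropping an inner vertex exchanges two consecutive directions. A door is fixed where the
    adjacent cell would leave the cube. *)
Definition flip (w : state) : state := let: (v, p, t) := w in
  if t == 0 :> nat then
    if v ((p^-1)%g o0) == k :> nat then w else (cell_up v p, (p * pdown)%g, inord d.+1)
  else if t == d.+1 :> nat then
    if v ((p^-1)%g od) == 0 :> nat then w else (cell_down v p, (p * pup)%g, ord0)
  else (v, (p * tperm (ins t.-1) (ins t))%g, t).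

Lemma cell_upE (v : cell) (p : {perm 'I_M}) j : v ((p^-1)%g o0) != k :> nat ->
  cell_up v p j = v j + (p j == 0 :> nat) :> nat.
Proof.
move=> vk; rewrite ffunE inordK //; case: eqP => pj; last by rewrite addn0.
have e : (p^-1)%g o0 = j by apply: (canLR (permK p)); apply: val_inj.
by rewrite e in vk; have := ltn_ord (v j); rewrite addn1 !ltnS leq_eqVlt (negPf vk).
Qed.

Lemma cell_downE (v : cell) (p : {perm 'I_M}) j :
  cell_down v p j = v j - (p j == d :> nat) :> nat.
Proof.
by rewrite ffunE inordK //; apply: leq_ltn_trans (leq_subr _ _) (ltn_ord (v j)).
Qed.

Lemma vertex_up (v : cell) (p : {perm 'I_M}) t : v ((p^-1)%g o0) != k :> nat -> t <= d ->
  vertex (cell_up v p) (p * pdown)%g t = vertex v p t.+1.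
Proof.
move=> vk td; apply/ffunP => j; rewrite [LHS]ffunE [RHS]ffunE cell_upE //.
rewrite permM permE shift_downE -addnA; congr addn.
by case: (eqVneq (p j : nat) 0) => pj; repeat case: ifP; lia.
Qed.

Lemma vertex_down (v : cell) (p : {perm 'I_M}) t : v ((p^-1)%g od) != 0 :> nat -> t <= d ->
  vertex (cell_down v p) (p * pup)%g t.+1 = vertex v p t.
Proof.
move=> vk td; apply/ffunP => j; rewrite [LHS]ffunE [RHS]ffunE cell_downE.
rewrite permM permE shift_upE; case: (eqVneq (p j : nat) d) => pj; last first.
  by rewrite subn0; congr addn; case: ifP; lia.
have e : (p^-1)%g od = j by apply: (canLR (permK p)); apply: val_inj.
by rewrite e in vk; lia.
Qed.

Lemma insE i : i <= d -> ins i = i :> nat.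
Proof. by move=> id; rewrite val_insubd ifT //; lia. Qed.

Lemma vertex_swap (v : cell) (p : {perm 'I_M}) (t t' : nat) : 0 < t -> t <= d -> t' != t ->
  vertex v (p * tperm (ins t.-1) (ins t))%g t' = vertex v p t'.
Proof.
move=> t0 td tt; apply/ffunP => j; rewrite [LHS]ffunE [RHS]ffunE permM; congr addn.
have e1 : ins t.-1 = t.-1 :> nat by apply: insE; lia.
have e2 := insE td.
by case: tpermP => [->|->|_ _]; rewrite ?e1 ?e2; lia.
Qed.

Lemma in_face_up (v : cell) (p : {perm 'I_M}) : v ((p^-1)%g o0) != k :> nat ->
  in_face d.+1 v p -> in_face d.+1 (cell_up v p) (p * pdown)%g.
Proof.
move=> vk /in_faceP F; apply/in_faceP => j dj; have [pj vj] := F j dj.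
rewrite cell_upE // permM permE pj vj; split; last by lia.
by apply: val_inj; rewrite /= shift_downE; repeat case: ifP; lia.
Qed.

Lemma in_face_down (v : cell) (p : {perm 'I_M}) :
  in_face d.+1 v p -> in_face d.+1 (cell_down v p) (p * pup)%g.
Proof.
move=> /in_faceP F; apply/in_faceP => j dj; have [pj vj] := F j dj.
rewrite cell_downE permM permE pj vj; split; last by lia.
by apply: val_inj; rewrite /= shift_upE; repeat case: ifP; lia.
Qed.

Lemma in_face_swap (v : cell) (p : {perm 'I_M}) t : 0 < t -> t <= d ->
  in_face d.+1 v p -> in_face d.+1 v (p * tperm (ins t.-1) (ins t))%g.
Proof.
move=> t0 td /in_faceP F; apply/in_faceP => j dj; have [pj vj] := F j dj.
rewrite permM pj vj; split=> //; apply: tpermD; apply/eqP => /(congr1 val) /=.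
  by rewrite insE; lia.
by rewrite insE; lia.
Qed.

Lemma flip_door : {in doors, forall w, flip w \in doors}.
Proof.
have dM' : d.+1 < M.+1 by rewrite ltnS.
move=> [[v p] t]; rewrite /doors !inE => D; have /doorP [F td H] := D; rewrite /flip.
case: ifPn => t0; [case: ifPn => // vk|case: ifPn => t1; [case: ifPn => // vk|]].
- apply/doorP; split; rewrite ?inordK //; first exact: in_face_up.
  move=> i /H [[|t'] [t'd t't E]]; first by rewrite eq_sym t0 in t't.
  by exists t'; split=> //; [lia|lia|rewrite vertex_up].
- apply/doorP; split=> //; first exact: in_face_down.
  move=> i /H [t' [t'd t't E]]; have t'd' : t' <= d by move: t't; rewrite (eqP t1); lia.
  by exists t'.+1; split=> //; rewrite vertex_down.
- have t0' : 0 < t by lia.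
  have td' : t <= d by lia.
  apply/doorP; split=> //; first exact: in_face_swap.
  move=> i /H [t' [t'd t't E]]; exists t'; split=> //.
  by rewrite vertex_swap.
Qed.

Lemma flipK : {in doors, forall w, flip (flip w) = w}.
Proof.
have dM' : d.+1 < M.+1 by rewrite ltnS.
move=> [[v p] t]; rewrite /doors !inE => /doorP [F td H]; rewrite {2}/flip.
case: ifPn => t0; [case: ifPn => vk|case: ifPn => t1; [case: ifPn => vk|]].
- by rewrite /flip t0 vk.
- rewrite /flip inordK //= eqxx.
  have e : ((p * pdown)^-1)%g od = (p^-1)%g o0.
    by apply: (canLR (permK _)); rewrite permM permKV permE.
  rewrite e cell_upE // permKV /= addn1 /=.
  congr (_, _, _).
  + apply/ffunP => j; apply: val_inj; rewrite /= cell_downE cell_upE // permM permE shift_downE.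
    by have := ltn_ord (p j); repeat case: ifP; lia.
  + apply/permP => j; rewrite !permM !permE; exact: shift_downK.
  + by apply: val_inj; rewrite /= (eqP t0).
- by rewrite /flip (negPf t0) t1 vk.
- rewrite /flip /=.
  have e : ((p * pup)^-1)%g o0 = (p^-1)%g od.
    by apply: (canLR (permK _)); rewrite permM permKV permE /shift_up eqxx.
  have vk' : cell_down v p ((p^-1)%g od) != k :> nat.
    rewrite cell_downE permKV /= eqxx; have := ltn_ord (v ((p^-1)%g od)); move: vk; rewrite subn1; case: (nat_of_ord _) => /= [|x] *; rewrite ?neq_ltn; lia.
  rewrite e (negPf vk').
  have vk2 : cell_down v p (((p * pup)^-1)%g o0) != k :> nat by rewrite e.
  congr (_, _, _).
  + apply/ffunP => j; apply: val_inj; rewrite /= cell_upE // cell_downE permM permE shift_upE.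
    case: (eqVneq (p j : nat) d) => pj; last by repeat case: ifP; lia.
    have ej : (p^-1)%g od = j by apply: (canLR (permK p)); apply: val_inj.
    by rewrite ej in vk; rewrite /=; lia.
  + apply/permP => j; rewrite !permM !permE; exact: shift_upK.
  + by apply: val_inj; rewrite /= inordK // (eqP t1).
- rewrite /flip (negPf t0) (negPf t1); congr (_, _, _).
  by rewrite -mulgA tperm2 mulg1.
Qed.

Lemma flip_fixed (v : cell) (p : {perm 'I_M}) (t : 'I_M.+1) : door (v, p, t) ->
  (flip (v, p, t) == (v, p, t)) = (t == d.+1 :> nat) && full d (v, p).
Proof.
move=> D; have /doorP [F td H] := D; rewrite /flip.
have dM' : d.+1 < M.+1 by rewrite ltnS.
case: ifPn => t0; [case: ifPn => vk|case: ifPn => t1; [case: ifPn => vk|]].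
(* The facet lies where the coordinate [p^-1 o0] equals [k + 1]. There [u] is true in this
   coordinate, so this label cannot occur, although it is at most [d]. *)
- exfalso; have j0d : (p^-1)%g o0 <= d.
    rewrite leqNgt; apply/negP => dj; have /in_faceP/(_ _ dj) := F.
    by rewrite permKV => -[/(congr1 val) /= e _]; move: dj; rewrite -e.
  have [t' [t'd t't E]] := H _ j0d.
  have := label_false E; rewrite u_high // => [j|]; first exact: vertex_le.
  rewrite ffunE permKV (eqP vk) /=; suff -> : 0 < t' by rewrite addn1.
  by move: t't; rewrite (eqP t0); lia.
- rewrite (eqP t0) /=; apply/negbTE/eqP => /(congr1 (fun w : state => nat_of_ord w.2)).
  by rewrite /= inordK // (eqP t0).
- rewrite eqxx /=; apply/esym/(fullP _ (ltnW dM)) => /=.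
  have H' i : i <= d -> exists2 t', t' <= d & label (vertex v p t') = i.
    move=> /H [t' [t'd t't E]]; exists t' => //.
    by move: t't; rewrite (eqP t1); lia.
  split=> //; have [t' t'd E] := H' _ (leqnn d).
  (* The facet lies where the coordinate [p^-1 od] is 0, so its labels are at most that index; as
     the label [d] occurs, the index is [d] itself. *)
  have e : (p^-1)%g od = od.
    apply: val_inj; apply/eqP; rewrite eqn_leq; apply/andP; split; rewrite /=.
      rewrite leqNgt; apply/negP => dj; have /in_faceP/(_ _ dj) := F.
      by rewrite permKV => -[/(congr1 val) /= e' _]; move: dj; rewrite -e' ltnn.
    rewrite -[X in X <= _]E; apply: label_le; apply: u_low => [j|]; first exact: vertex_le.
    by rewrite ffunE permKV (eqP vk) /= ltnNge t'd.
  apply/in_faceP => j; rewrite leq_eqVlt => /orP[/eqP dj|]; last by have /in_faceP := F; apply.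
  have -> : j = od by apply: val_inj.
  split; last by rewrite -[in v _]e; exact/eqP.
  by rewrite -[in LHS]e permKV.
- rewrite [LHS](_ : _ = false); last first.
    by apply/negbTE/eqP => /(congr1 (fun w : state => nat_of_ord w.2)) /= e; rewrite -e in t0.
  rewrite /=; apply/esym/negbTE/negP => /(fullP _ (ltnW dM)) [/in_faceP F' _].
  have [e1 e2] := F' od (leqnn _); move/negP: vk; apply.
  by rewrite -[in X in v X]e1 permK; apply/eqP.
- rewrite /=; apply/negbTE/eqP => /(congr1 (fun w : state => w.1.2)) /=.
  move/permP => /(_ ((p^-1)%g (ins t))); rewrite permM permKV tpermR.
  by move/(congr1 val); rewrite /= !insE; lia.
Qed.

Lemma card_flip_fixed :
  #|[set w in doors | flip w == w]| = #|[set w | full d w]|.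
Proof.
have dM' : d.+1 < M.+1 by rewrite ltnS.
have -> : [set w | full d w] = [set w.1 | w in [set w in doors | flip w == w]].
  apply/setP => -[v p]; rewrite inE; apply/idP/imsetP => [Fu|].
    exists (v, p, inord d.+1) => //.
    have D : door (v, p, inord d.+1).
      have /(fullP _ (ltnW dM)) [F H] := Fu; apply/doorP; rewrite inordK //; split=> //.
        by apply/in_faceP => j dj; have /in_faceP := F; apply; exact: ltnW.
      move=> i /H [t td E]; exists t; split=> //; first exact: leqW.
      by rewrite neq_ltn ltnS td.
    by rewrite /doors !inE D flip_fixed // inordK // eqxx Fu.
  move=> [[[v' p'] t]]; rewrite /doors !inE => /andP[D]; rewrite flip_fixed //.
  by move=> /andP[_ Fu] /= [-> ->].
rewrite card_in_imset // => -[[v p] t] [[v' p'] t']; rewrite /doors !inE => /andP[D].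
rewrite flip_fixed // => /andP[/eqP E _] /andP[D'].
rewrite flip_fixed // => /andP[/eqP E' _] /= [-> ->].
by congr (_, _); apply: val_inj; rewrite /= E E'.
Qed.

(** Doors are counted modulo 2 in two ways: the fixed points of [twin] are the full simplices of
    dimension [d + 1], those of [flip] the full ones of dimension [d]. *)
Lemma odd_full_step : odd #|[set w | full d.+1 w]| = odd #|[set w | full d w]|.
Proof.
rewrite -card_twin_fixed -card_flip_fixed.
by rewrite -(odd_card_involution twin_door twinK) -(odd_card_involution flip_door flipK).
Qed.

End Level.

Lemma odd_full d : d <= M -> odd #|[set w | full d w]|.
Proof.
elim: d => [_|d IH dM]; last by rewrite odd_full_step // IH // ltnW.
suff -> : [set w | full 0 w] = [set ([ffun=> ord0] : cell, 1%g : {perm 'I_M})].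
  by rewrite cards1.
apply/setP => -[v p]; rewrite !inE; apply/(fullP _ (leq0n M))/eqP => [[/in_faceP F _]|[-> ->]].
  congr (_, _).
    by apply/ffunP => j; apply: val_inj; rewrite ffunE; have [] := F j (leq0n _).
  by apply/permP => j; rewrite perm1; have [] := F j (leq0n _).
have F : in_face 0 [ffun=> ord0] 1%g.
  by apply/in_faceP => j _; rewrite perm1 ffunE.
split=> // i; rewrite leqn0 => /eqP ->; exists 0 => //.
by apply/eqP; rewrite -leqn0 in_face_label.
Qed.

Lemma cubical_sperner : exists v : {ffun 'I_M -> 'I_k.+1}, forall i : 'I_M,
  exists a b : {ffun 'I_M -> nat},
  [/\ forall j, v j <= a j <= (v j).+1, forall j, v j <= b j <= (v j).+1,
      u a i = false & u b i = true].
Proof.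
have := odd_full (leqnn M); case: (pickP (full M)) => [[v p] /(fullP _ (leqnn M))[_ H] _|N].
  exists v => i; have [t tM E] := H i (ltnW (ltn_ord i)).
  have [t' t'M E'] := H M (leqnn _).
  exists (vertex v p t), (vertex v p t').
  split; try (by move=> j; rewrite ffunE; case: (_ < _); lia).
    exact: label_false.
  by apply: label_true; rewrite E'.
by rewrite eq_card0 // => w; rewrite inE N.
Qed.

End CubicalSperner.
End Sperner.

Lemma norm_between (R : realDomainType) (a b z : R) : a <= z <= b -> `|z| <= `|a| + `|b|.
Proof.
move=> /andP[h1 h2]; have := ler_norm b; have := ler_norm (- a); rewrite normrN => n1 n2.
have p1 := normr_ge0 a; have p2 := normr_ge0 b.
by rewrite ler_norml; apply/andP; split; lra.
Qed.

Section PoincareMiranda.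
Variables (R : realType) (M : nat) (lo hi : 'I_M -> R) (F : 'rV[R]_M -> 'I_M -> R).
Hypothesis lohi : forall i, lo i < hi i.
Hypothesis cF : forall i, continuous (fun x => F x i).
Let inbox (x : 'rV[R]_M) := forall j, lo j <= x 0 j <= hi j.
Hypothesis F_low : forall x i, inbox x -> x 0 i = lo i -> F x i <= 0.
Hypothesis F_high : forall x i, inbox x -> x 0 i = hi i -> 0 <= F x i.

Let grid_pt (k : nat) (x : {ffun 'I_M -> nat}) : 'rV[R]_M :=
  \row_j (lo j + (x j)%:R / k.+1%:R * (hi j - lo j)).

Lemma grid_pt_box k (x : {ffun 'I_M -> nat}) : (forall j, (x j <= k.+1)%N) -> inbox (grid_pt k x).
Proof.
move=> xk j; rewrite mxE; have := lohi j; rewrite -subr_gt0 => h0.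
have q0 : 0 <= (x j)%:R / k.+1%:R :> R by rewrite divr_ge0.
have q1 : (x j)%:R / k.+1%:R <= 1 :> R by rewrite ler_pdivrMr // mul1r ler_nat.
rewrite lerDl mulr_ge0 ?(ltW h0) //= -lerBrDl.
by rewrite ler_piMl // ltW.
Qed.

Lemma sign_grid k : exists v : {ffun 'I_M -> nat}, (forall j, (v j <= k.+1)%N) /\
  forall i, exists a b : {ffun 'I_M -> nat},
  [/\ forall j, (v j <= a j <= (v j).+1)%N, forall j, (v j <= b j <= (v j).+1)%N,
      inbox (grid_pt k a) /\ F (grid_pt k a) i <= 0 &
      inbox (grid_pt k b) /\ 0 <= F (grid_pt k b) i].
Proof.
(* On the boundary [u] is decided by position and not by the sign of [F], which may vanish there. *)
pose u (x : {ffun 'I_M -> nat}) i :=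
  if x i == 0%N then false else if x i == k.+1 then true else 0 <= F (grid_pt k x) i.
have [||v H] := @cubical_sperner M k u.
- by move=> x i _ x0; rewrite /u x0.
- by move=> x i _ xk; rewrite /u xk eqxx.
exists [ffun j => v j : nat]; split=> [j|i]; first by rewrite ffunE ltnW.
have [a [b [va vb ua ub]]] := H i; exists a, b.
have ak j : (a j <= k.+1)%N by have /andP[_ h] := va j; apply: leq_trans h _; exact: ltn_ord.
have bk j : (b j <= k.+1)%N by have /andP[_ h] := vb j; apply: leq_trans h _; exact: ltn_ord.
split; try by move=> j; rewrite ffunE.
- split; first exact: grid_pt_box.
  move: ua; rewrite /u; case: eqP => [a0 _|_].
    by apply: F_low; [exact: grid_pt_box|rewrite mxE a0 mul0r mul0r addr0].
  by case: ifP => // _ /negbT; rewrite -ltNge => /ltW.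
- split; first exact: grid_pt_box.
  move: ub; rewrite /u; case: ifP => // _; case: eqP => [b1 _|//].
  apply: F_high; first exact: grid_pt_box.
  by rewrite mxE b1 divff ?pnatr_eq0 // mul1r addrC subrK.
Qed.

Lemma grid_pt_close (D : R) k (v a : {ffun 'I_M -> nat}) : (forall j, hi j - lo j <= D) ->
  0 <= D -> (forall j, (v j <= a j <= (v j).+1)%N) ->
  `|grid_pt k a - grid_pt k v| <= D * k.+1%:R^-1.
Proof.
move=> HD D0 va; apply: norm_rVP => [|j]; first by rewrite mulr_ge0.
rewrite !mxE opprD addrACA subrr add0r -mulrBl -mulrBl.
have /andP[v1 v2] := va j.
rewrite -natrB // !normrM mulrC.
rewrite (ger0_norm (_ : 0 <= hi j - lo j)) ?subr_ge0 ?(ltW (lohi j)) //.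
apply: ler_pM => //; first by rewrite subr_ge0 ltW.
rewrite normfV !normr_nat -[leRHS]mul1r ler_wpM2r ?invr_ge0 //.
by rewrite (_ : 1 = 1%:R) // ler_nat; lia.
Qed.

(** In ever finer grids there are cells on which every component takes both signs; they accumulate
    at a common zero. *)
Lemma poincare_miranda : exists2 x, inbox x & forall i, F x i = 0.
Proof.
have [v vP] := choice sign_grid.
pose D := 1 + \sum_j (hi j - lo j).
have hl0 j : 0 <= hi j - lo j by rewrite subr_ge0 ltW.
have HD j : hi j - lo j <= D.
  rewrite /D (bigD1 j) //= addrCA lerDl addr_ge0 // sumr_ge0 //.
have D0 : 0 < D by rewrite ltr_pwDl // sumr_ge0.
have [|x xP] := @bounded_seq_cluster R M (fun k => grid_pt k (v k)) (\sum_j (`|lo j| + `|hi j|)).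
  move=> k; have S0 : forall j, 0 <= `|lo j| + `|hi j| by move=> j; rewrite addr_ge0.
  apply: norm_rVP => [|j]; first exact: sumr_ge0.
  rewrite (bigD1 j) //= -[leLHS]addr0 lerD ?sumr_ge0 //.
  by have [vk _] := vP k; apply: norm_between; exact: grid_pt_box.
have close (e : R) : 0 < e -> exists k, `|grid_pt k (v k) - x| < e /\
    forall a : {ffun 'I_M -> nat}, (forall j, (v k j <= a j <= (v k j).+1)%N) -> `|grid_pt k a - x| < e.
  move=> e0; have e2 : 0 < e / 2 by rewrite divr_gt0.
  have [N NP] := archi_inv (divr_gt0 e2 D0).
  have [k [Nk kx]] := xP _ e2 N; exists k; split; first by lra.
  move=> a va; have h := grid_pt_close k HD (ltW D0) va.
  have h2 : D * k.+1%:R^-1 < e / 2 by rewrite mulrC -ltr_pdivlMr //; exact: NP.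
  have {h h2}h := le_lt_trans h h2.
  rewrite -(subrK (grid_pt k (v k)) (grid_pt k a)) -addrA.
  by apply: le_lt_trans (ler_normD _ _) _; lra.
have xbox : inbox x.
  move=> j; apply/andP; split; rewrite leNgt; apply/negP => hj.
    have [k [kx _]] := close _ (eq_ind_r is_true hj (subr_gt0 (x 0 j) (lo j))).
    have [vk _] := vP k; have /(_ j) /andP[h1 h2] := grid_pt_box vk.
    have h3 := coordB_le (grid_pt k (v k)) x j.
    by have := ler_norm (grid_pt k (v k) 0 j - x 0 j); lra.
  have [k [kx _]] := close _ (eq_ind_r is_true hj (subr_gt0 (hi j) (x 0 j))).
  have [vk _] := vP k; have /(_ j) /andP[h1 h2] := grid_pt_box vk.
  have h3 := coordB_le (grid_pt k (v k)) x j.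
  by have := ler_norm (- (grid_pt k (v k) 0 j - x 0 j)); rewrite normrN; lra.
exists x => // i; apply: le_anti; apply/andP; split; rewrite leNgt; apply/negP => Fx.
  have [d d0 dP] := (continuous_eps (fun y => F y i)).1 (@cF i) x _ Fx.
  have [k [_ kx]] := close _ d0; have [_ /(_ i) [a [b [va vb [_ Fa] _]]]] := vP k.
  have := dP _ (kx a va); have := ler_norm (- (F (grid_pt k a) i - F x i)); rewrite normrN; lra.
have Fx' : 0 < - F x i by rewrite oppr_gt0.
have [d d0 dP] := (continuous_eps (fun y => F y i)).1 (@cF i) x _ Fx'.
have [k [_ kx]] := close _ d0; have [_ /(_ i) [a [b [va vb _ [_ Fb]]]]] := vP k.
by have := dP _ (kx b vb); have := ler_norm (F (grid_pt k b) i - F x i); lra.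
Qed.

End PoincareMiranda.

(** * Minimax critical points *)

Section QuadApprox.
Variables (R : realType) (M : nat).
Implicit Types (F : 'rV[R]_M -> R) (P : 'rV[R]_M -> 'rV[R]_M).

(** Differentiability with Lipschitz gradient [P], in one inequality: it is Taylor's formula and, by
    [quad_approx_lipschitz], also a bound on the variation of [P]. *)
Definition quad_approx (l : R) F P :=
  forall x y, `|F y - F x - dot (P x) (y - x)| <= l * n2 (y - x).

(** The expansions between [x], [y] and [y + s e], with [e = P y - P x], are combined. They leave
    [s * n2 e] against quadratic errors, and [s = 1 / (6 l)] lets the linear term win. *)
Lemma quad_approx_lipschitz l F P : 0 < l -> quad_approx l F P ->
  forall x y, n2 (P y - P x) <= 36 * l ^+ 2 * n2 (y - x).
Proof.
move=> l0 FP x y; set e := P y - P x; pose s := (6 * l)^-1.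
have s0 : 6 * l * s = 1 by rewrite divff // gt_eqF //; lra.
clearbody s.
have := FP x y; rewrite ler_norml => /andP[_ h1].
have := FP y (y + s *: e); rewrite ler_norml => /andP[h2 _].
have := FP x (y + s *: e); rewrite ler_norml => /andP[_ h3].
have e2 : y + s *: e - y = s *: e by rewrite addrAC subrr add0r.
have e3 : y + s *: e - x = s *: e + (y - x) by rewrite addrAC addrC.
rewrite e2 in h2; rewrite e3 in h3.
have ee : dot (P y) e - dot (P x) e = n2 e by rewrite -dotBl.
have h4 : n2 (s *: e + (y - x)) <= 2 * (s ^+ 2 * n2 e) + 2 * n2 (y - x).
  by rewrite -n2Z; exact: n2D_le.
have h5 : l * n2 (s *: e + (y - x)) <= l * (2 * (s ^+ 2 * n2 e) + 2 * n2 (y - x)).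
  by rewrite ler_wpM2l // ltW.
rewrite dotDr dotZr in h3; rewrite dotZr n2Z in h2.
have h6 : s * n2 e <= 3 * l * (s * s * n2 e) + 3 * l * n2 (y - x).
  have := FP x y; rewrite ler_norml => /andP[h1' _].
  move: h1' h2 h3 h5; rewrite -ee.
  lra.
have h7 : 0 < l * 12 by lra.
have := ler_wpM2l (ltW h7) h6.
have -> : l * 12 * (s * n2 e) = 2 * (6 * l * s) * n2 e by ring.
have -> : l * 12 * (3 * l * (s * s * n2 e) + 3 * l * n2 (y - x)) =
  (6 * l * s) ^+ 2 * n2 e + 36 * l ^+ 2 * n2 (y - x) by ring.
rewrite s0; lra.
Qed.

Lemma quad_approx_continuous l F P : 0 < l -> quad_approx l F P ->
  continuous F /\ continuous P.
Proof.
move=> l0 FP; split; last first.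
  apply: (@lipschitz_continuous _ _ _ _ (6 * l * (M%:R + 1))) => x y.
  have c0 : 0 <= 6 * l * (M%:R + 1) by rewrite mulr_ge0 ?addr_ge0 ?ler0n //; lra.
  rewrite -(@ler_pXn2r _ 2%N) ?nnegrE //; last exact: mulr_ge0.
  apply: le_trans (norm_sqr_le _) _; apply: le_trans (quad_approx_lipschitz l0 FP x y) _.
  have -> : (6 * l * (M%:R + 1) * `|y - x|) ^+ 2 =
    36 * l ^+ 2 * ((M%:R + 1) ^+ 2 * `|y - x| ^+ 2) by ring.
  have q0 : 0 <= 36 * l ^+ 2 by apply: mulr_ge0; rewrite ?sqr_ge0.
  rewrite ler_wpM2l //.
  apply: le_trans (n2_le _) _; rewrite ler_wpM2r ?sqr_ge0 //.
  have : 0 <= M%:R :> R by []; nra.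
apply/continuous_eps => x e e0.
pose c := 1 + M%:R * `|P x| + l * M%:R.
have c1 : 1 <= c by rewrite /c -addrA lerDl addr_ge0 // mulr_ge0 // ltW.
have c0 : 0 < c by apply: lt_le_trans c1.
exists (Num.min 1 (e / c)) => [|y]; first by rewrite lt_min ltr01 divr_gt0.
rewrite lt_min ltr_pdivlMr // => /andP[y1 ye].
apply: le_lt_trans ye; have h := FP x y; have h2 := dot_le (P x) (y - x).
have h3 := n2_le (y - x); have n0 := normr_ge0 (y - x).
have h4 : l * n2 (y - x) <= l * M%:R * `|y - x|.
  rewrite -mulrA ler_wpM2l ?(ltW l0) //; apply: le_trans h3 _.
  by rewrite ler_wpM2l // expr2 ler_piMl // ltW.
have h5 := ler_normD (F y - F x - dot (P x) (y - x)) (dot (P x) (y - x)).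
rewrite subrK in h5; rewrite /c !mulrDr mulr1.
have -> : `|y - x| * (M%:R * `|P x|) = M%:R * (`|P x| * `|y - x|) by ring.
have -> : `|y - x| * (l * M%:R) = l * M%:R * `|y - x| by ring.
lra.
Qed.

End QuadApprox.

Section Minimax.
Variables (R : realType) (M : nat) (d b : 'I_M -> R) (i0 : 'I_M).
Variables (Psi : 'rV[R]_M -> R) (psi : 'rV[R]_M -> 'rV[R]_M) (l Kb C0 r0 : R).
Hypotheses (l0 : 0 < l) (PsiP : quad_approx l Psi psi) (Psi_ge0 : forall x, 0 <= Psi x).
Hypotheses (r00 : 0 < r0) (Psi_0 : forall x, n2 x <= r0 -> Psi x = 0).
Hypothesis Psi_big : forall x : 'rV[R]_M, \sum_i b i * x 0 i ^+ 2 - C0 <= Psi x.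
Hypothesis psi_asymp : forall x i, `|psi x 0 i - 2 * b i * x 0 i| <= Kb.
Hypotheses (b0 : forall i, 0 < b i) (db : forall i, d i != b i) (di0 : 0 < d i0 < b i0).

Definition action (x : 'rV[R]_M) := \sum_i d i * x 0 i ^+ 2 - Psi x.
Let G (x : 'rV[R]_M) : 'rV[R]_M := \row_i (2 * d i * x 0 i - psi x 0 i).

Lemma C0_ge0 : 0 <= C0.
Proof.
have := Psi_big 0; rewrite Psi_0 ?/n2 ?dot0l ?(ltW r00) // big1 => [|i _]; first by lra.
by rewrite mxE expr0n mulr0.
Qed.

Let l' := \sum_i `|d i| + l.

Lemma l'_gt0 : 0 < l'.
Proof. by rewrite ltr_wpDl // sumr_ge0. Qed.

Lemma action_quad : quad_approx l' action G.
Proof.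
move=> x y; have h := PsiP x y.
have -> : action y - action x - dot (G x) (y - x) =
    \sum_i d i * (y - x) 0 i ^+ 2 - (Psi y - Psi x - dot (psi x) (y - x)).
  have -> : dot (G x) (y - x) = \sum_i 2 * d i * x 0 i * (y - x) 0 i - dot (psi x) (y - x).
    rewrite /dot -sumrB; apply: eq_bigr => i _; rewrite [G _ _ _]mxE; ring.
  have -> : \sum_i d i * (y - x) 0 i ^+ 2 = \sum_i d i * y 0 i ^+ 2 -
      \sum_i d i * x 0 i ^+ 2 - \sum_i 2 * d i * x 0 i * (y - x) 0 i.
    rewrite -!sumrB; apply: eq_bigr => i _; rewrite !mxE; ring.
  rewrite /action; ring.
apply: le_trans (ler_normB _ _) _; rewrite mulrDl; apply: lerD => //.
apply: le_trans (ler_norm_sum _ _ _) _; rewrite mulr_suml; apply: ler_sum => i _.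
by rewrite normrM ler_wpM2l // ger0_norm ?sqr_ge0 // coord_sqr_le.
Qed.

Let cA : continuous action.
Proof. by have [] := quad_approx_continuous l'_gt0 action_quad. Qed.

Let cG : continuous G.
Proof. by have [] := quad_approx_continuous l'_gt0 action_quad. Qed.

(** Up to a bounded error the gradient is [2 (d i - b i) x_i], so nonresonance [d i != b i] makes it
    large far out. This takes the place of a Palais-Smale condition. *)
Lemma gradient_coercive x : `|G x| < 1 -> `|x| <= \sum_i (Kb + 1) / (2 * `|d i - b i|).
Proof.
move=> G1; have q0 i : 0 < 2 * `|d i - b i|.
  by rewrite mulr_gt0 // normr_gt0 subr_eq0.
have hi i : `|x 0 i| <= (Kb + 1) / (2 * `|d i - b i|).
  rewrite ler_pdivlMr // mulrC.
  have h1 : `|G x 0 i| < 1 by apply: le_lt_trans (coord_le _ _) G1.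
  have h2 := psi_asymp x i; rewrite mxE in h1.
  have -> : 2 * `|d i - b i| * `|x 0 i| = `|2 * d i * x 0 i - 2 * b i * x 0 i|.
    have -> : 2 * d i * x 0 i - 2 * b i * x 0 i = 2 * (d i - b i) * x 0 i by ring.
    by rewrite !normrM normr_nat.
  have := ler_distD (psi x 0 i) (2 * d i * x 0 i) (2 * b i * x 0 i); lra.
have k0 i : 0 <= (Kb + 1) / (2 * `|d i - b i|) by apply: le_trans (hi i).
apply: norm_rVP => [|i]; first exact: sumr_ge0.
by rewrite (bigD1 i) //= -[leLHS]addr0 lerD ?sumr_ge0.
Qed.

Hypothesis no_crit : forall x : 'rV[R]_M, (forall i, 2 * d i * x 0 i = psi x 0 i) ->
  0 < action x <= C0 -> False.

(** Chosen such that a vector in the positive directions with [\sum d i * x_i ^+ 2 = alpha] has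
    [n2 x <= r0], where [Psi] vanishes. *)
Let alpha := r0 / (1 + \sum_(i | 0 < d i) (d i)^-1).

Lemma alpha_den_gt0 : 0 < 1 + \sum_(i | 0 < d i) (d i)^-1.
Proof. by rewrite ltr_pwDl // sumr_ge0 // => i di; rewrite invr_ge0 ltW. Qed.

Lemma alpha_gt0 : 0 < alpha.
Proof. by rewrite divr_gt0 // alpha_den_gt0. Qed.

(** On the compact part of the strip a zero of [G] would be one of the excluded critical points;
    outside of it coercivity applies. *)
Lemma gradient_bound : exists2 e, 0 < e & forall x, alpha <= action x <= C0 -> e <= n2 (G x).
Proof.
pose rho := \sum_i (Kb + 1) / (2 * `|d i - b i|).
pose S := [set x | `|x| <= rho /\ alpha <= action x <= C0].
have far x : rho < `|x| -> 1 <= n2 (G x).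
  move=> hx; have h1 : 1 <= `|G x|.
    by rewrite leNgt; apply/negP => /gradient_coercive; rewrite leNgt -/rho hx.
  by apply: le_trans (norm_sqr_le _); rewrite expr2; nra.
have [[x0 Sx0]|noS] := pselect (exists x, S x); last first.
  exists 1 => // x Ax; apply: far; rewrite ltNge; apply/negP => hx.
  by apply: noS; exists x.
have cl : closed S.
  have -> : S = (fun x => `|x|) @^-1` [set t | t <= rho] `&`
      (action @^-1` [set t | alpha <= t] `&` action @^-1` [set t | t <= C0]).
    by apply/seteqP; split => x /=; [move=> [? /andP[? ?]]|move=> [? [? ?]]];
      split=> //; apply/andP.
  apply: closedI; last apply: closedI.
  - by apply: closed_comp; [move=> x _; exact: norm_continuous|exact: closed_le].
  - by apply: closed_comp; [move=> x _; exact: cA|exact: closed_ge].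
  - by apply: closed_comp; [move=> x _; exact: cA|exact: closed_le].
have [||||x Sx xmin] := @min_on_box R M (fun x => n2 (G x)) S rho.
- by apply: ct_comp; [exact: cG|exact: n2_continuous].
- by exists x0.
- by move=> x [].
- exact: cl.
have Gx : 0 < n2 (G x).
  rewrite n2_gt0; apply/eqP => Gx0; case: Sx => _ /andP[ax xC].
  apply: (@no_crit x) => [i|]; last by rewrite xC andbT (lt_le_trans alpha_gt0).
  by have := congr1 (fun u : 'rV_M => u 0 i) Gx0; rewrite /G !mxE => /eqP; rewrite subr_eq0 => /eqP.
exists (Num.min 1 (n2 (G x))) => [|y Ay]; first by rewrite lt_min ltr01 Gx.
case: (lerP `|y| rho) => hy; last by rewrite ge_min far.
by rewrite ge_min xmin ?orbT.
Qed.

Let s := (2 * l')^-1.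
Let chi (a : R) := Num.min 1 (Num.max 0 (a / alpha)).
(** A step of gradient descent, switched off where the action is nonpositive, so that the boundary
    of the linking box stays fixed, and carried out in full where the action is at least [alpha]. *)
Let T (x : 'rV[R]_M) : 'rV[R]_M := x - (s * chi (action x)) *: G x.

Lemma s_gt0 : 0 < s.
Proof. by rewrite invr_gt0 mulr_gt0 // l'_gt0. Qed.

Lemma chi_bounds a : 0 <= chi a <= 1.
Proof. by rewrite /chi le_min ge_min ler01 lexx le_max lexx. Qed.

Lemma chi_one a : alpha <= a -> chi a = 1.
Proof.
move=> h; apply/min_idPl; rewrite le_max ler_pdivlMr ?alpha_gt0 // mul1r h.
exact: orbT.
Qed.

Lemma chi_zero a : a <= 0 -> chi a = 0.
Proof.
move=> h; rewrite /chi; have -> : Num.max 0 (a / alpha) = 0.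
  by apply/max_idPl; rewrite ler_pdivrMr ?alpha_gt0 // mul0r.
by apply/min_idPr.
Qed.

Lemma chi_continuous : continuous chi.
Proof.
move=> a; apply: (@continuous_min R R (fun=> 1) (fun a => Num.max 0 (a / alpha))).
  exact: cst_continuous.
apply: (@continuous_max R R (fun=> 0) (fun a => a / alpha)); first exact: cst_continuous.
exact: mulrr_continuous.
Qed.

Lemma descent x : action (T x) <= action x - s / 2 * chi (action x) * n2 (G x).
Proof.
have := action_quad x (T x); rewrite ler_norml => /andP[_].
have -> : T x - x = - ((s * chi (action x)) *: G x) by rewrite /T addrAC subrr add0r.
rewrite dotNr n2N dotZr n2Z -/(n2 (G x)).
have /andP[c0 c1] := chi_bounds (action x).
have n0 := n2_ge0 (G x).
have sl : l' * s = 2^-1.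
  by rewrite /s invfM mulrCA divff ?mulr1 // gt_eqF // l'_gt0.
set c := chi _ in c0 c1 *; set n := n2 _ in n0 *.
have -> : l' * ((s * c) ^+ 2 * n) = (l' * s) * (s * c * (c * n)) by ring.
rewrite sl => h; have : s * c * (c * n) <= s * c * n.
  by rewrite ler_wpM2l ?mulr_ge0 ?(ltW s_gt0) // ler_piMl.
lra.
Qed.

Lemma descent_le x : action (T x) <= action x.
Proof.
apply: le_trans (descent x) _; rewrite gerDl oppr_le0.
have /andP[c0 _] := chi_bounds (action x).
by apply: mulr_ge0 (n2_ge0 _); apply: mulr_ge0 => //; apply: divr_ge0 (ltW s_gt0) _.
Qed.

Lemma T_fixed x : action x <= 0 -> T x = x.
Proof. by move=> h; rewrite /T chi_zero // mulr0 scale0r subr0. Qed.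

Lemma T_continuous : continuous T.
Proof.
apply: ctB; first exact: ct_id.
apply: ctZ; last exact: cG.
apply: ctM; first exact: ct_cst.
by apply: ct_comp => //; exact: chi_continuous.
Qed.

(** The directions that span the linking box: those where the quadratic form is nonpositive, and the
    single positive direction [i0], in which [Psi] wins at infinity. *)
Let moving i := (d i <= 0) || (i == i0).
Let p (x : 'rV[R]_M) : 'rV[R]_M := \row_i (if moving i then x 0 i else 0).

Lemma moving_lt i : moving i -> d i < b i.
Proof.
by case/orP => [di|/eqP ->]; [exact: le_lt_trans (b0 i)|case/andP: di0].
Qed.

Lemma action_p_le (x : 'rV[R]_M) i : moving i -> action (p x) <= (d i - b i) * x 0 i ^+ 2 + C0.
Proof.
move=> mi; rewrite /action; have := Psi_big (p x).
rewrite (bigD1 i) //= [X in _ -> X - _ <= _](bigD1 i) //= => h.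
have : \sum_(j | j != i) d j * p x 0 j ^+ 2 <= \sum_(j | j != i) b j * p x 0 j ^+ 2.
  apply: ler_sum => j _; rewrite mxE; case: ifP => [mj|]; last by rewrite expr0n !mulr0.
  by rewrite ler_wpM2r ?sqr_ge0 // ltW // moving_lt.
move: h; rewrite !mxE mi; lra.
Qed.

Lemma action_p_bound x : action (p x) <= C0.
Proof.
have m0 : moving i0 by rewrite /moving eqxx orbT.
apply: le_trans (action_p_le x m0) _; rewrite gerDr mulr_le0_ge0 ?sqr_ge0 //.
by rewrite subr_le0 ltW // moving_lt.
Qed.

Lemma action_p_i0 (x : 'rV[R]_M) : x 0 i0 = 0 -> action (p x) <= 0.
Proof.
move=> x0; rewrite /action subr_le0; apply: le_trans (Psi_ge0 _).
apply: sumr_le0 => i _; rewrite mxE; case: ifP => [|_]; last by rewrite expr0n mulr0.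
case/orP => [di|/eqP ->]; last by rewrite x0 expr0n mulr0.
by rewrite mulr_le0_ge0 ?sqr_ge0.
Qed.

Lemma iter_action_le k x : action (iter k T x) <= action x.
Proof. by elim: k => //= k IH; apply: le_trans (descent_le _) IH. Qed.

Lemma iter_T_fixed k x : action x <= 0 -> iter k T x = x.
Proof. by move=> h; elim: k => //= k ->; exact: T_fixed. Qed.

Lemma iter_T_continuous k : continuous (iter k T).
Proof.
elim: k => [|k IH]; first exact: ct_id.
by apply: (@ct_comp _ _ _ (iter k T) T) => //; exact: T_continuous.
Qed.

Lemma p_continuous : continuous p.
Proof.
apply: (@lipschitz_continuous _ _ _ _ 1) => x y; rewrite mul1r.
apply: norm_rVP => // i; rewrite !mxE; case: ifP => _; last by rewrite subrr normr0.
exact: coordB_le.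
Qed.

(** Large enough for [C0 <= |d i - b i| L] for all [i] and for [alpha <= d i0 * L]; since [L >= 1],
    both hold with [L ^+ 2] as well. *)
Let L := 1 + \sum_i C0 / `|d i - b i| + alpha / d i0.

Lemma L_ge1 : 1 <= L.
Proof.
rewrite /L -addrA lerDl addr_ge0 //.
  by apply: sumr_ge0 => i _; rewrite divr_ge0 // C0_ge0.
by case/andP: di0 => h _; rewrite divr_ge0 ?(ltW alpha_gt0) // ltW.
Qed.

Lemma action_p_face (x : 'rV[R]_M) i : moving i -> x 0 i ^+ 2 = L ^+ 2 -> action (p x) <= 0.
Proof.
move=> mi xL; apply: le_trans (action_p_le x mi) _; rewrite xL.
have bd : 0 < `|d i - b i| by rewrite normr_gt0 subr_eq0.
have -> : d i - b i = - `|d i - b i| by rewrite ltr0_norm ?subr_lt0 ?moving_lt // opprK.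
rewrite mulNr addrC subr_le0 mulrC -ler_pdivrMr //.
have L1 := L_ge1; apply: (@le_trans _ _ L); last by rewrite expr2; nra.
have aux (q S a : R) : 0 <= S -> 0 <= a -> q <= 1 + (q + S) + a by lra.
rewrite /L (bigD1 i) //=; apply: aux; first by apply: sumr_ge0 => j _; rewrite divr_ge0 // C0_ge0.
by case/andP: di0 => h _; rewrite divr_ge0 ?(ltW alpha_gt0) // ltW.
Qed.

Lemma linking_sphere (x : 'rV[R]_M) : (forall i, d i <= 0 -> x 0 i = 0) ->
  \sum_(i | 0 < d i) d i * x 0 i ^+ 2 = alpha -> action x = alpha.
Proof.
move=> xneg xpos; rewrite /action Psi_0 ?subr0.
  rewrite -xpos [RHS]big_mkcond /=; apply: eq_bigr => i _.
  by case: ltP => // /xneg ->; rewrite expr0n mulr0.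
have -> : n2 x = \sum_(i | 0 < d i) x 0 i ^+ 2.
  rewrite [RHS]big_mkcond /=; apply: eq_bigr => i _; rewrite -expr2.
  by case: ltP => // /xneg ->; rewrite expr0n.
have : \sum_(i | 0 < d i) x 0 i ^+ 2 <= alpha * \sum_(i | 0 < d i) (d i)^-1.
  rewrite mulr_sumr; apply: ler_sum => i di; rewrite ler_pdivlMr // -xpos (bigD1 i) //=.
  rewrite mulrC lerDl sumr_ge0 // => j /andP[dj _].
  by rewrite mulr_ge0 ?sqr_ge0 // ltW.
have : alpha * (1 + \sum_(i | 0 < d i) (d i)^-1) = r0.
  by rewrite /alpha mulfVK // gt_eqF // alpha_den_gt0.
rewrite mulrDr mulr1; have := alpha_gt0; lra.
Qed.

(** The deformed box always meets the small sphere of the positive directions. Poincare-Miranda is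
    applied to the coordinates that have to vanish and, in place of coordinate [i0], to the equation
    of this sphere; the coordinates suppressed by [p] are simply set to 0. On the faces the signs
    are those of the undeformed box, because [T] fixes points of nonpositive action. *)
Lemma linking k : exists x, action (iter k T (p x)) = alpha.
Proof.
pose F (x : 'rV[R]_M) i := if d i <= 0 then iter k T (p x) 0 i else
  if i == i0 then \sum_(j | 0 < d j) d j * iter k T (p x) 0 j ^+ 2 - alpha else x 0 i.
have L1 := L_ge1; have [d0 db0] := andP di0.
have dn : (d i0 <= 0) = false by rewrite leNgt d0.
have cTp : continuous (fun x => iter k T (p x)).
  by apply: (@ct_comp _ _ _ p (iter k T)); [exact: p_continuous|exact: iter_T_continuous].
have [||||x _ Fx] := @poincare_miranda R M (fun i => if i == i0 then 0 else - L) (fun=> L) F.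
- by move=> i; case: ifP => _; lra.
- move=> i; rewrite /F; case: (d i <= 0); [|case: (i == i0)].
  + by apply: (@ct_comp _ _ _ _ (fun u : 'rV[R]_M => u 0 i)); [exact: cTp|exact: coord_continuous_rV].
  + apply: ctB; last exact: ct_cst.
    apply: ct_sum => j; apply: ctM; first exact: ct_cst.
    apply: ctX.
    by apply: (@ct_comp _ _ _ _ (fun u : 'rV[R]_M => u 0 j)); [exact: cTp|exact: coord_continuous_rV].
  + exact: coord_continuous_rV.
- move=> x i _; rewrite /F; case: (eqVneq i i0) => [->|ii0] xi.
    rewrite dn iter_T_fixed ?action_p_i0 // subr_le0.
    apply: le_trans (ltW alpha_gt0); apply: sumr_le0 => j dj; rewrite mxE /moving [d j <= 0]leNgt dj /=.
    by case: eqP => [->|_]; rewrite ?xi expr0n mulr0.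
  case: ifP => [di|_]; last by rewrite xi; lra.
  have mi : moving i by rewrite /moving di.
  by rewrite iter_T_fixed ?(@action_p_face _ i) ?xi ?sqrrN // mxE mi xi; lra.
- move=> x i _ xi; rewrite /F; case: ifP => [di|_].
    have mi : moving i by rewrite /moving di.
    by rewrite iter_T_fixed ?(@action_p_face _ i) ?xi // mxE mi xi; lra.
  case: eqP => [ii0|_]; last by rewrite xi; lra.
  have mi : moving i0 by rewrite /moving eqxx orbT.
  rewrite ii0 in xi; rewrite iter_T_fixed ?(@action_p_face _ i0) ?xi // subr_ge0.
  rewrite (bigD1 i0) //= mxE mi xi; apply: (@le_trans _ _ (d i0 * L ^+ 2)); last first.
    by rewrite lerDl sumr_ge0 // => j /andP[dj _]; rewrite mulr_ge0 ?sqr_ge0 // ltW.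
  rewrite mulrC -ler_pdivrMr //; apply: (@le_trans _ _ L); last by rewrite expr2; nra.
  rewrite /L lerDr addr_ge0 // sumr_ge0 // => j _; by rewrite divr_ge0 // C0_ge0.
exists x; apply: linking_sphere => [i di|]; first by have := Fx i; rewrite /F di.
by have := Fx i0; rewrite /F dn eqxx => /eqP; rewrite subr_eq0 => /eqP.
Qed.

(** Descent lowers the action by a fixed amount per step between [alpha] and [C0], yet after any
    number of steps some point of the box has action [alpha]. *)
Lemma minimax_contradiction : False.
Proof.
have [e e0 eP] := gradient_bound.
have drop k x : alpha <= action (iter k T (p x)) ->
    action (iter k T (p x)) <= C0 - k%:R * (s / 2 * e).
  elim: k => [|k IH] h /=; first by rewrite mul0r subr0 action_p_bound.
  have h1 : alpha <= action (iter k T (p x)) by apply: le_trans h (descent_le _).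
  have h2 : action (iter k T (p x)) <= C0 by apply: le_trans (iter_action_le _ _) (action_p_bound _).
  apply: le_trans (descent _) _; rewrite chi_one // mulr1.
  have h3 : s / 2 * e <= s / 2 * n2 (G (iter k T (p x))).
    by rewrite ler_wpM2l ?eP ?h1 //; apply: divr_ge0 (ltW s_gt0) _.
  have := IH h1; rewrite -[k.+1]addn1 natrD mulrDl mul1r; lra.
have se : 0 < s / 2 * e by apply: mulr_gt0 => //; apply: divr_gt0 s_gt0 _.
have C1 : 0 < C0 + 1 by have := C0_ge0; lra.
have [N NP] := archi_inv (divr_gt0 se C1).
have [x xa] := linking N.+1.
have := drop N.+1 x; rewrite xa => /(_ (lexx _)) h.
have := NP N.+1 (ltnSn N); rewrite ltr_pdivlMr // mulrC ltr_pdivrMr // => h2.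
rewrite mulrC in h2; have := alpha_gt0; lra.
Qed.

End Minimax.

Theorem minimax_critical_point (R : realType) (M : nat) (d b : 'I_M -> R) (i0 : 'I_M)
    (Psi : 'rV[R]_M -> R) (psi : 'rV[R]_M -> 'rV[R]_M) (l Kb C0 r0 : R) :
  0 < l -> quad_approx l Psi psi -> (forall x, 0 <= Psi x) ->
  0 < r0 -> (forall x, n2 x <= r0 -> Psi x = 0) ->
  (forall x : 'rV[R]_M, \sum_i b i * x 0 i ^+ 2 - C0 <= Psi x) ->
  (forall x i, `|psi x 0 i - 2 * b i * x 0 i| <= Kb) ->
  (forall i, 0 < b i) -> (forall i, d i != b i) -> 0 < d i0 < b i0 ->
  exists x : 'rV[R]_M, (forall i, 2 * d i * x 0 i = psi x 0 i) /\
    0 < \sum_i d i * x 0 i ^+ 2 - Psi x <= C0.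
Proof.
move=> l0 q P0 r00 Psi0 Pb pa b0 db di0; apply: contrapT => N.
apply: (minimax_contradiction l0 q P0 r00 Psi0 Pb pa b0 db di0) => x cx ax.
by apply: N; exists x.
Qed.

(** * Discrete loops and closed orbits *)

Section SymplecticLinear.
Variables (R : realType) (n : nat).
Local Notation V := 'rV[R]_(n * 2).

Lemma sum_mxvec_index p q (F : 'I_(p * q) -> R) :
  \sum_i F i = \sum_i \sum_j F (mxvec_index i j).
Proof.
by rewrite pair_bigA /= (reindex _ (curry_mxvec_bij p q)); apply: eq_bigr => -[].
Qed.

Lemma sum_xy (F : 'I_(n * 2) -> R) :
  \sum_i F i = \sum_j (F (mxvec_index j 0) + F (mxvec_index j 1)).
Proof.
rewrite sum_mxvec_index; apply: eq_bigr => j _; rewrite big_ord_recl big_ord1.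
by congr (_ + F (mxvec_index _ _)); apply: val_inj.
Qed.

Lemma xy_ext (u v : V) : (forall j, xc j u = xc j v) -> (forall j, yc j u = yc j v) -> u = v.
Proof.
move=> hx hy; apply/rowP => i; case/mxvec_indexP: i => j b.
have [->|->] : b = 0 \/ b = 1.
- by case: b => -[|[|//]] h; [left|right]; apply: val_inj.
- exact: hx.
- exact: hy.
Qed.

Definition of_xy (x y : 'I_n -> R) : V :=
  mxvec (\matrix_(j < n, b < 2) if b == 0 then x j else y j).

Lemma xc_of_xy x y j : xc j (of_xy x y) = x j.
Proof. by rewrite /xc /of_xy mxvecE mxE eqxx. Qed.

Lemma yc_of_xy x y j : yc j (of_xy x y) = y j.
Proof. by rewrite /yc /of_xy mxvecE mxE. Qed.

Lemma xcD j (u v : V) : xc j (u + v) = xc j u + xc j v. Proof. exact: mxE. Qed.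
Lemma ycD j (u v : V) : yc j (u + v) = yc j u + yc j v. Proof. exact: mxE. Qed.
Lemma xcZ j a (u : V) : xc j (a *: u) = a * xc j u. Proof. exact: mxE. Qed.
Lemma ycZ j a (u : V) : yc j (a *: u) = a * yc j u. Proof. exact: mxE. Qed.
Lemma xcN j (u : V) : xc j (- u) = - xc j u. Proof. exact: mxE. Qed.
Lemma ycN j (u : V) : yc j (- u) = - yc j u. Proof. exact: mxE. Qed.

Lemma dot_xy (u v : V) : dot u v = \sum_j (xc j u * xc j v + yc j u * yc j v).
Proof. exact: sum_xy. Qed.

Lemma n2_xy (u : V) : n2 u = \sum_j (xc j u ^+ 2 + yc j u ^+ 2).
Proof. by rewrite /n2 dot_xy; apply: eq_bigr => j _; rewrite !expr2. Qed.

(** The complex structure that links [omega_st] with [dot]: multiplication by [i] on each symplectic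
    plane. *)
Definition jm (v : V) : V := of_xy (fun j => - yc j v) (fun j => xc j v).

Lemma xc_jm j v : xc j (jm v) = - yc j v. Proof. exact: xc_of_xy. Qed.
Lemma yc_jm j v : yc j (jm v) = xc j v. Proof. exact: yc_of_xy. Qed.

Lemma jmD u v : jm (u + v) = jm u + jm v.
Proof. by apply: xy_ext => j; rewrite ?xcD ?ycD ?xc_jm ?yc_jm ?xcD ?ycD ?opprD. Qed.

Lemma jmZ a u : jm (a *: u) = a *: jm u.
Proof. by apply: xy_ext => j; rewrite ?xcZ ?ycZ ?xc_jm ?yc_jm ?xcZ ?ycZ ?mulrN. Qed.

Lemma jmN u : jm (- u) = - jm u.
Proof. by rewrite -scaleN1r jmZ scaleN1r. Qed.

Lemma jmB u v : jm (u - v) = jm u - jm v.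
Proof. by rewrite jmD jmN. Qed.

Lemma jm0 : jm 0 = 0.
Proof. by have := jmZ 0 0; rewrite !scale0r. Qed.

Lemma jm_sum (I : finType) (F : I -> V) : jm (\sum_i F i) = \sum_i jm (F i).
Proof. exact: (big_morph jm jmD jm0). Qed.

Lemma jmK u : jm (jm u) = - u.
Proof. by apply: xy_ext => j; rewrite ?xcN ?ycN !(xc_jm, yc_jm). Qed.

Lemma omega_dot (u v : V) : omega_st u v = dot (jm u) v.
Proof. rewrite dot_xy; apply: eq_bigr => j _; rewrite xc_jm yc_jm; ring. Qed.

Lemma dot_jm u v : dot (jm u) (jm v) = dot u v.
Proof. by rewrite !dot_xy; apply: eq_bigr => j _; rewrite !xc_jm !yc_jm; ring. Qed.

Lemma dot_jml u v : dot (jm u) v = - dot u (jm v).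
Proof. by rewrite -dot_jm jmK dotNl. Qed.

Lemma dot_jmu u : dot (jm u) u = 0.
Proof. by rewrite dot_xy big1 // => j _; rewrite xc_jm yc_jm; ring. Qed.

Lemma n2_jm u : n2 (jm u) = n2 u. Proof. exact: dot_jm. Qed.

Lemma linear_as_matrix p q (f : 'rV[R]_p -> 'rV[R]_q) :
  (forall u v, f (u + v) = f u + f v) -> (forall a u, f (a *: u) = a *: f u) ->
  exists A : 'M[R]_(p, q), forall u, f u = u *m A.
Proof.
move=> fD fZ; exists (\matrix_i f (delta_mx 0 i)) => u.
have f0 : f 0 = 0 by have := fZ 0 0; rewrite !scale0r.
rewrite [in LHS](row_sum_delta u) (big_morph f fD f0).
apply/rowP => j; rewrite summxE mxE; apply: eq_bigr => i _.
by rewrite fZ !mxE.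
Qed.

Lemma jm_matrix : exists A : 'M[R]_(n * 2), forall u, jm u = u *m A.
Proof. exact: (linear_as_matrix jmD jmZ). Qed.

Lemma coord_xy_sup (v : V) c : (forall j, `|xc j v| <= c) -> (forall j, `|yc j v| <= c) ->
  0 <= c -> `|v| <= c.
Proof.
move=> hx hy c0; apply: norm_rVP => // i; case/mxvec_indexP: i => j b.
have [->|->] : b = 0 \/ b = 1.
- by case: b => -[|[|//]] h; [left|right]; apply: val_inj.
- exact: hx.
- exact: hy.
Qed.

Lemma norm_jm v : `|jm v| = `|v|.
Proof.
have h u : `|jm u| <= `|u|.
  apply: coord_xy_sup => // j; rewrite ?xc_jm ?yc_jm ?normrN; exact: coord_le.
by apply: le_anti; rewrite h /=; have := h (jm v); rewrite jmK normrN.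
Qed.

(** The flow [exp (t jm)]; on a round sphere its orbits are the Hopf circles. *)
Definition rot (t : R) (v : V) : V := cos t *: v + sin t *: jm v.

Lemma rotDr t u v : rot t (u + v) = rot t u + rot t v.
Proof. by rewrite /rot jmD !scalerDr addrACA. Qed.

Lemma rotZ t a u : rot t (a *: u) = a *: rot t u.
Proof. by rewrite /rot jmZ !scalerA ![_ * a]mulrC -!scalerA scalerDr. Qed.

Lemma rotB t u v : rot t (u - v) = rot t u - rot t v.
Proof. by rewrite rotDr -scaleN1r rotZ scaleN1r. Qed.

Lemma rot0r t : rot t 0 = 0.
Proof. by have := rotZ t 0 0; rewrite !scale0r. Qed.

Lemma rot_sum t (I : finType) (F : I -> V) : rot t (\sum_i F i) = \sum_i rot t (F i).
Proof. exact: (big_morph (rot t) (rotDr t) (rot0r t)). Qed.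

Lemma rot0 v : rot 0 v = v.
Proof. by rewrite /rot cos0 sin0 scale1r scale0r addr0. Qed.

Lemma rotD s t v : rot (s + t) v = rot s (rot t v).
Proof.
rewrite /rot cosD sinD jmD !jmZ jmK; apply: xy_ext => j;
  rewrite ?xcD ?ycD ?xcZ ?ycZ ?xcD ?ycD ?xcZ ?ycZ ?xcN ?ycN; ring.
Qed.

Lemma rot_jm t v : rot t (jm v) = jm (rot t v).
Proof. by rewrite /rot jmD !jmZ. Qed.

Lemma dot_rot t u v : dot (rot t u) (rot t v) = dot u v.
Proof.
rewrite /rot dotDl !dotDr !dotZl !dotZr dot_jm (dot_jml u v).
transitivity ((cos t ^+ 2 + sin t ^+ 2) * dot u v); first ring.
by rewrite cos2Dsin2 mul1r.
Qed.

Lemma n2_rot t u : n2 (rot t u) = n2 u. Proof. exact: dot_rot. Qed.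

Lemma rotK t u : rot t (rot (- t) u) = u.
Proof. by rewrite -rotD subrr rot0. Qed.

Lemma dot_rotl t u v : dot (rot t u) v = dot u (rot (- t) v).
Proof. by rewrite -(dot_rot t u) rotK. Qed.

Lemma norm_rot_le t u : `|rot t u| <= 2 * `|u|.
Proof.
apply: le_trans (ler_normD _ _) _; rewrite !normrZ norm_jm.
rewrite -mulrDl ler_wpM2r // (_ : 2 = 1 + 1) // lerD // ler_norml.
  by rewrite cos_geN1 cos_le1.
by rewrite sin_geN1 sin_le1.
Qed.

Lemma rot_2pi k u : rot (2 * pi * k%:R) u = u.
Proof.
elim: k => [|k IH]; first by rewrite mulr0 rot0.
rewrite -[k.+1%:R]natr1 mulrDr mulr1 rotD.
have -> : rot (2 * pi) u = u by rewrite /rot mulr_natl cos2pi sin2pi scale1r scale0r addr0.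
exact: IH.
Qed.

Lemma n2_rotB1 t u : n2 (rot t u - u) = (2 - 2 * cos t) * n2 u.
Proof.
rewrite n2B n2_rot dotDl !dotZl dot_jmu -/(n2 u); ring.
Qed.

(** The sum is invariant under [rot t], whose only fixed vector is zero when [cos t != 1]. *)
Lemma rot_sum0 N t v : (forall u, rot (t * N%:R) u = u) -> cos t != 1 ->
  \sum_(k < N) rot (t * k%:R) v = 0.
Proof.
move=> tN ct; set S := (X in X = _).
have rS : rot t S = S.
  rewrite /S rot_sum; case: N tN @S => [|N] tN S; first by rewrite !big_ord0.
  have e : rot t (rot (t * N%:R) v) = v.
    by rewrite -rotD addrC -[X in _ + X]mulr1 -mulrDr natr1 tN.
  rewrite big_ord_recr /= e [RHS]big_ord_recl /= mulr0 rot0 addrC; congr (_ + _).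
  by apply: eq_bigr => i _; rewrite -rotD /bump /= add1n addrC -[X in _ + X]mulr1 -mulrDr natr1.
have := n2_rotB1 t S; rewrite rS subrr /n2 dot0l -/(n2 S) => /esym/eqP.
rewrite mulf_eq0 n2_eq0 => /orP[|/eqP //].
by rewrite -{1}(mulr1 2) -mulrBr mulf_eq0 pnatr_eq0 /= subr_eq0 eq_sym (negPf ct).
Qed.

End SymplecticLinear.

(** * Fourier analysis of discrete loops *)

Section DiscreteLoop.
Variables (R : realType) (n N : nat).
Hypotheses (N1 : (1 < N)%N).
Local Notation V := 'rV[R]_(n * 2).
Local Notation E := 'rV[R]_(N * (n * 2)).

Definition mode (e : E) (k : 'I_N) : V := row k (vec_mx e).
Definition of_modes (F : 'I_N -> V) : E := mxvec (\matrix_k F k).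
Definition basic_angle : R := 2 * pi / N%:R.
Local Notation w := basic_angle.
(** The inverse discrete Fourier transform with [jm] as imaginary unit; [analysis] is the transform
    itself. *)
Definition synth (e : E) (l : nat) : V := \sum_(k < N) rot (w * (k * l)%:R) (mode e k).
Definition analysis (F : nat -> V) (k : 'I_N) : V :=
  N%:R^-1 *: \sum_(l < N) rot (- (w * (k * l)%:R)) (F l).

Lemma N_neq0 : N%:R != 0 :> R.
Proof. by rewrite pnatr_eq0; case: N N1. Qed.

Implicit Types (F G : nat -> V) (e f : E).

Lemma mode_of_modes (F : 'I_N -> V) k : mode (of_modes F) k = F k.
Proof. by rewrite /mode /of_modes mxvecK rowK. Qed.

Lemma modeE (e : E) k i : e 0 (mxvec_index k i) = mode e k 0 i.
Proof. by rewrite !mxE. Qed.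

Lemma dot_modes e f : dot e f = \sum_k dot (mode e k) (mode f k).
Proof.
rewrite /dot sum_mxvec_index; apply: eq_bigr => k _; apply: eq_bigr => i _.
by rewrite !modeE.
Qed.

Lemma modeB e f k : mode (e - f) k = mode e k - mode f k.
Proof. by rewrite /mode linearB; apply/rowP => i; rewrite !mxE. Qed.

Lemma synthB e f l : synth (e - f) l = synth e l - synth f l.
Proof. by rewrite -sumrB; apply: eq_bigr => k _; rewrite modeB rotB. Qed.

Lemma rot_angleN a u : rot (w * (a * N)%:R) u = u :> V.
Proof.
have -> : w * (a * N)%:R = 2 * pi * a%:R.
  by rewrite /basic_angle natrM -!mulrA; congr (_ * (_ * _)); rewrite mulrCA mulVf ?mulr1 // N_neq0.
exact: rot_2pi.
Qed.

Lemma synth_period e l : synth e (l + N) = synth e l.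
Proof.
by apply: eq_bigr => k _; rewrite mulnDr natrD mulrDr rotD rot_angleN.
Qed.

Lemma cos_angle_neq1 (a : nat) : (0 < a < N)%N -> cos (w * a%:R) != 1.
Proof.
move=> /andP[a0 aN]; set x := pi * a%:R / N%:R : R.
have N0 : 0 < N%:R :> R by rewrite ltr0n; case: N N1.
have -> : w * a%:R = x *+ 2 by rewrite /w /x -mulr_natl; ring.
have x0 : 0 < x by rewrite divr_gt0 // mulr_gt0 ?pi_gt0 ?ltr0n.
have xp : x < pi by rewrite ltr_pdivrMr // ltr_pM2l ?pi_gt0 // ltr_nat.
have sx : 0 < sin x by apply: sin_gt0_pi; rewrite ?x0.
have c2 := cos2Dsin2 x; rewrite cos_mulr2n; apply/negP => /eqP h.
have : 0 < sin x ^+ 2 by rewrite exprn_gt0.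
lra.
Qed.

Lemma rot_orthogonal (a b : 'I_N) v :
  \sum_(k < N) rot (w * (k * a)%:R) (rot (- (w * (k * b)%:R)) v) =
  if a == b then N%:R *: v else 0 :> V.
Proof.
case: eqP => [->|/eqP ab].
  rewrite (eq_bigr (fun=> v)) => [|k _]; last exact: rotK.
  by rewrite sumr_const card_ord scaler_nat.
pose t := w * (a%:R - b%:R).
have -> : \sum_(k < N) rot (w * (k * a)%:R) (rot (- (w * (k * b)%:R)) v) =
    \sum_(k < N) rot (t * k%:R) v.
  by apply: eq_bigr => k _; rewrite -rotD /t !natrM; congr rot; ring.
apply: rot_sum0 => [u|].
  have -> : t * N%:R = w * (a * N)%:R + - (w * (b * N)%:R) by rewrite /t !natrM; ring.
  by rewrite rotD rot_angleN -[u in LHS](rot_angleN b) -rotD addNr rot0.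
case: (ltngtP a b) => [h|h|h]; last by move/eqP: ab; case; apply: val_inj.
  have -> : t = - (w * (b - a)%:R) by rewrite /t (natrB _ (ltnW h)); ring.
  by rewrite cosN cos_angle_neq1 // subn_gt0 h /=; have := ltn_ord b; lia.
have -> : t = w * (a - b)%:R by rewrite /t (natrB _ (ltnW h)).
by rewrite cos_angle_neq1 // subn_gt0 h /=; have := ltn_ord a; lia.
Qed.

Lemma scaleVN (v : V) : N%:R^-1 *: (N%:R *: v) = v.
Proof. by rewrite scalerA mulVf ?scale1r // N_neq0. Qed.

Lemma synthK e k : analysis (synth e) k = mode e k.
Proof.
rewrite /analysis /synth; under eq_bigr => l _ do rewrite rot_sum.
rewrite exchange_big /= (bigD1 k) //= [X in _ + X]big1 ?addr0 => [|k' kk'].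
  rewrite -[RHS]scaleVN; congr (_ *: _).
  rewrite (eq_bigr (fun=> mode e k)) ?sumr_const ?card_ord ?scaler_nat // => l _.
  by rewrite -rotD addNr rot0.
transitivity (\sum_(l < N) rot (w * (l * k')%:R) (rot (- (w * (l * k)%:R)) (mode e k'))).
  by apply: eq_bigr => l _; rewrite -!rotD addrC !(mulnC l).
by rewrite rot_orthogonal (negPf kk').
Qed.

Lemma analysisK_ord F (l : 'I_N) : synth (of_modes (analysis F)) l = F l.
Proof.
rewrite /synth; under eq_bigr => k _ do rewrite mode_of_modes /analysis rotZ rot_sum.
rewrite -scaler_sumr exchange_big /= (bigD1 l) //= [X in _ + X]big1 ?addr0 => [|l' ll'].
  by rewrite rot_orthogonal eqxx scaleVN.
by rewrite rot_orthogonal eq_sym (negPf ll').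
Qed.

Lemma analysisK F l : (forall l, F (l + N)%N = F l) -> synth (of_modes (analysis F)) l = F l.
Proof.
move=> FN; elim/ltn_ind: l => l IH; case: (ltnP l N) => [lN|Nl].
  exact: (analysisK_ord F (Ordinal lN)).
by rewrite -(subnK Nl) synth_period FN IH //; lia.
Qed.

(** [analysis] is adjoint to [synth] up to the factor [N]. This turns the gradient of a function
    averaged over the loop into Fourier coefficients. *)
Lemma sum_dot_synth e F :
  N%:R^-1 * \sum_(l < N) dot (synth e l) (F l) = \sum_k dot (mode e k) (analysis F k).
Proof.
rewrite /synth; under eq_bigr => l _ do rewrite dot_suml.
rewrite exchange_big mulr_sumr; apply: eq_bigr => k _ /=.
rewrite /analysis dotZr dot_sumr; congr (_ * _); apply: eq_bigr => l _.
exact: dot_rotl.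
Qed.

Lemma parseval e : N%:R^-1 * \sum_(l < N) n2 (synth e l) = n2 e.
Proof.
rewrite [LHS]sum_dot_synth [RHS]dot_modes; apply: eq_bigr => k _.
by rewrite synthK.
Qed.

Lemma analysis_norm_le F c k : (forall l, `|F l| <= c) -> `|analysis F k| <= 2 * c.
Proof.
move=> Fc; rewrite normrZ ger0_norm ?invr_ge0 // mulrC ler_pdivrMr; last first.
  by rewrite lt_def N_neq0 ler0n.
apply: le_trans (ler_norm_sum _ _ _) _.
apply: (@le_trans _ _ (\sum_(l < N) 2 * c)).
  by apply: ler_sum => l _; apply: le_trans (norm_rot_le _ _) _; rewrite ler_wpM2l.
by rewrite sumr_const card_ord mulr_natr.
Qed.

Lemma analysisB F G k : analysis (fun l => F l - G l) k = analysis F k - analysis G k.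
Proof.
by rewrite /analysis -scalerBr -sumrB; congr (_ *: _); apply: eq_bigr => l _; rewrite rotB.
Qed.

Lemma analysisZ a F k : analysis (fun l => a *: F l) k = a *: analysis F k.
Proof.
rewrite /analysis; under eq_bigr => l _ do rewrite rotZ.
by rewrite -scaler_sumr !scalerA mulrC.
Qed.

Section PlaneScaling.
Variable beta : 'I_n -> R.

Definition plane_scale (v : V) : V := \row_i (of_xy beta beta 0 i * v 0 i).

Lemma xc_plane j v : xc j (plane_scale v) = beta j * xc j v.
Proof. by rewrite {1}/xc mxE -/(xc j _) xc_of_xy. Qed.

Lemma yc_plane j v : yc j (plane_scale v) = beta j * yc j v.
Proof. by rewrite {1}/yc mxE -/(yc j _) yc_of_xy. Qed.

Lemma plane_scaleD u v : plane_scale (u + v) = plane_scale u + plane_scale v.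
Proof. by apply/rowP => i; rewrite !mxE mulrDr. Qed.

Lemma plane_scaleZ a v : plane_scale (a *: v) = a *: plane_scale v.
Proof. by apply/rowP => i; rewrite !mxE mulrCA. Qed.

Lemma plane_scale_rot t v : plane_scale (rot t v) = rot t (plane_scale v).
Proof.
have h u : plane_scale (jm u) = jm (plane_scale u).
  by apply: xy_ext => j; rewrite ?xc_plane ?yc_plane ?xc_jm ?yc_jm ?xc_plane ?yc_plane ?mulrN.
by rewrite /rot plane_scaleD !plane_scaleZ h.
Qed.

Lemma analysis_plane F k : analysis (fun l => plane_scale (F l)) k = plane_scale (analysis F k).
Proof.
have p0 : plane_scale 0 = 0 by apply/rowP => i; rewrite !mxE mulr0.
rewrite /analysis plane_scaleZ (big_morph _ plane_scaleD p0); congr (_ *: _).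
by apply: eq_bigr => l _; rewrite plane_scale_rot.
Qed.

End PlaneScaling.

(** This is [tan (w k / 2)], the Cayley transform of the rotation by [w k]. *)
Definition slope (k : nat) : R := sin (w * k%:R) / (1 + cos (w * k%:R)).

(** With cosine [-1] the rotation is [- id], whose odd powers are never the identity. For even [N]
    one mode would have infinite slope. *)
Lemma cos_angle_neqN1 (j0 : 'I_n) (k : nat) : odd N -> 1 + cos (w * k%:R) != 0.
Proof.
move=> oN; apply/eqP => ck.
have c1 : cos (w * k%:R) = -1 by lra.
have s0 : sin (w * k%:R) = 0.
  by apply/eqP; rewrite -sqrf_eq0; have := cos2Dsin2 (w * k%:R); rewrite c1; apply/contra_eqT; lra.
pose u : V := of_xy (fun=> 1) (fun=> 1).
have h a : rot (w * k%:R * a%:R) u = (-1) ^+ a *: u.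
  elim: a => [|a IH]; first by rewrite mulr0 rot0 expr0 scale1r.
  rewrite -[a.+1%:R]natr1 mulrDr mulr1 addrC rotD IH rotZ /rot c1 s0 scale0r addr0.
  by rewrite scalerA exprS mulrC.
have := h N; rewrite -mulrA -natrM rot_angleN -signr_odd oN expr1 scaleN1r => /(congr1 (xc j0)).
by rewrite xcN xc_of_xy; lra.
Qed.

Lemma slope_rot (j0 : 'I_n) (k : nat) (u : V) : odd N ->
  rot (w * k%:R) u - u = jm (slope k *: (rot (w * k%:R) u + u)).
Proof.
move=> oN; have ck := cos_angle_neqN1 j0 k oN; have c2 := cos2Dsin2 (w * k%:R).
have e1 : slope k * (1 + cos (w * k%:R)) = sin (w * k%:R) by rewrite /slope mulfVK.
have e2 : slope k * sin (w * k%:R) = 1 - cos (w * k%:R).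
  apply: (mulIf ck); rewrite mulrAC e1 -expr2; lra.
move: e1 e2; rewrite /rot; set c := cos _; set s := sin _; set t := slope k => e1 e2.
rewrite jmZ !jmD !jmZ jmK; apply: xy_ext => j; rewrite ?xcD ?ycD ?xcN ?ycN ?xcZ ?ycZ
  ?xcD ?ycD ?xcZ ?ycZ ?xcN ?ycN; [set a := xc j u; set b := xc j (jm u)|
  set a := yc j u; set b := yc j (jm u)].
- transitivity (- (1 - c) * a + s * b); first ring.
  by rewrite -e2 -{2}e1; ring.
- transitivity (- (1 - c) * a + s * b); first ring.
  by rewrite -e2 -{2}e1; ring.
Qed.

Section Variational.
Variables (j0 : 'I_n) (Ht : V -> R) (P : V -> V) (beta : 'I_n -> R) (l Kb C0 r0 : R).
Hypotheses (oN : odd N) (l0 : 0 < l) (HtP : quad_approx l Ht P) (Ht0 : forall z, 0 <= Ht z).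
Hypotheses (r00 : 0 < r0) (Ht_near0 : forall z, n2 z <= r0 -> Ht z = 0).
Hypothesis Ht_big : forall z, dot z (plane_scale beta z) - C0 <= Ht z.
Hypothesis P_asymp : forall z, `|P z - 2 *: plane_scale beta z| <= Kb.
Hypotheses (beta0 : forall j, 0 < beta j).
Hypothesis nonres : forall j (k : 'I_N), N%:R * slope k != beta j.
Hypothesis slope1 : 0 < slope 1 /\ N%:R * slope 1 < beta j0.

Let Psi (e : E) := N%:R^-1 * \sum_(l < N) Ht (synth e l).
Let psi (e : E) := of_modes (analysis (fun l => P (synth e l))).
Let dd : E := mxvec (\matrix_(k < N, i < n * 2) (N%:R * slope k)).
Let bb : E := mxvec (\matrix_(k < N, i < n * 2) of_xy beta beta 0 i).

Lemma avg_le (F G : 'I_N -> R) : (forall l, F l <= G l) ->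
  N%:R^-1 * \sum_(l < N) F l <= N%:R^-1 * \sum_(l < N) G l.
Proof. by move=> h; rewrite ler_wpM2l ?invr_ge0 //; exact: ler_sum. Qed.

Lemma Psi_quad : quad_approx l Psi psi.
Proof.
move=> e f; have -> : dot (psi e) (f - e) =
    N%:R^-1 * \sum_(l < N) dot (P (synth e l)) (synth f l - synth e l).
  rewrite dotC dot_modes -(eq_bigr _ (fun k _ => congr1 (dot _) (esym (mode_of_modes _ k)))).
  rewrite -(sum_dot_synth _ (fun l => P (synth e l))); congr (_ * _); apply: eq_bigr => i _.
  by rewrite synthB dotC.
rewrite /Psi -!mulrBr -!sumrB normrM ger0_norm ?invr_ge0 //.
rewrite -parseval mulrCA ler_wpM2l ?invr_ge0 // mulr_sumr.
apply: le_trans (ler_norm_sum _ _ _) _; apply: ler_sum => i _.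
by rewrite synthB.
Qed.

Lemma beta_bounds (i : 'I_(n * 2)) : exists j, of_xy beta beta 0 i = beta j.
Proof.
case/mxvec_indexP: i => j b; exists j; rewrite mxvecE mxE; by case: ifP.
Qed.

(** By [slope_rot] the trapezoidal rule is diagonal in Fourier modes, and its solutions are the
    critical points of the form with coefficients [N * slope k] minus the average of [Ht]. The
    minimax theorem is applied with mode 1 of plane [j0] as the distinguished direction. At a
    critical point the quadratic part is half the average of [dot (P z) z]. *)
Theorem discrete_loop : exists z : nat -> V,
  [/\ forall l, z (l + N)%N = z l,
      forall l, z l.+1 - z l = (2 * N%:R)^-1 *: jm (P (z l) + P (z l.+1)) &
      0 < N%:R^-1 * \sum_(l < N) (2^-1 * dot (P (z l)) (z l) - Ht (z l)) <= C0].
Proof.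
have N0 : 0 < N%:R :> R by rewrite lt_def N_neq0 ler0n.
have N0' : (0 < N)%N by case: N N1.
have [s1 sb] := slope1.
pose i0 := mxvec_index (Ordinal N1) (mxvec_index j0 (0 : 'I_2)).
have ddE k i : dd 0 (mxvec_index k i) = N%:R * slope k by rewrite mxvecE mxE.
have bbE k i : bb 0 (mxvec_index k i) = of_xy beta beta 0 i by rewrite mxvecE mxE.
have sumd (e : E) : \sum_i dd 0 i * e 0 i ^+ 2 = \sum_(k < N) N%:R * slope k * n2 (mode e k).
  rewrite sum_mxvec_index; apply: eq_bigr => k _; rewrite mulr_sumr.
  by apply: eq_bigr => i _; rewrite ddE modeE expr2.
(* The bound [2 * Kb] accounts for rotations enlarging the sup norm at most twice. The radius
   [r0 / N] comes from Parseval: a single value of the loop has at most [N] times the squared norm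
   of the modes. *)
have [||||||||e [ce ve]] := @minimax_critical_point R _ (fun i => dd 0 i) (fun i => bb 0 i) i0
    Psi psi l (2 * Kb) C0 (r0 / N%:R) l0 Psi_quad.
- by move=> e; rewrite mulr_ge0 ?invr_ge0 // sumr_ge0.
- by rewrite divr_gt0.
- move=> e he; rewrite /Psi big1 ?mulr0 // => k _; apply: Ht_near0.
  rewrite ler_pdivlMr // -parseval mulrAC mulVf ?N_neq0 // mul1r in he.
  apply: le_trans he; rewrite (bigD1 k) //= lerDl sumr_ge0 // => i _; exact: n2_ge0.
- move=> e; have -> : \sum_i bb 0 i * e 0 i ^+ 2 =
      \sum_k dot (mode e k) (plane_scale beta (mode e k)).
    rewrite sum_mxvec_index; apply: eq_bigr => k _; apply: eq_bigr => i _.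
    rewrite bbE modeE [plane_scale _ _ _ _]mxE; ring.
  have -> : \sum_k dot (mode e k) (plane_scale beta (mode e k)) =
      N%:R^-1 * \sum_(l < N) dot (synth e l) (plane_scale beta (synth e l)).
    rewrite (sum_dot_synth e (fun l => plane_scale beta (synth e l))).
    by apply: eq_bigr => k _; rewrite analysis_plane synthK.
  have -> : C0 = N%:R^-1 * \sum_(l < N) C0.
    by rewrite sumr_const card_ord -[C0 *+ N]mulr_natl mulKf // N_neq0.
  by rewrite -mulrBr -sumrB; apply: avg_le => i; exact: Ht_big.
- move=> e; case/mxvec_indexP => k i; rewrite bbE !modeE mode_of_modes.
  have -> : 2 * of_xy beta beta 0 i * mode e k 0 i =
      (analysis (fun l => 2 *: plane_scale beta (synth e l)) k) 0 i.
    by rewrite analysisZ analysis_plane synthK !mxE mulrA.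
  apply: le_trans (coordB_le _ _ _) _; rewrite -analysisB.
  by apply: analysis_norm_le => i'; exact: P_asymp.
- by case/mxvec_indexP => k i; rewrite bbE; have [j ->] := beta_bounds i.
- by case/mxvec_indexP => k i; rewrite bbE ddE; have [j ->] := beta_bounds i.
- by rewrite /i0 ddE bbE mxvecE mxE eqxx /= mulr_gt0.
have ce' (k : 'I_N) : (2 * (N%:R * slope k)) *: mode e k = analysis (fun l => P (synth e l)) k.
  apply/rowP => i; have := ce (mxvec_index k i).
  by rewrite ddE !modeE mode_of_modes => <-; rewrite [LHS]mxE.
pose F l := P (synth e l).
have Pper i : F (i + N)%N = F i by rewrite /F synth_period.
have inv i : synth (of_modes (analysis F)) i = F i by exact: analysisK.
exists (synth e); split.
- exact: synth_period.
- move=> i; rewrite -[P (synth e i)]/(F i) -[P (synth e i.+1)]/(F i.+1) -(inv i) -(inv i.+1).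
  rewrite /synth -sumrB -big_split jm_sum scaler_sumr; apply: eq_bigr => k _ /=.
  rewrite mode_of_modes -ce' !rotZ -scalerDr jmZ scalerA (mulnS k) natrD mulrDr rotD.
  have -> : (2 * N%:R)^-1 * (2 * (N%:R * slope k)) = slope k.
    by rewrite mulrA mulrA mulVf ?mul1r // mulf_neq0 ?N_neq0 // pnatr_eq0.
  set u := rot (w * (k * i)%:R) _.
  have -> : rot (w * k%:R) u - u = jm (slope k *: (rot (w * k%:R) u + u)) by exact: slope_rot.
  by rewrite jmZ addrC.
- rewrite sumd in ve; suff -> : N%:R^-1 * \sum_(l < N) (2^-1 * dot (P (synth e l)) (synth e l) - Ht (synth e l)) =
      \sum_(k < N) N%:R * slope k * n2 (mode e k) - Psi e by [].
  rewrite sumrB mulrBr; congr (_ - _).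
  rewrite -mulr_sumr mulrCA.
  rewrite (eq_bigr (fun l : 'I_N => dot (synth e l) (P (synth e l)))); last by move=> *; rewrite dotC.
  rewrite (sum_dot_synth e (fun l => P (synth e l))) mulr_sumr; apply: eq_bigr => k _.
  by rewrite -ce' dotZr -/(n2 _) !mulrA mulVf ?mul1r // pnatr_eq0.
Qed.

End Variational.
End DiscreteLoop.

(** * Estimates for sine, cosine and rotations *)

Section Trigonometry.
Variable R : realType.
Implicit Types x y t : R.

Lemma sin_le x : 0 <= x -> sin x <= x.
Proof.
rewrite le_eqVlt => /orP[/eqP <-|x0]; first by rewrite sin0.
have [|c _ ] := @MVT R sin cos 0 x x0 (fun y _ => is_derive_sin y).
  by apply: continuous_subspaceT => y; exact: continuous_sin.
rewrite sin0 !subr0 => ->; rewrite ler_piMl ?(ltW x0) //; exact: cos_le1.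
Qed.

Lemma norm_sin_le x : `|sin x| <= `|x|.
Proof.
have h y : 0 <= y -> `|sin y| <= y.
  move=> y0; rewrite ler_norml sin_le // andbT.
  case: (lerP y 1) => y1; last by have := sin_geN1 y; lra.
  have p1 := pihalf_ge1 R.
  apply: le_trans (_ : 0 <= _); first by lra.
  have -> : sin y = cos (y - pi / 2) by rewrite cosBpihalf.
  by apply: cos_ge0_pihalf; apply/andP; split; lra.
have [x0|x0] := leP 0 x; first by rewrite [leRHS]ger0_norm //; exact: h.
by rewrite [leRHS]ltr0_norm // -normrN -sinN; apply: h; rewrite oppr_ge0 ltW.
Qed.

Lemma cosB1_le x : `|cos x - 1| <= x ^+ 2.
Proof.
have -> : x = (x / 2) *+ 2 by rewrite -mulr_natr mulfVK // pnatr_eq0.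
rewrite cos_mulr2n; set y := x / 2.
have -> : cos y ^+ 2 *+ 2 - 1 - 1 = - (2 * sin y ^+ 2).
  by rewrite -mulr_natl; have := cos2Dsin2 y; lra.
rewrite normrN ger0_norm; last by rewrite mulr_ge0 ?sqr_ge0.
have : sin y ^+ 2 <= y ^+ 2.
  rewrite -[sin y ^+ 2]real_normK ?num_real // -[y ^+ 2]real_normK ?num_real //.
  by rewrite ler_pXn2r ?nnegrE // norm_sin_le.
have -> : (y *+ 2) ^+ 2 = 4 * y ^+ 2 by rewrite -mulr_natl; ring.
have := sqr_ge0 y; lra.
Qed.

Lemma sinB_le x : `|sin x - x| <= x ^+ 2.
Proof.
have h y : 0 <= y -> `|sin y - y| <= y ^+ 2.
  rewrite le_eqVlt => /orP[/eqP <-|y0]; first by rewrite sin0 subrr normr0 expr0n.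
  case: (lerP 2 y) => y2.
    have := sin_geN1 y; have := sin_le1 y; rewrite ler_norml; nra.
  have [|c cy] := @MVT R sin cos 0 y y0 (fun z _ => is_derive_sin z).
    by apply: continuous_subspaceT => z; exact: continuous_sin.
  rewrite sin0 !subr0 => ->; have -> : cos c * y - y = (cos c - 1) * y by ring.
  rewrite normrM (gtr0_norm y0) expr2 ler_wpM2r ?(ltW y0) //.
  move: cy; rewrite in_itv /= => /andP[c0 cy].
  case: (lerP c 1) => c1.
    by apply: le_trans (cosB1_le c) _; nra.
  have [|k _] := @MVT R cos (fun x => - sin x) 0 c c0 (fun z _ => is_derive_cos z).
    by apply: continuous_subspaceT => z; exact: continuous_cos.
  rewrite cos0 !subr0 => ->; rewrite normrM normrN (gtr0_norm c0).
  apply: le_trans (ltW cy); rewrite ler_piMl ?(ltW c0) //.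
  by rewrite ler_norml sin_geN1 sin_le1.
have [x0|x0] := leP 0 x; first exact: h.
have := h (- x); rewrite sinN sqrrN -opprD normrN; apply; lra.
Qed.

(** Serves to read the winding number of an almost closed orbit from the cosine of its total
    angle. *)
Lemma cos_near1 e : 0 < e -> exists2 c, c < 1 & forall t, 0 <= t -> c < cos t ->
  exists k : nat, `|t - 2 * pi * k%:R| < e.
Proof.
move=> e0; pose e' := Num.min e pi; have p0 := pi_gt0 R.
have e'0 : 0 < e' by rewrite lt_min e0 p0.
have e'p : e' <= pi by rewrite ge_min lexx orbT.
have cosP k t : cos (t - 2 * pi * k%:R) = cos t.
  elim: k => [|k IH]; first by rewrite mulr0 subr0.
  rewrite -IH -[k.+1%:R]natr1 mulrDr mulr1 opprD addrA; set a := t - _.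
  rewrite cosB mulr_natl cos2pi sin2pi.
  by rewrite mulr1 mulr0 addr0.
exists (cos e').
  rewrite -[ltRHS](@cos0 R) ltr_cos // in_itv /= ?lexx ?(ltW p0) ?e'p ?(ltW e'0) //.
move=> t t0 ct; pose k := Num.trunc (t / (2 * pi)).
have pp : 0 < 2 * pi :> R by rewrite mulr_gt0.
have tk : t / (2 * pi) >= 0 by rewrite divr_ge0 // ltW.
have := trunc_itv tk; rewrite -/k => /andP[k1 k2].
rewrite ler_pdivlMr // mulrC in k1; rewrite ltr_pdivrMr // mulrC -[k.+1%:R]natr1 mulrDr mulr1 in k2.
set s := t - 2 * pi * k%:R; have s0 : 0 <= s by rewrite /s; lra.
have s2 : s < 2 * pi by rewrite /s; lra.
have cs : cos e' < cos s by rewrite /s cosP.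
case: (lerP s pi) => sp.
  exists k; rewrite -/s ger0_norm //; have : s < e'.
    by rewrite -ltr_cos // in_itv /= ?s0 ?sp ?(ltW e'0) ?e'p.
  by rewrite lt_min => /andP[].
exists k.+1; have -> : t - 2 * pi * k.+1%:R = - (2 * pi - s).
  by rewrite /s -[k.+1%:R]natr1 mulrDr mulr1; ring.
have cs' : cos e' < cos (2 * pi - s).
  have -> : 2 * pi - s = - (s - 2 * pi * 1%:R) by ring.
  by rewrite cosN (cosP 1%N s).
have : 2 * pi - s < e'.
  have m1 : 2 * pi - s \in `[0, pi] by rewrite in_itv /=; apply/andP; split; lra.
  have m2 : e' \in `[0, pi] by rewrite in_itv /= (ltW e'0) e'p.
  by rewrite -ltr_cos.
rewrite normrN ger0_norm; last by lra.
by rewrite lt_min => /andP[].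
Qed.

Section RotEstimates.
Variable n : nat.
Implicit Types u v : 'rV[R]_(n * 2).

Lemma rot_lipschitz s t u : `|rot t u - rot s u| <= 2 * `|t - s| * (1 + `|t - s|) * `|u|.
Proof.
have -> : rot t u - rot s u = rot s (rot (t - s) u - u) by rewrite rotB -rotD subrKC.
apply: le_trans (norm_rot_le _ _) _; set h := t - s.
have -> : rot h u - u = (cos h - 1) *: u + sin h *: jm u.
  by rewrite /rot scalerBl scale1r addrAC.
rewrite -!mulrA ler_wpM2l //; apply: le_trans (ler_normD _ _) _.
rewrite !normrZ norm_jm -mulrDl mulrA ler_wpM2r //.
apply: le_trans (lerD (cosB1_le h) (norm_sin_le h)) _.
by rewrite -[h ^+ 2]real_normK ?num_real // mulrDr mulr1 addrC expr2.
Qed.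

Lemma rot_taylor t h u : `|rot (t + h) u - rot t u - h *: jm (rot t u)| <= 4 * h ^+ 2 * `|u|.
Proof.
have -> : rot (t + h) u - rot t u - h *: jm (rot t u) =
   rot t ((cos h - 1) *: u + (sin h - h) *: jm u).
  rewrite rotDr !rotZ rot_jm [t + h]addrC rotD [rot h _]/rot.
  by rewrite !scalerBl scale1r -addrA addrACA.
apply: le_trans (norm_rot_le _ _) _.
apply: le_trans (ler_wpM2l _ (ler_normD _ _)) _ => //.
rewrite !normrZ norm_jm -mulrDl.
have -> : 4 * h ^+ 2 * `|u| = 2 * ((2 * h ^+ 2) * `|u|) by ring.
apply: ler_wpM2l => //; apply: ler_wpM2r => //.
have := cosB1_le h; have := sinB_le h; lra.
Qed.

End RotEstimates.
End Trigonometry.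

(** Pigeonhole on [#|T| + 1] distinct points of the interval. *)
Lemma avoid_finite (R : realType) (T : finType) (f : T -> R) (a b : R) : a < b ->
  exists2 x, a < x < b & forall t, f t != x.
Proof.
move=> ab; apply: contrapT => N.
pose p (i : 'I_#|T|.+1) : R := a + (b - a) / i.+2%:R.
have pab i : a < p i < b.
  have i0 : 0 < i.+2%:R :> R by rewrite ltr0n.
  rewrite ltrDl divr_gt0 ?subr_gt0 //= -ltrBrDl ltr_pdivrMr // ltr_pMr ?subr_gt0 //.
  by rewrite ltr1n.
have hit i : exists t, f t == p i.
  apply: contrapT => h; apply: N; exists (p i) => // t; apply/negP => ft.
  by apply: h; exists t.
have [g gP] := choice hit.
have : (#|'I_#|T|.+1| <= #|T|)%N.
  apply: (@leq_card _ _ g) => i j gij.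
  have := gP i; rewrite gij => /eqP e1; have := gP j; rewrite e1 => /eqP.
  rewrite /p => /addrI /(mulfI (lt0r_neq0 (etrans (subr_gt0 _ _) ab))) /invr_inj /eqP.
  by rewrite eqr_nat => /eqP[] /val_inj.
by rewrite card_ord ltnn.
Qed.

(** * The Hamiltonian outside of a cylinder *)

Section Cutoff.
Variables (R : realType) (C : R).
Hypothesis C0 : 0 < C.
Implicit Types s t : R.
Let mp t := Num.max 0 t.

Lemma mp_neg s : s <= 0 -> mp s = 0. Proof. by move=> h; apply/max_idPl. Qed.
Lemma mp_pos s : 0 <= s -> mp s = s. Proof. by move=> h; apply/max_idPr. Qed.

(** A primitive of [dcut]: the difference of two squared positive parts lets the slope rise linearly
    from 0 to 1 on [[C, 3 C]]. *)
Definition cut t := (mp (t - C) ^+ 2 - mp (t - 3 * C) ^+ 2) / (4 * C).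
Definition dcut t := (mp (t - C) - mp (t - 3 * C)) / (2 * C).

Lemma cut_mul t : 4 * C * cut t = mp (t - C) ^+ 2 - mp (t - 3 * C) ^+ 2.
Proof. by rewrite /cut mulrC mulfVK // gt_eqF // mulr_gt0. Qed.

Lemma dcut_mul t : 2 * C * dcut t = mp (t - C) - mp (t - 3 * C).
Proof. by rewrite /dcut mulrC mulfVK // gt_eqF // mulr_gt0. Qed.

Lemma cut_low t : t <= C -> cut t = 0 /\ dcut t = 0.
Proof.
have Cp := C0.
move=> h; have h1 : t - C <= 0 by lra.
have h2 : t - 3 * C <= 0 by lra.
by rewrite /cut /dcut (mp_neg h1) (mp_neg h2) !subrr !mul0r.
Qed.

Lemma cut_high t : 3 * C <= t -> cut t = t - 2 * C /\ dcut t = 1.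
Proof.
have Cp := C0.
move=> h; have c4 : 4 * C != 0 by rewrite gt_eqF // mulr_gt0.
have c2 : 2 * C != 0 by rewrite gt_eqF // mulr_gt0.
have h1 : 0 <= t - C by lra.
have h2 : 0 <= t - 3 * C by lra.
rewrite /cut /dcut (mp_pos h1) (mp_pos h2).
split; first by apply: (mulIf c4); rewrite mulfVK //; ring.
by apply: (mulIf c2); rewrite mulfVK //; ring.
Qed.

Lemma cut_mid t : C <= t <= 3 * C -> 4 * C * cut t = (t - C) ^+ 2 /\ 2 * C * dcut t = t - C.
Proof.
have Cp := C0.
move=> /andP[h1 h2]; have h3 : 0 <= t - C by lra.
have h4 : t - 3 * C <= 0 by lra.
by rewrite cut_mul dcut_mul (mp_pos h3) (mp_neg h4) expr0n !subr0.
Qed.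

Lemma dcut_bounds t : 0 <= dcut t <= 1.
Proof.
have Cp := C0.
case: (lerP t C) => h1; first by have [_ ->] := cut_low h1; rewrite lexx ler01.
case: (lerP (3 * C) t) => h2; first by have [_ ->] := cut_high h2; rewrite lexx ler01.
have [|_ e] := @cut_mid t; first by rewrite !ltW.
by apply/andP; split; nra.
Qed.

Lemma cut_ge t : 0 <= cut t /\ t - 2 * C <= cut t.
Proof.
have Cp := C0.
case: (lerP t C) => h1; first by have [-> _] := cut_low h1; split=> //; lra.
case: (lerP (3 * C) t) => h2; first by have [-> _] := cut_high h2; split=> //; lra.
have [|e _] := @cut_mid t; first by rewrite !ltW.
have := sqr_ge0 (t - C); have := sqr_ge0 (t - 3 * C); rewrite -e => p1 p2.
by split; nra.
Qed.

Lemma cut_le t : 0 <= t -> cut t <= t.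
Proof.
have Cp := C0.
move=> t0; case: (lerP t C) => h1; first by have [-> _] := cut_low h1.
case: (lerP (3 * C) t) => h2; first by have [-> _] := cut_high h2; lra.
have [|e _] := @cut_mid t; first by rewrite !ltW.
by nra.
Qed.

Lemma mp_quad s t : `|mp t ^+ 2 - mp s ^+ 2 - 2 * mp s * (t - s)| <= (t - s) ^+ 2.
Proof.
have Cp := C0.
have q := sqr_ge0 (t - s).
have [ht|/ltW ht] := leP 0 t; have [hs|/ltW hs] := leP 0 s;
  rewrite ?(mp_pos ht) ?(mp_neg ht) ?(mp_pos hs) ?(mp_neg hs).
- have -> : t ^+ 2 - s ^+ 2 - 2 * s * (t - s) = (t - s) ^+ 2 by ring.
  by rewrite ger0_norm.
- have -> : t ^+ 2 - 0 ^+ 2 - 2 * 0 * (t - s) = t ^+ 2 by ring.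
  by rewrite ger0_norm ?sqr_ge0 //; nra.
- have -> : 0 ^+ 2 - s ^+ 2 - 2 * s * (t - s) = s * (s - 2 * t) by ring.
  rewrite ger0_norm; last by rewrite mulr_ge0 //; lra.
  by have := sqr_ge0 t; lra.
- have -> : 0 ^+ 2 - 0 ^+ 2 - 2 * 0 * (t - s) = 0 :> R by ring.
  by rewrite normr0.
Qed.

Lemma cut_quad s t : `|cut t - cut s - dcut s * (t - s)| * (2 * C) <= (t - s) ^+ 2.
Proof.
have Cp := C0.
have := mp_quad (s - C) (t - C); have := mp_quad (s - 3 * C) (t - 3 * C).
have -> : t - C - (s - C) = t - s by ring.
have -> : t - 3 * C - (s - 3 * C) = t - s by ring.
have := cut_mul t; have := cut_mul s; have := dcut_mul s.
set a := mp (t - C); set b := mp (s - C); set a' := mp (t - 3 * C); set b' := mp (s - 3 * C).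
clearbody a b a' b'; move: (cut t) (cut s) (dcut s) => x y z e1 e2 e3 h1 h2.
have c2 : 0 < 2 * C by lra.
rewrite -[X in _ * X <= _](gtr0_norm c2) -normrM.
have -> : (x - y - z * (t - s)) * (2 * C) =
  ((a ^+ 2 - b ^+ 2 - 2 * b * (t - s)) - (a' ^+ 2 - b' ^+ 2 - 2 * b' * (t - s))) / 2.
  have -> : (x - y - z * (t - s)) * (2 * C) =
     (4 * C * x - 4 * C * y - 2 * (2 * C * z) * (t - s)) / 2.
    by lra.
  by rewrite e1 e2 e3; lra.
move: h1 h2; rewrite !ler_norml => /andP[? ?] /andP[? ?]; apply/andP; split; lra.
Qed.

Lemma cut_error_le s t : 0 <= s -> 0 <= t ->
  `|cut t - cut s - dcut s * (t - s)| <= 2 * (s + t).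
Proof.
have Cp := C0.
move=> s0 t0; have [d0 d1] := andP (dcut_bounds s).
have [p1 _] := cut_ge s; have [p2 _] := cut_ge t; have q1 := cut_le s0; have q2 := cut_le t0.
rewrite ler_norml; apply/andP; split; nra.
Qed.

(** The constant does not depend on [C], and the unbounded gradient of [n2] does no harm, because
    [cut] is curved only below [3 C]. If [a + a' <= 18 C], then [cut_quad] suffices. Otherwise both
    arguments lie in the linear range, or they are so far apart that the crude bound [2 (a + a')] is
    enough. *)
Lemma cut_n2_quad m (u v : 'rV[R]_m) :
  `|cut (n2 v) - cut (n2 u) - dcut (n2 u) * (n2 v - n2 u)| <= 18 * n2 (v - u).
Proof.
have Cp := C0.
set a := n2 u; set a' := n2 v; set e := n2 (v - u); set E := `|_|.
have a0 : 0 <= a by exact: n2_ge0. have a'0 : 0 <= a' by exact: n2_ge0.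
have e0 : 0 <= e by exact: n2_ge0.
have h1 : E * (2 * C) <= (a' - a) ^+ 2 by exact: cut_quad.
have h2 : E <= 2 * (a + a') by exact: cut_error_le.
have h3 : (a' - a) ^+ 2 <= 2 * (a + a') * e.
  have -> : a' - a = dot (v + u) (v - u).
    rewrite /a /a' /n2 dotDl !dotBr (dotC u v); ring.
  apply: le_trans (cauchy_schwarz _ _) _; rewrite -/e ler_wpM2r //.
  by apply: le_trans (n2D_le _ _) _; rewrite -/a -/a' mulrDr addrC.
have h4 : a' <= 2 * a + 2 * e.
  by have := n2D_le u (v - u); rewrite subrKC.
have h5 : a <= 2 * a' + 2 * e.
  by have := n2D_le v (u - v); rewrite subrKC -[n2 (u - v)]n2N opprB.
case: (lerP (a + a') (18 * C)) => h6.
  rewrite -(@ler_pM2r _ (2 * C)) ?mulr_gt0 //; apply: le_trans h1 _; apply: le_trans h3 _.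
  nra.
case: (lerP (3 * C) a) => ha; case: (lerP (3 * C) a') => ha'.
- have [c1 c2] := cut_high ha; have [c3 _] := cut_high ha'.
  rewrite /E c1 c2 c3; have -> : a' - 2 * C - (a - 2 * C) - 1 * (a' - a) = 0 by ring.
  by rewrite normr0 mulr_ge0.
- lra.
- lra.
- lra.
Qed.

End Cutoff.

Section ClosedLoop.
Variables (R : realType) (n : nat) (j0 : 'I_n) (mu : 'I_n -> R) (C : R).
Hypotheses (C0 : 0 < C) (mu0 : forall j, 0 < mu j <= 1) (muj0 : mu j0 = 1).
Local Notation V := 'rV[R]_(n * 2).
Local Notation D := (plane_scale mu).

Definition barrier (kap : R) (z : V) := kap * cut C (n2 (D z)).
Definition dbarrier (kap : R) (z : V) : V := (2 * kap * dcut C (n2 (D z))) *: D (D z).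

Lemma dot_plane_sym (u v : V) : dot (D u) v = dot u (D v).
Proof. by apply: eq_bigr => i _; rewrite !mxE mulrCA mulrA. Qed.

Lemma plane_sup i : 0 < of_xy mu mu 0 i <= 1.
Proof. by have [j ->] := beta_bounds mu i. Qed.

Lemma n2_plane_le (z : V) : n2 (D z) <= n2 z.
Proof.
apply: ler_sum => i _; rewrite !mxE; have /andP[m0 m1] := plane_sup i.
rewrite mulrACA -[leRHS]mul1r -expr2 ler_wpM2r -?expr2 ?sqr_ge0 //.
by rewrite expr_le1 // ltW.
Qed.

Lemma planeB (u v : V) : D (u - v) = D u - D v.
Proof. by rewrite plane_scaleD -scaleN1r plane_scaleZ scaleN1r. Qed.

Lemma barrier_quad kap : 0 < kap <= 9 -> quad_approx 200 (barrier kap) (dbarrier kap).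
Proof.
move=> /andP[k0 k9] x y; rewrite /barrier /dbarrier.
have e := cut_n2_quad C0 (D x) (D y); rewrite -planeB in e.
have /andP[d0 d1] := dcut_bounds C0 (n2 (D x)).
have q : n2 (D y) - n2 (D x) = 2 * dot (D x) (D (y - x)) + n2 (D (y - x)).
  have e2 : D y = D x + D (y - x) by rewrite -plane_scaleD subrKC.
  by rewrite e2 n2D; ring.
have -> : dot ((2 * kap * dcut C (n2 (D x))) *: D (D x)) (y - x) =
   kap * (dcut C (n2 (D x)) * (n2 (D y) - n2 (D x))) - kap * (dcut C (n2 (D x)) * n2 (D (y - x))).
  by rewrite dotZl dot_plane_sym q; ring.
have h := n2_plane_le (y - x); have h0 := n2_ge0 (D (y - x)).
move: q e h h0 d0 d1; move: (n2 (D (y - x))) (n2 (y - x)) => m m'.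
move: (cut C (n2 (D y))) (cut C (n2 (D x))) (dcut C (n2 (D x))) => c1 c2 d.
move: (n2 (D x)) (n2 (D y)) => a b q e h h0 d0 d1.
have -> : kap * c1 - kap * c2 - (kap * (d * (b - a)) - kap * (d * m)) =
  kap * (c1 - c2 - d * (b - a)) + kap * (d * m) by ring.
apply: le_trans (ler_normD _ _) _; rewrite !normrM (gtr0_norm k0) (ger0_norm d0) (ger0_norm h0).
have h1 : d * m <= m by rewrite ler_piMl.
have h2 : kap * `|c1 - c2 - d * (b - a)| <= kap * (18 * m) by rewrite ler_wpM2l // ltW.
have h3 : kap * (d * m) <= kap * m by rewrite ler_wpM2l // ltW.
have h4 : kap * m <= 9 * m by rewrite ler_wpM2r.
lra.
Qed.

(** Since [N * slope 1 <= 2 pi < 8], a quadratic Hamiltonian with coefficient above 8 outgrows the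
    first Fourier mode. *)
Lemma slope1_bounds N : (4 < N)%N -> 0 < slope R N 1 /\ N%:R * slope R N 1 < 8.
Proof.
move=> N4; have N0 : 0 < N%:R :> R by rewrite ltr0n; case: N N4.
have p0 := pi_gt0 R; have /andP[p1 p2] := pihalf_02 R.
have h4 : 4 < N%:R :> R by rewrite ltr_nat.
have hp : 2 * pi < pi / 2 * N%:R :> R by nra.
rewrite /slope /basic_angle mulr1; set x := 2 * pi / N%:R.
have xN : N%:R * x = 2 * pi by rewrite /x mulrC mulfVK // gt_eqF.
have x0 : 0 < x by rewrite divr_gt0 // mulr_gt0.
have x1 : x < pi / 2 by rewrite ltr_pdivrMr.
clearbody x.
have s0 : 0 < sin x by apply: sin_gt0_pihalf; rewrite x0.
have c0 : 0 < cos x by apply: cos_gt0_pihalf; rewrite x1 andbT; lra.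
have c1 : 0 < 1 + cos x by rewrite addr_gt0.
split; first exact: divr_gt0.
apply: (@le_lt_trans _ _ (N%:R * x)).
  apply: ler_wpM2l; first exact: ltW.
  rewrite ler_pdivrMr //; apply: le_trans (sin_le (ltW x0)) _.
  by rewrite ler_peMr ?(ltW x0) // lerDl ltW.
by rewrite xN; lra.
Qed.

Variables (H : V -> R) (gH : V -> V) (lH B r0 : R).
Hypotheses (lH0 : 0 < lH) (HP : quad_approx lH H gH) (H0 : forall z, 0 <= H z).
Hypotheses (r00 : 0 < r0 <= C) (H_near0 : forall z, n2 z <= r0 -> H z = 0).
Hypothesis gHB : forall z, `|gH z| <= B.

(** The growth rate [kap] is taken above 8, to exceed the first mode, and off the finitely many
    resonances. The bound [18 C] dominates [2 kap C], the amount by which the barrier may fall below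
    its quadratic asymptote. *)
Theorem closed_loop N : odd N -> (4 < N)%N -> exists kap (z : nat -> V),
  [/\ 8 < kap < 9, forall l, z (l + N)%N = z l,
      forall l, z l.+1 - z l = (2 * N%:R)^-1 *:
        jm ((gH (z l) + dbarrier kap (z l)) + (gH (z l.+1) + dbarrier kap (z l.+1))) &
      0 < N%:R^-1 * \sum_(l < N) (2^-1 * dot (gH (z l) + dbarrier kap (z l)) (z l) -
        (H (z l) + barrier kap (z l))) <= 18 * C].
Proof.
move=> oN N4; have Cp := C0; have N1 : (1 < N)%N by case: N N4 {oN} => [|[|]].
have [kap k89 kavoid] := @avoid_finite R ('I_n * 'I_N)%type
  (fun p => N%:R * slope R N p.2 / mu p.1 ^+ 2) 8 9 (ltac:(lra)).
have /andP[k8 k9] := k89; have k0 : 0 < kap by lra.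
have r0p : 0 < r0 by case/andP: r00.
have r0C : r0 <= C by case/andP: r00.
have [s1 s8] := slope1_bounds N4.
have ds z : plane_scale (fun j => kap * mu j ^+ 2) z = kap *: D (D z).
  by apply: xy_ext => j; rewrite ?xcZ ?ycZ ?xc_plane ?yc_plane; ring.
have [||||||||||z [z1 z2 z3]] := @discrete_loop R n N N1 j0 (fun z => H z + barrier kap z)
  (fun z => gH z + dbarrier kap z) (fun j => kap * mu j ^+ 2) (lH + 200)
  (B + 18 * (1 + 3 * C)) (kap * (2 * C)) r0 oN.
- by rewrite addr_gt0.
- move=> x y; rewrite dotDl mulrDl.
  have -> : H y + barrier kap y - (H x + barrier kap x) - (dot (gH x) (y - x) + dot (dbarrier kap x) (y - x)) =
    (H y - H x - dot (gH x) (y - x)) + (barrier kap y - barrier kap x - dot (dbarrier kap x) (y - x)) by ring.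
  apply: le_trans (ler_normD _ _) _; apply: lerD; first exact: HP.
  by apply: barrier_quad; rewrite k0 ltW.
- move=> z; rewrite addr_ge0 // mulr_ge0 ?(ltW k0) //.
  by have [] := cut_ge C0 (n2 (D z)).
- exact: r0p.
- move=> z zr; rewrite H_near0 // add0r /barrier; have [|-> _] := @cut_low _ _ C0 (n2 (D z)).
    by apply: le_trans (n2_plane_le _) _; apply: le_trans zr _.
  by rewrite mulr0.
- move=> z; rewrite ds dotZr -dot_plane_sym -/(n2 _) /barrier -mulrBr.
  have [_ h] := cut_ge C0 (n2 (D z)).
  by rewrite -[leLHS]add0r lerD // ler_wpM2l // ltW.
- move=> z; rewrite ds /dbarrier.
  have -> : gH z + (2 * kap * dcut C (n2 (D z))) *: D (D z) - 2 *: (kap *: D (D z)) =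
     gH z - (2 * kap * (1 - dcut C (n2 (D z)))) *: D (D z).
    by move: (D (D z)) (dcut _ _) => u c; apply/rowP => i; rewrite !mxE; ring.
  apply: le_trans (ler_normB _ _) _; apply: lerD; first exact: gHB.
  case: (lerP (3 * C) (n2 (D z))) => h.
    have [_ ->] := cut_high C0 h; rewrite subrr mulr0 scale0r normr0; lra.
  have /andP[d0 d1] := dcut_bounds C0 (n2 (D z)).
  rewrite normrZ ger0_norm; last by rewrite !mulr_ge0 ?subr_ge0 // ltW.
  have h2 : `|D (D z)| <= 1 + 3 * C.
    have := norm_sqr_le (D (D z)); have := n2_plane_le (D z).
    by have := normr_ge0 (D (D z)); nra.
  apply: (@le_trans _ _ (18 * `|D (D z)|)); last by rewrite ler_wpM2l.
  rewrite ler_wpM2r //; nra.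
- move=> j; have /andP[m0 _] := mu0 j; by rewrite mulr_gt0 // exprn_gt0.
- move=> j k; have /andP[m0 _] := mu0 j; have := kavoid (j, k) => /=.
  by apply: contraNneq => ->; rewrite mulfK // gt_eqF // exprn_gt0.
- by split=> //; rewrite muj0 expr1n mulr1; apply: lt_trans s8 _.
exists kap, z; split=> //; case/andP: z3 => h1 h2; apply/andP; split=> //.
apply: le_trans h2 _; rewrite mulrA (mulrC kap) -mulrA mulrCA; nra.
Qed.

Lemma barrier_zero kap z : n2 (D z) <= C -> barrier kap z = 0 /\ dbarrier kap z = 0.
Proof.
move=> h; have [e1 e2] := cut_low C0 h.
by rewrite /barrier /dbarrier e1 e2 !mulr0 scale0r.
Qed.

(** Bounds what the barrier alone contributes to the action at one point of the loop. *)
Lemma barrier_virial kap z : 0 < kap < 9 ->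
  2^-1 * dot (dbarrier kap z) z - barrier kap z <= 18 * C.
Proof.
move=> /andP[k0 k9]; have Cp := C0; rewrite /dbarrier /barrier dotZl dot_plane_sym -/(n2 _).
set t := n2 _; have t0 : 0 <= t by exact: n2_ge0.
have -> : 2^-1 * (2 * kap * dcut C t * t) - kap * cut C t = kap * (dcut C t * t - cut C t) by lra.
have h : dcut C t * t - cut C t <= 2 * C.
  have /andP[d0 d1] := dcut_bounds C0 t; have [c0 c1] := cut_ge C0 t.
  have : dcut C t * t <= t by rewrite ler_piMl.
  lra.
apply: (@le_trans _ _ (kap * (2 * C))); first by rewrite ler_wpM2l // ltW.
nra.
Qed.

End ClosedLoop.

(** * Collars of symplectic embeddings *)

Section CompactSequences.
Variables (R : realType) (m : nat).
Local Notation V := 'rV[R]_m.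

Lemma compact_subseq (S : set V) (B : R) (u : nat -> V) :
  closed S -> (forall x, S x -> `|x| <= B) -> (forall k, S (u k)) ->
  exists2 x, S x & forall e : R, 0 < e -> forall N, exists k, (N <= k)%N /\ `|u k - x| < e.
Proof.
move=> cS SB Su; have [x xP] := bounded_seq_cluster (fun k => SB _ (Su k)).
exists x => //; suff : closure S x by rewrite -((closure_id S).1 cS).
move=> A /nbhs_ballP [e /= e0 eA].
have [k [_ kx]] := xP e e0 0%N; exists (u k); split; first exact: Su.
by apply: eA; rewrite -ball_normE /= distrC.
Qed.

Lemma bounded_on_compact (W : normedModType R) (S : set V) (B : R) (F : V -> W) :
  closed S -> (forall x, S x -> `|x| <= B) -> (forall x, S x -> {for x, continuous F}) ->
  exists2 c : R, 0 < c & forall x, S x -> `|F x| <= c.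
Proof.
move=> cS SB cF; apply: contrapT => N.
have H k : exists x, S x /\ k.+1%:R < `|F x|.
  apply: contrapT => h; apply: N; exists k.+1%:R; first by rewrite ltr0n.
  by move=> x Sx; rewrite leNgt; apply/negP => h'; apply: h; exists x.
have [u uP] := choice H.
have [x Sx xP] := compact_subseq cS SB (fun k => (uP k).1).
have /cvgrPdist_lt /(_ 1 ltr01) /nbhs_ballP [d /= d0 dP] := cF x Sx.
have [k [Nk kx]] := xP d d0 (Num.trunc (`|F x| + 1)).+1.
have : `|F x - F (u k)| < 1 by apply: dP; rewrite -ball_normE /= distrC.
have [_ h] := uP k.
have := ler_normB (F x - F (u k)) (F x).
rewrite addrAC subrr add0r normrN => h2.
have h3 : `|F x| + 1 < k.+1%:R.
  have := truncnS_gt (`|F x| + 1); move=> /lt_le_trans; apply.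
  by rewrite ler_nat; apply: leq_trans Nk _.
lra.
Qed.

End CompactSequences.

Section Segments.
Variables (R : realType) (m p : nat) (F : 'rV[R]_m -> 'rV[R]_p).

Lemma is_derive_segment (x h : 'rV[R]_m) (t : R) k : differentiable F (x + t *: h) ->
  is_derive t 1 (fun s : R => F (x + s *: h) 0 k) (('D_h F (x + t *: h)) 0 k).
Proof.
move=> dF; have := @diff_derivable _ _ _ F (x + t *: h) h dF; rewrite /derivable => /cvg_ex [L cL].
have -> : 'D_h F (x + t *: h) = L by apply/cvg_lim.
have cv : (fun s : R => s^-1 *: (F (x + (s *: (1 : R) + t) *: h) 0 k - F (x + t *: h) 0 k)) @ 0^' --> L 0 k.
  have -> : (fun s : R => s^-1 *: (F (x + (s *: (1 : R) + t) *: h) 0 k - F (x + t *: h) 0 k)) =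
    (fun u : 'rV[R]_p => u 0 k) \o (fun s : R => s^-1 *: (F (s *: h + (x + t *: h)) - F (x + t *: h))).
    apply/funext => s /=; rewrite !mxE; congr (_ * (F _ 0 k - _)).
    by rewrite scalerDl [s *: 1]mulr1 addrCA.
  by apply: cvg_comp cL _; exact: coord_continuous_rV.
apply: DeriveDef.
  by apply/cvg_ex; exists (L 0 k).
by apply/cvg_lim.
Qed.

Lemma segment_mvt (x h : 'rV[R]_m) k :
  (forall t, 0 <= t <= 1 -> differentiable F (x + t *: h)) ->
  exists2 t, 0 <= t <= 1 & F (x + h) 0 k - F x 0 k = ('D_h F (x + t *: h)) 0 k.
Proof.
move=> dF.
have [||t] := @MVT_segment R (fun s : R => F (x + s *: h) 0 k)
    (fun s => ('D_h F (x + s *: h)) 0 k) 0 1 ler01.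
- move=> t; rewrite in_itv /= => /andP[t0 t1].
  by apply: is_derive_segment; apply: dF; rewrite !ltW.
- apply: derivable_within_continuous => t; rewrite in_itv /= => t01.
  by have [] := is_derive_segment k (dF t t01).
rewrite in_itv /= subr0 mulr1 scale1r scale0r addr0 => t01 ->.
by exists t.
Qed.

End Segments.

Section Collar.
Variables (R : realType) (n : nat).
Local Notation V := 'rV[R]_(n * 2).

Definition collar (r eta : R) : set V := [set x | `|n2 x - r ^+ 2| <= eta].

(** All that later arguments know about an embedding near the sphere: first order Taylor estimates
    with a single constant, symplecticity, and a Lipschitz inverse. The derivative is a matrix
    acting on rows. *)
Record collar_map (r eta K : R) (f : V -> V) (Df : V -> 'M[R]_(n * 2)) := CollarMap {
  collar_taylor : forall x y, collar r eta x -> collar r eta y ->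
    `|f y - f x - (y - x) *m Df x| <= K * `|y - x| ^+ 2;
  collar_deriv_lip : forall (x y v : V), collar r eta x -> collar r eta y ->
    `|v *m Df y - v *m Df x| <= K * `|y - x| * `|v|;
  collar_deriv_le : forall (x v : V), collar r eta x -> `|v *m Df x| <= K * `|v|;
  collar_symplectic : forall (x u v : V), collar r eta x ->
    dot (jm (u *m Df x)) (v *m Df x) = dot (jm u) v;
  collar_lip : forall x y, collar r eta x -> collar r eta y -> `|f y - f x| <= K * `|y - x|;
  collar_inv_lip : forall x y, collar r eta x -> collar r eta y -> `|y - x| <= K * `|f y - f x| }.

Lemma collar_closed r eta : closed (collar r eta).
Proof.
have -> : collar r eta = (fun x => `|n2 x - r ^+ 2|) @^-1` [set t | t <= eta] by [].
apply: closed_comp; last exact: closed_le.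
move=> x _; apply: (@ct_comp _ _ _ (fun x : V => n2 x - r ^+ 2) (fun t : R => `|t|)).
  by apply: ctB; [exact: n2_continuous|exact: ct_cst].
exact: norm_continuous.
Qed.

Lemma collar_bounded r eta (x : V) : collar r eta x -> `|x| <= r ^+ 2 + eta + 1.
Proof.
rewrite /collar /= ler_norml => /andP[_ h]; have := norm_sqr_le x; have := normr_ge0 x; nra.
Qed.

Lemma collar_sub r eta eta' (x : V) : eta <= eta' -> collar r eta x -> collar r eta' x.
Proof. by move=> h1 h2; apply: le_trans h2 h1. Qed.

(** Points outside of [W] in ever thinner collars would accumulate at a point of the sphere. *)
Lemma open_collar (r : R) (W : set V) : open W -> (forall x, n2 x = r ^+ 2 -> W x) ->
  exists2 eta, 0 < eta & forall x, collar r eta x -> W x.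
Proof.
move=> oW SW; apply: contrapT => N.
have H k : exists x, collar r k.+1%:R^-1 x /\ ~ W x.
  apply: contrapT => h; apply: N; exists k.+1%:R^-1; first by rewrite invr_gt0 ltr0n.
  by move=> x cx; apply: contrapT => nW; apply: h; exists x.
have [u uP] := choice H.
have u1 k : collar r 1 (u k).
  apply: collar_sub (uP k).1; rewrite invf_le1 ?ltr0n // ler1n //.
have [x _ xP] := compact_subseq (@collar_closed r 1) (@collar_bounded r 1) u1.
have x2 : n2 x = r ^+ 2.
  apply/eqP; rewrite -subr_eq0 -normr_le0 leNgt; apply/negP => h.
  have h2 : 0 < `|n2 x - r ^+ 2| / 2 by rewrite divr_gt0.
  have [d d0 dP] := (continuous_eps (@n2 R (n * 2))).1 (@n2_continuous R _) x _ h2.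
  have [N0 NP] := archi_inv h2.
  have [k [Nk kx]] := xP d d0 N0; have := dP _ kx.
  have [cu _] := uP k; have := NP k.+1 (leq_ltn_trans Nk (ltnSn k)).
  move: cu; rewrite /collar /=; set i := _^-1 => cu i1 h3.
  have := ler_distD (n2 (u k)) (n2 x) (r ^+ 2); rewrite (distrC (n2 x) (n2 (u k))); clearbody i; lra.
have := oW; rewrite openE => /(_ x (SW x x2)) /nbhs_ballP [d /= d0 dP].
have [k [_ kx]] := xP d d0 0%N; have [_] := uP k; apply; apply: dP.
by rewrite -ball_normE /= distrC.
Qed.

(** The bound on [h] lets [n2] vary by at most [eta] along the segment. *)
Lemma collar_step r eta (x h : V) (t : R) :
  0 < eta -> collar r eta x ->
  `|h| <= eta / ((n * 2)%:R * (2 * (r ^+ 2 + eta + 1) + 1) + 1) -> `|h| <= 1 -> 0 <= t <= 1 -> collar r (2 * eta) (x + t *: h).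
Proof.
move=> e0 cx hd h1 /andP[t0 t1]; rewrite /collar /=.
have xb := collar_bounded cx; have x0 := normr_ge0 x.
have th : `|t *: h| <= `|h| by rewrite normrZ ger0_norm // ler_piMl.
have := n2_diff_le x (x + t *: h); rewrite addrAC subrr add0r => nd.
have xth : `|x + t *: h| <= `|x| + `|h|.
  by apply: le_trans (ler_normD _ _) _; rewrite lerD2l.
set c := (n * 2)%:R * (2 * (r ^+ 2 + eta + 1) + 1).
have c0 : 0 <= c by rewrite mulr_ge0 //; have := sqr_ge0 r; lra.
have hc : c * `|h| <= eta.
  have : (c + 1) * `|h| <= eta by move: hd; rewrite -/c ler_pdivlMr ?ltr_wpDl // mulrC.
  by have := normr_ge0 h; lra.
have nd2 : `|n2 (x + t *: h) - n2 x| <= eta.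
  apply: le_trans nd _; apply: le_trans hc; rewrite ler_pM ?mulr_ge0 ?addr_ge0 //.
  rewrite ler_wpM2l //; lra.
have := ler_distD (n2 x) (n2 (x + t *: h)) (r ^+ 2); move: cx; rewrite /collar /=; lra.
Qed.

(** The inverse of a symplectic matrix is conjugate to its transpose, hence bounded like the matrix;
    concretely, [n2 v] is [omega_st] of the images of [v] and [jm v]. *)
Lemma symplectic_lower (K : R) (A : 'M[R]_(n * 2)) (v : V) : 0 < K ->
  (forall u v : V, dot (jm (u *m A)) (v *m A) = dot (jm u) v) ->
  (forall v : V, `|v *m A| <= K * `|v|) -> `|v| <= (n * 2)%:R * K * `|v *m A|.
Proof.
move=> K0 AS AK; have [->|v0] := eqVneq v 0; first by rewrite normr0 !mulr_ge0 // ltW.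
have vp : 0 < `|v| by rewrite normr_gt0.
rewrite -(ler_pM2r vp) -expr2; apply: le_trans (norm_sqr_le _) _.
have -> : n2 v = dot (jm (v *m A)) (jm v *m A) by rewrite AS dot_jm.
apply: le_trans (ler_norm _) _; apply: le_trans (dot_le _ _) _.
rewrite norm_jm -!mulrA ler_wpM2l // mulrCA ler_wpM2l //.
by apply: le_trans (AK _) _; rewrite norm_jm.
Qed.

End Collar.

Ltac ge0 := repeat first [assumption | done | exact: sqr_ge0 | exact: ler0n | exact: normr_ge0
  | exact: n2_ge0 | exact: exprn_even_ge0 | apply: exprn_ge0 | apply: mulr_ge0 | apply: addr_ge0
  | apply: divr_ge0 | (apply: ltW; assumption)].

(** * Action of Hopf circles under symplectic embeddings *)

Section LoopAverage.
Variables (R : realType) (n : nat).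
Local Notation V := 'rV[R]_(n * 2).
Local Notation om u v := (dot (jm u) v).

Lemma om_le (u v : V) : `|om u v| <= (n * 2)%:R * (`|u| * `|v|).
Proof. by apply: le_trans (dot_le _ _) _; rewrite norm_jm. Qed.

(** On two of the planes [(z0, z1)] is sent to [(- conj z1, conj z0)], which is complex orthogonal
    to [x]; if this vanishes, a vector of the first plane does. The second plane exists because
    [1 < n]. *)
Lemma complex_orthogonal (x : V) : (1 < n)%N ->
  exists e : V, [/\ n2 e = n2 x, dot e x = 0 & dot e (jm x) = 0].
Proof.
move=> n1; pose j0 := Ordinal (ltnW n1); pose j1 := Ordinal n1.
have j01 : j1 != j0 by [].
pose e : V := of_xy (fun j => if j == j0 then - xc j1 x else if j == j1 then xc j0 x else 0)
  (fun j => if j == j0 then yc j1 x else if j == j1 then - yc j0 x else 0).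
have dotj (a : V) : dot e a = - xc j1 x * xc j0 a + yc j1 x * yc j0 a + (xc j0 x * xc j1 a - yc j0 x * yc j1 a).
  rewrite dot_xy (bigD1 j0) //= (bigD1 j1) //= big1 => [|j /andP[h0 h1]].
    rewrite !xc_of_xy !yc_of_xy !eqxx !(negPf j01); ring.
  by rewrite xc_of_xy yc_of_xy (negPf h0) (negPf h1) !mul0r addr0.
have ex : dot e x = 0 by rewrite dotj; ring.
have ejx : dot e (jm x) = 0 by rewrite dotj !xc_jm !yc_jm; ring.
suff [e' [e'0 e'1 e'2]] : exists e' : V, [/\ e' != 0, dot e' x = 0 & dot e' (jm x) = 0].
  have p : 0 < n2 e' by rewrite n2_gt0.
  exists (Num.sqrt (n2 x / n2 e') *: e'); rewrite n2Z !dotZl e'1 e'2 mulr0; split=> //.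
  by rewrite sqr_sqrtr ?divr_ge0 ?n2_ge0 // mulfVK // gt_eqF.
have z0 j : xc j (0 : V) = 0 by rewrite /xc mxE.
have z1 j : yc j (0 : V) = 0 by rewrite /yc mxE.
have [e0|] := eqVneq e 0; last by exists e.
have x0 : xc j0 x = 0.
  by have := congr1 (xc j1) e0; rewrite xc_of_xy z0 (negPf j01) eqxx.
have y0 : yc j0 x = 0.
  have := congr1 (yc j1) e0; rewrite yc_of_xy z1 (negPf j01) eqxx => /eqP.
  by rewrite oppr_eq0 => /eqP.
pose e1 : V := of_xy (fun j => (j == j0)%:R) (fun=> 0).
have dotj1 (a : V) : dot e1 a = xc j0 a.
  rewrite dot_xy (bigD1 j0) //= big1 => [|j h0].
    by rewrite !xc_of_xy !yc_of_xy eqxx mul1r mul0r !addr0.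
  by rewrite xc_of_xy yc_of_xy (negPf h0) !mul0r addr0.
exists e1; split; rewrite ?dotj1 ?xc_jm ?x0 ?y0 ?oppr0 //.
by apply/eqP => /(congr1 (xc j0)); rewrite xc_of_xy z0 eqxx; apply/eqP; rewrite oner_eq0.
Qed.

(** Twice the area of a quadrilateral, from its diagonals and from its oriented edges. In the second
    form the edges shared by neighbours cancel. *)
Lemma quad_area (p1 p2 p3 p4 : V) :
  om (p3 - p1) (p4 - p2) = om p1 p2 + om p2 p3 - om p4 p3 - om p1 p4.
Proof.
rewrite jmB dotBl !dotBr (dot_jml p3 p2) (dotC p3) (dot_jml p3 p4) (dotC p3); ring.
Qed.

(* Summing the areas of the quadrilaterals of a disc bounded by the loop
   [p 0 _] and contracted to the point [p N _]. *)
Lemma disc_area (N : nat) (p : nat -> nat -> V) (e : V) :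
  (forall j, p j N = p j 0%N) -> (forall l, p N l = e) ->
  \sum_(j < N) \sum_(l < N) om (p j.+1 l.+1 - p j l) (p j.+1 l - p j l.+1) =
  \sum_(l < N) om (p 0%N l) (p 0%N l.+1).
Proof.
move=> pN eN; pose E j := \sum_(l < N) om (p j l) (p j l.+1).
have EN : E N = 0 by rewrite /E big1 // => l _; rewrite !eN dot_jmu.
have h (j : 'I_N) : \sum_(l < N) om (p j.+1 l.+1 - p j l) (p j.+1 l - p j l.+1) = E j - E j.+1.
  pose v l := om (p j l) (p j.+1 l).
  rewrite (eq_bigr (fun l : 'I_N => (om (p j l) (p j l.+1) - om (p j.+1 l) (p j.+1 l.+1)) + (v l.+1 - v l))).
    rewrite big_split /= sumrB -/(E _) -/(E _) -(big_mkord xpredT (fun l => v l.+1 - v l)).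
    by rewrite telescope_sumr // /v !pN subrr addr0.
  by move=> l _; rewrite quad_area /v; ring.
rewrite (eq_bigr _ (fun j _ => h j)) -(big_mkord xpredT (fun j => E j - E j.+1)).
have := telescope_sumr E (leq0n N); rewrite EN sub0r => t.
by rewrite -[RHS]opprK -/(E 0%N) -t -sumrN; apply: eq_bigr => j _; rewrite opprB.
Qed.

Lemma cos_diff_le (a h : R) : `|cos (a + h) - cos a| <= h ^+ 2 + `|h|.
Proof.
rewrite cosD; have -> : cos a * cos h - sin a * sin h - cos a = cos a * (cos h - 1) - sin a * sin h by ring.
have c1 : `|cos a| <= 1 by rewrite ler_norml cos_geN1 cos_le1.
have s1 : `|sin a| <= 1 by rewrite ler_norml sin_geN1 sin_le1.
apply: le_trans (ler_normB _ _) _; rewrite !normrM; apply: lerD.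
  by apply: le_trans (cosB1_le h); rewrite ler_piMl.
by apply: le_trans (norm_sin_le h); rewrite ler_piMl.
Qed.

Lemma sin_diff_le (a h : R) : `|sin (a + h) - sin a| <= h ^+ 2 + `|h|.
Proof. by rewrite -!(cosBpihalf) addrAC; exact: cos_diff_le. Qed.

Variables (r eta K : R) (f : V -> V) (Df : V -> 'M[R]_(n * 2)).
Hypotheses (n1 : (1 < n)%N) (e0 : 0 < eta) (K0 : 0 < K) (cm : collar_map r eta K f Df).
Local Notation X := (r ^+ 2 + eta + 1).

(** To leading order both diagonals are mapped by [Df p1], which is symplectic. The Taylor
    remainders and the change from [Df p1] to [Df p2] each cost one more factor [h]. *)
Lemma quad_error (p1 p2 p3 p4 : V) (h : R) : collar r eta p1 -> collar r eta p2 ->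
  collar r eta p3 -> collar r eta p4 -> `|p3 - p1| <= h -> `|p4 - p2| <= h -> `|p2 - p1| <= h ->
  `|om (f p3 - f p1) (f p4 - f p2) - om (p3 - p1) (p4 - p2)| <= 3 * (n * 2)%:R * K ^+ 2 * h ^+ 3.
Proof.
move=> c1 c2 c3 c4 h1 h2 h3; have Kp := ltW K0.
have h0 : 0 <= h by apply: le_trans h3.
rewrite -(collar_symplectic cm (p3 - p1) (p4 - p2) c1).
set u := f p3 - f p1; set v := f p4 - f p2; set u0 := (p3 - p1) *m _; set v0 := (p4 - p2) *m _.
have bil (a b a' b' : V) : om a b - om a' b' = om (a - a') b + om a' (b - b').
  by rewrite jmB dotBl dotBr; ring.
rewrite bil.
have sq a b : 0 <= a -> a <= b -> a ^+ 2 <= b ^+ 2 :> R.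
  by move=> a0 ab; rewrite ler_pXn2r ?nnegrE // (le_trans a0).
have hu : `|u - u0| <= K * h ^+ 2.
  by apply: le_trans (collar_taylor cm c1 c3) _; rewrite ler_wpM2l // sq.
have hv : `|v| <= K * h by apply: le_trans (collar_lip cm c2 c4) _; rewrite ler_wpM2l.
have hu0 : `|u0| <= K * h by apply: le_trans (collar_deriv_le cm _ c1) _; rewrite ler_wpM2l.
have hv0 : `|v - v0| <= 2 * (K * h ^+ 2).
  have -> : v - v0 = (v - (p4 - p2) *m Df p2) + ((p4 - p2) *m Df p2 - v0) by rewrite addrA subrK.
  apply: le_trans (ler_normD _ _) _; rewrite mulr2n mulrDl mul1r; apply: lerD.
    by apply: le_trans (collar_taylor cm c2 c4) _; rewrite ler_wpM2l // sq.
  apply: le_trans (collar_deriv_lip cm _ c1 c2) _.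
  by rewrite -mulrA ler_wpM2l // expr2 ler_pM.
apply: le_trans (ler_normD _ _) _.
have Kh : 0 <= K * h ^+ 2 by rewrite mulr_ge0 ?sqr_ge0.
have Kh' : 0 <= K * h by rewrite mulr_ge0.
apply: (@le_trans _ _ ((n * 2)%:R * (K * h ^+ 2 * (K * h)) + (n * 2)%:R * (K * h * (2 * (K * h ^+ 2))))).
  by apply: lerD; apply: le_trans (om_le _ _) _; rewrite ler_wpM2l // ler_pM.
rewrite le_eqVlt; apply/orP; left; apply/eqP; ring.
Qed.

Lemma collar_n2 (x y : V) : n2 x = n2 y -> collar r eta x -> collar r eta y.
Proof. by rewrite /collar /= => ->. Qed.

(** The circle, run through [k] times, bounds a disc in the sphere of its radius: meridians contract
    it to a point [e] orthogonal to its complex line. There are [N ^ 2] quadrilaterals of size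
    [O(1/N)] with cubic errors, in total [O(1/N)]. *)
Lemma loop_area k : exists2 c, 0 < c & forall (x : V) N, collar r eta x -> (0 < N)%N ->
  `|\sum_(l < N) om (f (rot (2 * pi * k%:R / N%:R * l%:R) x)) (f (rot (2 * pi * k%:R / N%:R * l.+1%:R) x)) -
    \sum_(l < N) om (rot (2 * pi * k%:R / N%:R * l%:R) x) (rot (2 * pi * k%:R / N%:R * l.+1%:R) x)| <= c / N%:R.
Proof.
pose w : R := 2 * pi * k%:R; have pp := pi_gt0 R.
have w0 : 0 <= w by rewrite !mulr_ge0 // ltW.
pose q : R := pi / 2; have q0 : 0 < q by rewrite divr_gt0.
have ep := e0; have r2 := sqr_ge0 r; have X0 : 0 < X by lra.
pose c1 := 2 * w * (1 + w) * X; pose c2 := 3 * (q * (1 + q)) * X.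
have w1 : 0 <= 1 + w by rewrite addr_ge0.
have c10 : 0 <= c1 by apply: mulr_ge0 (ltW X0); apply: mulr_ge0 w1; rewrite mulr_ge0.
have q1 : 0 < 1 + q by rewrite addr_gt0.
have c20 : 0 < c2 by apply: mulr_gt0 X0; apply: mulr_gt0 => //; apply: mulr_gt0.
pose c := c1 + c2; have c0 : 0 < c by rewrite ltr_wpDl.
pose m : R := 3 * (n * 2)%:R * K ^+ 2.
have m0 : 0 <= m by rewrite /m; ge0.
exists (m * c ^+ 3 + 1) => [|x N cx N0]; first by apply: ltr_wpDl => //; apply: mulr_ge0 => //; apply: exprn_ge0; exact: ltW.
have NR : 0 < N%:R :> R by rewrite ltr0n.
have N1 : 1 <= N%:R :> R by rewrite ler1n.
rewrite -/w; set t := w / N%:R.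
have [e [en ex ejx]] := complex_orthogonal x n1; have Xp := ltW X0.
pose a (j : nat) : R := q / N%:R * j%:R.
pose p (j l : nat) : V := cos (a j) *: rot (t * l%:R) x + sin (a j) *: e.
have pn j l : n2 (p j l) = n2 x.
  rewrite /p n2D !n2Z n2_rot en dotZl dotZr /rot dotDl !dotZl (dotC x) (dotC (jm x)) ex ejx.
  transitivity ((cos (a j) ^+ 2 + sin (a j) ^+ 2) * n2 x); first by ring.
  by rewrite cos2Dsin2 mul1r.
have cp j l : collar r eta (p j l) by apply: collar_n2 cx; rewrite pn.
have ce : collar r eta e by apply: collar_n2 cx; rewrite en.
have p0 l : p 0%N l = rot (t * l%:R) x by rewrite /p /a mulr0 cos0 sin0 scale1r scale0r addr0.
have pe l : p N l = e.
  by rewrite /p /a mulfVK ?gt_eqF // /q cos_pihalf sin_pihalf scale0r scale1r add0r.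
have pN j : p j N = p j 0%N.
  by rewrite /p {1}/t mulfVK ?gt_eqF // rot_2pi mulr0 rot0.
have hp j l : `|p j l.+1 - p j l| <= c1 / N%:R.
  rewrite /p opprD addrACA subrr addr0 -scalerBr normrZ.
  apply: le_trans (_ : 1 * `|rot (t * l.+1%:R) x - rot (t * l%:R) x| <= _).
    by rewrite ler_wpM2r // ler_norml cos_geN1 cos_le1.
  rewrite mul1r; apply: le_trans (rot_lipschitz _ _ _) _.
  have -> : t * l.+1%:R - t * l%:R = t by rewrite -mulrBr -[l.+1%:R]natr1 addrAC subrr add0r mulr1.
  have t0 : 0 <= t by rewrite divr_ge0 // ltW.
  have tw : t <= w by rewrite ler_pdivrMr // ler_peMr.
  rewrite ger0_norm // /c1 [leRHS](_ : _ = 2 * t * (1 + w) * X); last by rewrite /t; ring.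
  have A : 2 * t * (1 + t) <= 2 * t * (1 + w) by apply: ler_wpM2l; [rewrite mulr_ge0|rewrite lerD2l].
  by apply: (ler_pM _ _ A (collar_bounded cx)) => //; rewrite mulr_ge0 ?addr_ge0 // mulr_ge0.
have hq j l : `|p j.+1 l - p j l| <= c2 / N%:R.
  pose h := q / N%:R; have h0 : 0 <= h by rewrite divr_ge0 // ltW.
  have hq : h <= q by rewrite ler_pdivrMr // ler_peMr // ltW.
  have aj : a j.+1 = a j + h by rewrite /a -[j.+1%:R]natr1 mulrDr mulr1.
  have -> : p j.+1 l - p j l = (cos (a j + h) - cos (a j)) *: rot (t * l%:R) x + (sin (a j + h) - sin (a j)) *: e.
    by rewrite /p aj opprD addrACA -!scalerBl.
  apply: le_trans (ler_normD _ _) _; rewrite !normrZ.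
  have hh : h ^+ 2 + `|h| <= h * (1 + q).
    have hh2 : h * h <= h * q by exact: ler_wpM2l.
    by rewrite ger0_norm //; move: hh2; clearbody h; lra.
  have hR : `|rot (t * l%:R) x| <= 2 * X.
    by apply: le_trans (norm_rot_le _ _) _; rewrite ler_wpM2l //; exact: collar_bounded.
  have eX : `|e| <= X by exact: collar_bounded.
  rewrite [leRHS](_ : _ = h * (1 + q) * (2 * X) + h * (1 + q) * X); last by rewrite /c2 /h; ring.
  apply: lerD; apply: ler_pM => //.
    by apply: le_trans (cos_diff_le _ _) hh.
  by apply: le_trans (sin_diff_le _ _) hh.
have cN : c / N%:R = c1 / N%:R + c2 / N%:R by rewrite -mulrDl.
have h1 j l : `|p j.+1 l.+1 - p j l| <= c / N%:R.
  rewrite -(subrK (p j l.+1) (p j.+1 l.+1)) -addrA cN addrC.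
  by apply: le_trans (ler_normD _ _) _; apply: lerD.
have h2 j l : `|p j.+1 l - p j l.+1| <= c / N%:R.
  rewrite -(subrK (p j l) (p j.+1 l)) -addrA cN addrC.
  by apply: le_trans (ler_normD _ _) _; apply: lerD => //; rewrite distrC.
have h3 j l : `|p j l.+1 - p j l| <= c / N%:R.
  by apply: le_trans (hp j l) _; rewrite cN lerDl divr_ge0 // ltW.
have d1 := @disc_area N p e pN pe.
have d2 := @disc_area N (fun j l => f (p j l)) (f e) (fun j => congr1 f (pN j)) (fun l => congr1 f (pe l)).
have -> : \sum_(l < N) om (rot (t * l%:R) x) (rot (t * l.+1%:R) x) = \sum_(l < N) om (p 0%N l) (p 0%N l.+1).
  by apply: eq_bigr => l _; rewrite !p0.
have -> : \sum_(l < N) om (f (rot (t * l%:R) x)) (f (rot (t * l.+1%:R) x)) = \sum_(l < N) om (f (p 0%N l)) (f (p 0%N l.+1)).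
  by apply: eq_bigr => l _; rewrite !p0.
rewrite -d1 -d2 -sumrB; apply: le_trans (ler_norm_sum _ _ _) _.
apply: (@le_trans _ _ (\sum_(j < N) \sum_(l < N) m * (c / N%:R) ^+ 3)).
  apply: ler_sum => j _; rewrite -sumrB; apply: le_trans (ler_norm_sum _ _ _) _.
  by apply: ler_sum => l _; exact: quad_error.
rewrite !sumr_const card_ord -mulrnA -[leLHS]mulr_natr natrM.
have -> : m * (c / N%:R) ^+ 3 * (N%:R * N%:R) = m * c ^+ 3 / N%:R.
  by field; rewrite gt_eqF.
by rewrite ler_wpM2r ?invr_ge0 ?(ltW NR) // lerDl.
Qed.

(** Twice the standard primitive of the symplectic form, pulled back by [f] and evaluated on the
    direction of the Hopf circle; for the identity it is [n2 x]. *)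
Definition ldens (x : V) := om (f x) (jm x *m Df x).

Lemma collar_image_bounded : exists2 B, 0 < B & forall x, collar r eta x -> `|f x| <= B.
Proof.
have [[x0 c0]|N] := pselect (exists x : V, collar r eta x); last first.
  by exists 1 => // x cx; case: N; exists x.
have ep := e0; have r2 := sqr_ge0 r; have X0 : 0 < X by lra.
exists (`|f x0| + K * (2 * X)) => [|x cx].
  by apply: ltr_wpDl => //; apply: mulr_gt0 => //; apply: mulr_gt0.
rewrite -(subrK (f x0) (f x)) addrC; apply: le_trans (ler_normD _ _) _; rewrite lerD2l.
apply: le_trans (collar_lip cm c0 cx) _; apply: (ler_wpM2l (ltW K0)).
apply: le_trans (ler_normB _ _) _; have := collar_bounded cx; have := collar_bounded c0; lra.
Qed.

(** By [loop_area] the circle and its image have almost the same polygonal action. For the image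
    this is a Riemann sum of [ldens]; for the circle it is [N sin t * n2 x], close to the total
    angle times [n2 x]. *)
Lemma loop_average k : exists2 c, 0 < c & forall (x : V) N, collar r eta x -> (0 < N)%N ->
  `|N%:R^-1 * \sum_(l < N) ldens (rot (2 * pi * k.+1%:R / N%:R * l%:R) x) - n2 x| <= c / N%:R.
Proof.
have [c c0 cP] := loop_area k.+1; have [B B0 BP] := collar_image_bounded.
pose w : R := 2 * pi * k.+1%:R; have pp := pi_gt0 R.
have w0 : 0 < w by rewrite !mulr_gt0.
have ep := e0; have r2 := sqr_ge0 r; have X0 : 0 < X by lra.
pose m : R := (n * 2)%:R; have m0 : 0 <= m by rewrite /m.
pose S := 2 * w * (1 + w) * X.
pose c' := m * B * (K * S ^+ 2 + K * (4 * w ^+ 2 * X)).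
have w1 : 0 < 1 + w by rewrite addr_gt0.
have S0 : 0 < S by apply: mulr_gt0 X0; apply: mulr_gt0 w1; apply: mulr_gt0.
have c'0 : 0 <= c'.
  by have mm := m0; rewrite /c'; ge0.
pose c'' := X * (n * 2)%:R * X * w ^+ 2.
have c''0 : 0 <= c'' by rewrite /c''; ge0.
exists ((c + c' + c'') / w) => [|x N cx N0]; first by rewrite divr_gt0 // -addrA ltr_wpDr // addr_ge0.
have NR : 0 < N%:R :> R by rewrite ltr0n.
have N1 : 1 <= N%:R :> R by rewrite ler1n.
have := cP x N cx N0; rewrite -/w; set t := w / N%:R => h1.
have t0 : 0 < t by rewrite divr_gt0.
have tw : t <= w by rewrite ler_pdivrMr // ler_peMr // ltW.
pose xl (l : nat) := rot (t * l%:R) x.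
have xlS l : xl l.+1 = rot t (xl l) by rewrite /xl -[l.+1%:R]natr1 mulrDr mulr1 addrC rotD.
have cxl l : collar r eta (xl l) by apply: collar_n2 cx; rewrite n2_rot.
have xlB l : `|xl l| <= X by exact: collar_bounded.
have st l : `|xl l.+1 - xl l| <= S / N%:R.
  have := rot_lipschitz 0 t (xl l); rewrite subr0 rot0 -xlS ger0_norm ?(ltW t0) // => /le_trans; apply.
  rewrite /S [leRHS](_ : _ = 2 * t * (1 + w) * X); last by rewrite /t; ring.
  have A : 2 * t * (1 + t) <= 2 * t * (1 + w) by apply: ler_wpM2l; [rewrite mulr_ge0 // ltW|rewrite lerD2l].
  have tp := ltW t0.
  by apply: (ler_pM _ _ A (xlB l)) => //; rewrite mulr_ge0 ?addr_ge0 // mulr_ge0.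
have h2 l : `|om (f (xl l)) (f (xl l.+1)) - t * ldens (xl l)| <= c' / N%:R ^+ 2.
  have -> : om (f (xl l)) (f (xl l.+1)) - t * ldens (xl l) =
      om (f (xl l)) ((f (xl l.+1) - f (xl l) - (xl l.+1 - xl l) *m Df (xl l)) +
                     (xl l.+1 - xl l - t *: jm (xl l)) *m Df (xl l)).
    have aux (a b w' j : V) (A : 'M[R]_(n * 2)) : a - b - w' *m A + (w' - t *: j) *m A = a - b - t *: (j *m A).
      by rewrite mulmxBl -scalemxAl addrA subrK.
    by rewrite aux /ldens !dotBr dotZr dot_jmu subr0.
  have Kp := ltW K0.
  have hA : `|f (xl l.+1) - f (xl l) - (xl l.+1 - xl l) *m Df (xl l)| <= K * (S / N%:R) ^+ 2.
    apply: le_trans (collar_taylor cm (cxl l) (cxl l.+1)) _; apply: ler_wpM2l => //.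
    by rewrite ler_pXn2r ?nnegrE // divr_ge0 // ltW.
  have hB : `|(xl l.+1 - xl l - t *: jm (xl l)) *m Df (xl l)| <= K * (4 * t ^+ 2 * X).
    apply: le_trans (collar_deriv_le cm _ (cxl l)) _; apply: ler_wpM2l => //.
    have := rot_taylor 0 t (xl l); rewrite add0r rot0 -xlS => /le_trans; apply.
    by apply: ler_wpM2l => //; rewrite mulr_ge0 ?sqr_ge0.
  apply: le_trans (om_le _ _) _.
  have -> : c' / N%:R ^+ 2 = m * (B * (K * (S / N%:R) ^+ 2 + K * (4 * t ^+ 2 * X))).
    by rewrite /c' /t; field; rewrite gt_eqF.
  apply: ler_wpM2l => //; apply: ler_pM => //; first exact: BP.
  by apply: le_trans (ler_normD _ _) _; apply: lerD.
have h3 : `|\sum_(l < N) om (f (xl l)) (f (xl l.+1)) - t * \sum_(l < N) ldens (xl l)| <= c' / N%:R.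
  rewrite mulr_sumr -sumrB; apply: le_trans (ler_norm_sum _ _ _) _.
  apply: (@le_trans _ _ (\sum_(l < N) c' / N%:R ^+ 2)); first by apply: ler_sum => l _.
  rewrite sumr_const card_ord -[leLHS]mulr_natr le_eqVlt; apply/orP; left; apply/eqP.
  by field; rewrite gt_eqF.
have h4 : \sum_(l < N) om (xl l) (xl l.+1) = N%:R * sin t * n2 x.
  rewrite (eq_bigr (fun=> sin t * n2 x)) => [|l _].
    by rewrite sumr_const card_ord -[LHS]mulr_natl mulrA.
  by rewrite xlS /rot dotDr !dotZr dot_jmu mulr0 add0r dot_jm -/(n2 _) n2_rot.
have h5 : `|N%:R * sin t * n2 x - w * n2 x| <= c'' / N%:R.
  have -> : N%:R * sin t * n2 x - w * n2 x = N%:R * (sin t - t) * n2 x.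
    by rewrite /t; field; rewrite gt_eqF.
  rewrite !normrM (ger0_norm (n2_ge0 _)) normr_nat.
  have hn : n2 x <= X * (n * 2)%:R * X.
    apply: le_trans (n2_le _) _; rewrite [leRHS](_ : _ = (n * 2)%:R * (X * X)); last by ring.
    by rewrite expr2; apply: ler_wpM2l => //; apply: ler_pM => //; exact: collar_bounded.
  apply: (@le_trans _ _ (N%:R * t ^+ 2 * (X * (n * 2)%:R * X))).
    apply: ler_pM; [by rewrite mulr_ge0|exact: n2_ge0| |exact: hn].
    by apply: ler_wpM2l; [exact: ltW|exact: sinB_le].
  by rewrite le_eqVlt; apply/orP; left; apply/eqP; rewrite /c'' /t; field; rewrite gt_eqF.
rewrite -(@ler_pM2l _ w) //.
have -> : w * (((c + c' + c'') / w) / N%:R) = (c + c' + c'') / N%:R by field; rewrite !gt_eqF.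
rewrite -{1}(gtr0_norm w0) -normrM mulrBr.
have -> : w * (N%:R^-1 * \sum_(l < N) ldens (rot (t * l%:R) x)) = t * \sum_(l < N) ldens (xl l) by rewrite mulrA.
rewrite -h4 in h5; rewrite 2!mulrDl.
have h1' : `|\sum_(l < N) om (f (xl l)) (f (xl l.+1)) - \sum_(l < N) om (xl l) (xl l.+1)| <= c / N%:R by exact: h1.
move: h1' h3 h5; move: (c / N%:R) (c' / N%:R) (c'' / N%:R) => z1 z2 z3.
move: (\sum_(l < N) om (f (xl l)) _) (t * _) (\sum_(l < N) om (xl l) _) (w * n2 x) => S1 S2 S3 S4 k1 k2 k3.
have := ler_distD S1 S2 S4; have := ler_distD S3 S1 S4.
by rewrite (distrC S2 S1); lra.
Qed.

End LoopAverage.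

(** * Uniform estimates near the sphere *)

Section CollarExists.
Variables (R : realType).

Lemma compact_subseq2 m (S : set 'rV[R]_m) (B : R) (u v : nat -> 'rV[R]_m) :
  closed S -> (forall x, S x -> `|x| <= B) -> (forall k, S (u k)) -> (forall k, S (v k)) ->
  exists x y, [/\ S x, S y & forall e : R, 0 < e -> forall N, exists k,
    [/\ (N <= k)%N, `|u k - x| < e & `|v k - y| < e]].
Proof.
move=> cS SB Su Sv; have [x Sx xP] := compact_subseq cS SB Su.
have i0 j : 0 < j.+1%:R^-1 :> R by rewrite invr_gt0 ltr0n.
have [phi phiP] := choice (fun j => xP _ (i0 j) j).
have [y Sy yP] := compact_subseq cS SB (fun j => Sv (phi j)).
exists x, y; split=> // e e0 N; have [N0 NP] := archi_inv e0.
have [j [Nj jy]] := yP e e0 (maxn N N0); have [h1 h2] := phiP j.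
exists (phi j); split => //.
  by apply: leq_trans h1; apply: leq_trans Nj; exact: leq_maxl.
apply: lt_trans h2 _; apply: NP; rewrite ltnS; apply: leq_trans Nj; exact: leq_maxr.
Qed.

Lemma derive_coords m p (F : 'rV[R]_m -> 'rV[R]_p) (y h : 'rV[R]_m) : differentiable F y ->
  'D_h F y = \sum_j h 0 j *: 'D_(delta_mx 0 j) F y.
Proof.
move=> dF; rewrite deriveE // {1}(row_sum_delta h) linear_sum; apply: eq_bigr => j _.
by rewrite linearZ deriveE.
Qed.

Lemma derive_coords_le m p (F : 'rV[R]_m -> 'rV[R]_p) (y h : 'rV[R]_m) (c : 'I_m -> R) :
  differentiable F y -> (forall j, `|'D_(delta_mx 0 j) F y| <= c j) ->
  `|'D_h F y| <= (\sum_j c j) * `|h|.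
Proof.
move=> dF cP; rewrite derive_coords // mulr_suml.
apply: le_trans (ler_norm_sum _ _ _) _; apply: ler_sum => j _.
by rewrite normrZ mulrC ler_pM // coord_le.
Qed.

Variables (n : nat).
Local Notation V := 'rV[R]_(n * 2).

Lemma sum_dominates (a b c d e f : R) : 0 <= a -> 0 <= b -> 0 <= c -> 0 <= d -> 0 <= e -> 0 <= f ->
  let s := 1 + a + b + c + d + e + f in
  0 < s /\ [/\ a <= s, b <= s, c <= s, d <= s & e <= s /\ f <= s].
Proof. by move=> ? ? ? ? ? ? s; rewrite /s; split; [lra|split; [lra..|split; lra]]. Qed.

(** Derivatives are bounded on a compact collar of twice the thickness, which leaves room for short
    segments. Between near points the estimates follow from the mean value theorem, between distant
    ones from a larger constant; only the Lipschitz inverse for distant points needs injectivity and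
    compactness. *)
Lemma collar_exists (r : R) (U : set V) : 0 < r -> sphere_embeds r U ->
  exists eta K f Df, [/\ 0 < eta, eta <= r ^+ 2 / 2, 0 < K, collar_map r eta K f Df &
    forall x, collar r eta x -> U (f x)].
Proof.
move=> r0 [W [f [oW SW [sf _ [_ fi _] fU fs]]]].
have [eta1 e10 e1W] : exists2 eta, 0 < eta & forall x, collar r eta x -> W x.
  by apply: open_collar => // x xr; apply: SW; rewrite /sphere /= -n2_xy.
pose eta := Num.min (eta1 / 2) (r ^+ 2 / 2).
have r2 : 0 < r ^+ 2 by rewrite exprn_gt0.
have e0 : 0 < eta by rewrite lt_min !divr_gt0.
have eW (x : V) : collar r (2 * eta) x -> W x.
  move=> cx; apply: e1W; apply: collar_sub cx.
  have : eta <= eta1 / 2 by rewrite ge_min lexx.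
  lra.
have e2 : eta <= r ^+ 2 / 2 by rewrite ge_min lexx orbT.
clearbody eta.
have sub2 (x : V) : collar r eta x -> collar r (2 * eta) x by apply: collar_sub; lra.
have [dfW ddf] := sf 2.
pose Df (x : V) : 'M[R]_(n * 2) := lin1_mx ('d f x).
have DfE x (v : V) : 'd f x v = v *m Df x by rewrite mul_rV_lin1.
have DvE x (v : V) : W x -> 'D_v f x = v *m Df x by move=> Wx; rewrite deriveE ?DfE //; exact: dfW.
clearbody Df.
have cB := @collar_bounded R n r (2 * eta).
have cC := @collar_closed R n r (2 * eta).
have H2 (q : 'I_(n * 2) * 'I_(n * 2)) : exists c : R, 0 < c /\
    forall x, collar r (2 * eta) x -> `|'D_(delta_mx 0 q.2) ('D_(delta_mx 0 q.1) f) x| <= c.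
  have [|c c0 cP] := bounded_on_compact cC cB (_ : forall x, collar r (2 * eta) x ->
    {for x, continuous ('D_(delta_mx 0 q.2) ('D_(delta_mx 0 q.1) f))}).
    by move=> x cx; have [_ h] := ddf (delta_mx 0 q.1); apply: h; exact: eW.
  by exists c.
have [c2 c2P] := choice H2.
have H1 (q : 'I_(n * 2)) : exists c : R, 0 < c /\
    forall x, collar r (2 * eta) x -> `|'D_(delta_mx 0 q) f x| <= c.
  have [|c c0 cP] := bounded_on_compact cC cB (_ : forall x, collar r (2 * eta) x ->
    {for x, continuous ('D_(delta_mx 0 q) f)}).
    move=> x cx; have [h _] := ddf (delta_mx 0 q); apply: differentiable_continuous.
    by apply: h; exact: eW.
  by exists c.
have [c1 c1P] := choice H1.
have [|B0 B00 B0P] := bounded_on_compact cC cB (_ : forall x, collar r (2 * eta) x -> {for x, continuous f}).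
  by move=> x cx; apply: differentiable_continuous; apply: dfW; exact: eW.
pose B1 := 1 + \sum_q c1 q; pose M := \sum_i \sum_j c2 (i, j).
have M0 : 0 <= M by apply: sumr_ge0 => i _; apply: sumr_ge0 => j _; have [/ltW] := c2P (i, j).
have S10 : 0 <= \sum_q c1 q by apply: sumr_ge0 => j _; have [/ltW] := c1P j.
have B10 : 0 < B1 by rewrite /B1; lra.
have DfB (x v : V) : collar r (2 * eta) x -> `|v *m Df x| <= B1 * `|v|.
  move=> cx; rewrite -DvE; last exact: eW.
  apply: le_trans (derive_coords_le _ (dfW _ (eW _ cx)) (fun j => (c1P j).2 x cx)) _.
  by rewrite ler_wpM2r // /B1 lerDr.
pose d := Num.min 1 (eta / ((n * 2)%:R * (2 * (r ^+ 2 + eta + 1) + 1) + 1)).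
have dd0 : 0 < (n * 2)%:R * (2 * (r ^+ 2 + eta + 1) + 1) + 1 :> R.
  by rewrite ltr_wpDl // mulr_ge0 //; lra.
have d0 : 0 < d by rewrite lt_min ltr01 divr_gt0.
have d1 : d <= 1 by rewrite ge_min lexx.
have dd2 : d <= eta / ((n * 2)%:R * (2 * (r ^+ 2 + eta + 1) + 1) + 1).
  by rewrite /d ge_min lexx orbT.
have step (x h : V) (t : R) : collar r eta x -> `|h| <= d -> 0 <= t <= 1 -> collar r (2 * eta) (x + t *: h).
  by move=> cx hd t01; exact: collar_step e0 cx (le_trans hd dd2) (le_trans hd d1) t01.
have step1 (x h : V) : collar r eta x -> `|h| <= d -> collar r (2 * eta) (x + h).
  by move=> cx hd; rewrite -[h]scale1r; apply: step => //; rewrite ler01 lexx.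
have locD (x h v : V) : collar r eta x -> `|h| <= d ->
    `|v *m Df (x + h) - v *m Df x| <= M * `|h| * `|v|.
  move=> cx hd; have Wx : W x by apply: eW; exact: sub2.
  have Wxh : W (x + h) by apply: eW; exact: step1.
  have q1 := DvE x v Wx; have q2 := DvE (x + h) v Wxh; rewrite -q2 -q1.
  rewrite (derive_coords v (dfW _ Wxh)) (derive_coords v (dfW _ Wx)).
  rewrite -sumrB /M -mulrA mulr_suml; apply: le_trans (ler_norm_sum _ _ _) _.
  apply: ler_sum => i _; rewrite -scalerBr normrZ mulrA mulrC ler_pM ?coord_le //.
  have cs : 0 <= \sum_j c2 (i, j) by apply: sumr_ge0 => j _; have [/ltW] := c2P (i, j).
  apply: norm_rVP => [|k]; first by rewrite mulr_ge0.
  have [dFi _] := ddf (delta_mx 0 i).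
  have [|t t01 e] := @segment_mvt R _ _ ('D_(delta_mx 0 i) f) x h k.
    by move=> t t01; apply: dFi; apply: eW; exact: step.
  rewrite [in leLHS]mxE [X in `|_ + X|]mxE e; apply: le_trans (coord_le _ _) _.
  apply: derive_coords_le; first by apply: dFi; apply: eW; exact: step.
  by move=> j; apply: (c2P (i, j)).2; exact: step.
have locT (x h : V) : collar r eta x -> `|h| <= d -> `|f (x + h) - f x - h *m Df x| <= M * `|h| ^+ 2.
  move=> cx hd; apply: norm_rVP => [|k]; first by rewrite mulr_ge0 ?sqr_ge0.
  have [|t t01 e] := @segment_mvt R _ _ f x h k.
    by move=> t t01; apply: dfW; apply: eW; exact: step.
  rewrite [in leLHS]mxE [X in `|X + _|]mxE [X in `|_ + X + _|]mxE [X in `|_ + X|]mxE e.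
  rewrite DvE; last by apply: eW; exact: step.
  apply: le_trans (coordB_le _ _ _) _.
  have th : `|t *: h| <= `|h| by case/andP: t01 => t0 t1; rewrite normrZ ger0_norm // ler_piMl.
  apply: le_trans (locD _ _ _ cx (le_trans th hd)) _.
  by rewrite expr2 mulrA ler_wpM2r // ler_wpM2l.
pose Dm := 2 * (r ^+ 2 + eta + 1).
have diam (x y : V) : collar r eta x -> collar r eta y -> `|y - x| <= Dm.
  move=> cx cy; apply: le_trans (ler_normB _ _) _.
  by have := collar_bounded cx; have := collar_bounded cy; rewrite /Dm; lra.
have Dm0 : 0 < Dm by rewrite /Dm; lra.
have d20 : 0 < d ^+ 2 by rewrite exprn_gt0.
have [a1 p1 a1E] : exists2 a, 0 <= a & a * d ^+ 2 = 2 * B0.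
  exists (2 * B0 / d ^+ 2); first by rewrite divr_ge0 ?(ltW d20) // mulr_ge0 // ltW.
  by rewrite mulfVK // gt_eqF.
have [a2 p2 a2E] : exists2 a, 0 <= a & a * d = B1.
  by exists (B1 / d); [rewrite divr_ge0 // ltW|rewrite mulfVK // gt_eqF].
clearbody d.
pose K1 := M + a1 + a2; pose K2 := M + 2 * a2.
have K10 : 0 <= K1 by rewrite /K1 !addr_ge0.
have K20 : 0 <= K2 by rewrite /K2 addr_ge0 // mulr_ge0.
have T (x y : V) : collar r eta x -> collar r eta y -> `|f y - f x - (y - x) *m Df x| <= K1 * `|y - x| ^+ 2.
  move=> cx cy; have [hd|hd] := leP `|y - x| d.
    have := locT x (y - x) cx hd; rewrite subrKC => /le_trans; apply.
    by rewrite ler_wpM2r ?sqr_ge0 // /K1 -addrA lerDl addr_ge0.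
  apply: le_trans (ler_normB _ _) _; apply: (@le_trans _ _ (2 * B0 + B1 * `|y - x|)).
    apply: lerD; last by apply: DfB; exact: sub2.
    apply: le_trans (ler_normB _ _) _.
    by have := B0P _ (sub2 _ cx); have := B0P _ (sub2 _ cy); lra.
  have h2 : d ^+ 2 <= `|y - x| ^+ 2 by rewrite ler_pXn2r ?nnegrE ?(ltW d0) ?(ltW hd).
  have q1 : 2 * B0 <= a1 * `|y - x| ^+ 2 by rewrite -a1E ler_wpM2l.
  have q2 : B1 * `|y - x| <= a2 * `|y - x| ^+ 2.
    by rewrite -a2E expr2 -!mulrA ler_wpM2l // ler_wpM2r // ltW.
  have q3 : 0 <= M * `|y - x| ^+ 2 by rewrite mulr_ge0 ?sqr_ge0.
  apply: le_trans (lerD q1 q2) _; rewrite -mulrDl ler_wpM2r ?sqr_ge0 // /K1 -addrA lerDr.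
  exact: M0.
have D2 (x y v : V) : collar r eta x -> collar r eta y -> `|v *m Df y - v *m Df x| <= K2 * `|y - x| * `|v|.
  move=> cx cy; have [hd|hd] := leP `|y - x| d.
    have := locD x (y - x) v cx hd; rewrite subrKC => /le_trans; apply.
    by rewrite ler_wpM2r // ler_wpM2r // /K2 lerDl mulr_ge0.
  apply: le_trans (ler_normB _ _) _; apply: (@le_trans _ _ (2 * B1 * `|v|)).
    by have := DfB _ v (sub2 _ cx); have := DfB _ v (sub2 _ cy); lra.
  rewrite ler_wpM2r //; apply: (@le_trans _ _ (2 * a2 * `|y - x|)).
    by rewrite -a2E mulrA ler_wpM2l ?mulr_ge0 // ltW.
  by rewrite ler_wpM2r // /K2 lerDr.
have Lp (x y : V) : collar r eta x -> collar r eta y -> `|f y - f x| <= (B1 + K1 * Dm) * `|y - x|.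
  move=> cx cy; have h1 := T x y cx cy; have h2 := DfB x (y - x) (sub2 _ cx).
  have h3 := ler_normD (f y - f x - (y - x) *m Df x) ((y - x) *m Df x).
  rewrite subrK in h3; apply: le_trans h3 _; rewrite mulrDl addrC; apply: lerD => //.
  apply: le_trans h1 _; rewrite expr2 mulrA ler_wpM2r // ler_wpM2l //; exact: diam.
have Sy (x u v : V) : collar r eta x -> dot (jm (u *m Df x)) (v *m Df x) = dot (jm u) v.
  by move=> cx; rewrite -(DfE x u) -(DfE x v) -!omega_dot; apply: fs; apply: eW; exact: sub2.
clearbody K1 K2.
clear locD locT step step1 c1P c2P H1 H2 M0 S10 ddf sf dfW DvE B0P cB cC e1W oW SW fs DfE.
pose L := (n * 2)%:R * B1 + 1.
have nB : 0 <= (n * 2)%:R * B1 by rewrite mulr_ge0 // ltW.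
have L1 : 1 <= L by rewrite /L lerDr.
have Slow (x v : V) : collar r eta x -> `|v| <= L * `|v *m Df x|.
  move=> cx; have h := @symplectic_lower _ _ B1 (Df x) v B10 (fun u w => Sy x u w cx) (fun w => DfB x w (sub2 _ cx)).
  apply: le_trans h _.
  by rewrite ler_wpM2r // /L lerDl.
have dlp : 0 < 2 * L * (K1 + 1) by rewrite !mulr_gt0 //; lra.
have [del del0 delE] : exists2 d', 0 < d' & d' * (2 * L * (K1 + 1)) = 1.
  by exists (2 * L * (K1 + 1))^-1; [rewrite invr_gt0|rewrite mulVf // gt_eqF].
(* For [|y - x| <= del] the Taylor remainder takes up at most half of the lower bound that
   symplecticity gives for the derivative. *)
have near_inv (x y : V) : collar r eta x -> collar r eta y -> `|y - x| <= del -> `|y - x| <= 2 * L * `|f y - f x|.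
  move=> cx cy hd; have h1 := T x y cx cy; have h2 := Slow x (y - x) cx.
  have h3 := ler_normB (f y - f x) (f y - f x - (y - x) *m Df x).
  rewrite opprB addrC subrK in h3.
  have h4 : 2 * L * (K1 * `|y - x| ^+ 2) <= `|y - x|.
    have : `|y - x| * (2 * L * (K1 + 1)) <= 1 by rewrite -[leRHS]delE ler_wpM2r // ltW.
    have y0 := normr_ge0 (y - x); have : 0 <= 2 * L * `|y - x| by rewrite !mulr_ge0 //; lra.
    rewrite expr2; move: (`|y - x|) y0 => z z0 g5 g6.
    have : 0 <= 2 * L * z * (1 - z * (2 * L * (K1 + 1))) by apply: mulr_ge0 => //; lra.
    have : 0 <= z * L by rewrite mulr_ge0 //; lra.
    nra.
  have h5 : L * `|(y - x) *m Df x| <= L * (`|f y - f x| + `|f y - f x - (y - x) *m Df x|).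
    by rewrite ler_wpM2l //; lra.
  have h6 : L * `|f y - f x - (y - x) *m Df x| <= L * (K1 * `|y - x| ^+ 2) by rewrite ler_wpM2l //; lra.
  lra.
(* Pairs of distant points with merging images would accumulate at two distinct points with the same
   image. *)
have [c c0 far] : exists2 c, 0 < c & forall x y : V, collar r eta x -> collar r eta y -> del <= `|y - x| -> c <= `|f y - f x|.
  apply: contrapT => N.
  have H k : exists q : V * V, [/\ collar r eta q.1, collar r eta q.2, del <= `|q.2 - q.1| &
      `|f q.2 - f q.1| < k.+1%:R^-1].
    apply: contrapT => h; apply: N; exists k.+1%:R^-1; first by rewrite invr_gt0 ltr0n.
    move=> x y cx cy hd; rewrite leNgt; apply/negP => h'; apply: h; by exists (x, y).
  have [q qP] := choice H.
  have [||x [y [cx cy xyP]]] := compact_subseq2 (@collar_closed R n r eta) (@collar_bounded R n r eta)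
    (_ : forall k, collar r eta (q k).1) (_ : forall k, collar r eta (q k).2).
  - by move=> k; have [] := qP k.
  - by move=> k; have [] := qP k.
  pose L2 := B1 + K1 * Dm; have L20 : 0 < L2.
    by rewrite /L2 ltr_pwDl // mulr_ge0 // ltW.
  have fxy : f x = f y.
    apply/eqP; rewrite -subr_eq0 -normr_le0 leNgt; apply/negP => h.
    have L3 : 0 < 3 * (L2 + 1) by rewrite mulr_gt0 // addr_gt0.
    have t0 : 0 < `|f x - f y| / (3 * (L2 + 1)) by rewrite divr_gt0.
    have [N0 NP] := archi_inv (divr_gt0 h (ltr0Sn R 2)).
    have [k [Nk kx ky]] := xyP _ t0 N0; have [cu cv _ fk] := qP k.
    have := lt_trans fk (NP k.+1 (leq_ltn_trans Nk (ltnSn k))) => {}fk.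
    have g1 := Lp _ _ cx cu; have g2 := Lp _ _ cy cv.
    rewrite ltr_pdivlMr // in kx.
    rewrite ltr_pdivlMr // in ky.
    have g3 := ler_distD (f (q k).1) (f x) (f y); have g4 := ler_distD (f (q k).2) (f (q k).1) (f y).
    rewrite (distrC (f x) (f (q k).1)) in g3; rewrite (distrC (f (q k).1) (f (q k).2)) in g4.
    have n1 := normr_ge0 ((q k).1 - x); have n2' := normr_ge0 ((q k).2 - y).
    rewrite -/L2 in g1 g2; clearbody L2; lra.
  have xy : x = y by apply: fi => //; apply: mem_set; apply: eW; exact: sub2.
  have t0 : 0 < del / 2 by rewrite divr_gt0.
  have [k [_ kx ky]] := xyP _ t0 0%N; have [_ _ hd _] := qP k.
  have := ler_distD x (q k).2 (q k).1; rewrite (distrC x) {1}xy; move: hd kx ky; lra.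
have [cc cc0 ccE] : exists2 a, 0 <= a & a * c = Dm.
  by exists (Dm / c); [rewrite divr_ge0 // ltW|rewrite mulfVK // gt_eqF].
have kd : 0 <= K1 * Dm by rewrite mulr_ge0 // ltW.
pose K := 1 + K1 + K2 + B1 + (B1 + K1 * Dm) + 2 * L + cc.
have [Kp [k1 k2 k3 k4 [k5 k6]]] : 0 < K /\ [/\ K1 <= K, K2 <= K, B1 <= K, B1 + K1 * Dm <= K & 2 * L <= K /\ cc <= K].
  apply: sum_dominates => //; [exact: ltW|by rewrite addr_ge0 // ltW|].
  by apply: mulr_ge0 => //; exact: le_trans ler01 L1.
exists eta, K, f, Df; split=> //.
- split.
  + by move=> x y cx cy; apply: le_trans (T x y cx cy) _; rewrite ler_wpM2r ?sqr_ge0.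
  + by move=> x y v cx cy; apply: le_trans (D2 x y v cx cy) _; rewrite ler_wpM2r // ler_wpM2r.
  + by move=> x v cx; apply: le_trans (DfB x v (sub2 _ cx)) _; rewrite ler_wpM2r.
  + exact: Sy.
  + by move=> x y cx cy; apply: le_trans (Lp x y cx cy) _; rewrite ler_wpM2r.
  + move=> x y cx cy; have [hd|hd] := leP `|y - x| del.
      by apply: le_trans (near_inv x y cx cy hd) _; rewrite ler_wpM2r.
    have h1 := far x y cx cy (ltW hd); apply: le_trans (diam x y cx cy) _.
    apply: (@le_trans _ _ (cc * `|f y - f x|)); last by rewrite ler_wpM2r.
    by rewrite -ccE ler_wpM2l.
- by move=> x cx; apply: fU; exists x => //; apply: eW; exact: sub2.
Qed.

End CollarExists.

(** * Openness of the image and transported profiles *)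

Section CollarOpen.
Variables (R : realType) (n : nat).
Local Notation V := 'rV[R]_(n * 2).
Local Notation om u v := (dot (jm u) v).
Variables (r eta K : R) (f : V -> V) (Df : V -> 'M[R]_(n * 2)).
Hypotheses (e0 : 0 < eta) (K0 : 0 < K) (cm : collar_map r eta K f Df).

Lemma collar_deriv_surj (x w : V) : collar r eta x -> exists v : V, v *m Df x = w.
Proof.
move=> cx; have inj (v : V) : v *m Df x = 0 -> v = 0.
  move=> v0; have := @symplectic_lower _ _ K (Df x) v K0 (fun u w => collar_symplectic cm u w cx)
    (fun v => collar_deriv_le cm v cx).
  by rewrite v0 normr0 mulr0 normr_le0 => /eqP.
have : row_free (Df x).
  rewrite -kermx_eq0; apply/eqP/row_matrixP => i; rewrite row0; apply: inj.
  by rewrite -row_mul mulmx_ker row0.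
rewrite row_free_unit => ux; exists (w *m invmx (Df x)).
by rewrite mulmxKV.
Qed.

Lemma collar_open : exists2 d, 0 < d & forall x w : V, collar r (eta / 2) x ->
  `|w - f x| < d -> exists2 y, collar r eta y & f y = w.
Proof.
have ep := e0; have Kp := K0.
pose e2 := eta / 2; have e20 : 0 < e2 by rewrite divr_gt0.
pose M := (n * 2)%:R * (2 * (r ^+ 2 + e2 + 1) + 1) + 1 : R.
have M0 : 0 < M by rewrite /M; have := sqr_ge0 r; have := ler0n R (n * 2); nra.
pose rho := Num.min 1 (e2 / M); have rho0 : 0 < rho by rewrite lt_min ltr01 divr_gt0.
pose m1 := (n * 2)%:R + 2 : R; have m10 : 0 < m1 by rewrite ltr_wpDl.
pose d := rho / (K * m1); have d0 : 0 < d by rewrite divr_gt0 // mulr_gt0.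
have dE : rho = d * (K * m1) by rewrite /d mulfVK // gt_eqF // mulr_gt0.
exists d => // x w cx wx.
have cxh (y : V) : `|y - x| <= rho -> collar r eta y.
  move=> yx; have -> : eta = 2 * e2 by rewrite /e2 mulrC mulfVK // pnatr_eq0.
  rewrite -[y](subrKC x) -[y - x]scale1r; apply: collar_step => //.
  - by apply: le_trans yx _; rewrite /rho ge_min lexx orbT.
  - by apply: le_trans yx _; rewrite /rho ge_min lexx.
  - by rewrite ler01 lexx.
have cx' : collar r eta x by apply: cxh; rewrite subrr normr0 ltW.
pose S := [set y : V | `|y - x| <= rho].
have Slip (y y' : V) : `|y - x| <= rho -> `|y' - x| <= rho -> `|f y' - f y| <= K * `|y' - y|.
  by move=> h1 h2; apply: (collar_lip cm); exact: cxh.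
have clS : closed S.
  have -> : S = (fun y : V => `|y - x|) @^-1` [set t | t <= rho] by [].
  apply: closed_comp; last exact: closed_le.
  move=> y _; apply: (@ct_comp _ _ _ (fun y : V => y - x) (fun y : V => `|y|)); last exact: norm_continuous.
  by apply: ctB; [exact: ct_id|exact: ct_cst].
have SB y : S y -> `|y| <= `|x| + rho.
  by move=> Sy; rewrite -[y](subrKC x); apply: le_trans (ler_normD _ _) _; rewrite lerD2l.
(* Minimise the distance to [w] over the ball: the minimum is interior, hence
   critical, hence zero as [Df] is onto. *)
have [y Sy ymin] : exists2 y, S y & forall y', S y' -> n2 (f y - w) <= n2 (f y' - w).
  have Sne : S !=set0 by exists x; rewrite /S /= subrr normr0 ltW.
  have cpS : compact S.
    apply: bounded_closed_compact => //; exists (`|x| + rho); split; first exact: num_real.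
    by move=> M' MM y Sy; apply: le_trans (SB _ Sy) (ltW MM).
  have cfS : {within S, continuous (fun y => n2 (f y - w))}.
    apply/subspace_continuousP => y Sy; apply/cvgrPdist_lt => e ep'.
    have [d' d'0 d'P] := (continuous_eps (@n2 R (n * 2))).1 (@n2_continuous R _) (f y - w) e ep'.
    rewrite near_withinE; apply/nbhs_ballP; exists (d' / K); first exact: divr_gt0.
    move=> y'; rewrite -ball_normE /= distrC ltr_pdivlMr // => yy Sy'.
    rewrite distrC; apply: d'P; rewrite opprB addrA subrK.
    by apply: le_lt_trans (Slip _ _ Sy Sy') _; rewrite mulrC.
  have [y /set_mem Sy ymin] := @EVT_min_rV R _ (fun y => n2 (f y - w)) S Sne cpS cfS.
  by exists y => // y' Sy'; apply: ymin; exact: mem_set.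
exists y; first exact: cxh.
apply/eqP; rewrite -subr_eq0 -n2_eq0; apply/contraT => nz.
have e_gt0 : 0 < n2 (f y - w) by rewrite lt_def nz n2_ge0.
(* On the boundary of the ball the Lipschitz inverse keeps [f y] farther from [w] than [f x] is. The
   factor [m1] in [d] makes up for comparing the sup norm with [n2]. *)
have interior : `|y - x| < rho.
  rewrite ltNge; apply/negP => h.
  have yr : `|y - x| = rho by apply/eqP; rewrite eq_le h andbT; exact: Sy.
  have h1 : n2 (f y - w) <= (n * 2)%:R * d ^+ 2.
    apply: le_trans (ymin x _) _; first by rewrite /S /= subrr normr0 ltW.
    apply: le_trans (n2_le _) _; rewrite ler_wpM2l //.
    by rewrite ler_pXn2r ?nnegrE ?(ltW d0) // distrC ltW.
  have h2 : rho <= K * `|f y - f x|.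
    by rewrite -yr; apply: (collar_inv_lip cm) => //; exact: cxh.
  have h3 : ((n * 2)%:R + 1) * d <= `|f y - w|.
    have h4 : m1 * d <= `|f y - f x|.
      by rewrite -(ler_pM2l Kp); apply: le_trans h2; rewrite dE; nra.
    have := ler_distD w (f y) (f x); rewrite /m1 in h4; have := ltW wx; lra.
  have h5 := norm_sqr_le (f y - w).
  have h6 : (((n * 2)%:R + 1) * d) ^+ 2 <= `|f y - w| ^+ 2.
    by rewrite ler_pXn2r ?nnegrE // mulr_ge0 ?addr_ge0 // ltW.
  have h7 := le_trans h6 (le_trans h5 h1); move: h7; rewrite exprMn.
  have q : 0 < d ^+ 2 by rewrite exprn_gt0.
  rewrite ler_pM2r //; have := ler0n R (n * 2); nra.
(* Along [v] the map [f] moves straight towards [w]; a short step would lower the minimum, since its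
   second order error is smaller than the gain. *)
have [v vE] := collar_deriv_surj (- (f y - w)) (cxh _ Sy).
pose c := 2 * (n * 2)%:R * `|f y - w| * (K * `|v| ^+ 2) + (n * 2)%:R * (K * `|v|) ^+ 2.
have c0 : 0 <= c by rewrite /c; ge0.
pose t := Num.min 1 (Num.min ((rho - `|y - x|) / (`|v| + 1)) (n2 (f y - w) / (c + 1))).
have v1 : 0 < `|v| + 1 by rewrite ltr_wpDl.
have c1 : 0 < c + 1 by rewrite ltr_wpDl.
have t0 : 0 < t by rewrite !lt_min ltr01 !divr_gt0 // subr_gt0.
have t1 : t <= 1 by rewrite /t ge_min lexx.
have t2 : t * (`|v| + 1) <= rho - `|y - x|.
  by rewrite -ler_pdivlMr // /t !ge_min lexx !orbT.
have t3 : t * (c + 1) <= n2 (f y - w).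
  by rewrite -ler_pdivlMr // /t !ge_min lexx !orbT.
clearbody t.
have Syt : S (y + t *: v).
  rewrite /S /= addrAC; apply: le_trans (ler_normD _ _) _.
  rewrite normrZ (gtr0_norm t0); have := normr_ge0 v; nra.
have tay := collar_taylor cm (cxh _ Sy) (cxh _ Syt).
have lip := collar_lip cm (cxh _ Sy) (cxh _ Syt).
have ey : y + t *: v - y = t *: v by rewrite addrAC subrr add0r.
rewrite ey -scalemxAl vE normrZ (gtr0_norm t0) in tay.
rewrite ey normrZ (gtr0_norm t0) in lip.
have := ymin _ Syt; set a := f y - w in e_gt0 vE t3 tay *.
have -> : f (y + t *: v) - w = a + (f (y + t *: v) - f y) by rewrite /a [RHS]addrC addrA subrK.
set b := f (y + t *: v) - f y in tay lip *.
have cE : c = 2 * (n * 2)%:R * `|a| * (K * `|v| ^+ 2) + (n * 2)%:R * (K * `|v|) ^+ 2 by [].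
clearbody c; clearbody a b.
rewrite n2D => h.
have h1 : dot a b <= - t * n2 a + (n * 2)%:R * (`|a| * (K * (t * `|v|) ^+ 2)).
  have -> : dot a b = dot a (b - t *: - a) - t * n2 a.
    by rewrite dotBr dotZr dotNr /n2; ring.
  rewrite addrC mulNr lerD2l; apply: le_trans (ler_norm _) _; apply: le_trans (dot_le _ _) _.
  by apply: ler_wpM2l => //; apply: ler_wpM2l.
have h2 : n2 b <= (n * 2)%:R * (K * (t * `|v|)) ^+ 2.
  apply: le_trans (n2_le _) _; apply: ler_wpM2l => //.
  rewrite ler_pXn2r ?nnegrE //; ge0.
have h3 : 2 * t * n2 a <= t ^+ 2 * c.
  have -> : t ^+ 2 * c = 2 * ((n * 2)%:R * (`|a| * (K * (t * `|v|) ^+ 2))) + (n * 2)%:R * (K * (t * `|v|)) ^+ 2.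
    by rewrite cE; ring.
  lra.
have h4 : 2 * n2 a <= t * c.
  by rewrite -(ler_pM2l t0); move: h3; rewrite expr2 mulrA (mulrC 2 t) -!mulrA.
have h5 : t * c <= n2 a by have := ltW t0; nra.
lra.
Qed.

Lemma collar_inj (x y : V) : collar r eta x -> collar r eta y -> f x = f y -> x = y.
Proof.
move=> cx cy fxy; have := collar_inv_lip cm cx cy; rewrite fxy subrr normr0 mulr0 normr_le0.
by rewrite subr_eq0 => /eqP.
Qed.

(** The gradient, at the point [f x], of the function with value [S (n2 x)] there, if [a] is the
    derivative of [S] at [n2 x]. Symplecticity expresses it through [Df x] itself instead of its
    inverse. *)
Definition hamiltonian_dir (a : R) (x : V) : V := (- 2 * a) *: jm (jm x *m Df x).

Lemma profile_quad (S dS : R -> R) (Ls Ms : R) : 0 < Ls -> 0 < Ms ->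
  (forall a b, `|S b - S a - dS a * (b - a)| <= Ls * (b - a) ^+ 2) -> (forall a, `|dS a| <= Ms) ->
  exists2 l, 0 < l & forall x y : V, collar r eta x -> collar r eta y ->
    `|S (n2 y) - S (n2 x) - dot (hamiltonian_dir (dS (n2 x)) x) (f y - f x)| <= l * n2 (f y - f x).
Proof.
move=> Ls0 Ms0 Sq Sb; have ep := e0; have Kp := K0; have r2 := sqr_ge0 r.
pose X := r ^+ 2 + eta + 1; have X0 : 0 < X by rewrite /X; lra.
pose m : R := (n * 2)%:R; have m0 : 0 <= m by exact: ler0n.
pose l1 := Ls * (m * (2 * X)) ^+ 2 + Ms * m + m * (2 * Ms * (K * X)) * K.
have l10 : 0 <= l1 by rewrite /l1; ge0.
exists (l1 * K ^+ 2 + 1) => [|x y cx cy].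
  by apply: ltr_wpDl => //; ge0.
have xB := collar_bounded cx; have yB := collar_bounded cy.
set h := y - x; set a := dS (n2 x); set G := hamiltonian_dir a x.
have hE : dot G (h *m Df x) = 2 * a * dot x h.
  rewrite /G /hamiltonian_dir dotZl (collar_symplectic cm _ _ cx) jmK dotNl; ring.
have GB : `|G| <= 2 * Ms * (K * X).
  rewrite normrZ norm_jm normrM normrN normr_nat; apply: ler_pM => //.
    by rewrite ler_wpM2l //; exact: Sb.
  by apply: le_trans (collar_deriv_le cm _ cx) _; rewrite ler_wpM2l ?norm_jm // ltW.
have q : n2 y - n2 x = 2 * dot x h + n2 h.
  by rewrite -[in n2 y](subrKC x y) -/h n2D; ring.
have E1 := Sq (n2 x) (n2 y).
have E2 : (n2 y - n2 x) ^+ 2 <= (m * (2 * X)) ^+ 2 * `|h| ^+ 2.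
  rewrite -exprMn -[(n2 y - n2 x) ^+ 2]real_normK ?num_real // ler_pXn2r ?nnegrE //; last by ge0.
  apply: le_trans (n2_diff_le _ _) _; rewrite -/h; apply: ler_wpM2r => //; apply: ler_wpM2l => //.
  by rewrite -/X in xB yB; lra.
have E3 : `|dot G (f y - f x - h *m Df x)| <= m * (2 * Ms * (K * X)) * K * `|h| ^+ 2.
  apply: le_trans (dot_le _ _) _.
  rewrite [leRHS](_ : _ = m * ((2 * Ms * (K * X)) * (K * `|h| ^+ 2))); last by ring.
  by apply: ler_wpM2l => //; apply: ler_pM => //; exact: (collar_taylor cm).
have E4 : `|a * n2 h| <= Ms * m * `|h| ^+ 2.
  rewrite normrM (ger0_norm (n2_ge0 _)) -mulrA; apply: ler_pM => //; [exact: n2_ge0|exact: Sb|exact: n2_le].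
have -> : S (n2 y) - S (n2 x) - dot G (f y - f x) =
   (S (n2 y) - S (n2 x) - a * (n2 y - n2 x)) + (a * n2 h - dot G (f y - f x - h *m Df x)).
  by rewrite (dotBr (f y - f x)) hE q; ring.
have hK : `|h| ^+ 2 <= K ^+ 2 * n2 (f y - f x).
  apply: (@le_trans _ _ ((K * `|f y - f x|) ^+ 2)).
    rewrite ler_pXn2r ?nnegrE //; [exact: (collar_inv_lip cm)|by ge0].
  by rewrite exprMn; apply: ler_wpM2l; [exact: sqr_ge0|exact: norm_sqr_le].
apply: (@le_trans _ _ (l1 * `|h| ^+ 2)).
  apply: le_trans (ler_normD _ _) _; apply: le_trans (lerD (lexx _) (ler_normB _ _)) _.
  have E5 := le_trans E1 (ler_wpM2l (ltW Ls0) E2); rewrite mulrA in E5.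
  apply: le_trans (lerD E5 (lerD E4 E3)) _; rewrite le_eqVlt; apply/orP; left; apply/eqP.
  by rewrite /l1; ring.
apply: (@le_trans _ _ (l1 * (K ^+ 2 * n2 (f y - f x)))); first exact: ler_wpM2l.
by rewrite mulrA ler_wpM2r ?n2_ge0 // lerDl.
Qed.

End CollarOpen.

(** * The region bounded by an embedded sphere *)

Lemma path_const (R : realType) (V : normedModType R) (Q : V -> Prop) (phi : V -> R) (e L : R) (g : R -> V) :
  0 < e -> 0 <= L -> (forall x y, Q x -> Q y -> `|y - x| < e -> phi x = phi y) ->
  (forall t, 0 <= t <= 1 -> Q (g t)) ->
  (forall t h, 0 <= t -> 0 <= h <= 1 -> `|g (t + h) - g t| <= L * h) -> phi (g 0) = phi (g 1).
Proof.
move=> e0 L0 loc Qg Lg; have L1 : 0 < L + 1 by rewrite ltr_wpDl.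
have [N NP] := archi_inv (divr_gt0 e0 L1).
have NR : 0 < N.+1%:R :> R by rewrite ltr0n.
have i01 i : (i <= N.+1)%N -> 0 <= (i%:R / N.+1%:R : R) <= 1.
  by move=> iN; rewrite divr_ge0 //= ler_pdivrMr // mul1r ler_nat.
have H i : (i <= N.+1)%N -> phi (g (i%:R / N.+1%:R)) = phi (g 0).
  elim: i => [|i IH] iN; first by rewrite mul0r.
  rewrite -IH; last exact: ltnW.
  apply/esym/loc; [exact: Qg _ (i01 _ (ltnW iN))|exact: Qg _ (i01 _ iN)|].
  have -> : i.+1%:R / N.+1%:R = i%:R / N.+1%:R + N.+1%:R^-1 :> R by rewrite -natr1 mulrDl mul1r.
  have n0 : 0 <= N.+1%:R^-1 :> R by rewrite invr_ge0 ltW.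
  apply: le_lt_trans (Lg _ _ _ _) _; first by case/andP: (i01 _ (ltnW iN)).
    by rewrite n0 /= invf_le1 // ler1n.
  apply: (@le_lt_trans _ _ ((L + 1) * N.+1%:R^-1)); first by rewrite ler_wpM2r // lerDl.
  by rewrite mulrC -ltr_pdivlMr //; exact: NP.
by rewrite -(H N.+1 (leqnn _)) divff // gt_eqF.
Qed.

Section InsideFunction.
Variables (R : realType) (n : nat).
Local Notation V := 'rV[R]_(n * 2).
Variables (r eta K : R) (f : V -> V) (Df : V -> 'M[R]_(n * 2)) (i0 : 'I_(n * 2)).
Hypotheses (n1 : (1 < n)%N) (r0 : 0 < r) (e0 : 0 < eta) (K0 : 0 < K) (cm : collar_map r eta K f Df).
Variables (S dS : R -> R) (Ls Ms : R).
Hypotheses (Ls0 : 0 < Ls) (Ms0 : 0 < Ms) (S01 : forall a, 0 <= S a <= 1).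
Hypotheses (S_low : forall a, a <= r ^+ 2 - eta / 2 -> S a = 1)
  (S_high : forall a, r ^+ 2 + eta / 2 <= a -> S a = 0).
Hypothesis S_quad : forall a b, `|S b - S a - dS a * (b - a)| <= Ls * (b - a) ^+ 2.
Hypotheses (dS_le : forall a, `|dS a| <= Ms) (dS_off : forall a, eta / 2 <= `|a - r ^+ 2| -> dS a = 0).

(** With [sphere_arcs] this shows that the collar is connected by chains of short steps: a function
    constant at some scale [e] is constant along rays and along great circles. *)
Lemma collar_rays (x : V) : collar r eta x -> n2 x != 0 -> exists2 y : V, n2 y = r ^+ 2 &
  forall phi (e : R), 0 < e -> (forall a b : V, collar r eta a -> collar r eta b -> `|b - a| < e -> phi a = phi b) ->
  phi x = phi y :> R.
Proof.
move=> cx nx; have x0 : 0 < n2 x by rewrite lt_def nx n2_ge0.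
pose lam := r / Num.sqrt (n2 x); have sx : 0 < Num.sqrt (n2 x) by rewrite sqrtr_gt0.
have lam0 : 0 < lam by rewrite divr_gt0.
have lamE : lam ^+ 2 * n2 x = r ^+ 2.
  by rewrite /lam exprMn exprVn sqr_sqrtr ?(ltW x0) // mulfVK.
exists (lam *: x) => [|phi e e0' loc]; first by rewrite n2Z.
have := @path_const R V (collar r eta) phi e (`|lam - 1| * `|x|) (fun t => (1 + t * (lam - 1)) *: x) e0'.
rewrite mul0r addr0 scale1r mul1r subrKC; apply => //.
- move=> t /andP[t0 t1]; rewrite /collar /= n2Z; move: cx; rewrite /collar /=.
  set a := 1 + t * (lam - 1); rewrite -lamE => cx.
  have cx2 : `|n2 x| * `|1 - lam ^+ 2| <= eta by rewrite -normrM (_ : n2 x * (1 - lam ^+ 2) = n2 x - lam ^+ 2 * n2 x) //; ring.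
  rewrite -mulrBl normrM mulrC; apply: le_trans cx2; apply: ler_wpM2l => //.
  have -> : a ^+ 2 - lam ^+ 2 = (1 - t) * (1 - lam) * (a + lam) by rewrite /a; ring.
  have -> : 1 - lam ^+ 2 = (1 - lam) * (1 + lam) by ring.
  have a0 : 0 <= a by rewrite /a; nra.
  rewrite !normrM (ger0_norm (_ : 0 <= 1 - t)); last by lra.
  rewrite (ger0_norm (_ : 0 <= a + lam)); last by lra.
  rewrite (ger0_norm (_ : 0 <= 1 + lam)); last by lra.
  rewrite -mulrA mulrCA; apply: ler_wpM2l => //; rewrite /a; nra.
- move=> t h t0 /andP[h0 h1]; rewrite -scalerBl.
  have -> : 1 + (t + h) * (lam - 1) - (1 + t * (lam - 1)) = h * (lam - 1) by ring.
  by rewrite normrZ normrM (ger0_norm h0) -mulrA mulrC.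
Qed.

Lemma sphere_arcs (x y : V) : n2 x = r ^+ 2 -> n2 y = r ^+ 2 ->
  forall phi (e : R), 0 < e -> (forall a b : V, collar r eta a -> collar r eta b -> `|b - a| < e -> phi a = phi b) ->
  phi x = phi y :> R.
Proof.
move=> nx ny phi e e0' loc; have r2 : 0 < r ^+ 2 by rewrite exprn_gt0.
pose a := dot x y / r ^+ 2; have aE : a * r ^+ 2 = dot x y by rewrite /a mulfVK // gt_eqF.
have a2 : a ^+ 2 <= 1.
  have := cauchy_schwarz x y; rewrite nx ny -aE.
  have -> : (a * r ^+ 2) ^+ 2 = a ^+ 2 * (r ^+ 2 * r ^+ 2) by ring.
  by rewrite ger_pMl // mulr_gt0.
have am : -1 <= a <= 1 by rewrite -ler_norml; have := normr_ge0 a; rewrite -real_normK ?num_real // in a2; nra.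
pose b := Num.sqrt (1 - a ^+ 2).
have b2 : b ^+ 2 = 1 - a ^+ 2 by rewrite sqr_sqrtr // subr_ge0.
have [u [nu ux yE]] : exists u, [/\ n2 u = r ^+ 2, dot x u = 0 & y = a *: x + b *: u].
  (* For [y = x] or [y = - x] the arc is not determined; it is taken through [jm x]. *)
  have [b0|b0] := eqVneq b 0.
    exists (jm x); rewrite n2_jm nx dotC dot_jmu b0 scale0r addr0; split=> //.
    apply/eqP; rewrite -subr_eq0 -n2_eq0 n2B n2Z ny nx dotZr (dotC y) -aE.
    by rewrite b0 expr0n /= in b2; apply/eqP; nra.
  exists (b^-1 *: (y - a *: x)); rewrite n2Z n2B n2Z ny nx !dotZr dotBr dotZr -/(n2 x) nx (dotC y) -aE subrr mulr0.
  rewrite scalerA divff // scale1r subrKC; split=> //.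
  have -> : r ^+ 2 - 2 * (a * (a * r ^+ 2)) + a ^+ 2 * r ^+ 2 = b ^+ 2 * r ^+ 2 by rewrite b2; ring.
  by rewrite exprVn mulKf // expf_neq0.
pose p := acos a; have cp : cos p = a by apply: acosK; rewrite in_itv.
have sp : sin p = b by rewrite sin_acos.
have p0 : 0 <= p by exact: acos_ge0.
pose g t := cos (t * p) *: x + sin (t * p) *: u.
have -> : x = g 0 by rewrite /g mul0r cos0 sin0 scale1r scale0r addr0.
have -> : y = g 1 by rewrite /g mul1r cp sp yE.
apply: (@path_const R V (collar r eta) phi e (p * (1 + p) * (`|x| + `|u|)) g e0') => //.
- by ge0.
- move=> t _; rewrite /collar /g /= n2D !n2Z dotZl dotZr ux nx nu !mulr0 addr0 -mulrDl cos2Dsin2 mul1r subrr normr0; exact: ltW.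
- move=> t h t0 /andP[h0 h1]; rewrite /g mulrDl opprD addrACA -!scalerBl.
  apply: le_trans (ler_normD _ _) _; rewrite !normrZ.
  have hp : 0 <= h * p by rewrite mulr_ge0.
  have b1 : (h * p) ^+ 2 + `|h * p| <= p * (1 + p) * h.
    rewrite ger0_norm //; have : 0 <= p ^+ 2 * (h * (1 - h)) by rewrite !mulr_ge0 ?sqr_ge0 // subr_ge0.
    nra.
  rewrite mulrAC mulrDr; apply: lerD; apply: ler_wpM2r => //.
    exact: le_trans (cos_diff_le _ _) b1.
  exact: le_trans (sin_diff_le _ _) b1.
Qed.

Lemma collar_connected (x y : V) : eta <= r ^+ 2 / 2 -> collar r eta x -> collar r eta y ->
  forall phi (e : R), 0 < e -> (forall a b : V, collar r eta a -> collar r eta b -> `|b - a| < e -> phi a = phi b) ->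
  phi x = phi y :> R.
Proof.
move=> er cx cy phi e e0' loc; have r2 : 0 < r ^+ 2 by rewrite exprn_gt0.
have nz (z : V) : collar r eta z -> n2 z != 0.
  by rewrite /collar /= ler_norml => /andP[h _]; apply/eqP => z0; rewrite z0 in h; lra.
have [x' nx' hx] := collar_rays cx (nz _ cx); have [y' ny' hy] := collar_rays cy (nz _ cy).
by rewrite (hx _ _ e0' loc) (hy _ _ e0' loc) (sphere_arcs nx' ny' e0' loc).
Qed.

Definition in_image (z : V) := exists2 x, collar r eta x & f x = z.
Definition in_core (z : V) := exists2 x, collar r (eta / 2) x & f x = z.
Let pre (z : V) : V := xget 0 [set x | collar r eta x /\ f x = z].
(** Extended by 0, this function jumps at the inner rim of the image. Only its increments between
    near points of the image are meaningful. *)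
Let s (z : V) : R := if `[< in_image z >] then S (n2 (pre z)) else 0.
Let G (z : V) : V := if `[< in_image z >] then hamiltonian_dir Df (dS (n2 (pre z))) (pre z) else 0.

Lemma pre_f (x : V) : collar r eta x -> pre (f x) = x.
Proof.
move=> cx; have [c1 c2] : [set y | collar r eta y /\ f y = f x] (pre (f x)).
  by apply: xgetPex; exists x.
exact: (collar_inj cm c1 cx c2).
Qed.

Lemma s_f (x : V) : collar r eta x -> s (f x) = S (n2 x).
Proof. by move=> cx; rewrite /s asboolT ?pre_f //; exists x. Qed.

Lemma G_f (x : V) : collar r eta x -> G (f x) = hamiltonian_dir Df (dS (n2 x)) x.
Proof. by move=> cx; rewrite /G asboolT ?pre_f //; exists x. Qed.

Lemma s_out z : ~ in_image z -> s z = 0.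
Proof. by move=> h; rewrite /s asboolF. Qed.

Lemma core_image z : in_core z -> in_image z.
Proof.
by move=> [x cx <-]; exists x => //; apply: collar_sub cx; have ep := e0; lra.
Qed.

Lemma s_noncore z : ~ in_core z -> s z = 0 \/ s z = 1.
Proof.
move=> nz; have [[x cx fx]|h] := pselect (in_image z); last by left; exact: s_out.
rewrite -fx s_f //; have : ~ collar r (eta / 2) x by move=> h; apply: nz; exists x.
rewrite /collar /= => /negP; rewrite -ltNge; have [h|h] := leP (n2 x - r ^+ 2) 0.
  by rewrite ler0_norm // => h2; right; apply: S_low; lra.
by rewrite gtr0_norm // => h2; left; apply: S_high; lra.
Qed.

(** Near the core everything lies in the image, by [collar_open]. Off the core the image has two
    sides, on each of which [s] is constant, and their values of [n2] differ by at least [eta]. *)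
Lemma core_nbhs : exists2 d, 0 < d &
  (forall z w, in_core z -> `|w - z| < d -> in_image w) /\
  (forall z w, ~ in_core z -> ~ in_core w -> in_image z -> in_image w -> `|w - z| < d -> s z = s w).
Proof.
have [d d0 dP] := collar_open e0 K0 cm; have ep := e0; have Kp := K0; have r2 := sqr_ge0 r.
pose c := (n * 2)%:R * (2 * (r ^+ 2 + eta + 1)) * K + 1.
have c0 : 0 < c by apply: ltr_wpDl => //; rewrite !mulr_ge0 //; lra.
exists (Num.min d (eta / c)); first by rewrite lt_min d0 divr_gt0.
split=> [z w [x cx <-]|z w nz nw [x cx fx] [y cy fy]]; rewrite lt_min => /andP[h1 h2].
  by have [y cy fy] := dP _ _ cx h1; exists y.
have dn : `|n2 y - n2 x| < eta.
  apply: le_lt_trans (n2_diff_le _ _) _.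
  have h3 := collar_inv_lip cm cx cy; rewrite fx fy in h3.
  rewrite ltr_pdivlMr // in h2; apply: le_lt_trans h2.
  have xB := collar_bounded cx; have yB := collar_bounded cy.
  apply: (@le_trans _ _ ((n * 2)%:R * (2 * (r ^+ 2 + eta + 1)) * (K * `|w - z|))).
    apply: ler_pM => //.
    by apply: ler_wpM2l => //; lra.
  by rewrite -subr_ge0 [X in 0 <= X](_ : _ = `|w - z|) //; rewrite /c; ring.
have ncx : ~ collar r (eta / 2) x by move=> h; apply: nz; exists x.
have ncy : ~ collar r (eta / 2) y by move=> h; apply: nw; exists y.
rewrite -fx -fy !s_f //; move: ncx ncy dn; rewrite /collar /= => /negP + /negP.
rewrite -!ltNge; move: (n2 x) (n2 y) => a b; rewrite ltr_norml => ha hb /andP[k1 k2].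
have [ha'|ha'] := leP (a - r ^+ 2) 0; have [hb'|hb'] := leP (b - r ^+ 2) 0;
  rewrite ?(ler0_norm ha') ?(gtr0_norm ha') in ha; rewrite ?(ler0_norm hb') ?(gtr0_norm hb') in hb.
- rewrite !S_low //; lra.
- lra.
- lra.
- rewrite !S_high //; lra.
Qed.

(** Increments of [s] inside the image, extended by zero to all pairs of points. On small triangles
    this is a cocycle: if one vertex is outside of the image, then all three are off the core, where
    near increments vanish. *)
Let Dl (z w : V) : R := if `[< in_image z /\ in_image w >] then s w - s z else 0.

Section Lift.
Variable d : R.
Hypotheses (d0 : 0 < d) (core_near : forall z w, in_core z -> `|w - z| < d -> in_image w).
Hypothesis side_near : forall z w, ~ in_core z -> ~ in_core w -> in_image z -> in_image w -> `|w - z| < d -> s z = s w.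

Lemma Dl_out z w : ~ (in_image z /\ in_image w) -> Dl z w = 0.
Proof. by move=> h; rewrite /Dl asboolF. Qed.

Lemma Dl_noncore z w : ~ in_core z -> ~ in_core w -> `|w - z| < d -> Dl z w = 0.
Proof.
move=> nz nw h; rewrite /Dl; have [[hz hw]|k] := pselect (in_image z /\ in_image w).
  by rewrite asboolT // (side_near nz nw hz hw h) subrr.
by rewrite asboolF.
Qed.

Lemma core_near' z w : ~ in_image w -> `|w - z| < d -> ~ in_core z.
Proof. by move=> nw h cz; apply: nw; exact: core_near cz h. Qed.

Lemma Dl_cocycle x y z : `|y - x| < d -> `|z - y| < d -> `|z - x| < d -> Dl x y + Dl y z = Dl x z.
Proof.
move=> h1 h2 h3; have [[hx [hy hz]]|N] := pselect (in_image x /\ (in_image y /\ in_image z)).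
  by rewrite /Dl !asboolT //; ring.
have [nx [ny nz]] : ~ in_core x /\ (~ in_core y /\ ~ in_core z).
  have h1' : `|x - y| < d by rewrite distrC. have h2' : `|y - z| < d by rewrite distrC.
  have h3' : `|x - z| < d by rewrite distrC.
  have [hx|hx] := pselect (in_image x); last first.
    split; last by split; [exact: core_near' hx h1'|exact: core_near' hx h3'].
    by move/core_image.
  have [hy|hy] := pselect (in_image y); last first.
    split; first exact: core_near' hy h1. split; last exact: core_near' hy h2'.
    by move/core_image.
  have hz : ~ in_image z by move=> hz; apply: N.
  split; first exact: core_near' hz h3. split; first exact: core_near' hz h2.
  by move/core_image.
by rewrite !Dl_noncore // addr0.
Qed.

(** Off the core [s] is 0 or 1, so the extension by zero alters an increment by an integer. *)
Lemma Dl_int z w : `|w - z| < d -> exists k : int, Dl z w = s w - s z + k%:~R.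
Proof.
move=> h; have [[hz hw]|N] := pselect (in_image z /\ in_image w).
  by exists 0; rewrite /Dl asboolT // addr0.
have h' : `|z - w| < d by rewrite distrC.
have [nz nw] : ~ in_core z /\ ~ in_core w.
  have [hz|hz] := pselect (in_image z); last by split; [move/core_image|exact: core_near' hz h'].
  by split; [apply: (@core_near' _ w)|move/core_image] => //; move=> hw; apply: N.
rewrite Dl_out //; have [->|->] := s_noncore nz; have [->|->] := s_noncore nw.
- by exists 0; rewrite subrr addr0.
- by exists (-1); rewrite subr0 rmorphN1 subrr.
- by exists 1; rewrite sub0r rmorph1 addNr.
- by exists 0; rewrite subrr addr0.
Qed.

Variable B : R.
Hypothesis imageB : forall z, in_image z -> `|z| <= B.

Let h := d / 4.
Let e : V := delta_mx 0 i0.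
Let p (z : V) (i : nat) : V := z + (i%:R * h) *: e.
(** The primitive of the cocycle at [z], summed along the ray in direction [i0], which leaves the
    bounded image after finitely many steps. *)
Let T (z : V) (N : nat) : R := \sum_(i < N) Dl (p z i.+1) (p z i).
Let Nz (z : V) := (Num.trunc ((B + `|z|) / h)).+1.

Lemma h_gt0 : 0 < h. Proof. by rewrite divr_gt0. Qed.

Lemma p_coord z i : p z i 0 i0 = z 0 i0 + i%:R * h.
Proof. by rewrite !mxE !eqxx mulr1. Qed.

Lemma far_out (z : V) : B < z 0 i0 -> ~ in_image z.
Proof.
move=> h1 /imageB; apply/negP; rewrite -ltNge; apply: lt_le_trans h1 _.
by apply: le_trans (ler_norm _) (coord_le _ _).
Qed.

Lemma p_far z i : (Nz z <= i)%N -> ~ in_image (p z i).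
Proof.
move=> Ni; apply: far_out; rewrite p_coord.
have : (B + `|z|) / h < i%:R.
  by apply: lt_le_trans (truncnS_gt _) _; rewrite ler_nat.
rewrite ltr_pdivrMr ?h_gt0 // => k; have := coord_le z i0; rewrite ler_norml => /andP[k2 _]; lra.
Qed.

Lemma T_stable z N : (Nz z <= N)%N -> T z N = T z (Nz z).
Proof.
move=> /subnKC <-; elim: (N - Nz z)%N => [|k IH]; first by rewrite addn0.
rewrite addnS /T big_ord_recr /= -/(T _ _) IH Dl_out ?addr0 // => -[+ _].
by apply: p_far; rewrite -addnS leq_addr.
Qed.

Definition lifted (z : V) := T z (Nz z).

Lemma p_step z i : p z i - p z i.+1 = - (h *: e).
Proof. by rewrite /p opprD addrACA subrr add0r -scalerBl -mulrBl -[i.+1%:R]natr1 opprD addNKr mulN1r scaleNr. Qed.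

Lemma e_norm : `|e| <= 1.
Proof. by apply: norm_rVP => // i; rewrite mxE; case: (_ && _); rewrite ?normr1 ?normr0. Qed.

Lemma he_norm : `|h *: e| <= d / 4.
Proof. by rewrite normrZ (gtr0_norm h_gt0) ler_piMr ?(ltW h_gt0) // e_norm. Qed.

(** The rays from [z] and [w] form a ladder. The cocycle identity on the two triangles of each
    square makes the difference of the sums telescope to the first rung. *)
Lemma lift_local z w : `|w - z| < d / 2 -> lifted w - lifted z = Dl z w.
Proof.
move=> wz; have dp := d0; pose N := maxn (Nz z) (Nz w).
rewrite /lifted -(@T_stable z N) ?leq_maxl // -(@T_stable w N) ?leq_maxr // /T -sumrB.
have pd i : p w i - p z i = w - z by rewrite /p opprD addrACA subrr addr0.
rewrite (eq_bigr (fun i : 'I_N => Dl (p z i) (p w i) - Dl (p z i.+1) (p w i.+1))).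
  rewrite -(big_mkord xpredT (fun i => Dl (p z i) (p w i) - Dl (p z i.+1) (p w i.+1))).
  rewrite -[LHS]opprK -sumrN (eq_bigr (fun i => Dl (p z i.+1) (p w i.+1) - Dl (p z i) (p w i))); last by move=> i _; rewrite opprB.
  rewrite telescope_sumr // opprB [X in _ - X]Dl_out ?subr0; last by move=> -[+ _]; apply: p_far; exact: leq_maxl.
  by rewrite /p !mul0r !scale0r !addr0.
move=> i _; have hh := he_norm.
have d1 : `|p w i.+1 - p z i.+1| < d by rewrite pd; lra.
have d2 : `|p w i - p z i| < d by rewrite pd; lra.
have d3 : `|p w i - p w i.+1| < d by rewrite p_step normrN; lra.
have d4 : `|p z i - p z i.+1| < d by rewrite p_step normrN; lra.
have d5 : `|p w i - p z i.+1| < d.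
  rewrite -(subrK (p z i) (p w i)) -addrA pd p_step; apply: le_lt_trans (ler_normB _ _) _; lra.
have := Dl_cocycle d1 d3 d5; have := Dl_cocycle d4 d2 d5; lra.
Qed.

Lemma lift_int z : exists k : int, lifted z = s z + k%:~R.
Proof.
have H N : exists k : int, T z N = s z - s (p z N) + k%:~R.
  elim: N => [|N [k IH]]; first by exists 0; rewrite /T big_ord0 /p mul0r scale0r (addr0 z) subrr addr0.
  have hN : `|p z N - p z N.+1| < d.
    by rewrite p_step normrN; have := he_norm; have dp := d0; lra.
  have [k' k'P] := Dl_int hN; exists (k + k').
  by rewrite /T big_ord_recr /= -/(T z N) IH k'P rmorphD /=; ring.
by have [k kP] := H (Nz z); exists k; rewrite /lifted kP (s_out (p_far (leqnn _))) subr0.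
Qed.

Lemma lift_far (z : V) : B < z 0 i0 -> lifted z = 0.
Proof.
move=> hz; rewrite /lifted /T big1 // => i _; apply: Dl_out => -[+ _]; apply: far_out.
by rewrite p_coord; apply: lt_le_trans hz _; rewrite lerDl mulr_ge0 // ltW // h_gt0.
Qed.

End Lift.

Let clamp (t : R) := Num.max 0 (Num.min 1 t).

Lemma clamp_id t : 0 <= t <= 1 -> clamp t = t.
Proof. by move=> /andP[t0 t1]; rewrite /clamp (min_idPr t1) (max_idPr t0). Qed.

Lemma clamp01 t : 0 <= clamp t <= 1.
Proof. by rewrite /clamp le_max lexx /= ge_max ler01 ge_min lexx. Qed.

Lemma clamp_int (k : int) : clamp k%:~R = 0 \/ clamp k%:~R = 1.
Proof.
have [k0|k0] := lerP k 0.
  by left; rewrite /clamp; apply/max_idPl; rewrite ge_min; apply/orP; right; rewrite lerz0.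
right; have k1 : 1 <= k%:~R :> R by rewrite (ler_int R 1 k).
by rewrite /clamp (min_idPl k1); apply/max_idPr.
Qed.

Lemma G_noncore z : ~ in_core z -> G z = 0.
Proof.
move=> nz; have [[x cx fx]|h] := pselect (in_image z); last by rewrite /G asboolF.
rewrite -fx G_f // /hamiltonian_dir dS_off ?mulr0 ?scale0r //.
by rewrite leNgt; apply/negP => h; apply: nz; exists x => //; rewrite /collar /= ltW.
Qed.

Lemma G_bound : exists2 M, 0 <= M & forall z, `|G z| <= M.
Proof.
have ep := e0; have Kp := K0; have Mp := Ms0; have r2 := sqr_ge0 r.
pose M := 2 * Ms * (K * (r ^+ 2 + eta + 1)).
have M0 : 0 <= M by rewrite /M; apply: mulr_ge0; [lra|apply: mulr_ge0; lra].
exists M => // z; have [[x cx fx]|h] := pselect (in_image z); last by rewrite /G asboolF // normr0.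
rewrite -fx G_f // /hamiltonian_dir normrZ norm_jm normrM normrN (ger0_norm (_ : 0 <= 2)) //.
apply: ler_pM => //; first by rewrite ler_wpM2l.
apply: le_trans (collar_deriv_le cm _ cx) _; rewrite ler_pM2l // norm_jm.
exact: collar_bounded cx.
Qed.

(** On the connected collar the primitive is [S (n2 x)] plus an integer [c]. Elsewhere it may take
    further integer values, which truncation to [[0, 1]] removes; [cc] then makes the function
    vanish far out. Which of its two values [cc] has is decided later, by comparing volumes. *)
Theorem inside_function : eta <= r ^+ 2 / 2 -> exists (sigma : V -> R) (P : V -> V) (cc l B : R),
  [/\ 0 < l, quad_approx l sigma P,
      ((cc = 0) \/ (cc = -1)) /\ (forall z, cc <= sigma z <= cc + 1),
      forall x, collar r eta x -> sigma (f x) = S (n2 x) + cc /\ P (f x) = hamiltonian_dir Df (dS (n2 x)) x &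
      [/\ forall z, ~ in_core z -> P z = 0,
          forall z w : V, (forall t : R, 0 <= t <= 1 -> ~ in_core (z + t *: (w - z))) -> sigma z = sigma w,
          forall z : V, B < z 0 i0 -> sigma z = 0 &
          forall z, ~ in_core z -> sigma z = cc \/ sigma z = cc + 1]].
Proof.
move=> er; have Kp := K0; have [d d0 [near side]] := core_nbhs.
have [B B0 BP] := collar_image_bounded e0 K0 cm.
have imB z : in_image z -> `|z| <= B by move=> [x cx <-]; exact: BP.
pose L := lifted d B.
have Lloc z w : `|w - z| < d / 2 -> L w - L z = Dl z w by exact: lift_local.
have d20 : 0 < d / 2 by rewrite divr_gt0.
pose x0 : V := r *: delta_mx 0 i0.
have cx0 : collar r eta x0.
  rewrite /collar /= n2Z (_ : n2 _ = 1) ?mulr1 ?subrr ?normr0 ?(ltW e0) //.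
  by rewrite /n2 dot_delta mxE !eqxx.
pose c := L (f x0) - S (n2 x0).
have cE x : collar r eta x -> L (f x) = S (n2 x) + c.
  move=> cx; suff : L (f x) - S (n2 x) = c by move=> <-; rewrite subrKC.
  apply: (@collar_connected _ _ er cx cx0 (fun x => L (f x) - S (n2 x)) (d / 2 / (K + 1))).
    by rewrite divr_gt0 // ltr_wpDl // ltW.
  move=> a b ca cb ab.
  have fab : `|f b - f a| < d / 2.
    apply: le_lt_trans (collar_lip cm ca cb) _; rewrite ltr_pdivlMr in ab; last by rewrite ltr_wpDl // ltW.
    by apply: le_lt_trans ab; rewrite mulrC ler_wpM2l // lerDl.
  have := Lloc _ _ fab; rewrite /Dl asboolT; last by split; [exists a|exists b].
  by rewrite !s_f // => h; lra.
have [k kE] : exists k : int, c = k%:~R.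
  have [k kP] := @lift_int d d0 near B imB (f x0).
  by exists k; rewrite /c /L kP s_f // addrAC subrr add0r.
pose cc := - clamp (- c).
have ccP : cc = 0 \/ cc = -1.
  by rewrite /cc kE -rmorphN; have [->|->] := clamp_int (- k); [left; rewrite oppr0|right].
pose sigma z := clamp (L z - c) + cc.
have sf x : collar r eta x -> sigma (f x) = S (n2 x) + cc.
  by move=> cx; rewrite /sigma cE // addrK clamp_id.
have sloc z w : ~ in_core z -> ~ in_core w -> `|w - z| < d / 2 -> sigma z = sigma w.
  move=> nz nw zw; have := Lloc _ _ zw; rewrite (Dl_noncore side nz nw); last by have dp := d0; lra.
  by move/eqP; rewrite subr_eq0 /sigma => /eqP ->.
have [Mg Mg0 MgP] := G_bound.
have [l1 l10 l1P] := profile_quad e0 K0 cm Ls0 Ms0 S_quad dS_le.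
pose m : R := (n * 2)%:R; have m0 : 0 <= m by exact: ler0n.
pose l := l1 + (2 / d) ^+ 2 + m * Mg * (2 / d).
have dd : 0 < 2 / d by rewrite divr_gt0.
have l2 : 0 <= (2 / d) ^+ 2 by exact: sqr_ge0.
have l3 : 0 <= m * Mg * (2 / d) by apply: mulr_ge0; [exact: mulr_ge0|exact: ltW].
have sb z : cc <= sigma z <= cc + 1.
  by rewrite /sigma addrC lerDl lerD2l; exact: clamp01.
exists sigma, G, cc, l, B; split => //.
- by rewrite /l; lra.
(* For distant points a large constant suffices, as [sigma] varies by at most 1 and [G] is bounded.
   Near points both lie in the image, or [sigma] agrees at them and [z] is off the core, where [G]
   vanishes. *)
- move=> z w; have [wz|wz] := ltP `|w - z| (d / 2); last first.
    have n2wz : `|w - z| ^+ 2 <= n2 (w - z) by exact: norm_sqr_le.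
    have h1 : 1 <= (2 / d) * `|w - z|.
      by rewrite -ler_pdivrMl // invf_div mulr1.
    move: (sb z) (sb w) => /andP[a1 a2] /andP[b1 b2].
    have s1 : `|sigma w - sigma z| <= 1 by rewrite ler_norml; apply/andP; split; lra.
    have s2 : 1 <= (2 / d) ^+ 2 * `|w - z| ^+ 2 by rewrite -exprMn exprn_ege1.
    have s3 : `|dot (G z) (w - z)| <= m * Mg * (2 / d) * `|w - z| ^+ 2.
      apply: le_trans (dot_le _ _) _; rewrite -/m -!mulrA; apply: ler_wpM2l => //.
      apply: ler_pM => //; rewrite expr2 !mulrA; exact: ler_peMl.
    apply: le_trans (ler_normB _ _) _.
    apply: (@le_trans _ _ (l * `|w - z| ^+ 2)); last by apply: ler_wpM2l => //; rewrite /l; lra.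
    have : 0 <= l1 * `|w - z| ^+ 2 by rewrite mulr_ge0 ?exprn_ge0 // ltW.
    by rewrite /l !mulrDl; lra.
  have [[[x cx fx] [y cy fy]]|N] := pselect (in_image z /\ in_image w).
    rewrite -fx -fy !sf // G_f // opprD addrACA subrr addr0.
    apply: le_trans (l1P _ _ cx cy) _; apply: ler_wpM2r; first exact: n2_ge0.
    by rewrite /l; lra.
  have wz' : `|w - z| < d by have dp := d0; lra.
  have nz : ~ in_core z.
    move=> cz; apply: N; split; [exact: core_image|exact: near cz wz'].
  have := Lloc _ _ wz; rewrite Dl_out // => /eqP; rewrite subr_eq0 => /eqP Lzw.
  rewrite /sigma Lzw subrr G_noncore // dot0l subrr normr0 mulr_ge0 ?n2_ge0 //.
  by rewrite /l; lra.
- by move=> x cx; split; [exact: sf|exact: G_f].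
- split; first exact: G_noncore.
  + move=> z w nc; have := @path_const R V (fun z => ~ in_core z) sigma (d / 2) `|w - z| (fun t => z + t *: (w - z)) d20 (normr_ge0 _) sloc nc.
    rewrite scale0r addr0 scale1r subrKC; apply => t h t0 /andP[h0 h1].
    by rewrite opprD addrACA subrr add0r -scalerBl [t + h]addrC addrK normrZ (ger0_norm h0) mulrC.
  + move=> z hz; rewrite /sigma /L (lift_far d0 imB hz) sub0r /cc subrr //.
  + move=> z nz; have [k' kP] := @lift_int d d0 near B imB z.
    have [j jE] : exists j : int, L z - c = j%:~R.
      have [s0|s1] := s_noncore nz; rewrite /L kP kE ?s0 ?s1.
        by exists (k' - k); rewrite add0r rmorphB.
      by exists (1 + k' - k); rewrite rmorphB rmorphD.
    by rewrite /sigma jE; have [->|->] := clamp_int j; [left; rewrite add0r|right; rewrite addrC].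
Qed.

End InsideFunction.

(** * A translation invariant integral *)

Section RampTent.
Variable R : realType.
Implicit Types t s : R.

Definition ramp t := Num.max 0 (Num.min 1 t).

Lemma rampP t : [\/ t <= 0 /\ ramp t = 0, (0 <= t <= 1) /\ ramp t = t | 1 <= t /\ ramp t = 1].
Proof.
rewrite /ramp; have [h|h] := leP t 0.
  by constructor 1; split=> //; apply/max_idPl; rewrite ge_min h orbT.
have [k|k] := leP t 1; first by constructor 2; rewrite (max_idPr (ltW h)) (ltW h).
by constructor 3; rewrite (ltW k) (max_idPr ler01).
Qed.

Lemma ramp_lip t s : `|ramp t - ramp s| <= `|t - s|.
Proof.
have := ler_norm (t - s); have := ler_norm (- (t - s)); rewrite normrN => h1 h2.
by rewrite ler_norml; case: (rampP t) => -[a ->]; case: (rampP s) => -[b ->]; apply/andP; split; lra.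
Qed.

Lemma ramp_homo t s : t <= s -> ramp t <= ramp s.
Proof. by move=> ts; case: (rampP t) => -[a ->]; case: (rampP s) => -[b ->]; lra. Qed.

Lemma ramp01 t : 0 <= ramp t <= 1.
Proof. by case: (rampP t) => -[a ->]; apply/andP; split; lra. Qed.

Lemma ramp_eq0 t : t <= 0 -> ramp t = 0.
Proof. by move=> h; case: (rampP t) => -[a ->]; lra. Qed.

Lemma ramp_eq1 t : 1 <= t -> ramp t = 1.
Proof. by move=> h; case: (rampP t) => -[a ->]; lra. Qed.

(** The hat function on [[-1, 1]], written as a difference so that sums over integer translates
    telescope. *)
Definition tent t := ramp (t + 1) - ramp t.

Lemma tent01 t : 0 <= tent t <= 1.
Proof.
rewrite /tent subr_ge0 ramp_homo ?lerDl //=.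
by have := ramp01 t; have := ramp01 (t + 1); lra.
Qed.

Lemma tent_lip t s : `|tent t - tent s| <= 2 * `|t - s|.
Proof.
have -> : tent t - tent s = (ramp (t + 1) - ramp (s + 1)) - (ramp t - ramp s) by rewrite /tent; ring.
apply: le_trans (ler_normB _ _) _; have := ramp_lip t s; have := ramp_lip (t + 1) (s + 1).
by rewrite opprD addrACA subrr addr0; lra.
Qed.

Lemma tent_out t : 1 <= `|t| -> tent t = 0.
Proof.
rewrite ler_normr /tent => /orP[h|h].
  by rewrite !ramp_eq1 ?subrr //; lra.
by rewrite !ramp_eq0 ?subrr //; lra.
Qed.

Lemma tent_sum t (N : nat) :
  \sum_(j < N.*2.+1) tent (t + N%:R - j%:R) = ramp (t + N%:R + 1) - ramp (t - N%:R).
Proof.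
have -> : \sum_(j < N.*2.+1) tent (t + N%:R - j%:R) =
    - \sum_(0 <= j < N.*2.+1) (ramp (t + N%:R + 1 - j.+1%:R) - ramp (t + N%:R + 1 - j%:R)).
  rewrite big_mkord -sumrN; apply: eq_bigr => j _; rewrite opprB /tent -[j.+1%:R]natr1.
  by congr (ramp _ - ramp _); ring.
rewrite telescope_sumr // opprB subr0; congr (_ - ramp _).
by rewrite -[X in _ - X]natr1 -addnn natrD; ring.
Qed.

End RampTent.

Section InvariantIntegral.
Variables (R : realType) (m : nat).
Local Notation E := 'rV[R]_m.
Implicit Types (phi psi : E -> R) (x y v : E).

(** Lipschitz functions of bounded support; one constant serves as Lipschitz constant and as radius
    of the support. *)
Definition lip_cs phi := exists2 c : R, 0 < c &
  (forall x y, `|phi y - phi x| <= c * `|y - x|) /\ forall x, c < `|x| -> phi x = 0.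

Lemma lip_cs_bounded phi : lip_cs phi -> exists2 M : R, 0 < M & forall x, `|phi x| <= M.
Proof.
move=> [c c0 [lp sp]]; exists (`|phi 0| + c * c + 1).
  by apply: ltr_wpDl => //; rewrite addr_ge0 // mulr_ge0 // ltW.
move=> x; have [cx|xc] := ltP c `|x|.
  by rewrite sp // normr0 addr_ge0 // addr_ge0 // mulr_ge0 // ltW.
rewrite -(subrK (phi 0) (phi x)); apply: le_trans (ler_normD _ _) _.
have := lp 0 x; rewrite subr0; have : c * `|x| <= c * c by rewrite ler_pM2l.
lra.
Qed.

Lemma lip_csI phi (c1 c2 : R) : (forall x y, `|phi y - phi x| <= c1 * `|y - x|) ->
  (forall x, c2 < `|x| -> phi x = 0) -> lip_cs phi.
Proof.
move=> h1 h2; exists (`|c1| + `|c2| + 1); first by rewrite ltr_wpDl // addr_ge0.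
have k1 := ler_norm c1; have k2 := ler_norm c2; have k3 := normr_ge0 c1; have k4 := normr_ge0 c2.
split=> [x y|x hx]; last by apply: h2; lra.
by apply: le_trans (h1 x y) _; apply: ler_wpM2r => //; lra.
Qed.

Lemma lip_csD phi psi : lip_cs phi -> lip_cs psi -> lip_cs (fun x => phi x + psi x).
Proof.
move=> [c c0 [lp sp]] [d d0 [lq sq]]; apply: (@lip_csI _ (c + d) (c + d)) => [x y|x hx].
  rewrite opprD addrACA mulrDl; apply: le_trans (ler_normD _ _) _; exact: lerD.
by rewrite sp ?sq ?addr0 //; lra.
Qed.

Lemma lip_csM phi psi (k : R) : lip_cs phi -> (forall x y, `|psi y - psi x| <= k * `|y - x|) ->
  lip_cs (fun x => phi x * psi x).
Proof.
move=> hp; have [M M0 MP] := lip_cs_bounded hp; move: hp => [c c0 [lp sp]] lq.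
have qb x : `|x| <= c -> `|psi x| <= `|psi 0| + `|k| * c.
  move=> xc; rewrite -(subrK (psi 0) (psi x)) addrC; apply: le_trans (ler_normD _ _) _.
  rewrite lerD2l; have := lq 0 x; rewrite subr0 => h; apply: le_trans h _.
  apply: (@le_trans _ _ (`|k| * `|x|)); first by rewrite ler_wpM2r // ler_norm.
  by rewrite ler_wpM2l.
have main x y : `|x| <= c -> `|phi y * psi y - phi x * psi x| <= (M * `|k| + (`|psi 0| + `|k| * c) * c) * `|y - x|.
  move=> xc; have -> : phi y * psi y - phi x * psi x = phi y * (psi y - psi x) + psi x * (phi y - phi x) by ring.
  apply: le_trans (ler_normD _ _) _; rewrite !normrM mulrDl -!mulrA; apply: lerD.
    apply: ler_pM => //; apply: le_trans (lq _ _) _; by rewrite ler_wpM2r // ler_norm.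
  by apply: ler_pM => //; exact: qb.
apply: (@lip_csI _ (M * `|k| + (`|psi 0| + `|k| * c) * c) c) => [x y|x hx]; last by rewrite sp // mul0r.
have [xc|xc] := leP `|x| c; first exact: main.
have [yc|yc] := leP `|y| c; first by rewrite distrC (distrC y); exact: main.
rewrite !sp // !mul0r subrr normr0 mulr_ge0 //.
by rewrite addr_ge0 ?mulr_ge0 // ?addr_ge0 ?mulr_ge0 // ltW.
Qed.

Lemma lip_csZ (a : R) phi : lip_cs phi -> lip_cs (fun x => a * phi x).
Proof.
move=> hp; have -> : (fun x => a * phi x) = (fun x => phi x * a) by apply/funext => x; rewrite mulrC.
by apply: (@lip_csM _ _ 0) => // x y; rewrite subrr normr0 mul0r.
Qed.

Lemma lip_cs_comp phi (g : E -> E) (k : R) : lip_cs phi -> (forall x y, `|g y - g x| <= k * `|y - x|) ->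
  (forall x, `|x| <= k * (`|g x| + 1)) -> lip_cs (fun x => phi (g x)).
Proof.
move=> [c c0 [lp sp]] gk pk; apply: (@lip_csI _ (c * k) (k * (c + 1))) => [x y|x hx].
  by apply: le_trans (lp _ _) _; rewrite -mulrA ler_pM2l.
apply: sp; rewrite ltNge; apply/negP => h; have kx := pk x.
have [k0|k0] := leP 0 k; last by have := normr_ge0 x; have := normr_ge0 (g x); nra.
have : k * (`|g x| + 1) <= k * (c + 1) by rewrite ler_wpM2l // lerD2r.
lra.
Qed.

Lemma lip_cs_tr phi v : lip_cs phi -> lip_cs (fun x => phi (x + v)).
Proof.
move=> hp; apply: (@lip_cs_comp _ (fun x => x + v) (1 + `|v|)) => // [x y|x].
  by rewrite opprD addrACA subrr addr0 mulrDl mul1r lerDl mulr_ge0.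
have : `|x| <= `|x + v| + `|v| by rewrite -{1}(addrK v x); exact: ler_normB.
have := normr_ge0 (x + v); have := normr_ge0 v; nra.
Qed.

Lemma lip_cs0 : lip_cs (fun=> 0).
Proof. by apply: (@lip_csI _ 0 0) => // x y; rewrite subrr normr0 mul0r. Qed.

Lemma lip_cs_sum (T : Type) (s : seq T) (F : T -> E -> R) : (forall k, lip_cs (F k)) ->
  lip_cs (fun x => \sum_(k <- s) F k x).
Proof.
move=> H; elim: s => [|k s IH].
  by rewrite (_ : (fun x => _) = fun=> 0); [exact: lip_cs0|apply/funext => x; rewrite big_nil].
rewrite (_ : (fun x => _) = fun x => F k x + \sum_(j <- s) F j x); first exact: lip_csD.
by apply/funext => x; rewrite big_cons.
Qed.

Definition plateau (B : R) x := ramp (B + 1 - `|x|).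

Lemma plateau_lip_cs B : lip_cs (plateau B).
Proof.
apply: (@lip_csI _ 1 (B + 1)) => [x y|x hx]; last by rewrite /plateau ramp_eq0 //; lra.
apply: le_trans (ramp_lip _ _) _.
by rewrite opprD addrACA subrr add0r opprK addrC distrC mul1r; exact: ler_dist_dist.
Qed.

Lemma plateau1 B x : `|x| <= B -> plateau B x = 1.
Proof. by move=> h; rewrite /plateau ramp_eq1 //; lra. Qed.

Lemma plateau_ge0 B x : 0 <= plateau B x.
Proof. by case/andP: (ramp01 (B + 1 - `|x|)). Qed.

(** Integration against a multiple of Lebesgue measure, through the properties that characterise it
    on Lipschitz functions of bounded support. *)
Record inv_int (I : (E -> R) -> R) := InvInt {
  inv_intD : forall phi psi, lip_cs phi -> lip_cs psi -> I (fun x => phi x + psi x) = I phi + I psi;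
  inv_intZ : forall (a : R) phi, lip_cs phi -> I (fun x => a * phi x) = a * I phi;
  inv_int_ge0 : forall phi, lip_cs phi -> (forall x, 0 <= phi x) -> 0 <= I phi;
  inv_int_tr : forall v phi, lip_cs phi -> I (fun x => phi (x + v)) = I phi }.

Section Basic.
Variables (I : (E -> R) -> R) (hI : inv_int I).

Lemma inv_int0 : I (fun=> 0) = 0.
Proof.
transitivity (0 * I (fun=> 0)); last by rewrite mul0r.
rewrite -(inv_intZ hI); last exact: lip_cs0.
by congr I; apply/funext => x; rewrite mul0r.
Qed.

Lemma inv_intB phi psi : lip_cs phi -> lip_cs psi -> I (fun x => phi x - psi x) = I phi - I psi.
Proof.
move=> hp hq; rewrite -mulN1r -(inv_intZ hI) // -(inv_intD hI) //; last exact: lip_csZ.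
by congr I; apply/funext => x; rewrite mulN1r.
Qed.

Lemma lip_csB phi psi : lip_cs phi -> lip_cs psi -> lip_cs (fun x => phi x - psi x).
Proof.
move=> hp hq; rewrite (_ : (fun x => _) = fun x => phi x + (-1) * psi x).
  by apply: lip_csD => //; exact: lip_csZ.
by apply/funext => x; rewrite mulN1r.
Qed.

Lemma inv_int_le phi psi : lip_cs phi -> lip_cs psi -> (forall x, phi x <= psi x) -> I phi <= I psi.
Proof.
move=> hp hq h; rewrite -subr_ge0 -inv_intB //; apply: (inv_int_ge0 hI) => [|x]; last by rewrite subr_ge0.
exact: lip_csB.
Qed.

Lemma inv_int_norm phi psi : lip_cs phi -> lip_cs psi -> (forall x, `|phi x| <= psi x) -> `|I phi| <= I psi.
Proof.
move=> hp hq h; rewrite ler_norml; apply/andP; split.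
  rewrite -mulN1r -(inv_intZ hI) //; apply: inv_int_le => // [|x]; first exact: lip_csZ.
  by have := h x; rewrite ler_norml mulN1r => /andP[].
by apply: inv_int_le => // x; apply: le_trans (h x); exact: ler_norm.
Qed.

Lemma inv_int_sum (T : Type) (s : seq T) (F : T -> E -> R) : (forall k, lip_cs (F k)) ->
  I (fun x => \sum_(k <- s) F k x) = \sum_(k <- s) I (F k).
Proof.
move=> H; elim: s => [|k s IH].
  by rewrite big_nil -[RHS]inv_int0; congr I; apply/funext => x; rewrite big_nil.
rewrite big_cons -IH -(inv_intD hI) //; last exact: lip_cs_sum.
by congr I; apply/funext => x; rewrite big_cons.
Qed.

End Basic.

Definition tent_prod (h : R) x := \prod_i tent (x 0 i / h).

Lemma prodB_le (T : Type) (s : seq T) (F G : T -> R) : (forall i, 0 <= F i <= 1) -> (forall i, 0 <= G i <= 1) ->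
  `|\prod_(i <- s) F i - \prod_(i <- s) G i| <= \sum_(i <- s) `|F i - G i|.
Proof.
move=> hF hG; elim: s => [|i s IH]; first by rewrite !big_nil subrr normr0.
rewrite !big_cons; set P := \prod_(j <- s) F j in IH *; set Q := \prod_(j <- s) G j in IH *.
have P1 : 0 <= P <= 1.
  rewrite /P; elim: (s) => [|j t IHt]; first by rewrite big_nil ler01 lexx.
  by rewrite big_cons; case/andP: IHt => a b; case/andP: (hF j) => a' b'; rewrite mulr_ge0 ?mulr_ile1.
have -> : F i * P - G i * Q = (F i - G i) * P + G i * (P - Q) by ring.
apply: le_trans (ler_normD _ _) _; rewrite !normrM; apply: lerD.
  by apply: ler_piMr => //; rewrite ger0_norm; case/andP: P1.
apply: le_trans IH; apply: ler_piMl => //; rewrite ger0_norm; by case/andP: (hG i).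
Qed.

Lemma tent_prod_ge0 h x : 0 <= tent_prod h x.
Proof. by apply: prodr_ge0 => i _; case/andP: (tent01 (x 0 i / h)). Qed.

Lemma tent_prod_out h x : 0 < h -> h < `|x| -> tent_prod h x = 0.
Proof.
move=> h0 hx; have [i hi] : exists i, h <= `|x 0 i|.
  apply: contrapT => N; move: hx; apply/negP; rewrite -leNgt; apply: norm_rVP; first exact: ltW.
  by move=> i; rewrite leNgt; apply/negP => k; apply: N; exists i; exact: ltW.
rewrite /tent_prod (bigD1 i) //= tent_out ?mul0r // normrM normfV (gtr0_norm h0).
by rewrite ler_pdivlMr // mul1r.
Qed.

Lemma tent_prod_lip h x y : 0 < h -> `|tent_prod h y - tent_prod h x| <= m%:R * (2 / h) * `|y - x|.
Proof.
move=> h0; apply: le_trans (prodB_le _ _ _) _; [by move=> i; exact: tent01|by move=> i; exact: tent01|].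
have -> : m%:R * (2 / h) * `|y - x| = \sum_(i < m) (2 / h * `|y - x|).
  by rewrite sumr_const card_ord -[RHS]mulr_natl -mulrA.
apply: ler_sum => i _; apply: le_trans (tent_lip _ _) _.
rewrite -mulrBl normrM normfV (gtr0_norm h0) mulrA mulrAC; apply: ler_wpM2l; last exact: coordB_le.
by rewrite divr_ge0 // ltW.
Qed.

Lemma tent_prod_lip_cs h : 0 < h -> lip_cs (tent_prod h).
Proof.
move=> h0; apply: (@lip_csI _ (m%:R * (2 / h)) h) => [x y|x]; first exact: tent_prod_lip.
exact: tent_prod_out.
Qed.

Definition grid_pt (h : R) (N : nat) (k : {ffun 'I_m -> 'I_N.*2.+1}) : E :=
  \row_i (h * ((k i)%:R - N%:R)).

Lemma tent_partition (h : R) (N : nat) x : 0 < h ->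
  (0 <= \sum_(k : {ffun 'I_m -> 'I_N.*2.+1}) tent_prod h (x - grid_pt h k) <= 1) /\
  (`|x| <= h * N%:R -> \sum_(k : {ffun 'I_m -> 'I_N.*2.+1}) tent_prod h (x - grid_pt h k) = 1).
Proof.
move=> h0; have -> : \sum_(k : {ffun 'I_m -> 'I_N.*2.+1}) tent_prod h (x - grid_pt h k) =
    \prod_(i < m) (ramp (x 0 i / h + N%:R + 1) - ramp (x 0 i / h - N%:R)).
  under [RHS]eq_bigr => i _ do rewrite -tent_sum.
  rewrite bigA_distr_bigA; apply: eq_bigr => k _; apply: eq_bigr => i _; congr tent.
  rewrite !mxE; move: (k i)%:R (N%:R : R) => a b; field; exact: lt0r_neq0.
split.
  apply/andP; split.
    apply: prodr_ge0 => i _; rewrite subr_ge0 ramp_homo //; have := ler0n R N; lra.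
  apply: prodr_ile1 => i _; rewrite subr_ge0 ramp_homo /=; last by have := ler0n R N; lra.
  by have := ramp01 (x 0 i / h + N%:R + 1); have := ramp01 (x 0 i / h - N%:R); lra.
move=> hx; apply: big1 => i _.
have : `|x 0 i / h| <= N%:R.
  rewrite normrM normfV (gtr0_norm h0) ler_pdivrMr // mulrC; apply: le_trans hx; exact: coord_le.
rewrite ler_norml => /andP[a b]; rewrite ramp_eq1 ?ramp_eq0 ?subr0 //; lra.
Qed.

Lemma tent_interp phi (c h : R) (N : nat) x : 0 < c ->
  (forall x y, `|phi y - phi x| <= c * `|y - x|) -> (forall x, c < `|x| -> phi x = 0) ->
  0 < h <= 1 -> c <= h * N%:R ->
  `|phi x - \sum_(k : {ffun 'I_m -> 'I_N.*2.+1}) phi (grid_pt h k) * tent_prod h (x - grid_pt h k)| <=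
  c * h * plateau (c + 1) x.
Proof.
move=> c0 lp sp /andP[h0 h1] hN.
have [W01 W1] := @tent_partition h N x h0.
have -> : phi x - \sum_(k : {ffun 'I_m -> 'I_N.*2.+1}) phi (grid_pt h k) * tent_prod h (x - grid_pt h k) =
    \sum_(k : {ffun 'I_m -> 'I_N.*2.+1}) (phi x - phi (grid_pt h k)) * tent_prod h (x - grid_pt h k).
  under [RHS]eq_bigr => k _ do rewrite mulrBl.
  rewrite sumrB -mulr_sumr; congr (_ - _).
  have [xc|xc] := leP `|x| c; first by rewrite W1 ?mulr1 //; exact: le_trans hN.
  by rewrite sp // mul0r.
apply: le_trans (ler_norm_sum _ _ _) _.
apply: (@le_trans _ _ (\sum_(k : {ffun 'I_m -> 'I_N.*2.+1}) (c * h * plateau (c + 1) x) * tent_prod h (x - grid_pt h k))); last first.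
  rewrite -mulr_sumr; apply: ler_piMr; last by case/andP: W01.
  by rewrite mulr_ge0 ?plateau_ge0 // mulr_ge0 // ltW.
apply: ler_sum => k _; rewrite normrM (ger0_norm (tent_prod_ge0 _ _)).
have [xk|xk] := ltP h `|x - grid_pt h k|; first by rewrite tent_prod_out // !mulr0.
apply: ler_wpM2r; first exact: tent_prod_ge0.
have [xc|xc] := leP `|x| (c + 1).
  rewrite plateau1 // mulr1 distrC; apply: le_trans (lp _ _) _.
  by rewrite distrC ler_pM2l.
rewrite !sp ?subrr ?normr0 ?mulr_ge0 ?plateau_ge0 ?(ltW c0) ?(ltW h0) //; last by lra.
have : `|x| <= `|x - grid_pt h k| + `|grid_pt h k| by rewrite -{1}(subrK (grid_pt h k) x) ler_normD.
lra.
Qed.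

(** The function is interpolated by a partition of unity into translated tents. Invariance gives all
    of them the same integral, which leaves a Riemann sum times [I (tent_prod h)]. *)
Lemma riemann_tent (I : (E -> R) -> R) phi (c h : R) (N : nat) : inv_int I -> 0 < c ->
  (forall x y, `|phi y - phi x| <= c * `|y - x|) -> (forall x, c < `|x| -> phi x = 0) ->
  0 < h <= 1 -> c <= h * N%:R ->
  `|I phi - I (tent_prod h) * \sum_(k : {ffun 'I_m -> 'I_N.*2.+1}) phi (grid_pt h k)| <= c * h * I (plateau (c + 1)).
Proof.
move=> hI c0 lp sp /andP[h0 h1] hN; have hp : lip_cs phi by exact: lip_csI lp sp.
have ht k : lip_cs (fun x => phi (grid_pt h k) * tent_prod h (x - @grid_pt h N k)).
  by apply: lip_csZ; apply: lip_cs_tr; exact: tent_prod_lip_cs.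
have -> : I (tent_prod h) * \sum_(k : {ffun 'I_m -> 'I_N.*2.+1}) phi (grid_pt h k) =
    I (fun x => \sum_(k : {ffun 'I_m -> 'I_N.*2.+1}) phi (grid_pt h k) * tent_prod h (x - grid_pt h k)).
  rewrite inv_int_sum // mulr_sumr; apply: eq_bigr => k _; rewrite (inv_intZ hI).
    by rewrite (inv_int_tr hI) 1?mulrC //; exact: tent_prod_lip_cs.
  by apply: lip_cs_tr; exact: tent_prod_lip_cs.
rewrite -inv_intB //; last exact: lip_cs_sum.
rewrite -(inv_intZ hI); last exact: plateau_lip_cs.
apply: inv_int_norm => //; first by apply: lip_csB => //; exact: lip_cs_sum.
  by apply: lip_csZ; exact: plateau_lip_cs.
move=> x; by apply: tent_interp; rewrite ?h0.
Qed.

Lemma small_eq0 (x D h0 : R) : 0 < h0 -> (forall h, 0 < h <= h0 -> `|x| <= D * h) -> x = 0.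
Proof.
move=> h00 H; apply/eqP; rewrite -normr_eq0; apply/eqP/le_anti; rewrite normr_ge0 andbT leNgt.
apply/negP => x0; have D1 : 0 < `|D| + 1 by rewrite ltr_wpDl.
pose h := Num.min h0 (`|x| / 2 / (`|D| + 1)).
have hp : 0 < h by rewrite lt_min h00 !divr_gt0.
have := H h; rewrite hp /h ge_min lexx => /(_ isT); rewrite -/h => xh.
have : (`|D| + 1) * h <= `|x| / 2 by rewrite mulrC -ler_pdivlMr // /h ge_min lexx orbT.
have : D * h <= `|D| * h by rewrite ler_wpM2r ?ler_norm // ltW.
lra.
Qed.

(* Both functionals are close to the same Riemann sums, up to normalisation by a small tent. *)
Lemma inv_int_unique (I J : (E -> R) -> R) phi psi : inv_int I -> inv_int J -> lip_cs phi -> lip_cs psi ->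
  I phi * J psi = J phi * I psi.
Proof.
move=> hI hJ [c c0 [lp sp]] [d d0 [lq sq]].
pose e := c + d; have e0 : 0 < e by rewrite addr_gt0.
have lp' x y : `|phi y - phi x| <= e * `|y - x|.
  by apply: le_trans (lp x y) _; rewrite ler_wpM2r // /e lerDl ltW.
have lq' x y : `|psi y - psi x| <= e * `|y - x|.
  by apply: le_trans (lq x y) _; rewrite ler_wpM2r // /e lerDr ltW.
have sp' x : e < `|x| -> phi x = 0 by move=> h; apply: sp; rewrite /e in h; lra.
have sq' x : e < `|x| -> psi x = 0 by move=> h; apply: sq; rewrite /e in h; lra.
pose C := e * (I (plateau (e + 1)) + J (plateau (e + 1))).
have pI : 0 <= I (plateau (e + 1)) by apply: (inv_int_ge0 hI); [exact: plateau_lip_cs|exact: plateau_ge0].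
have pJ : 0 <= J (plateau (e + 1)) by apply: (inv_int_ge0 hJ); [exact: plateau_lip_cs|exact: plateau_ge0].
have C0 : 0 <= C by rewrite mulr_ge0 ?addr_ge0 // ltW.
apply/eqP; rewrite -subr_eq0; apply/eqP.
apply: (@small_eq0 _ (C * (`|I phi| + `|J psi| + `|J phi| + `|I psi| + 2 * C)) 1) => // h /andP[h0 h1].
pose N := (Num.trunc (e / h)).+1.
have hN : e <= h * N%:R by rewrite mulrC -ler_pdivrMr // ltW // truncnS_gt.
have hh : 0 < h <= 1 by rewrite h0.
have CI : e * h * I (plateau (e + 1)) <= C * h.
  rewrite /C mulrAC; apply: ler_wpM2r; [exact: ltW|by rewrite ler_pM2l // lerDl].
have CJ : e * h * J (plateau (e + 1)) <= C * h.
  rewrite /C mulrAC; apply: ler_wpM2r; [exact: ltW|by rewrite ler_pM2l // lerDr].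
have h1' := le_trans (@riemann_tent I phi e h N hI e0 lp' sp' hh hN) CI.
have h2' := le_trans (@riemann_tent J phi e h N hJ e0 lp' sp' hh hN) CJ.
have h3' := le_trans (@riemann_tent I psi e h N hI e0 lq' sq' hh hN) CI.
have h4' := le_trans (@riemann_tent J psi e h N hJ e0 lq' sq' hh hN) CJ.
have Ch : C * h <= C by rewrite ler_piMr.
move: h1' h2' h3' h4'; move: (\sum_k phi _) (\sum_k psi _) (I (tent_prod h)) (J (tent_prod h)) => a b t u.
move: (I phi) (J phi) (I psi) (J psi) => A1 A2 B1 B2 k1 k2 k3 k4.
have step (p p' q q' : R) : `|p - p'| <= C * h -> `|q - q'| <= C * h -> `|p * q - p' * q'| <= C * h * (`|p| + `|q| + C).
  move=> w1 w2; have -> : p * q - p' * q' = p * (q - q') + (q' - q) * (p - p') + q * (p - p') by ring.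
  apply: le_trans (ler_normD _ _) _; apply: le_trans (lerD (ler_normD _ _) (lexx _)) _; rewrite !normrM.
  have s1 : `|p| * `|q - q'| <= `|p| * (C * h) by rewrite ler_wpM2l.
  have s2 : `|q| * `|p - p'| <= `|q| * (C * h) by rewrite ler_wpM2l.
  have s3 : `|q' - q| * `|p - p'| <= C * (C * h).
    by apply: ler_pM => //; rewrite distrC; exact: le_trans Ch.
  lra.
have := step _ _ _ _ k1 k4; have := step _ _ _ _ k2 k3.
have -> : A1 * B2 - A2 * B1 = (A1 * B2 - t * a * (u * b)) - (A2 * B1 - u * a * (t * b)) by ring.
move=> s1 s2; apply: le_trans (ler_normB _ _) _; lra.
Qed.

End InvariantIntegral.

Section GridCount.
Variable R : realType.

Lemma count_near_le (M : nat) (c B : R) : 0 <= B -> \sum_(j < M) (`|j%:R - c| <= B)%R%:R <= 2 * B + 2.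
Proof.
move=> B0; pose S k : R := \sum_(j < k) (`|j%:R - c| <= B)%R%:R.
suff H k : S k <= 2 * B + 2 /\ (S k <= k%:R - c + B + 1 \/ S k = 0) by case: (H M).
elim: k => [|k [IH1 IH2]]; first by rewrite /S big_ord0; split; [lra|right].
have -> : S k.+1 = S k + (`|k%:R - c| <= B)%R%:R by rewrite /S big_ord_recr.
have e : k.+1%:R = k%:R + 1 :> R by rewrite -natr1.
have [h|h] := boolP (`|k%:R - c| <= B) => /=.
  move: h; rewrite ler_norml => /andP[h1 h2]; case: IH2 => IH2; rewrite e.
    by split; [|left]; lra.
  by rewrite IH2; split; [|left]; lra.
by rewrite addr0 e; split=> //; case: IH2 => IH2; [left; lra|right].
Qed.

Lemma count_near_ge (M c : nat) (B : R) : 0 <= B -> (M%:R - c%:R <= B)%R ->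
  M%:R - c%:R <= \sum_(j < M) (`|j%:R - c%:R| <= B)%R%:R :> R.
Proof.
move=> B0; pose S k : R := \sum_(j < k) (`|j%:R - c%:R| <= B)%R%:R.
suff H k : k%:R - c%:R <= B -> 0 <= S k /\ k%:R - c%:R <= S k by move=> h; case: (H M h).
elim: k => [|k IH].
  by rewrite /S big_ord0 sub0r oppr_le0 ler0n.
have e : k.+1%:R = k%:R + 1 :> R by rewrite -natr1.
rewrite e => h; have [IH1 IH2] : 0 <= S k /\ k%:R - c%:R <= S k by apply: IH; lra.
have -> : S k.+1 = S k + (`|k%:R - c%:R| <= B)%R%:R by rewrite /S big_ord_recr.
have [kc|ck] := ltnP k c.
  have kc1 : k%:R + 1 <= c%:R :> R by rewrite natr1 ler_nat.
  have := ler0n R ((`|k%:R - c%:R| <= B)%R); lra.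
have ck' : c%:R <= k%:R :> R by rewrite ler_nat.
by rewrite ger0_norm ?subr_ge0 // (_ : k%:R - c%:R <= B) /=; lra.
Qed.

Lemma grid_count (m N : nat) (h B : R) (x : 'rV[R]_m) : 0 < h -> 0 <= B ->
  \sum_(k : {ffun 'I_m -> 'I_N.*2.+1}) (`|x - grid_pt h k| <= B)%R%:R <= (2 * (B / h) + 2) ^+ m.
Proof.
move=> h0 B0; have Bh : 0 <= B / h by rewrite divr_ge0 // ltW.
apply: (@le_trans _ _ (\sum_(k : {ffun 'I_m -> 'I_N.*2.+1}) \prod_i (`|(k i)%:R - (x 0 i / h + N%:R)| <= B / h)%R%:R)).
  apply: ler_sum => k _; have [H|H] := boolP (`|x - grid_pt h k| <= B); last by apply: prodr_ge0 => i _; rewrite ler0n.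
  rewrite big1 // => i _; rewrite (_ : `|_| <= B / h) //.
  rewrite ler_pdivlMr // -{2}(gtr0_norm h0) -normrM; apply: le_trans H.
  have := coord_le (x - grid_pt h k) i; rewrite !mxE; apply: le_trans.
  by rewrite -[leRHS]normrN le_eqVlt; apply/orP; left; apply/eqP; congr `|_|; field; exact: lt0r_neq0.
rewrite -(bigA_distr_bigA (fun (i : 'I_m) (j : 'I_N.*2.+1) => (`|j%:R - (x 0 i / h + N%:R)| <= B / h)%R%:R)).
have -> : (2 * (B / h) + 2) ^+ m = \prod_(i < m) (2 * (B / h) + 2) by rewrite prodr_const card_ord.
apply: ler_prod => i _; rewrite count_near_le // andbT; exact: sumr_ge0.
Qed.

Lemma grid_scale (m : nat) (h B : R) : 0 < h <= 1 -> 0 <= B ->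
  h ^+ m * (2 * (B / h) + 2) ^+ m <= (2 * B + 2) ^+ m.
Proof.
move=> /andP[h0 h1] B0; rewrite -exprMn; apply: lerXn2r.
- by rewrite nnegrE mulr_ge0 ?addr_ge0 ?mulr_ge0 ?invr_ge0 // ltW.
- by rewrite nnegrE addr_ge0 ?mulr_ge0.
- have -> : h * (2 * (B / h) + 2) = 2 * B + 2 * h by field; exact: lt0r_neq0.
  lra.
Qed.

End GridCount.

(** * Existence of an invariant integral *)

Section Existence.
Variables (R : realType) (m : nat).
Local Notation E := 'rV[R]_m.
Implicit Types (phi psi : E -> R) (x y v : E).

(** A grid of spacing [1 / (q + 1)] on the cube of half width [q + 1], so that it becomes finer and
    exhausts the space at the same time. *)
Definition grid_mean (q : nat) phi : R :=
  q.+1%:R^-1 ^+ m * \sum_(k : {ffun 'I_m -> 'I_(q.+1 ^ 2).*2.+1}) phi (grid_pt q.+1%:R^-1 k).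

Lemma grid_mean_le q phi (B M : R) : 0 <= B -> 0 <= M -> (forall x, `|phi x| <= M) ->
  (forall x, B < `|x| -> phi x = 0) -> `|grid_mean q phi| <= M * (2 * B + 2) ^+ m.
Proof.
move=> B0 M0 hM hB; set h : R := q.+1%:R^-1; have h0 : 0 < h by rewrite invr_gt0.
have h1 : h <= 1 by rewrite invf_le1 // ler1n.
rewrite /grid_mean -/h normrM ger0_norm ?exprn_ge0 ?(ltW h0) //.
have s1 : `|\sum_(k : {ffun 'I_m -> 'I_(q.+1 ^ 2).*2.+1}) phi (grid_pt h k)| <= M * (2 * (B / h) + 2) ^+ m.
  apply: le_trans (ler_norm_sum _ _ _) _.
  apply: le_trans (ler_wpM2l M0 (@grid_count R m (q.+1 ^ 2) h B 0 h0 B0)); rewrite mulr_sumr.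
  apply: ler_sum => k _; rewrite sub0r normrN; have [H|H] := boolP (`|grid_pt h k| <= B); first by rewrite mulr1.
  by rewrite mulr0 hB ?normr0 // ltNge.
apply: le_trans (ler_wpM2l (exprn_ge0 m (ltW h0)) s1) _.
by rewrite mulrCA; apply: ler_wpM2l => //; apply: grid_scale; rewrite ?h0.
Qed.

Lemma grid_mean_plateau q : 1 <= grid_mean q (plateau 1).
Proof.
set h : R := q.+1%:R^-1; have h0 : 0 < h by rewrite invr_gt0.
rewrite /grid_mean -/h mulrC -ler_pdivrMr ?exprn_gt0 // mul1r -exprVn invrK.
apply: (@le_trans _ _ (\sum_(k : {ffun 'I_m -> 'I_(q.+1 ^ 2).*2.+1}) \prod_i (`|(k i)%:R - (q.+1 ^ 2)%:R| <= q.+1%:R :> R)%R%:R)); last first.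
  apply: ler_sum => k _; have [H|H] := pselect (forall i, `|(k i)%:R - (q.+1 ^ 2)%:R| <= q.+1%:R :> R).
    rewrite big1 => [|i _]; last by rewrite H.
    rewrite plateau1 //; apply: norm_rVP => // i.
    by rewrite !mxE normrM (gtr0_norm h0) mulrC ler_pdivrMr // mul1r.
  have [i Hi] : exists i, ~ `|(k i)%:R - (q.+1 ^ 2)%:R| <= q.+1%:R :> R by apply: contrapT => N; apply: H => i; apply: contrapT => N'; apply: N; exists i.
  by rewrite (bigD1 i) //= (negbTE (introN idP Hi)) mul0r plateau_ge0.
rewrite -(bigA_distr_bigA (fun (i : 'I_m) (j : 'I_(q.+1 ^ 2).*2.+1) => (`|j%:R - (q.+1 ^ 2)%:R| <= q.+1%:R :> R)%R%:R)).
have -> : q.+1%:R ^+ m = \prod_(i < m) q.+1%:R :> R by rewrite prodr_const card_ord.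
apply: ler_prod => i _; rewrite ler0n /=.
pose M := (q.+1 ^ 2 + q.+1)%N; have MM : (M <= (q.+1 ^ 2).*2.+1)%N.
  by rewrite /M -addnn -addnS leq_add2l; apply: leqW; exact: (@leq_pexp2l q.+1 1 2).
have := @count_near_ge R M (q.+1 ^ 2) q.+1%:R (ler0n _ _).
rewrite {1 2}/M natrD [_ + q.+1%:R - _]addrAC subrr add0r => /(_ (lexx _)) H.
apply: le_trans H _.
rewrite -(big_mkord xpredT (fun j => (`|j%:R - (q.+1 ^ 2)%:R| <= q.+1%:R :> R)%R%:R)).
rewrite -(big_mkord xpredT (fun j => (`|j%:R - (q.+1 ^ 2)%:R| <= q.+1%:R :> R)%R%:R)).
by rewrite [leRHS](big_cat_nat _ (n := M)) //= lerDl sumr_ge0.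
Qed.

(** Reduction modulo the number of indices makes the shift a bijection; the indices that wrap around
    belong to points outside of the support, before and after the shift. *)
Lemma grid_sum_shift (q : nat) phi (c : R) (s : 'I_m -> nat) : 0 < c ->
  (forall x, c < `|x| -> phi x = 0) -> (forall i, (s i)%:R / q.+1%:R + c < q.+1%:R) ->
  \sum_(k : {ffun 'I_m -> 'I_(q.+1 ^ 2).*2.+1}) phi (grid_pt q.+1%:R^-1 k + \row_i ((s i)%:R / q.+1%:R)) =
  \sum_(k : {ffun 'I_m -> 'I_(q.+1 ^ 2).*2.+1}) phi (grid_pt q.+1%:R^-1 k).
Proof.
move=> c0 hc hs; set h : R := q.+1%:R^-1; set M := (q.+1 ^ 2).*2.
have Q0 : 0 < q.+1%:R :> R by rewrite ltr0n.
have h0 : 0 < h by rewrite invr_gt0.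
have hQ : h * (q.+1 ^ 2)%:R = q.+1%:R by rewrite /h natrX expr2 mulKf // gt_eqF.
have sM i : (s i < M.+1)%N.
  rewrite ltnS -(ler_nat R) /M -addnn natrD -subr_ge0; have := hs i; rewrite -ltrBrDr ltr_pdivrMr // => k.
  have : (q.+1%:R - c) * q.+1%:R <= (q.+1 ^ 2)%:R by rewrite natrX expr2 ler_pM2r //; lra.
  have := ler0n R (q.+1 ^ 2); lra.
pose T (k : {ffun 'I_m -> 'I_M.+1}) : {ffun 'I_m -> 'I_M.+1} := [ffun i => k i + inord (s i)].
have Tinj : injective T.
  move=> k k' /ffunP e; apply/ffunP => i; have := e i; rewrite !ffunE; exact: addIr.
rewrite [RHS](reindex_inj Tinj); apply: eq_bigr => k _.
have val_T i : T k i = ((k i + s i) %% M.+1)%N :> nat by rewrite ffunE /= inordK.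
have [H|H] := pselect (forall i, (k i + s i < M.+1)%N).
  congr phi; apply/rowP => i; rewrite !mxE val_T modn_small // natrD; ring.
have [i Hi] : exists i, (M.+1 <= k i + s i)%N.
  by apply: contrapT => N; apply: H => i; rewrite ltnNge; apply/negP => l; apply: N; exists i.
have kiM : (k i <= M)%N by rewrite -ltnS.
have si := hs i; have Mr : (M%:R : R) = (q.+1 ^ 2)%:R + (q.+1 ^ 2)%:R by rewrite /M -addnn natrD.
have big x (a : R) : x 0 i = a -> c < `|a| -> phi x = 0.
  by move=> <- ca; apply: hc; apply: lt_le_trans ca _; exact: coord_le.
rewrite (@big _ (h * ((k i)%:R + (s i)%:R - (q.+1 ^ 2)%:R))); first last.
- apply: lt_le_trans (ler_norm _).
  have : M.+1%:R <= (k i)%:R + (s i)%:R :> R by rewrite -natrD ler_nat.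
  rewrite -natr1 Mr => l; apply: (@lt_le_trans _ _ q.+1%:R); last by rewrite -hQ ler_pM2l //; lra.
  by apply: le_lt_trans si; rewrite lerDr divr_ge0.
- by rewrite !mxE; ring.
apply/esym/(@big _ (h * (((k i + s i) %% M.+1)%N%:R - (q.+1 ^ 2)%:R))); first by rewrite mxE val_T.
rewrite -normrN; apply: lt_le_trans (ler_norm _).
have : (((k i + s i) %% M.+1)%N%:R <= (s i)%:R :> R).
  rewrite ler_nat -(subnK Hi) modnDr modn_small; last first.
    by rewrite ltn_subLR // -addSn; apply: leq_add => //; exact: ltnW.
  by rewrite leq_subLR leq_add2r; exact: leqW.
move=> l; have : h * ((k i + s i) %% M.+1)%N%:R <= (s i)%:R / q.+1%:R by rewrite [leRHS]mulrC ler_pM2l.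
rewrite mulrBr hQ => hk; move: si hk; move: ((s i)%:R / q.+1%:R) (h * _) => a b ? ?; lra.
Qed.

(** The vector is rounded down to the grid, for whose translations the sums are invariant. Rounding
    changes the mean by [O(1/q)]. *)
Lemma grid_mean_tr phi v : lip_cs phi -> (forall i, 0 <= v 0 i) -> exists2 C : R, 0 <= C &
  \forall q \near \oo, `|grid_mean q (fun x => phi (x + v)) - grid_mean q phi| <= C * q.+1%:R^-1.
Proof.
move=> [c c0 [lp sp]] v0; pose B := c + `|v| + 1.
have B0 : 0 <= B by rewrite /B !addr_ge0 // ltW.
exists (c * (2 * B + 2) ^+ m); first by rewrite mulr_ge0 ?(ltW c0) // exprn_ge0 // addr_ge0 ?mulr_ge0.
exists (Num.trunc B).+1 => // q /= Hq; have Q0 : 0 < q.+1%:R :> R by rewrite ltr0n.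
set h : R := q.+1%:R^-1; have h0 : 0 < h by rewrite invr_gt0.
have h1 : h <= 1 by rewrite invf_le1 // ler1n.
have Bq : B < q.+1%:R.
  by apply: lt_le_trans (truncnS_gt B) _; rewrite ler_nat; exact: leqW.
pose s i := Num.trunc (v 0 i * q.+1%:R).
have sP i : (s i)%:R / q.+1%:R <= v 0 i < (s i)%:R / q.+1%:R + h.
  have vq : 0 <= v 0 i * q.+1%:R by rewrite mulr_ge0.
  rewrite ler_pdivrMr // truncn_le vq /=.
  have -> : (s i)%:R / q.+1%:R + h = (s i).+1%:R / q.+1%:R by rewrite -[in RHS]natr1 mulrDl mul1r.
  by rewrite ltr_pdivlMr // truncnS_gt.
pose w : E := \row_i ((s i)%:R / q.+1%:R).
have s0 i : 0 <= (s i)%:R / q.+1%:R :> R by rewrite divr_ge0.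
have vw : `|v - w| <= h.
  apply: norm_rVP => [|i]; first exact: ltW.
  by have /andP[a b] := sP i; rewrite !mxE ger0_norm ?subr_ge0 // lerBlDl ltW.
have wv : `|w| <= `|v|.
  apply: norm_rVP => // i; rewrite mxE ger0_norm //; have /andP[a b] := sP i.
  by apply: le_trans a _; apply: le_trans (ler_norm _) (coord_le _ _).
rewrite /grid_mean -/h -mulrBr.
rewrite -(@grid_sum_shift q phi c s c0 sp); last first.
  move=> i; have /andP[a _] := sP i; apply: le_lt_trans Bq; rewrite /B.
  apply: le_trans (lerD a (lexx c)) _; clear a; have := le_trans (ler_norm _) (coord_le v i); lra.
rewrite -/h -/w -sumrB normrM ger0_norm ?exprn_ge0 ?(ltW h0) //.
apply: (@le_trans _ _ (h ^+ m * (c * h * \sum_(k : {ffun 'I_m -> 'I_(q.+1 ^ 2).*2.+1}) (`|0 - grid_pt h k| <= B)%R%:R))).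
  apply: ler_wpM2l; first by rewrite exprn_ge0 // ltW.
  apply: le_trans (ler_norm_sum _ _ _) _; rewrite mulr_sumr; apply: ler_sum => k _.
  rewrite sub0r normrN; have [H|H] := boolP (`|grid_pt h k| <= B).
    rewrite mulr1; apply: le_trans (lp _ _) _; rewrite ler_pM2l //.
    by rewrite opprD addrACA subrr add0r.
  have pB : B < `|grid_pt h k| by rewrite ltNge.
  have e1 (u : E) : `|u| <= `|v| -> phi (grid_pt h k + u) = 0.
    move=> uv; apply: sp; have : `|grid_pt h k| <= `|grid_pt h k + u| + `|u|.
      by rewrite -{1}(addrK u (grid_pt h k)); exact: ler_normB.
    by rewrite /B in pB; lra.
  by rewrite !e1 // subrr normr0 mulr0.
have ch : 0 <= c * h by rewrite mulr_ge0 // ltW.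
rewrite mulrCA [leRHS]mulrAC; apply: ler_wpM2l => //.
apply: le_trans (ler_wpM2l _ (@grid_count R m (q.+1 ^ 2) h B 0 h0 B0)) _; first by rewrite exprn_ge0 // ltW.
by apply: grid_scale; rewrite ?h0.
Qed.

(** The means of a function are bounded and converge along a free ultrafilter of indices. An
    arbitrary translation is a nonnegative one followed by the inverse of another. *)
Theorem inv_int_exists : exists2 I : (E -> R) -> R, inv_int I & 1 <= I (plateau 1).
Proof.
have [G [GU sG]] := @ultraFilterLemma nat \oo _.
have GP : ProperFilter G by exact: ultra_proper.
have cvgG phi : lip_cs phi -> exists l : R, (fun q => grid_mean q phi) @ G --> l.
  move=> hp; have [M M0 MP] := lip_cs_bounded hp; have [c c0 [lp sp]] := hp.
  pose D := M * (2 * c + 2) ^+ m.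
  have cD : compact `[- D, D]%classic by exact: segment_compact.
  have [l [lD lc]] : `[- D, D]%classic `&` cluster ((fun q => grid_mean q phi) @ G) !=set0.
    apply: cD; have H : G [set q | `[- D, D]%classic (grid_mean q phi)].
      by apply: filterS filterT => q _ /=; rewrite in_itv /= -ler_norml; apply: grid_mean_le => //; exact: ltW.
    exact: H.
  exists l => A nA; apply: contrapT => nG.
  have [] := in_ultra_setVsetC ((fun q => grid_mean q phi) @^-1` A) GU => // GA.
  by have [a [b1 b2]] := lc (~` A) A GA nA; exact: b1 b2.
pose I phi := lim ((fun q => grid_mean q phi) @ G).
have cvI phi : lip_cs phi -> (fun q => grid_mean q phi) @ G --> I phi.
  by move=> /cvgG [l lP]; apply/cvg_ex; exists l.
exists I; last first.
  have := cvI _ (@plateau_lip_cs R m 1) => cv; apply: (cvgr_to_ge cv).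
  by apply: filterS filterT => q _; exact: grid_mean_plateau.
have trp v phi : (forall i, 0 <= v 0 i) -> lip_cs phi -> I (fun x => phi (x + v)) = I phi.
  move=> v0 hp; have [C C0 HC] := grid_mean_tr hp v0.
  have cv1 := cvI _ hp; have cv2 := cvI _ (@lip_cs_tr R m phi v hp).
  have cv3 : (fun q => grid_mean q (fun x => phi (x + v)) - grid_mean q phi) @ G --> (0 : R).
    apply/cvgrPdist_le => e e0; have HG : G [set q | `|grid_mean q (fun x => phi (x + v)) - grid_mean q phi| <= C * q.+1%:R^-1] by exact: sG.
    have He : G [set q : nat | C * q.+1%:R^-1 <= e].
      apply: sG; exists (Num.trunc (C / e)).+1 => // q /= hq.
      rewrite ler_pdivrMr ?ltr0n // mulrC -ler_pdivrMr //; apply: ltW.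
      by apply: lt_le_trans (truncnS_gt _) _; rewrite ler_nat; exact: leqW.
    by apply: filterS2 HG He => q /= a b; rewrite sub0r normrN; exact: le_trans b.
  have : I (fun x => phi (x + v)) - I phi = 0 by apply: (cvg_unique (@Rhausdorff R) (cvgB cv2 cv1) cv3).
  by move/eqP; rewrite subr_eq0 => /eqP.
split.
- move=> phi psi hp hq; apply: (cvg_lim (@Rhausdorff R)).
  rewrite (_ : (fun q => _) = (fun q => grid_mean q phi) \+ (fun q => grid_mean q psi)); first exact: cvgD (cvI _ hp) (cvI _ hq).
  by apply/funext => q /=; rewrite /grid_mean big_split mulrDr.
- move=> a phi hp; apply: (cvg_lim (@Rhausdorff R)).
  rewrite (_ : (fun q => _) = (fun q => a * grid_mean q phi)); first exact: cvgMr (cvI _ hp).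
  by apply/funext => q /=; rewrite /grid_mean -mulr_sumr mulrCA.
- move=> phi hp h0; apply: (cvgr_to_ge (cvI _ hp)).
  apply: filterS filterT => q _; rewrite /grid_mean mulr_ge0 ?exprn_ge0 ?invr_ge0 //.
  by apply: sumr_ge0 => k _.
- move=> v phi hp; pose vp : E := \row_i Num.max 0 (v 0 i); pose vm : E := \row_i Num.max 0 (- v 0 i).
  have vE : v = vp - vm.
    apply/rowP => i; rewrite !mxE; have [h|h] := leP 0 (v 0 i).
      by rewrite (max_idPl (_ : - v 0 i <= 0)) ?oppr_le0 // subr0.
    by rewrite (max_idPr (_ : 0 <= - v 0 i)) ?oppr_ge0 ?(ltW h) // sub0r opprK.
  have hm : lip_cs (fun x => phi (x - vm)) by exact: lip_cs_tr.
  have p1 i : 0 <= vp 0 i by rewrite mxE le_max lexx.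
  have p2 i : 0 <= vm 0 i by rewrite mxE le_max lexx.
  have := trp vm _ p2 hm; have := trp vp _ p1 hm.
  rewrite (_ : (fun x => phi (x + vp - vm)) = fun x => phi (x + v)); last by apply/funext => x; rewrite vE addrA.
  rewrite (_ : (fun x => phi (x + vm - vm)) = phi); last by apply/funext => x; rewrite addrK.
  by move=> -> ->.
Qed.

End Existence.

Lemma lup_exists (R : realType) (m : nat) (A : 'M[R]_m) : exists (s : 'S_m) (L U : 'M[R]_m),
  [/\ perm_mx s *m A = L *m U, forall i j : 'I_m, (i <= j)%N -> L i j = (i == j)%:R,
      forall i j : 'I_m, (j < i)%N -> U i j = 0 & \det L = 1].
Proof.
case: m A => [|m] A.
  exists 1%g, 1%:M, A; rewrite perm_mx1 !mul1mx det1; split=> // [i j|i j]; by case: i.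
have := cormen_lup_correct A; have := cormen_lup_perm A; have := @cormen_lup_lower _ _ A.
have := @cormen_lup_upper _ _ A; have := cormen_lup_detL A.
case: cormen_lup => [[P L] U] /= dL hU hL /is_perm_mxP [s ->] e.
by exists s, L, U.
Qed.

(** * Volume distortion of linear maps *)

Section LinearChange.
Variables (R : realType) (m : nat).
Local Notation E := 'rV[R]_m.
Variables (I : (E -> R) -> R).
Hypotheses (hI : inv_int I) (I1 : 1 <= I (plateau 1)).
Implicit Types (A B : 'M[R]_m) (phi : E -> R).

Lemma lip_cs_mulmx A phi : A \in unitmx -> lip_cs phi -> lip_cs (fun x => phi (x *m A)).
Proof.
move=> uA hp; have [c c0 cP] := mulmx_norm_le A; have [d d0 dP] := mulmx_norm_le (invmx A).
apply: (@lip_cs_comp _ _ phi (fun x => x *m A) (c + d)) => // [x y|x].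
  by rewrite -mulmxBl; apply: le_trans (cP _) _; rewrite ler_wpM2r // lerDl ltW.
rewrite -{1}(mulmxK uA x); apply: le_trans (dP _) _; apply: ler_pM => //; first exact: ltW.
  by rewrite lerDr ltW.
by rewrite lerDl.
Qed.

Let Ip : 0 < I (plateau 1). Proof. exact: lt_le_trans I1. Qed.

(** By uniqueness, precomposition with an invertible [A] multiplies the integral by this factor; it
    plays the role of [1 / |det A|]. *)
Definition vol_scale A := I (fun x => plateau 1 (x *m A)) / I (plateau 1).

Lemma vol_scaleP A phi : A \in unitmx -> lip_cs phi -> I (fun x => phi (x *m A)) = vol_scale A * I phi.
Proof.
move=> uA hp; pose J phi := I (fun x => phi (x *m A)).
have hJ : inv_int J.
  split=> [p q hp' hq|a p hp'|p hp' p0|v p hp'].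
  - by rewrite /J (inv_intD hI) //; exact: lip_cs_mulmx.
  - by rewrite /J (inv_intZ hI) //; exact: lip_cs_mulmx.
  - by apply: (inv_int_ge0 hI); [exact: lip_cs_mulmx|move=> x; exact: p0].
  - rewrite /J -[RHS](inv_int_tr hI (v *m invmx A)); last exact: lip_cs_mulmx.
    by congr I; apply/funext => x; rewrite mulmxDl mulmxKV.
have := inv_int_unique hI hJ hp (@plateau_lip_cs R m 1).
rewrite /J /vol_scale => e; apply: (mulIf (lt0r_neq0 Ip)).
by rewrite -e mulrAC divfK ?gt_eqF // mulrC.
Qed.

Lemma vol_scaleM A B : A \in unitmx -> B \in unitmx -> vol_scale (A *m B) = vol_scale A * vol_scale B.
Proof.
move=> uA uB; rewrite {1}/vol_scale.
rewrite (_ : (fun x => _) = fun x => (fun y => plateau 1 (y *m B)) (x *m A)); last first.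
  by apply/funext => x; rewrite mulmxA.
rewrite (@vol_scaleP A (fun y => plateau 1 (y *m B))) //; last by apply: lip_cs_mulmx => //; exact: plateau_lip_cs.
by rewrite -mulrA.
Qed.

Lemma vol_scale1 : vol_scale 1%:M = 1.
Proof.
rewrite /vol_scale (_ : (fun x => _) = plateau 1); last by apply/funext => x; rewrite mulmx1.
by rewrite divff // gt_eqF.
Qed.

Lemma vol_scale_ge0 A : A \in unitmx -> 0 <= vol_scale A.
Proof.
move=> uA; apply: divr_ge0; last exact: ltW.
apply: (inv_int_ge0 hI); first by apply: lip_cs_mulmx => //; exact: plateau_lip_cs.
by move=> x; exact: plateau_ge0.
Qed.

(** Continuity of the factor at an invertible matrix: the two integrands differ by [O(h)] on a fixed
    ball and vanish outside of it. *)
Lemma vol_scale_lim B (d : R) : B \in unitmx -> (forall e, 0 < e -> exists A,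
  [/\ A \in unitmx, vol_scale A = d & forall v : E, `|v *m A - v *m B| <= e * `|v|]) -> vol_scale B = d.
Proof.
move=> uB H; have [k k0 kP] := mulmx_norm_le (invmx B).
have kB (x : E) : `|x| <= k * `|x *m B| by rewrite -{1}(mulmxK uB x).
have [c c0 [lp sp]] := @plateau_lip_cs R m 1.
have hp := @plateau_lip_cs R m 1.
pose D := c * (2 * k * c) * I (plateau (2 * k * c)).
apply: (mulIf (lt0r_neq0 Ip)); apply/eqP; rewrite -subr_eq0; apply/eqP.
apply: (@small_eq0 _ _ D (2 * k)^-1) => [|h /andP[h0 h1]]; first by rewrite invr_gt0 mulr_gt0.
have [A [uA <- AB]] := H h h0.
rewrite -!vol_scaleP // -(inv_intB hI); try exact: lip_cs_mulmx.
have kh : k * h <= 1 / 2.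
  have : 2 * k * h <= 1 by rewrite mulrC -ler_pdivlMr ?mulr_gt0 // mul1r.
  lra.
rewrite /D mulrAC [leRHS]mulrC -[leRHS]mulrC -(inv_intZ hI); last exact: plateau_lip_cs.
apply: (inv_int_norm hI).
- by apply: lip_csB; exact: lip_cs_mulmx.
- by apply: lip_csZ; exact: plateau_lip_cs.
move=> x; have c2 : 0 <= c * (2 * k * c) * h by rewrite !mulr_ge0 // ltW.
have [xs|xl] := leP `|x| (2 * k * c).
  rewrite (plateau1 xs) mulr1; apply: le_trans (lp _ _) _.
  apply: (@le_trans _ _ (c * (h * `|x|))); first by rewrite ler_pM2l // distrC.
  by rewrite -[leRHS]mulrA ler_pM2l // [leRHS]mulrC ler_wpM2l // ltW.
have xB := kB x.
have xA : `|x| <= 2 * k * `|x *m A|.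
  have : `|x *m B| <= `|x *m A| + `|x *m A - x *m B|.
    by rewrite -{1}(subKr (x *m A) (x *m B)); exact: ler_normB.
  have := AB x; move: (`|x *m A|) (`|x *m B|) (`|x *m A - x *m B|) (normr_ge0 x) xB => a b d' x0 xB ? ?.
  nra.
have kc : k * `|x *m B| <= 2 * k * `|x *m B| by rewrite -mulrA ler_peMl ?mulr_ge0 ?(ltW k0) //; lra.
have k2 : 0 < 2 * k by rewrite mulr_gt0.
have e1 : plateau 1 (x *m A) = 0 by apply: sp; rewrite -(ltr_pM2l k2); exact: lt_le_trans xA.
have e2 : plateau 1 (x *m B) = 0.
  by apply: sp; rewrite -(ltr_pM2l k2); apply: lt_le_trans kc; exact: lt_le_trans xB.
by rewrite e1 e2 subrr normr0; apply: mulr_ge0 c2 (plateau_ge0 _ _).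
Qed.

(** Conjugation with the diagonal matrix of entries [t ^+ w i] keeps the factor and multiplies the
    off-diagonal entries by positive powers of [t]; as [t] tends to 0, only the diagonal remains. *)
Lemma vol_scale_tri A (w : 'I_m -> nat) : A \in unitmx -> diag_mx (\row_i A i i) \in unitmx ->
  (forall i j, i != j -> A i j != 0 -> (w i < w j)%N) -> vol_scale A = vol_scale (diag_mx (\row_i A i i)).
Proof.
move=> uA uD tri; apply/esym/vol_scale_lim => // e e0.
pose S := \sum_i \sum_j `|A i j|; have S0 : 0 <= S by apply: sumr_ge0 => i _; apply: sumr_ge0.
have S1 : 0 < S + 1 by rewrite ltr_wpDl.
pose t := Num.min 1 (e / (S + 1)); have t0 : 0 < t by rewrite lt_min ltr01 divr_gt0.
have t1 : t <= 1 by rewrite ge_min lexx.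
have tS : S * t <= e.
  have : (S + 1) * t <= e by rewrite mulrC -ler_pdivlMr // ge_min lexx orbT.
  lra.
pose T := diag_mx (\row_i t ^+ w i) : 'M[R]_m; pose T' := diag_mx (\row_i t ^- w i) : 'M[R]_m.
have TT : T' *m T = 1%:M.
  rewrite mulmx_diag -diag_const_mx; congr diag_mx; apply/rowP => i; rewrite !mxE mulVf //.
  by rewrite expf_neq0 // gt_eqF.
have [uT' uT] : T' \in unitmx /\ T \in unitmx.
  by apply/andP; rewrite -unitmx_mul TT unitmx1.
exists (T' *m A *m T); split.
- by rewrite !unitmx_mul uT' uA uT.
- rewrite !vol_scaleM ?unitmx_mul ?uT' // mulrAC -vol_scaleM // TT vol_scale1 mul1r //.
move=> v; rewrite -mulmxBr; apply: norm_rVP => [|j]; first by rewrite mulr_ge0 // ltW.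
rewrite mxE; apply: le_trans (ler_norm_sum _ _ _) _.
apply: (@le_trans _ _ (\sum_i (t * `|v|) * `|A i j|)); last first.
  have SA : \sum_i `|A i j| <= S.
    rewrite /S; apply: ler_sum => i _; rewrite [leRHS](bigD1 j) //= lerDl; exact: sumr_ge0.
  rewrite -mulr_sumr; apply: (@le_trans _ _ (t * `|v| * S)).
    by apply: ler_wpM2l => //; rewrite mulr_ge0 // ltW.
  by rewrite mulrC mulrA ler_wpM2r.
apply: ler_sum => i _; rewrite normrM [t * _]mulrC -mulrA; apply: ler_pM => //; first exact: coord_le.
rewrite mul_mx_diag mul_diag_mx !mxE; have [<-|ij] := eqVneq i j.
  rewrite mulr1n mulrAC mulVf ?mul1r ?subrr ?normr0 ?mulr_ge0 ?(ltW t0) //.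
  by rewrite expf_neq0 // gt_eqF.
rewrite mulr0n subr0; have [->|Aij] := eqVneq (A i j) 0; first by rewrite mulr0 mul0r normr0 mulr0.
have wij := tri _ _ ij Aij; rewrite mulrAC normrM; apply: ler_wpM2r => //.
rewrite -(subnKC (ltnW wij)) exprD mulKf ?expf_neq0 ?gt_eqF //.
rewrite ger0_norm ?exprn_ge0 ?(ltW t0) //.
rewrite -(prednK (_ : (0 < w j - w i)%N)) ?subn_gt0 // exprS ler_piMr ?(ltW t0) //.
by apply: exprn_ile1 => //; exact: ltW.
Qed.

(** A permutation has finite order, and the factor is nonnegative. *)
Lemma vol_scale_perm (s : 'S_m) : vol_scale (perm_mx s) = 1.
Proof.
have H k : vol_scale (perm_mx s) ^+ k = vol_scale (perm_mx (s ^+ k)%g).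
  elim: k => [|k IH]; first by rewrite expr0 expg0 perm_mx1 vol_scale1.
  by rewrite exprS expgS perm_mxM vol_scaleM ?unitmx_perm // IH.
have := H #[s]%g; rewrite expg_order perm_mx1 vol_scale1 => /eqP.
rewrite pexpr_eq1 ?order_gt0 //; first by move/eqP.
by apply: vol_scale_ge0; rewrite unitmx_perm.
Qed.

(** In an LUP decomposition, transposition acts on triangular matrices, whose factor depends on the
    diagonal alone, and on a permutation, whose factor is 1. *)
Lemma vol_scale_tr A : A \in unitmx -> vol_scale A^T = vol_scale A.
Proof.
move=> uA; have [s [L [U [e hL hU dL]]]] := lup_exists A.
have uL : L \in unitmx by rewrite unitmxE dL unitr1.
have uU : U \in unitmx.
  have : L *m U \in unitmx by rewrite -e unitmx_mul unitmx_perm.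
  by rewrite unitmx_mul => /andP[].
have uLT : L^T \in unitmx by rewrite unitmx_tr.
have uUT : U^T \in unitmx by rewrite unitmx_tr.
have DL : diag_mx (\row_i L i i) = 1%:M :> 'M[R]_m.
  by rewrite -diag_const_mx; congr diag_mx; apply/rowP => i; rewrite !mxE hL // eqxx.
have DLT : diag_mx (\row_i L^T i i) = 1%:M :> 'M[R]_m.
  by rewrite -DL; congr diag_mx; apply/rowP => i; rewrite !mxE.
have DUT : diag_mx (\row_i U^T i i) = diag_mx (\row_i U i i) :> 'M[R]_m.
  by congr diag_mx; apply/rowP => i; rewrite !mxE.
have uD : diag_mx (\row_i U i i) \in unitmx.
  move: uUT; rewrite !unitmxE det_diag det_trig.
    by rewrite (eq_bigr (fun i => (\row_i U i i) 0 i)) // => i _; rewrite !mxE.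
  by apply/is_trig_mxP => i j ij; rewrite mxE hU.
have low i j : i != j -> L i j != 0 -> (j < i)%N.
  move=> ij; apply: contraNT; rewrite -leqNgt => h; by rewrite hL // (negbTE ij).
have upp i j : i != j -> U i j != 0 -> (i < j)%N.
  move=> ij; apply: contraNT; rewrite -leqNgt leq_eqVlt => /orP[/eqP h|h]; last by rewrite hU.
  by case/eqP: ij; apply/val_inj.
have wlt (i j : 'I_m) : (i < j)%N -> (m - j < m - i)%N.
  by move=> ij; rewrite ltn_sub2l.
have sL : vol_scale L = 1.
  rewrite (@vol_scale_tri L (fun i => (m - i)%N)) ?DL ?vol_scale1 ?unitmx1 // => i j ij Lij.
  by apply: wlt; exact: low.
have sLT : vol_scale L^T = 1.
  rewrite (@vol_scale_tri L^T (fun i => i)) ?DLT ?vol_scale1 ?unitmx1 // => i j ij; rewrite mxE => Lij.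
  by apply: low => //; rewrite eq_sym.
have sU : vol_scale U^T = vol_scale U.
  rewrite (@vol_scale_tri U (fun i => i)) //.
  rewrite (@vol_scale_tri U^T (fun i => (m - i)%N)) ?DUT // => i j ij; rewrite mxE => Uij.
  by apply: wlt; apply: upp => //; rewrite eq_sym.
have -> : vol_scale A = vol_scale U.
  by have := vol_scaleM (unitmx_perm R s) uA; rewrite e vol_scaleM // sL vol_scale_perm !mul1r.
rewrite -sU; have := vol_scaleM (_ : A^T \in unitmx) (unitmx_perm R (s^-1)%g).
rewrite unitmx_tr => /(_ uA); rewrite -tr_perm_mx -trmx_mul e trmx_mul vol_scaleM // sLT mulr1 => ->.
by rewrite tr_perm_mx vol_scale_perm mulr1.
Qed.

End LinearChange.

(** From [A J A^T = J] and invariance under transposition, the factor of [A] has square 1. *)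
Lemma vol_scale_symplectic (R : realType) (n : nat) (I : ('rV[R]_(n * 2) -> R) -> R) (A : 'M[R]_(n * 2)) :
  inv_int I -> 1 <= I (plateau 1) -> (forall u v, dot (jm (u *m A)) (v *m A) = dot (jm u) v) ->
  A \in unitmx /\ vol_scale I A = 1.
Proof.
move=> hI I1 hA; have [J JP] := jm_matrix R n.
have JJ : J *m (- J) = 1%:M.
  by apply/row_matrixP => i; rewrite !rowE mulmxN mulmxN mulmxA -!JP jmK opprK mulmx1.
have uJ : J \in unitmx by case/mulmx1_unit: JJ.
have AJA : A *m J *m A^T = J.
  apply/row_matrixP => i; rewrite !rowE; apply/rowP => j.
  rewrite -!dot_delta [LHS]dotC !mulmxA -dot_mulmx dotC -!JP; exact: hA.
have uA : A \in unitmx by move: uJ; rewrite -AJA !unitmx_mul => /andP[/andP[]].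
have uAT : A^T \in unitmx by rewrite unitmx_tr.
split=> //; have := vol_scaleM hI I1 (_ : A *m J \in unitmx) uAT.
rewrite AJA unitmx_mul uA uJ => /(_ isT); rewrite vol_scaleM // vol_scale_tr // => e.
have sJ : vol_scale I J != 0.
  apply/eqP => s0; have := vol_scaleM hI I1 uJ (_ : - J \in unitmx).
  have uNJ : - J \in unitmx by case/mulmx1_unit: JJ.
  by rewrite JJ vol_scale1 // s0 mul0r => /(_ uNJ) /eqP; rewrite oner_eq0.
have sA := vol_scale_ge0 hI I1 uA.
have : vol_scale I A ^+ 2 == 1.
  by apply/eqP/(mulIf sJ); rewrite mul1r [RHS]e expr2; ring.
by rewrite pexpr_eq1 // => /eqP.
Qed.

(** * Liouville's theorem and the volume bounded by an embedded sphere *)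

Section Liouville.
Variables (R : realType) (n : nat).
Local Notation V := 'rV[R]_(n * 2).
Variables (r eta K : R) (f : V -> V) (Df : V -> 'M[R]_(n * 2)).
Hypotheses (e0 : 0 < eta) (K0 : 0 < K) (cm : collar_map r eta K f Df).
Variables (I : (V -> R) -> R) (hI : inv_int I) (I1 : 1 <= I (plateau 1)).
Variables (psi : V -> R) (hpsi : lip_cs psi).
Hypothesis psi_core : forall z, ~ (exists2 x, collar r (eta / 2) x & f x = z) -> psi z = 0.

Definition pull_back (x : V) : R := if `[< collar r eta x >] then psi (f x) else 0.

Lemma pull_backE (x : V) : collar r eta x -> pull_back x = psi (f x).
Proof. by move=> h; rewrite /pull_back asboolT. Qed.

Lemma pull_back_core (x : V) : ~ collar r (eta / 2) x -> pull_back x = 0.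
Proof.
move=> nx; have [cx|cx] := pselect (collar r eta x); last by rewrite /pull_back asboolF.
rewrite pull_backE // psi_core // => -[y cy fy]; apply: nx.
have ep := e0; have cy' : collar r eta y by apply: collar_sub cy; lra.
by rewrite -(collar_inj cm cy' cx fy).
Qed.

Lemma collar_near : exists2 d, 0 < d & forall x y : V, collar r (eta / 2) x -> `|y - x| < d -> collar r eta y.
Proof.
have ep := e0; have r2 := sqr_ge0 r; pose B := r ^+ 2 + eta + 1.
have B0 : 0 < B by rewrite /B; lra.
pose q := (n * 2)%:R * (2 * B + 1) + 1; have q0 : 0 < q by rewrite ltr_wpDl // mulr_ge0 //; lra.
exists (Num.min 1 (eta / 2 / q)); first by rewrite lt_min ltr01 !divr_gt0.
move=> x y cx; rewrite lt_min => /andP[h1 h2].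
have xB : `|x| <= B.
  by apply: (@collar_bounded _ _ r eta); apply: collar_sub cx; lra.
have yB : `|y| <= B + 1.
  have : `|y| <= `|y - x| + `|x| by rewrite -{1}(subrK x y) ler_normD.
  lra.
have h3 := n2_diff_le x y.
have h4 : (n * 2)%:R * (`|y| + `|x|) * `|y - x| <= eta / 2.
  move: h2; rewrite ltr_pdivlMr // => h2; apply: le_trans (ltW h2).
  rewrite [leRHS]mulrC; apply: ler_wpM2r => //; rewrite /q.
  apply: (@le_trans _ _ ((n * 2)%:R * (2 * B + 1))); last by rewrite lerDl.
  by apply: ler_wpM2l => //; lra.
move: cx; rewrite /collar /= => cx; rewrite -(subrK (n2 x) (n2 y)) -addrA.
apply: le_trans (ler_normD _ _) _; lra.
Qed.

Lemma pull_back_lip_cs : lip_cs pull_back.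
Proof.
have [d d0 dP] := collar_near; have [M M0 MP] := lip_cs_bounded hpsi.
have [c c0 [lp _]] := hpsi; have Kp := K0.
have Mb x : `|pull_back x| <= M.
  by rewrite /pull_back; case: ifP => // _; rewrite normr0 ltW.
have Md : 0 < M / d by rewrite divr_gt0.
have half (x y : V) : ~ collar r eta y -> `|pull_back y - pull_back x| <= M / d * `|y - x|.
  move=> ny; rewrite {1}/pull_back asboolF // sub0r normrN.
  have [xy|xy] := ltP `|y - x| d.
    rewrite pull_back_core => [|cx]; last by apply: ny (dP _ _ cx xy).
    by rewrite normr0; apply: mulr_ge0 => //; exact: ltW.
  by apply: le_trans (Mb x) _; rewrite mulrAC ler_pdivlMr // ler_pM2l.
apply: (@lip_csI _ _ _ (c * K + M / d) (r ^+ 2 + eta + 1)) => [x y|x hx]; last first.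
  by rewrite /pull_back asboolF // => /collar_bounded; rewrite leNgt hx.
have cK : 0 <= c * K by rewrite mulr_ge0 // ltW.
have [cx|nx] := pselect (collar r eta x); have [cy|ny] := pselect (collar r eta y).
- rewrite !pull_backE //; apply: le_trans (lp _ _) _.
  apply: (@le_trans _ _ (c * K * `|y - x|)); last by rewrite ler_wpM2r // lerDl ltW.
  by have := ler_wpM2l (ltW c0) (collar_lip cm cx cy); rewrite mulrA.
- by apply: le_trans (half _ _ ny) _; rewrite ler_wpM2r // lerDr.
- by rewrite distrC (distrC y); apply: le_trans (half _ _ nx) _; rewrite ler_wpM2r // lerDr.
- by apply: le_trans (half _ _ ny) _; rewrite ler_wpM2r // lerDr.
Qed.

(** The tent at [p], carried over by the affine approximation of [f] at [p]. *)
Let chart (h : R) (p : V) (z : V) : R := tent_prod h ((z - f p) *m invmx (Df p)).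

Let unitD p : collar r eta p -> Df p \in unitmx.
Proof.
by move=> cp; case: (vol_scale_symplectic hI I1 (fun u v => collar_symplectic cm u v cp)).
Qed.

Lemma chart_int (h : R) (p : V) : 0 < h -> collar r eta p ->
  lip_cs (chart h p) /\ I (chart h p) = I (tent_prod h).
Proof.
move=> h0 cp; have uA := unitD cp.
have [_ sA] := vol_scale_symplectic hI I1 (fun u v => collar_symplectic cm u v cp).
have uA' : invmx (Df p) \in unitmx by rewrite unitmx_inv.
have sA' : vol_scale I (invmx (Df p)) = 1.
  by have := vol_scaleM hI I1 uA uA'; rewrite mulmxV // vol_scale1 // sA mul1r.
have ht : lip_cs (fun z => tent_prod h (z *m invmx (Df p))).
  by apply: lip_cs_mulmx => //; exact: tent_prod_lip_cs.
split; first exact: (lip_cs_tr (- f p) ht).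
rewrite (inv_int_tr hI (- f p) ht) (vol_scaleP hI I1 uA') ?sA' ?mul1r //.
exact: tent_prod_lip_cs.
Qed.

(* Near x the map f agrees with its affine approximation to second order, so a tent of width h is
   displaced by O(h^2) and its values change by O(h). *)
Lemma chart_near : exists2 C, 0 < C & exists2 B, 1 <= B & forall (h : R) (x p : V), 0 < h -> collar r eta x -> collar r eta p ->
  `|tent_prod h (x - p) - chart h p (f x)| <= C * h * (`|x - p| <= B * h)%R%:R.
Proof.
have Kp := K0; pose m : R := (n * 2)%:R; have m0 : 0 <= m by exact: ler0n.
pose Q := m * K; have Q0 : 0 <= Q by rewrite mulr_ge0 // ltW.
pose B := 1 + K * K; have B1 : 1 <= B by rewrite lerDl mulr_ge0 // ltW.
have C0 : 0 <= m * 2 * (Q * (K * B ^+ 2)) by rewrite !mulr_ge0 ?exprn_ge0 // ?(ltW K0) //; lra.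
exists (m * 2 * (Q * (K * B ^+ 2)) + 1); first by rewrite ltr_wpDl.
exists B => // h x p h0 cx cp; set u := x - p; set w := (f x - f p) *m invmx (Df p).
have uA := unitD cp; have wD : w *m Df p = f x - f p by rewrite mulmxKV.
have [uh|uh] := leP `|u| (B * h); last first.
  rewrite mulr0 /chart -/w !tent_prod_out ?subrr ?normr0 //.
    rewrite ltNge; apply/negP => wh.
    have h1 : `|f x - f p| <= K * h.
      by rewrite -wD; apply: le_trans (collar_deriv_le cm _ cp) _; rewrite ler_pM2l.
    have h2 := collar_inv_lip cm cp cx.
    have h3 : K * `|f x - f p| <= K * (K * h) by rewrite ler_pM2l.
    have : `|u| <= K * K * h by rewrite -mulrA; exact: le_trans h2 h3.
    rewrite /B mulrDl in uh; lra.
  by apply: le_lt_trans uh; rewrite ler_peMl // ltW.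
rewrite mulr1 distrC; apply: le_trans (tent_prod_lip _ _ h0) _; rewrite -/w -/m.
have h4 : `|w - u| <= Q * (K * (B * h) ^+ 2).
  have h5 := @symplectic_lower _ _ K (Df p) (w - u) K0 (fun u v => collar_symplectic cm u v cp)
    (fun v => collar_deriv_le cm v cp).
  apply: le_trans h5 _; rewrite -/m -/Q; apply: ler_wpM2l => //.
  rewrite mulmxBl wD; apply: le_trans (collar_taylor cm cp cx) _; rewrite ler_pM2l //.
  by apply: lerXn2r; rewrite ?nnegrE // mulr_ge0 // ?(ltW h0) //; lra.
have h2i : 0 <= m * (2 / h) by rewrite mulr_ge0 // divr_ge0 // ltW.
apply: le_trans (ler_wpM2l h2i h4) _.
have -> : m * (2 / h) * (Q * (K * (B * h) ^+ 2)) = m * 2 * (Q * (K * B ^+ 2)) * h by field; exact: lt0r_neq0.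
by rewrite ler_pM2r // lerDl.
Qed.

(** Both sides are compared with the integral of a sum of carried-over tents, weighted by values of
    [pull_back]. Each of them has the integral of a tent, which gives a Riemann sum of [pull_back],
    while pointwise the sum approximates [psi]. *)
Theorem liouville : I pull_back = I psi.
Proof.
have [d d0 dP] := collar_open e0 K0 cm; have Kp := K0; have ep := e0.
have [M M0 MP] := lip_cs_bounded pull_back_lip_cs; have hp := pull_back_lip_cs.
have [c c0 [lp sp]] := pull_back_lip_cs.
have [C C0 [B B1 CP]] := chart_near.
have [Bf Bf0 BfP] := collar_image_bounded e0 K0 cm.
pose m := (n * 2)%N.
pose D1 := c + M * C * (2 * B + 2) ^+ m.
have core_sub (x : V) : collar r (eta / 2) x -> collar r eta x by apply: collar_sub; lra.
have D10 : 0 <= D1.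
  rewrite /D1 addr_ge0 ?(ltW c0) //; apply: mulr_ge0; first by rewrite mulr_ge0 ?ltW.
  by apply: exprn_ge0; lra.
pose h0 := Num.min 1 (d / (K + 1)); have K1 : 0 < K + 1 by lra.
apply/eqP; rewrite -subr_eq0; apply/eqP.
apply: (@small_eq0 _ _ (D1 * I (plateau Bf) + c * I (plateau (c + 1))) h0).
  by rewrite lt_min ltr01 divr_gt0.
move=> h /andP[hp0 hh0].
have h1 : h <= 1 by apply: le_trans hh0 _; rewrite ge_min lexx.
have Kh : K * h < d.
  have : (K + 1) * h <= d by rewrite mulrC -ler_pdivlMr //; apply: le_trans hh0 _; rewrite ge_min lexx orbT.
  by apply: lt_le_trans; rewrite ltr_pM2r // ltrDl.
have hh : 0 < h <= 1 by rewrite hp0.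
pose N := (Num.trunc (c / h)).+1.
have hN : c <= h * N%:R by rewrite mulrC -ler_pdivrMr // ltW // truncnS_gt.
pose G := {ffun 'I_m -> 'I_N.*2.+1}.
pose F (k : G) (z : V) := pull_back (grid_pt h k) * chart h (grid_pt h k) z.
have FP k : lip_cs (F k) /\ I (F k) = pull_back (grid_pt h k) * I (tent_prod h).
  have [ck|nk] := pselect (collar r (eta / 2) (grid_pt h k : V)).
    have [l1 l2] := chart_int hp0 (core_sub _ ck).
    by split; [exact: lip_csZ|rewrite /F (inv_intZ hI) // l2].
  have -> : F k = fun=> 0 by apply/funext => z; rewrite /F pull_back_core // mul0r.
  by rewrite pull_back_core // mul0r (inv_int0 hI); split=> //; exact: lip_cs0.
have FL : lip_cs (fun z => \sum_(k : G) F k z) by apply: lip_cs_sum => k; case: (FP k).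
have FI : I (fun z => \sum_(k : G) F k z) = I (tent_prod h) * \sum_(k : G) pull_back (grid_pt h k).
  rewrite (inv_int_sum hI) => [|k]; last by case: (FP k).
  by rewrite mulr_sumr; apply: eq_bigr => k _; case: (FP k) => _ ->; rewrite mulrC.
have e1 : `|I pull_back - I (fun z => \sum_(k : G) F k z)| <= c * h * I (plateau (c + 1)).
  by rewrite FI; exact: riemann_tent.
have e2 : `|I psi - I (fun z => \sum_(k : G) F k z)| <= D1 * h * I (plateau Bf).
  rewrite -(inv_intB hI) // -(inv_intZ hI); last exact: plateau_lip_cs.
  apply: (inv_int_norm hI); [exact: lip_csB|by apply: lip_csZ; exact: plateau_lip_cs|].
  move=> z; have [[x cx fx]|nz] := pselect (exists2 x, collar r eta x & f x = z); last first.
    rewrite psi_core; last by move=> [x cx fx]; apply: nz; exists x => //; exact: core_sub.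
    rewrite big1 ?subrr ?normr0 => [|k _].
      by apply: mulr_ge0; [rewrite mulr_ge0 // ltW|exact: plateau_ge0].
    rewrite /F; have [ck|nk] := pselect (collar r (eta / 2) (grid_pt h k : V)); last by rewrite pull_back_core // mul0r.
    rewrite /chart tent_prod_out ?mulr0 // ltNge; apply/negP => wh.
    case: nz; apply: (dP (grid_pt h k)) => //; apply: le_lt_trans Kh.
    rewrite -[z - _](mulmxKV (unitD (core_sub _ ck))).
    by apply: le_trans (collar_deriv_le cm _ (core_sub _ ck)) _; rewrite ler_pM2l.
  rewrite -fx plateau1 ?BfP // mulr1 -pull_backE //.
  have t1 := @tent_interp _ _ pull_back c h N x c0 lp sp hh hN.
  set A := \sum_k _ in t1; set A' := \sum_k _.
  have t2 : `|A - A'| <= M * C * (2 * B + 2) ^+ m * h.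
    rewrite /A /A' -sumrB; apply: le_trans (ler_norm_sum _ _ _) _.
    have BhE : B * h / h = B by rewrite mulfK // gt_eqF.
    have Bh0 : 0 <= B * h by rewrite mulr_ge0 ?(ltW hp0) //; lra.
    have := @grid_count R m N h (B * h) x hp0 Bh0; rewrite BhE => cnt.
    rewrite mulrAC; apply: le_trans (ler_wpM2l _ cnt); last by rewrite !mulr_ge0 // ltW.
    rewrite mulr_sumr; apply: ler_sum => k _; rewrite /F -mulrBr normrM -!mulrA.
    have [ck|nk] := pselect (collar r (eta / 2) (grid_pt h k : V)); last first.
      rewrite pull_back_core // normr0 mul0r; apply: mulr_ge0; first exact: ltW.
      by apply: mulr_ge0; [exact: ltW|apply: mulr_ge0; [exact: ltW|]].
    by apply: ler_pM => //; rewrite mulrA; exact: CP (core_sub _ ck).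
  have t3 : c * h * plateau (c + 1) x <= c * h.
    by apply: ler_piMr; [rewrite mulr_ge0 // ltW|case/andP: (ramp01 (c + 1 + 1 - `|x|))].
  rewrite /D1 mulrDl -(subrK A (pull_back x)) -addrA.
  by apply: le_trans (ler_normD _ _) _; lra.
rewrite -(subrK (I (fun z => \sum_(k : G) F k z)) (I pull_back)) -addrA.
apply: le_trans (ler_normD _ _) _; rewrite distrC in e2; rewrite mulrDl; lra.
Qed.

End Liouville.

Lemma segment_delta (R : realType) (m : nat) (z : 'rV[R]_m) (s t : R) (j i : 'I_m) :
  (z + t *: (z + s *: delta_mx 0 j - z)) 0 i = z 0 i + (t * s) *+ (i == j).
Proof. by rewrite [z + _ - z]addrC addKr scalerA !mxE eqxx /= mulr_natr. Qed.

Section VolumeIdentity.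
Variables (R : realType) (n : nat).
Local Notation V := 'rV[R]_(n * 2).
Variables (I : (V -> R) -> R) (hI : inv_int I) (I1 : 1 <= I (plateau 1)).

(** Outside of a large cube any point can be joined to the far end in direction [i0]: directly if
    this does not lead through the cube, otherwise after a detour in direction [i1]. *)
Lemma inside_far (core : V -> Prop) (sigma : V -> R) (B0 B : R) (i0 i1 : 'I_(n * 2)) : i0 != i1 -> 0 <= B0 ->
  (forall z, core z -> `|z| <= B0) ->
  (forall z w : V, (forall t : R, 0 <= t <= 1 -> ~ core (z + t *: (w - z))) -> sigma z = sigma w) ->
  (forall z : V, B < z 0 i0 -> sigma z = 0) -> forall z : V, B0 < `|z| -> sigma z = 0.
Proof.
move=> i01 B00 coreB seg far.
have outc (z : V) i : B0 < `|z 0 i| -> ~ core z.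
  by move=> h /coreB; apply/negP; rewrite -ltNge; apply: lt_le_trans h (coord_le _ _).
have main (z : V) j : B0 < `|z 0 j| -> (j = i0 -> 0 < z 0 i0) -> sigma z = 0.
  move=> hj j0; pose s := `|B| + `|z| + 1.
  have s0 : 0 <= s by rewrite !addr_ge0.
  rewrite (seg z (z + s *: delta_mx 0 i0)).
    apply: far; rewrite !mxE !eqxx mulr1.
    have := ler_norm B; have := coord_le z i0; rewrite ler_norml => /andP[a _]; rewrite /s; lra.
  move=> t /andP[t0 t1]; apply: (outc _ j); rewrite segment_delta.
  have [e|ne] := eqVneq j i0; last by rewrite mulr0n addr0.
  rewrite mulr1n; rewrite e in hj *; have z0 := j0 e; have ts : 0 <= t * s by rewrite mulr_ge0.
  apply: lt_le_trans hj _; rewrite !ger0_norm ?lerDl // ?ltW //; lra.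
move=> z hz; have [j hj] : exists j, B0 < `|z 0 j|.
  apply: contrapT => N; move: hz; apply/negP; rewrite -leNgt; apply: norm_rVP => // i.
  by rewrite leNgt; apply/negP => h; apply: N; exists i.
have [j0|j0] := pselect (j = i0 -> 0 < z 0 i0); first exact: main hj j0.
have [ji zi] : j = i0 /\ z 0 i0 <= 0.
  by split; [apply: contrapT => h; apply: j0|rewrite leNgt; apply/negP => h; apply: j0].
rewrite ji in hj; pose s := B0 + `|z| + 1; have s0 : 0 <= s by rewrite !addr_ge0.
rewrite (seg z (z + s *: delta_mx 0 i1)).
  apply: (main _ i1) => [|e]; last by move: i01; rewrite e eqxx.
  rewrite !mxE !eqxx mulr1; apply: lt_le_trans (ler_norm _).
  have := coord_le z i1; rewrite ler_norml => /andP[a _]; rewrite /s; lra.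
by move=> t _; apply: (outc _ i0); rewrite segment_delta (negbTE i01) mulr0n addr0.
Qed.

(** The divergence theorem for the field [sigma z], one coordinate at a time: the increment of
    [sigma z * z_i] under translation by [h e_i] integrates to zero and is [h (sigma z + P_i z_i)]
    to first order. *)
Lemma scaling_identity (sigma : V -> R) (P : V -> V) (l B : R) : 0 < l -> 0 <= B -> quad_approx l sigma P ->
  (forall z, `|sigma z| <= 1) -> (forall z, B < `|z| -> sigma z = 0 /\ P z = 0) ->
  [/\ lip_cs sigma, lip_cs (fun z => dot (P z) z) & (n * 2)%:R * I sigma = - I (fun z => dot (P z) z)].
Proof.
move=> l0 B0 qa s1 far; pose m : R := (n * 2)%:R; have m0 : 0 <= m by exact: ler0n.
have Pl (x y : V) i : `|P y 0 i - P x 0 i| <= 6 * l * (m + 1) * `|y - x|.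
  have h1 := quad_approx_lipschitz l0 qa x y; have h2 := n2_le (y - x); rewrite -/m in h2.
  have h3 := coord_sqr_le (P y - P x) i; rewrite !mxE in h3.
  have h4 : `|P y 0 i - P x 0 i| ^+ 2 <= (6 * l * (m + 1) * `|y - x|) ^+ 2.
    rewrite real_normK ?num_real //; apply: le_trans h3 _; apply: le_trans h1 _.
    apply: (@le_trans _ _ (36 * l ^+ 2 * (m * `|y - x| ^+ 2))).
      by apply: ler_wpM2l h2; rewrite mulr_ge0 ?sqr_ge0.
    have -> : (6 * l * (m + 1) * `|y - x|) ^+ 2 = 36 * l ^+ 2 * ((m + 1) ^+ 2 * `|y - x| ^+ 2) by ring.
    apply: ler_wpM2l; first by rewrite mulr_ge0 ?sqr_ge0.
    by apply: ler_wpM2r; [exact: sqr_ge0|nra].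
  move: h4; rewrite ler_pXn2r // nnegrE // mulr_ge0 // mulr_ge0 ?addr_ge0 //; lra.
have Pcs i : lip_cs (fun z : V => P z 0 i).
  by apply: (@lip_csI _ _ _ (6 * l * (m + 1)) B) => [x y|z hz]; [exact: Pl|case: (far z hz) => _ ->; rewrite mxE].
have Zlip i (x y : V) : `|y 0 i - x 0 i| <= 1 * `|y - x| by rewrite mul1r coordB_le.
have PZ i : lip_cs (fun z : V => P z 0 i * z 0 i) by apply: (lip_csM (Pcs i) (Zlip i)).
have [Mp Mp0 MpP] : exists2 M : R, 0 <= M & forall z, `|P z| <= M.
  have [c c0 cP] := mulmx_norm_le (1%:M : 'M[R]_(n * 2)).
  pose L := 6 * l * (m + 1); have L0 : 0 <= L by rewrite mulr_ge0 ?addr_ge0 //; lra.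
  exists (`|P 0| + L * B) => [|z]; first by rewrite addr_ge0 // mulr_ge0.
  have [zB|zB] := ltP B `|z|; first by case: (far z zB) => _ ->; rewrite normr0 addr_ge0 // mulr_ge0.
  rewrite -(subrK (P 0) (P z)) addrC; apply: le_trans (ler_normD _ _) _; rewrite lerD2l.
  apply: norm_rVP => [|i]; first by rewrite mulr_ge0.
  rewrite !mxE; apply: le_trans (Pl 0 z i) _; rewrite subr0 -/L; exact: ler_wpM2l.
pose L := m * Mp + l * m + 2.
have L2 : 2 <= L by rewrite /L addrC lerDl addr_ge0 ?mulr_ge0 // ltW.
have slip (x y : V) : `|sigma y - sigma x| <= L * `|y - x|.
  have [xy|xy] := leP 1 `|y - x|.
    apply: le_trans (ler_normB _ _) _; have := s1 x; have := s1 y.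
    have : L * 1 <= L * `|y - x| by apply: ler_wpM2l => //; lra.
    lra.
  rewrite -(subrK (dot (P x) (y - x)) (sigma y - sigma x)); apply: le_trans (ler_normD _ _) _.
  have q1 : `|dot (P x) (y - x)| <= m * Mp * `|y - x|.
    by apply: le_trans (dot_le _ _) _; rewrite -/m -mulrA; apply: ler_wpM2l => //; exact: ler_wpM2r.
  have q2 : l * n2 (y - x) <= l * m * `|y - x|.
    rewrite -mulrA; apply: ler_wpM2l; first exact: ltW.
    apply: le_trans (n2_le _) _; apply: ler_wpM2l => //; rewrite expr2; apply: ler_piMl => //; exact: ltW.
  have := qa x y; have := normr_ge0 (y - x); rewrite /L !mulrDl; lra.
have scs : lip_cs sigma by apply: (@lip_csI _ _ _ L B) => // z hz; case: (far z hz).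
have SZ i : lip_cs (fun z : V => sigma z * z 0 i) by apply: (lip_csM scs (Zlip i)).
have key i : I (fun z => sigma z + P z 0 i * z 0 i) = 0.
  apply: (@small_eq0 _ _ (((B + 1) * l + L) * I (plateau (B + 1))) 1) => // h /andP[h0 h1].
  pose e : V := delta_mx 0 i.
  have ne : `|h *: e| <= h.
    rewrite normrZ (gtr0_norm h0); apply: ler_piMr; first exact: ltW.
    by apply: norm_rVP => // j; rewrite mxE; case: (_ && _); rewrite ?normr1 ?normr0.
  have n2e : n2 (h *: e) = h ^+ 2 by rewrite n2Z /n2 /e dot_delta mxE !eqxx mulr1.
  have hsum : lip_cs (fun z => sigma z + P z 0 i * z 0 i) by exact: lip_csD.
  have htr := lip_cs_tr (h *: e) (SZ i).
  rewrite -(ler_pM2l h0) -{1}(gtr0_norm h0) -normrM -(inv_intZ hI h hsum).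
  have -> : I (fun x => h * (sigma x + P x 0 i * x 0 i)) =
    - I (fun z => (sigma (z + h *: e) * (z + h *: e) 0 i - sigma z * z 0 i) - h * (sigma z + P z 0 i * z 0 i)).
    rewrite (inv_intB hI) ?(inv_intB hI) //; [|exact: lip_csB|exact: lip_csZ].
    by rewrite (inv_int_tr hI (h *: e) (SZ i)) subrr sub0r opprK.
  rewrite normrN; have -> : h * ((((B + 1) * l + L) * I (plateau (B + 1))) * h) =
      I (fun z => (h * h * ((B + 1) * l + L)) * plateau (B + 1) z).
    rewrite (inv_intZ hI); last exact: plateau_lip_cs.
    ring.
  apply: (inv_int_norm hI).
  - by apply: lip_csB; [exact: lip_csB|exact: lip_csZ].
  - by apply: lip_csZ; exact: plateau_lip_cs.
  move=> z; have [zB|zB] := ltP (B + 1) `|z|.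
    have z1 : B < `|z| by lra.
    have z2 : B < `|z + h *: e|.
      have : `|z| <= `|z + h *: e| + `|h *: e| by rewrite -{1}(addrK (h *: e) z); exact: ler_normB.
      lra.
    case: (far _ z1) => e1 e2; case: (far _ z2) => e3 _.
    rewrite e1 e2 e3 [X in _ + X * _]mxE !mul0r !addr0 mulr0 !subr0 normr0.
    by apply: mulr_ge0; [rewrite !mulr_ge0 ?addr_ge0 ?mulr_ge0 ?(ltW h0) ?(ltW l0) //; lra|exact: plateau_ge0].
  rewrite plateau1 // mulr1 (_ : (z + h *: e) 0 i = z 0 i + h); last by rewrite !mxE !eqxx mulr1.
  have -> : sigma (z + h *: e) * (z 0 i + h) - sigma z * z 0 i - h * (sigma z + P z 0 i * z 0 i) =
    z 0 i * (sigma (z + h *: e) - sigma z - h * P z 0 i) + h * (sigma (z + h *: e) - sigma z) by ring.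
  have q1 := qa z (z + h *: e); rewrite [z + _ - z]addrC addKr n2e dotZr /e dot_delta in q1.
  have q2 := slip z (z + h *: e); rewrite [z + _ - z]addrC addKr in q2.
  apply: le_trans (ler_normD _ _) _; rewrite !normrM (gtr0_norm h0).
  have q3 : `|z 0 i| * `|sigma (z + h *: e) - sigma z - h * P z 0 i| <= (B + 1) * (l * h ^+ 2).
    by apply: ler_pM => //; exact: le_trans (coord_le _ _) zB.
  have q4 : h * `|sigma (z + h *: e) - sigma z| <= h * (L * h).
    rewrite ler_pM2l //; apply: le_trans q2 _; apply: ler_wpM2l ne; lra.
  by apply: le_trans (lerD q3 q4) _; rewrite le_eqVlt; apply/orP; left; apply/eqP; ring.
have dotE : (fun z => dot (P z) z) = (fun z => \sum_i P z 0 i * z 0 i) by [].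
have key2 i : I sigma = - I (fun z => P z 0 i * z 0 i).
  by apply/eqP; rewrite -addr_eq0 -(inv_intD hI) //; apply/eqP; exact: key.
split=> //; first by rewrite dotE; exact: lip_cs_sum.
rewrite dotE (inv_int_sum hI) // -sumrN (eq_bigr (fun=> I sigma)); last by move=> i _; rewrite -key2.
by rewrite sumr_const card_ord mulr_natl.
Qed.

Lemma inv_int_rot (phi : V -> R) (t : R) : lip_cs phi ->
  lip_cs (fun x => phi (rot t x)) /\ I (fun x => phi (rot t x)) = I phi.
Proof.
move=> hp; have [A AP] := linear_as_matrix (@rotDr R n t) (@rotZ R n t).
have [uA sA] : A \in unitmx /\ vol_scale I A = 1.
  by apply: vol_scale_symplectic => // u v; rewrite -!AP -rot_jm dot_rot.
have -> : (fun x => phi (rot t x)) = (fun x => phi (x *m A)) by apply/funext => x; rewrite AP.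
by split; [exact: lip_cs_mulmx|rewrite vol_scaleP // sA mul1r].
Qed.

Section Compare.
Variables (r eta K : R) (f : V -> V) (Df : V -> 'M[R]_(n * 2)).
Hypotheses (n1 : (1 < n)%N) (r0 : 0 < r) (e0 : 0 < eta) (K0 : 0 < K) (cm : collar_map r eta K f Df).
Variables (dS : R -> R) (Ms : R) (psi : V -> R).
Hypotheses (Ms0 : 0 < Ms) (dS_le : forall a, `|dS a| <= Ms) (psi_cs : lip_cs psi).
Hypothesis psi_core : forall z, ~ (exists2 x, collar r (eta / 2) x & f x = z) -> psi z = 0.
Hypothesis psi_f : forall x, collar r eta x -> psi (f x) = 2 * dS (n2 x) * ldens f Df x.

(** The integral is invariant under [rot], so [ldens] may be replaced with its averages over Hopf
    circles, and these do not depend on the embedding. *)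
Lemma rotation_average (phi0 : V -> R) : lip_cs phi0 ->
  (forall x, collar r eta x -> phi0 x = 2 * dS (n2 x) * n2 x) -> (forall x, ~ collar r eta x -> phi0 x = 0) ->
  I psi = I phi0.
Proof.
move=> h0 p1 p2; have [c c0 cP] := loop_average n1 e0 K0 cm 0.
rewrite -(liouville e0 K0 cm hI I1 psi_cs psi_core).
set phi := pull_back r eta f psi; have hphi : lip_cs phi by apply: (@pull_back_lip_cs R n r eta K f Df).
pose X := r ^+ 2 + eta + 1.
have D0 : 0 <= 2 * Ms * c by rewrite !mulr_ge0 // ltW.
apply/eqP; rewrite -subr_eq0; apply/eqP; pose D := 2 * Ms * c * I (plateau X).
have bound N : (0 < N)%N -> `|I phi - I phi0| <= D * N%:R^-1.
  move=> N0; have NR : 0 < N%:R :> R by rewrite ltr0n.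
  pose th (l : 'I_N) := 2 * pi * 1%:R / N%:R * l%:R : R.
  have hl (l : 'I_N) : lip_cs (fun x => phi (rot (th l) x)) by case: (inv_int_rot (th l) hphi).
  have hS : lip_cs (fun x => \sum_(l < N) phi (rot (th l) x)) by exact: lip_cs_sum.
  have -> : I phi = I (fun x => N%:R^-1 * \sum_(l < N) phi (rot (th l) x)).
    rewrite (inv_intZ hI) // (inv_int_sum hI) // (eq_bigr (fun=> I phi)).
      by rewrite sumr_const card_ord -[X in _ = _ * X]mulr_natl mulKf // gt_eqF.
    by move=> l _; case: (inv_int_rot (th l) hphi).
  rewrite -(inv_intB hI) //; last exact: lip_csZ.
  rewrite /D mulrAC -(inv_intZ hI); last exact: plateau_lip_cs.
  apply: (inv_int_norm hI); [by apply: lip_csB => //; exact: lip_csZ|by apply: lip_csZ; exact: plateau_lip_cs|].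
  move=> x; have [cx|nx] := pselect (collar r eta x); last first.
    rewrite p2 // big1 => [|l _]; last first.
      by rewrite /phi /pull_back asboolF // => h; apply: nx; apply: collar_n2 h; rewrite n2_rot.
    rewrite mulr0 subrr normr0; apply: mulr_ge0; last exact: plateau_ge0.
    by rewrite mulr_ge0 // invr_ge0 ltW.
  rewrite plateau1 ?(collar_bounded cx) // mulr1 p1 //.
  rewrite (eq_bigr (fun l : 'I_N => 2 * dS (n2 x) * ldens f Df (rot (th l) x))); last first.
    move=> l _; have cl : collar r eta (rot (th l) x) by apply: collar_n2 cx; rewrite n2_rot.
    by rewrite /phi pull_backE // psi_f // n2_rot.
  rewrite -mulr_sumr mulrCA -mulrBr normrM -[leRHS]mulrA; apply: ler_pM => //; last exact: cP.
  by rewrite normrM ger0_norm // ler_pM2l.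
apply: (@small_eq0 _ _ (2 * D) 1) => // h /andP[hp h1].
have Dp : 0 <= D.
  by apply: mulr_ge0 => //; apply: (inv_int_ge0 hI); [exact: plateau_lip_cs|exact: plateau_ge0].
clearbody D; have := bound (Num.trunc h^-1).+1 isT; move/le_trans; apply.
rewrite [2 * D]mulrC -mulrA; apply: ler_wpM2l => //.
have := truncnS_gt h^-1; set q := (_.+1)%:R => hq; have q0 : 0 < q by rewrite ltr0n.
rewrite -[leLHS]mul1r ler_pdivrMr //; have : h^-1 * h < q * h by rewrite ltr_pM2r.
by rewrite mulVf ?gt_eqF //; lra.
Qed.

End Compare.

End VolumeIdentity.

Record profile (R : realType) (r eta : R) (S dS : R -> R) (Ls Ms : R) := Profile {
  prof_L : 0 < Ls; prof_M : 0 < Ms; prof01 : forall a, 0 <= S a <= 1;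
  prof_low : forall a, a <= r ^+ 2 - eta / 2 -> S a = 1;
  prof_high : forall a, r ^+ 2 + eta / 2 <= a -> S a = 0;
  prof_quad : forall a b, `|S b - S a - dS a * (b - a)| <= Ls * (b - a) ^+ 2;
  prof_le : forall a, `|dS a| <= Ms;
  prof_off : forall a, eta / 2 <= `|a - r ^+ 2| -> dS a = 0 }.

Lemma unit_shift_norm (R : realType) (s c : R) : c = 0 \/ c = -1 -> c <= s <= c + 1 -> `|s| <= 1.
Proof. by rewrite ler_norml => -[->|->] /andP[a b]; apply/andP; split; lra. Qed.

Lemma below_mid_norm (R : realType) (q s eta : R) : 0 < eta -> s - eta <= q -> q <= s - eta / 2 -> `|q - s| <= eta.
Proof. by rewrite ler_norml => e0 h1 h2; apply/andP; split; lra. Qed.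

Lemma three_quarters (R : realType) (s eta : R) : 0 < eta -> s - eta <= s - eta * (3 / 4) /\ s - eta * (3 / 4) < s - eta / 2.
Proof. by move=> e0; split; lra. Qed.

Section SphereInside.
Variables (R : realType) (n : nat).
Local Notation V := 'rV[R]_(n * 2).
Variables (I : (V -> R) -> R) (hI : inv_int I) (I1 : 1 <= I (plateau 1)).

Lemma collar_map_id (r eta : R) : collar_map r eta 1 (fun x : V => x) (fun=> 1%:M).
Proof.
split.
- by move=> x y _ _; rewrite mulmx1 subrr normr0 mul1r exprn_ge0.
- by move=> x y v _ _; rewrite subrr normr0 mul1r mulr_ge0.
- by move=> x v _; rewrite mulmx1 mul1r.
- by move=> x u v _; rewrite !mulmx1.
- by move=> x y _ _; rewrite mul1r.
- by move=> x y _ _; rewrite mul1r.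
Qed.

Lemma small_bump (s : R) : (0 < n)%N -> 0 < s -> exists phi : V -> R,
  [/\ lip_cs phi, 0 < I phi, forall x, 0 <= phi x <= 1 & forall x, s < n2 x -> phi x = 0].
Proof.
move=> n0 s0; pose m : R := (n * 2)%:R; have m0 : 0 < m by rewrite ltr0n muln_gt0 n0.
pose t := 2 * (m / s + 1); have ms : 0 < m / s by rewrite divr_gt0.
have t0 : 0 < t by rewrite mulr_gt0 // ltr_wpDl // ltW.
have e1 : t%:M *m t^-1%:M = 1%:M :> 'M[R]_(n * 2) by rewrite -scalar_mxM divff // gt_eqF.
have [u1 u2] := mulmx1_unit e1.
have sc : 0 < vol_scale I t%:M.
  rewrite lt_def vol_scale_ge0 // andbT; apply/eqP => z.
  by have := vol_scaleM hI I1 u1 u2; rewrite e1 vol_scale1 // z mul0r => /eqP; rewrite oner_eq0.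
exists (fun x => plateau 1 (x *m t%:M)); split.
- by apply: lip_cs_mulmx => //; exact: plateau_lip_cs.
- rewrite vol_scaleP //; last exact: plateau_lip_cs.
  by rewrite mulr_gt0 //; exact: lt_le_trans I1.
- by move=> x; exact: ramp01.
move=> x sx; rewrite /plateau mul_mx_scalar normrZ (gtr0_norm t0) ramp_eq0 //.
have h1 := n2_le x; rewrite -/m in h1.
have h2 : s < m * `|x| ^+ 2 by exact: lt_le_trans sx h1.
have h3 : 1 <= (m / s) * `|x| ^+ 2.
  by rewrite mulrAC ler_pdivlMr // mul1r ltW.
have x0 := normr_ge0 x; move: h3 ms; rewrite /t; move: (m / s) (`|x|) x0 => q a a0 h3 q0.
have : 1 <= (q + 1) * a by nra.
lra.
Qed.

Lemma n2_segment (x y : V) (t c : R) : 0 <= t <= 1 -> n2 x < c -> n2 y < c -> n2 (x + t *: (y - x)) < c.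
Proof.
move=> /andP[t0 t1] hx hy; have h := n2_ge0 (y - x).
have -> : n2 (x + t *: (y - x)) = (1 - t) * n2 x + t * n2 y - t * (1 - t) * n2 (y - x).
  rewrite n2D n2Z dotZr dotBr -/(n2 x) n2B (dotC y); ring.
have h0 : 0 <= t * (1 - t) * n2 (y - x) by rewrite !mulr_ge0 // subr_ge0.
have h1 : 0 <= t * (c - n2 y) by rewrite mulr_ge0 // subr_ge0 ltW.
have h2 : 0 <= (1 - t) * (c - n2 x) by rewrite mulr_ge0 // subr_ge0 // ltW.
have [t2|t2] := leP t (1 / 2).
  have : 0 <= (1 / 2 - t) * (c - n2 x) by rewrite mulr_ge0 // subr_ge0 // ltW.
  lra.
have : 0 <= (t - 1 / 2) * (c - n2 y) by rewrite mulr_ge0 // subr_ge0 // ltW.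
lra.
Qed.

Lemma n2_ray (x : V) (t s : R) : 0 <= t -> 0 <= s -> n2 x <= n2 (x + t *: (s *: x)).
Proof.
move=> t0 s0; rewrite scalerA -{2}[x]scale1r -scalerDl n2Z.
apply: ler_peMl; first exact: n2_ge0.
by have := mulr_ge0 t0 s0; move: (t * s) => a a0; nra.
Qed.

(** [inside_function] is applied to the embedding and to the identity. By [scaling_identity] both
    volumes are given by integrals of [dot (P z) z], which agree by [rotation_average]; for the
    identity the function is the profile of a round ball. Hence the comparison with functions above
    and below the ball, and also [cc = 0], as [cc = -1] would make the volume nonpositive. *)
Theorem sphere_inside (r eta K : R) (f : V -> V) (Df : V -> 'M[R]_(n * 2)) (S dS : R -> R) (Ls Ms : R) :
  (1 < n)%N -> 0 < r -> 0 < eta -> eta <= r ^+ 2 / 2 -> 0 < K -> collar_map r eta K f Df ->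
  profile r eta S dS Ls Ms ->
  let core z := exists2 x, collar r (eta / 2) x & f x = z in
  exists (sigma : V -> R) (P : V -> V) (l B : R),
  [/\ 0 < l /\ quad_approx l sigma P, forall z, 0 <= sigma z <= 1,
      forall x, collar r eta x -> sigma (f x) = S (n2 x) /\ P (f x) = hamiltonian_dir Df (dS (n2 x)) x,
      [/\ forall z, ~ core z -> P z = 0 /\ (sigma z = 0 \/ sigma z = 1),
          forall z w : V, (forall t : R, 0 <= t <= 1 -> ~ core (z + t *: (w - z))) -> sigma z = sigma w &
          forall z : V, B < `|z| -> sigma z = 0] &
      [/\ lip_cs sigma,
          forall phi, lip_cs phi -> (forall x, phi x <= 1) -> (forall x, r ^+ 2 - eta / 2 < n2 x -> phi x <= 0) ->
            I phi <= I sigma &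
          forall phi, lip_cs phi -> (forall x, 0 <= phi x) -> (forall x, n2 x <= r ^+ 2 + eta / 2 -> 1 <= phi x) ->
            I sigma <= I phi]].
Proof.
move=> n1 r0 e0 er K0 cm [L0 M0 S01 Slow Shigh Squad dSle dSoff] core.
have n0 : (0 < n)%N by exact: ltnW.
have N2 : (1 < n * 2)%N by rewrite muln2 -addnn -[1%N]/(1 + 0)%N -addnS; apply: leq_add => //; exact: ltnW.
pose i0 : 'I_(n * 2) := Ordinal (ltnW N2); pose i1 : 'I_(n * 2) := Ordinal N2.
have i01 : i0 != i1 by [].
have r2 : 0 < r ^+ 2 by rewrite exprn_gt0.
have [sg [P [cc [l [B [l0 qa [ccP sb] sf [Pn seg far sn]]]]]]] :=
  inside_function i0 r0 e0 K0 cm L0 M0 S01 Slow Shigh Squad dSle dSoff er.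
have cmi := collar_map_id r eta.
have [sg' [P' [cc' [l' [B' [l0' qa' [ccP' sb'] sf' [Pn' seg' far' sn']]]]]]] :=
  inside_function i0 r0 e0 ltr01 cmi L0 M0 S01 Slow Shigh Squad dSle dSoff er.
have core_sub (x : V) : collar r (eta / 2) x -> collar r eta x by apply: collar_sub; lra.
have [Bf Bf0 BfP] := collar_image_bounded e0 K0 cm.
have coreB z : core z -> `|z| <= Bf by move=> [x cx <-]; apply: BfP; exact: core_sub.
have coreB' z : in_core r eta (fun x : V => x) z -> `|z| <= r ^+ 2 + eta + 1.
  by move=> [x cx <-]; apply: collar_bounded; exact: core_sub.
have Bi0 : 0 <= r ^+ 2 + eta + 1 by lra.
have sfar := inside_far i01 (ltW Bf0) coreB seg far.
have sfar' := inside_far i01 Bi0 coreB' seg' far'.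
have far2 z : Bf < `|z| -> sg z = 0 /\ P z = 0.
  by move=> h; split; [exact: sfar|apply: Pn => /coreB; rewrite leNgt h].
have far2' z : r ^+ 2 + eta + 1 < `|z| -> sg' z = 0 /\ P' z = 0.
  by move=> h; split; [exact: sfar'|apply: Pn' => /coreB'; rewrite leNgt h].
have s1 z : `|sg z| <= 1.
  exact: unit_shift_norm ccP (sb z).
have s1' z : `|sg' z| <= 1.
  exact: unit_shift_norm ccP' (sb' z).
have [scs pcs Isg] := scaling_identity hI l0 (ltW Bf0) qa s1 far2.
have [scs' pcs' Isg'] := scaling_identity hI l0' Bi0 qa' s1' far2'.
have dotP (g : V -> V) (Dg : V -> 'M[R]_(n * 2)) x : dot (hamiltonian_dir Dg (dS (n2 x)) x) (g x) = 2 * dS (n2 x) * ldens g Dg x.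
  by rewrite /hamiltonian_dir /ldens dotZl dot_jml (dotC (jm (g x))); ring.
have Ieq : I (fun z => dot (P z) z) = I (fun z => dot (P' z) z).
  apply: (rotation_average hI I1 n1 e0 K0 cm M0 dSle pcs) => //.
  - by move=> z nz; rewrite Pn // dot0l.
  - by move=> x cx; case: (sf x cx) => _ ->; exact: dotP.
  - move=> x cx; case: (sf' x cx) => _ ->.
    by rewrite (dotP (fun x => x)) /ldens mulmx1 -/(n2 (jm x)) n2_jm.
  - by move=> x nx; rewrite Pn' ?dot0l // => -[y cy e]; apply: nx; rewrite -e; exact: core_sub.
have m0 : (n * 2)%:R != 0 :> R by rewrite pnatr_eq0 muln_eq0 negb_or -!lt0n n0.
have Isig : I sg = I sg' by apply: (mulfI m0); rewrite Isg Isg' Ieq.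
have outside' x : r ^+ 2 + eta / 2 < n2 x -> sg' x = 0.
  move=> hx; have xn : 0 < `|x|.
    rewrite normr_gt0; apply/eqP => x0; move: hx; rewrite x0 /n2 dot0l => hx; lra.
  pose s := (r ^+ 2 + eta + 1) / `|x| + 1; have s0 : 0 <= s by rewrite addr_ge0 // divr_ge0.
  rewrite (seg' x (x + s *: x)).
    apply: sfar'; rewrite -{1}[x]scale1r -scalerDl normrZ (ger0_norm (addr_ge0 ler01 s0)).
    have -> : (1 + s) * `|x| = (r ^+ 2 + eta + 1) + 2 * `|x| by rewrite /s; field; rewrite gt_eqF.
    by rewrite ltrDl mulr_gt0.
  move=> t /andP[t0 t1]; rewrite [x + s *: x - x]addrC addKr => -[y cy e].
  have := n2_ray x t0 s0; rewrite -e; move: cy; rewrite /collar /= ler_norml => /andP[_ h]; lra.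
have delta_n2 (s : R) : n2 (s *: (delta_mx 0 i0 : V)) = s ^+ 2.
  by rewrite n2Z /n2 dot_delta mxE !eqxx mulr1.
have cc0 : cc' = 0.
  pose x := Num.sqrt (r ^+ 2 + eta) *: (delta_mx 0 i0 : V).
  have nx : n2 x = r ^+ 2 + eta by rewrite delta_n2 sqr_sqrtr //; lra.
  have cx : collar r eta x by rewrite /collar /= nx addrAC subrr add0r gtr0_norm.
  have [h _] := sf' x cx; move: h; rewrite outside' ?nx; last by lra.
  have -> : S (r ^+ 2 + eta) = 0 by apply: Shigh; lra.
  by rewrite add0r => <-.
have inside' x : n2 x <= r ^+ 2 - eta / 2 -> sg' x = 1.
  move=> hx; have [h|h] := leP (r ^+ 2 - eta) (n2 x).
    have cx : collar r eta x by exact: below_mid_norm e0 h hx.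
    by case: (sf' x cx) => -> _; rewrite cc0 addr0 Slow.
  pose y := Num.sqrt (r ^+ 2 - eta * (3 / 4)) *: (delta_mx 0 i0 : V).
  have ny : n2 y = r ^+ 2 - eta * (3 / 4) by rewrite delta_n2 sqr_sqrtr //; lra.
  have [y1 y2] := three_quarters (r ^+ 2) e0; rewrite -ny in y1 y2.
  have cy : collar r eta y by exact: below_mid_norm e0 y1 (ltW y2).
  rewrite (seg' x y); first by case: (sf' y cy) => -> _; rewrite cc0 addr0 Slow // ltW.
  move=> t t01 [z cz e]; have : n2 (x + t *: (y - x)) < r ^+ 2 - eta / 2.
    apply: n2_segment => //; apply: lt_trans h _; have [k1 k2] := three_quarters (r ^+ 2) e0.
    exact: le_lt_trans k1 k2.
  by rewrite -e; move: cz; rewrite /collar /= ler_norml => /andP[k _]; lra.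
have sb0 z : 0 <= sg' z <= 1 by have := sb' z; rewrite cc0 add0r.
have lower phi : lip_cs phi -> (forall x, phi x <= 1) -> (forall x, r ^+ 2 - eta / 2 < n2 x -> phi x <= 0) -> I phi <= I sg.
  move=> hp p1 p0; rewrite Isig; apply: (inv_int_le hI) => // x.
  have [h|h] := leP (n2 x) (r ^+ 2 - eta / 2); first by rewrite inside'.
  by apply: le_trans (p0 x h) _; case/andP: (sb0 x).
have upper phi : lip_cs phi -> (forall x, 0 <= phi x) -> (forall x, n2 x <= r ^+ 2 + eta / 2 -> 1 <= phi x) -> I sg <= I phi.
  move=> hp p0 p1; rewrite Isig; apply: (inv_int_le hI) => // x.
  have [h|h] := leP (n2 x) (r ^+ 2 + eta / 2); last by rewrite outside'.
  by apply: le_trans (p1 x h); case/andP: (sb0 x).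
have cc00 : cc = 0.
  case: ccP => // ccN; have [phi [hp Ip p01 p0]] := @small_bump (r ^+ 2 - eta / 2) n0 ltac:(lra).
  have h1 : I phi <= I sg.
    by apply: lower => // x => [|hx]; [case/andP: (p01 x)|rewrite p0].
  have h2 : I sg <= I (fun=> 0).
    by apply: (inv_int_le hI) => // [|z]; [exact: lip_cs0|have := sb z; rewrite ccN addNr => /andP[]].
  by rewrite (inv_int0 hI) in h2; have := lt_le_trans Ip (le_trans h1 h2); rewrite ltxx.
exists sg, P, l, Bf; split=> //.
- by move=> z; have := sb z; rewrite cc00 add0r.
- by move=> x cx; have [h1 h2] := sf x cx; rewrite h1 cc00 addr0.
- split=> //; move=> z nz; split; first exact: Pn.
  by have := sn z nz; rewrite cc00 add0r.
Qed.

End SphereInside.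

(** * Surrounding spheres in a thin cylinder *)

Section Smoothstep.
Variable R : realType.
Implicit Types s t u : R.

Definition smoothstep u := 3 * u ^+ 2 - 2 * u ^+ 3.

Lemma smoothstep01 u : 0 <= u <= 1 -> 0 <= smoothstep u <= 1.
Proof.
move=> /andP[u0 u1]; rewrite /smoothstep; apply/andP; split.
  have -> : 3 * u ^+ 2 - 2 * u ^+ 3 = u ^+ 2 * (3 - 2 * u) by ring.
  by rewrite mulr_ge0 ?sqr_ge0 //; lra.
rewrite -subr_ge0; have -> : 1 - (3 * u ^+ 2 - 2 * u ^+ 3) = (1 - u) ^+ 2 * (1 + 2 * u) by ring.
by rewrite mulr_ge0 ?sqr_ge0 //; lra.
Qed.

(** The derivative [6 u (1 - u)], extended by zero, is Lipschitz with constant 6. The nine cases are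
    the positions of [s] and [t] relative to [[0, 1]]. *)
Lemma smoothstep_quad s t :
  `|smoothstep (ramp t) - smoothstep (ramp s) - 6 * (ramp s * (1 - ramp s)) * (t - s)| <= 3 * (t - s) ^+ 2.
Proof.
rewrite /smoothstep; case: (rampP s) => -[hs ->]; case: (rampP t) => -[ht ->].
- have -> : 3 * 0 ^+ 2 - 2 * 0 ^+ 3 - (3 * 0 ^+ 2 - 2 * 0 ^+ 3) - 6 * (0 * (1 - 0)) * (t - s) = 0 by ring.
  by rewrite normr0 mulr_ge0 ?sqr_ge0.
- have -> : 3 * t ^+ 2 - 2 * t ^+ 3 - (3 * 0 ^+ 2 - 2 * 0 ^+ 3) - 6 * (0 * (1 - 0)) * (t - s) = t ^+ 2 * (3 - 2 * t) by ring.
  case/andP: ht => t0 t1; rewrite ger0_norm; last by rewrite mulr_ge0 ?sqr_ge0 //; lra.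
  have : t ^+ 2 <= (t - s) ^+ 2 by nra.
  have := sqr_ge0 t; nra.
- have -> : 3 * 1 ^+ 2 - 2 * 1 ^+ 3 - (3 * 0 ^+ 2 - 2 * 0 ^+ 3) - 6 * (0 * (1 - 0)) * (t - s) = 1 by ring.
  by rewrite normr1; nra.
- have -> : 3 * 0 ^+ 2 - 2 * 0 ^+ 3 - (3 * s ^+ 2 - 2 * s ^+ 3) - 6 * (s * (1 - s)) * (t - s) =
    3 * s ^+ 2 - 4 * s ^+ 3 + 6 * (s * (1 - s)) * (- t) by ring.
  case/andP: hs => s0 s1; have p : 0 <= s * (1 - s) by rewrite mulr_ge0 // subr_ge0.
  have p2 : 0 <= s * (1 - s) * - t by rewrite mulr_ge0 // oppr_ge0.
  have q : 0 <= s * s * - t by rewrite !mulr_ge0 // oppr_ge0.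
  rewrite ler_norml; apply/andP; split; nra.
- have -> : 3 * t ^+ 2 - 2 * t ^+ 3 - (3 * s ^+ 2 - 2 * s ^+ 3) - 6 * (s * (1 - s)) * (t - s) =
    (3 - 2 * t - 4 * s) * (t - s) ^+ 2 by ring.
  rewrite normrM (ger0_norm (sqr_ge0 _)); apply: ler_wpM2r; first exact: sqr_ge0.
  by case/andP: hs => s0 s1; case/andP: ht => t0 t1; rewrite ler_norml; apply/andP; split; lra.
- pose u := 1 - s; pose v := t - 1; have u0 : 0 <= u by rewrite subr_ge0; case/andP: hs.
  have u1 : u <= 1 by rewrite /u; case/andP: hs => ? ?; lra.
  have v0 : 0 <= v by rewrite subr_ge0.
  have -> : 3 * 1 ^+ 2 - 2 * 1 ^+ 3 - (3 * s ^+ 2 - 2 * s ^+ 3) - 6 * (s * (1 - s)) * (t - s) =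
    - (3 * u ^+ 2 - 4 * u ^+ 3 + 6 * (u * (1 - u)) * v) by rewrite /u /v; ring.
  have -> : t - s = u + v by rewrite /u /v; ring.
  have p : 0 <= u * (1 - u) by rewrite mulr_ge0 // subr_ge0.
  have p2 : 0 <= u * (1 - u) * v by rewrite mulr_ge0.
  have q : 0 <= u * u * v by rewrite !mulr_ge0.
  clearbody u v; rewrite normrN ler_norml; apply/andP; split; nra.
- have -> : 3 * 0 ^+ 2 - 2 * 0 ^+ 3 - (3 * 1 ^+ 2 - 2 * 1 ^+ 3) - 6 * (1 * (1 - 1)) * (t - s) = - 1 by ring.
  by rewrite normrN1; nra.
- pose w := 1 - t; case/andP: ht => t0 t1; have w0 : 0 <= w by rewrite subr_ge0.
  have -> : 3 * t ^+ 2 - 2 * t ^+ 3 - (3 * 1 ^+ 2 - 2 * 1 ^+ 3) - 6 * (1 * (1 - 1)) * (t - s) =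
    - (w ^+ 2 * (3 - 2 * w)) by rewrite /w; ring.
  rewrite normrN ger0_norm; last by rewrite mulr_ge0 ?sqr_ge0 // /w; lra.
  have : w ^+ 2 <= (t - s) ^+ 2 by rewrite /w; nra.
  have := sqr_ge0 w; nra.
- have -> : 3 * 1 ^+ 2 - 2 * 1 ^+ 3 - (3 * 1 ^+ 2 - 2 * 1 ^+ 3) - 6 * (1 * (1 - 1)) * (t - s) = 0 by ring.
  by rewrite normr0 mulr_ge0 ?sqr_ge0.
Qed.

(** The position across the core, from 0 at its inner side to 1 at its outer side. *)
Definition band (r eta a : R) := ramp ((a - r ^+ 2 + eta / 2) / eta).
Definition step_profile (r eta a : R) := 1 - smoothstep (band r eta a).
Definition step_slope (r eta a : R) := - (6 * (band r eta a * (1 - band r eta a)) / eta).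

Lemma step_slope_le0 r eta a : 0 < eta -> step_slope r eta a <= 0.
Proof.
move=> e0; rewrite /step_slope oppr_le0; apply: divr_ge0; last exact: ltW.
by have := ramp01 ((a - r ^+ 2 + eta / 2) / eta); rewrite -/(band r eta a) => /andP[b0 b1]; nra.
Qed.

Lemma step_is_profile (r eta : R) : 0 < eta ->
  profile r eta (step_profile r eta) (step_slope r eta) (3 / eta ^+ 2) (2 / eta).
Proof.
move=> e0; have en : eta != 0 by rewrite gt_eqF.
have b01 a : 0 <= band r eta a <= 1 by exact: ramp01.
have blow a : a <= r ^+ 2 - eta / 2 -> band r eta a = 0.
  by move=> h; apply: ramp_eq0; rewrite pmulr_lle0 ?invr_gt0 //; lra.
have bhigh a : r ^+ 2 + eta / 2 <= a -> band r eta a = 1.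
  by move=> h; apply: ramp_eq1; rewrite ler_pdivlMr // mul1r; lra.
split.
- by rewrite divr_gt0 // exprn_gt0.
- by rewrite divr_gt0.
- by move=> a; have := smoothstep01 (b01 a); rewrite /step_profile; lra.
- by move=> a /blow h; rewrite /step_profile h /smoothstep !expr0n /= !mulr0 !subr0.
- by move=> a /bhigh h; rewrite /step_profile h /smoothstep !expr1n; ring.
- move=> a b; have := smoothstep_quad ((a - r ^+ 2 + eta / 2) / eta) ((b - r ^+ 2 + eta / 2) / eta).
  rewrite -!/(band _ _ _) /step_profile /step_slope; set u := band r eta a; set v := band r eta b.
  have -> : (b - r ^+ 2 + eta / 2) / eta - (a - r ^+ 2 + eta / 2) / eta = (b - a) / eta by field.
  have -> : 1 - smoothstep v - (1 - smoothstep u) - - (6 * (u * (1 - u)) / eta) * (b - a) =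
    - (smoothstep v - smoothstep u - 6 * (u * (1 - u)) * ((b - a) / eta)) by field.
  by rewrite normrN; congr (_ <= _); field.
- move=> a; rewrite /step_slope normrN ger0_norm; last first.
    by apply: divr_ge0; [have /andP[b0 b1] := b01 a; nra|exact: ltW].
  by rewrite ler_pM2r ?invr_gt0 //; have /andP[b0 b1] := b01 a; nra.
- move=> a h; rewrite /step_slope; have [b|b] : band r eta a = 0 \/ band r eta a = 1.
  + have [k|k] := leP 0 (a - r ^+ 2).
      by right; apply: bhigh; rewrite ger0_norm // in h; lra.
    by left; apply: blow; rewrite ltr0_norm // in h; lra.
  + by rewrite b mul0r mulr0 mul0r oppr0.
  + by rewrite b subrr !mulr0 mul0r oppr0.
Qed.

End Smoothstep.

Lemma quad_approx_norm_lip (R : realType) (m : nat) (l : R) (F : 'rV[R]_m -> R) (P : 'rV[R]_m -> 'rV[R]_m) :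
  0 < l -> quad_approx l F P -> forall x y, `|P y - P x| <= 6 * l * (m%:R + 1) * `|y - x|.
Proof.
move=> l0 qa x y; have m0 := ler0n R m.
have h1 := quad_approx_lipschitz l0 qa x y; have h2 := n2_le (y - x).
have h3 := norm_sqr_le (P y - P x).
have h4 : `|P y - P x| ^+ 2 <= (6 * l * (m%:R + 1) * `|y - x|) ^+ 2.
  apply: le_trans h3 _; apply: le_trans h1 _.
  apply: (@le_trans _ _ (36 * l ^+ 2 * (m%:R * `|y - x| ^+ 2))).
    by apply: ler_wpM2l h2; rewrite mulr_ge0 ?sqr_ge0.
  have -> : (6 * l * (m%:R + 1) * `|y - x|) ^+ 2 = 36 * l ^+ 2 * ((m%:R + 1) ^+ 2 * `|y - x| ^+ 2) by ring.
  apply: ler_wpM2l; first by rewrite mulr_ge0 ?sqr_ge0.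
  by apply: ler_wpM2r; [exact: sqr_ge0|nra].
move: h4; rewrite ler_pXn2r // nnegrE // mulr_ge0 // mulr_ge0 ?addr_ge0 //; lra.
Qed.

(** * Discrete loops near the collar *)

Section Shadow.
Variables (R : realType) (n : nat).
Local Notation V := 'rV[R]_(n * 2).
Variables (r eta K : R) (f : V -> V) (Df : V -> 'M[R]_(n * 2)).
Hypotheses (e0 : 0 < eta) (K0 : 0 < K) (cm : collar_map r eta K f Df).

Let Xc := r ^+ 2 + eta + 1.
Let Xc0 : 0 < Xc. Proof. by rewrite /Xc; have := sqr_ge0 r; have ep := e0; lra. Qed.

(** The Hamiltonian field on the collar is the image of the rotation field at speed [2 a], so its
    orbits are images of Hopf circles. *)
Lemma jm_hamiltonian (a : R) (x : V) : jm (hamiltonian_dir Df a x) = (2 * a) *: (jm x *m Df x).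
Proof. by rewrite /hamiltonian_dir jmZ jmK scalerN -scaleNr mulNr opprK. Qed.

Lemma turn_lip (x y : V) : collar r eta x -> collar r eta y ->
  `|jm y *m Df y - jm x *m Df x| <= K * (1 + Xc) * `|y - x|.
Proof.
move=> cx cy; have -> : jm y *m Df y - jm x *m Df x = (jm y - jm x) *m Df y + (jm x *m Df y - jm x *m Df x).
  by rewrite mulmxBl addrA subrK.
apply: le_trans (ler_normD _ _) _.
have h1 := collar_deriv_le cm (jm y - jm x) cy; rewrite -jmB norm_jm in h1.
have h2 := collar_deriv_lip cm (jm x) cx cy; rewrite norm_jm in h2.
have h3 : K * `|y - x| * `|x| <= K * `|y - x| * Xc.
  by apply: ler_wpM2l; [rewrite mulr_ge0 // ltW|exact: collar_bounded].
rewrite -jmB; lra.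
Qed.

(** Consistency of the trapezoidal rule: [n2], and with it the speed, is constant along the
    rotation. Taylor's formula gives the displacement, and [X] varies between the two ends by only
    [O(1/N)]. *)
Lemma shadow_step (Lam M : R) : 0 < Lam -> 0 < M -> exists2 c, 0 < c & forall (X : V -> V) (a : R) (x : V) (N : nat) (s : R),
  (forall u v, `|X v - X u| <= Lam * `|v - u|) -> `|a| <= M -> n2 x = s ->
  (forall y, n2 y = s -> collar r eta y -> X (f y) = hamiltonian_dir Df a y) -> collar r eta x -> (0 < N)%N ->
  `|f (rot (2 * a / N%:R) x) - f x - (2 * N%:R)^-1 *: (jm (X (f x)) + jm (X (f (rot (2 * a / N%:R) x))))| <= c / N%:R ^+ 2.
Proof.
move=> L0 M0; pose T := 2 * M; have T0 : 0 < T by rewrite mulr_gt0.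
pose D := 2 * T * (1 + T) * Xc; have D0 : 0 < D by rewrite !mulr_gt0 //; lra.
pose c := K * D ^+ 2 + K * (4 * T ^+ 2 * Xc) + Lam * K * D.
have c1 : 0 < K * D ^+ 2 by rewrite mulr_gt0 // exprn_gt0.
have c2 : 0 <= K * (4 * T ^+ 2 * Xc) by rewrite !mulr_ge0 ?sqr_ge0 // ltW.
have c3 : 0 <= Lam * K * D by apply: mulr_ge0; [rewrite mulr_ge0 // ltW|exact: ltW].
exists c => [|X a x N s Xl aM nx Xf cx N0]; first by rewrite /c; lra.
pose q : R := N%:R^-1; have q0 : 0 < q by rewrite invr_gt0 ltr0n.
have q1 : q <= 1 by rewrite invf_le1 ?ltr0n // ler1n.
have -> : c / N%:R ^+ 2 = c * q ^+ 2 by rewrite exprVn.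
have -> : (2 * N%:R)^-1 = q / 2 by rewrite invfM mulrC.
have -> : 2 * a / N%:R = 2 * a * q by [].
have xX := collar_bounded cx; rewrite -/Xc in xX.
pose t := 2 * a * q; rewrite -/t.
have tq : `|t| <= T * q by rewrite /t normrM (gtr0_norm q0) ler_pM2r // normrM ger0_norm // ler_pM2l.
have tT : `|t| <= T by apply: le_trans tq _; rewrite ler_piMr // ltW.
set x' := rot t x; have cx' : collar r eta x' by apply: collar_n2 cx; rewrite n2_rot.
have dx : `|x' - x| <= D * q.
  have := rot_lipschitz 0 t x; rewrite rot0 subr0 => h; apply: le_trans h _.
  have -> : D * q = 2 * (T * q) * (1 + T) * Xc by rewrite /D; ring.
  apply: ler_pM; [by rewrite !mulr_ge0 ?addr_ge0|by []| |exact: xX].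
  apply: ler_pM; [by rewrite mulr_ge0|by rewrite addr_ge0|by rewrite ler_pM2l|by rewrite lerD2l].
have tay := rot_taylor 0 t x; rewrite add0r rot0 -/x' in tay.
have XE : jm (X (f x)) = (2 * a) *: (jm x *m Df x) by rewrite Xf // jm_hamiltonian.
have -> : f x' - f x - (q / 2) *: (jm (X (f x)) + jm (X (f x'))) =
    (f x' - f x - (x' - x) *m Df x) + (x' - x - t *: jm x) *m Df x - (q / 2) *: jm (X (f x') - X (f x)).
  rewrite [X in _ = _ + X - _]mulmxBl -scalemxAl.
  have -> : t *: (jm x *m Df x) = q *: jm (X (f x)) by rewrite XE scalerA /t mulrC.
  rewrite jmB; set A := jm (X (f x)); set B := jm (X (f x')).
  have -> : q *: A = (q / 2) *: A + (q / 2) *: A by rewrite -scalerDl; congr (_ *: _); lra.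
  rewrite scalerBr scalerDr; move: (f x' - f x) ((x' - x) *m Df x) ((q / 2) *: A) ((q / 2) *: B) => p1 p2 p3 p4.
  by apply/rowP => i; rewrite !mxE; ring.
apply: le_trans (ler_normB _ _) _; apply: le_trans (lerD (ler_normD _ _) (lexx _)) _.
have b1 : `|f x' - f x - (x' - x) *m Df x| <= K * D ^+ 2 * q ^+ 2.
  apply: le_trans (collar_taylor cm cx cx') _; rewrite -mulrA -exprMn ler_pM2l //.
  by apply: lerXn2r; rewrite ?nnegrE // mulr_ge0 // ltW.
have b2 : `|(x' - x - t *: jm x) *m Df x| <= K * (4 * T ^+ 2 * Xc) * q ^+ 2.
  apply: le_trans (collar_deriv_le cm _ cx) _; rewrite -mulrA ler_pM2l //.
  apply: le_trans tay _; have -> : 4 * T ^+ 2 * Xc * q ^+ 2 = 4 * (T * q) ^+ 2 * Xc by ring.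
  apply: ler_pM => //; first by rewrite mulr_ge0 ?sqr_ge0.
  apply: ler_wpM2l => //; rewrite -(real_normK (num_real t)).
  by apply: lerXn2r; rewrite ?nnegrE // mulr_ge0 // ltW.
have b3 : `|(q / 2) *: jm (X (f x') - X (f x))| <= Lam * K * D * q ^+ 2.
  rewrite normrZ norm_jm ger0_norm ?divr_ge0 ?(ltW q0) //.
  have h1 : `|X (f x') - X (f x)| <= Lam * (K * (D * q)).
    apply: le_trans (Xl _ _) _; rewrite ler_pM2l //.
    by apply: le_trans (collar_lip cm cx cx') _; rewrite ler_pM2l.
  apply: (@le_trans _ _ (q * (Lam * (K * (D * q))))); last by rewrite le_eqVlt; apply/orP; left; apply/eqP; ring.
  by apply: ler_pM => //; [rewrite divr_ge0 // ltW|lra].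
rewrite /c !mulrDl; lra.
Qed.

(* The orbit of the rotation satisfies the trapezoidal scheme of the loop up to an error O(1/N^2) per step,
   which accumulates to O(1/N). *)
Lemma shadow (Lam M : R) : 0 < Lam -> 0 < M -> exists2 E, 0 < E & forall (X : V -> V) (a : R) (x : V) (N : nat) (z : nat -> V),
  (forall u v, `|X v - X u| <= Lam * `|v - u|) -> `|a| <= M ->
  (forall y, n2 y = n2 x -> collar r eta y -> X (f y) = hamiltonian_dir Df a y) -> collar r eta x ->
  (0 < N)%N -> Lam <= N%:R -> z 0%N = f x ->
  (forall l, z l.+1 - z l = (2 * N%:R)^-1 *: jm (X (z l) + X (z l.+1))) ->
  forall l, (l <= N)%N -> `|z l - f (rot (2 * a / N%:R * l%:R) x)| <= E / N%:R.
Proof.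
move=> L0 M0; have [c c0 cP] := shadow_step L0 M0.
exists (2 * c * expR (2 * Lam)) => [|X a x N z Xl aM Xf cx N0 LN z0 zs]; first by rewrite !mulr_gt0 // expR_gt0.
pose q : R := N%:R^-1; have NR : 0 < N%:R :> R by rewrite ltr0n.
have q0 : 0 < q by rewrite invr_gt0.
have qN : q * N%:R = 1 by rewrite mulVf // gt_eqF.
pose y l := f (rot (2 * a / N%:R * l%:R) x).
have cl l : collar r eta (rot (2 * a / N%:R * l%:R) x) by apply: collar_n2 cx; rewrite n2_rot.
have ys l : `|y l.+1 - y l - (2 * N%:R)^-1 *: (jm (X (y l)) + jm (X (y l.+1)))| <= c * q ^+ 2.
  have := cP X a (rot (2 * a / N%:R * l%:R) x) N (n2 x) Xl aM (n2_rot _ _) Xf (cl l) N0.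
  by rewrite -rotD -[X in rot (X + _)]mulr1 -mulrDr nat1r exprVn.
have Lq : Lam * q <= 1 by rewrite ler_pdivrMr // mul1r.
pose d := 2 * c * q ^+ 2; have d0 : 0 < d by rewrite !mulr_gt0 // exprn_gt0.
pose err l := `|z l - y l|.
have step l : err l.+1 <= (1 + 2 * Lam * q) * err l + d.
  have e1 : z l.+1 - y l.+1 = (z l - y l) + (q / 2) *: jm ((X (z l) - X (y l)) + (X (z l.+1) - X (y l.+1))) -
      (y l.+1 - y l - (2 * N%:R)^-1 *: (jm (X (y l)) + jm (X (y l.+1)))).
    have -> : (2 * N%:R)^-1 = q / 2 by rewrite invfM mulrC.
    rewrite !jmD !jmN; set A := jm (X (z l)); set B := jm (X (z l.+1)); set A' := jm (X (y l)); set B' := jm (X (y l.+1)).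
    have -> : z l.+1 = z l + (q / 2) *: (A + B).
      by rewrite -[LHS](subrKC (z l)) zs invfM mulrC jmD.
    rewrite !scalerDr !scalerN; move: ((q / 2) *: A) ((q / 2) *: B) ((q / 2) *: A') ((q / 2) *: B') (z l) (y l) (y l.+1) => p1 p2 p3 p4 p5 p6 p7.
    by apply/rowP => i; rewrite !mxE; ring.
  have e2 : `|(q / 2) *: jm ((X (z l) - X (y l)) + (X (z l.+1) - X (y l.+1)))| <= q / 2 * (Lam * err l + Lam * err l.+1).
    rewrite normrZ norm_jm ger0_norm ?divr_ge0 ?(ltW q0) //; apply: ler_wpM2l; first by rewrite divr_ge0 // ltW.
    by apply: le_trans (ler_normD _ _) _; apply: lerD; exact: Xl.
  have e3 : err l.+1 <= err l + q / 2 * (Lam * err l + Lam * err l.+1) + c * q ^+ 2.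
    rewrite {1}/err e1; apply: le_trans (ler_normB _ _) _; apply: lerD; last exact: ys.
    by apply: le_trans (ler_normD _ _) _; rewrite lerD2l.
  have er0 : 0 <= err l by exact: normr_ge0. have er1 : 0 <= err l.+1 by exact: normr_ge0.
  move: e3 er0 er1 Lq; rewrite /d; move: (err l) (err l.+1) => u v e3 u0 v0 Lq.
  have Lp : 0 < Lam * q by rewrite mulr_gt0.
  move: e3; have -> : q / 2 * (Lam * u + Lam * v) = Lam * q / 2 * (u + v) by ring.
  have cq : 0 <= c * q ^+ 2 by rewrite mulr_ge0 ?sqr_ge0 // ltW.
  have -> : 2 * c * q ^+ 2 = 2 * (c * q ^+ 2) by ring.
  have -> : 1 + 2 * Lam * q = 1 + 2 * (Lam * q) by ring.
  move: Lp Lq cq; move: (Lam * q) (c * q ^+ 2) => g w g0 g1 w0 e3.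
  have g2 : 0 < 1 - g / 2 by lra.
  have k1 : 0 <= u * (g * (1 - g)) by rewrite !mulr_ge0 ?subr_ge0 // ltW.
  have k2 : 0 <= w * (1 - g) by rewrite mulr_ge0 ?subr_ge0.
  rewrite -(ler_pM2l g2); lra.
have claim l : err l <= d * l%:R * expR (2 * Lam * q * l%:R).
  elim: l => [|l IH].
    by rewrite /err /y mulr0 rot0 z0 subrr normr0 mulr0 mul0r.
  apply: le_trans (step l) _; pose g := 2 * Lam * q; rewrite -/g.
  have g0 : 0 <= g by rewrite !mulr_ge0 // ltW.
  have h1 : 1 + g <= expR g by exact: expR_ge1Dx.
  have h2 : 1 <= expR (g * l.+1%:R) by rewrite -expR0 ler_expR mulr_ge0.
  have -> : d * l.+1%:R * expR (g * l.+1%:R) = expR g * (d * l%:R * expR (g * l%:R)) + d * expR (g * l.+1%:R).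
    have -> : expR (g * l.+1%:R) = expR g * expR (g * l%:R) by rewrite -expRD -natr1; congr expR; ring.
    by rewrite -natr1; ring.
  apply: lerD; last by rewrite ler_pMr.
  by apply: ler_pM => //; [rewrite addr_ge0|exact: normr_ge0].
move=> l lN; apply: le_trans (claim l) _.
have lq : l%:R * q <= 1 by rewrite ler_pdivrMr // mul1r ler_nat.
have h1 : expR (2 * Lam * q * l%:R) <= expR (2 * Lam).
  by rewrite ler_expR -mulrA [q * _]mulrC ler_piMr // mulr_ge0 // ltW.
have -> : 2 * c * expR (2 * Lam) / N%:R = (2 * c * q) * expR (2 * Lam) by rewrite -/q; ring.
apply: ler_pM; [by rewrite mulr_ge0 // ltW|exact: expR_ge0| |exact: h1].
have -> : d * l%:R = 2 * c * q * (l%:R * q) by rewrite /d; ring.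
by rewrite ler_piMr // !mulr_ge0 // ltW.
Qed.

Lemma ldens_lip : exists2 c, 0 < c & forall x y : V, collar r eta x -> collar r eta y ->
  `|ldens f Df y - ldens f Df x| <= c * `|y - x|.
Proof.
have [B B0 BP] := collar_image_bounded e0 K0 cm.
pose m : R := (n * 2)%:R; have m0 : 0 <= m by exact: ler0n.
have c1 : 0 <= m * (K * (K * Xc)) by rewrite !mulr_ge0 // ltW.
have c2 : 0 <= m * (B * (K * (1 + Xc))).
  by apply: mulr_ge0 => //; apply: mulr_ge0; [exact: ltW|apply: mulr_ge0; [exact: ltW|rewrite addr_ge0 // ltW]].
exists (m * (K * (K * Xc)) + m * (B * (K * (1 + Xc))) + 1); first by lra.
move=> x y cx cy; rewrite /ldens.
have -> : dot (jm (f y)) (jm y *m Df y) - dot (jm (f x)) (jm x *m Df x) =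
  dot (jm (f y - f x)) (jm y *m Df y) + dot (jm (f x)) (jm y *m Df y - jm x *m Df x).
  by rewrite jmB dotBl dotBr; ring.
apply: le_trans (ler_normD _ _) _.
have h1 : `|dot (jm (f y - f x)) (jm y *m Df y)| <= m * (K * (K * Xc)) * `|y - x|.
  apply: le_trans (dot_le _ _) _; rewrite -/m norm_jm -mulrA; apply: ler_wpM2l => //.
  rewrite mulrAC; apply: ler_pM => //; first exact: (collar_lip cm).
  apply: le_trans (collar_deriv_le cm _ cy) _; rewrite norm_jm ler_pM2l //; exact: collar_bounded.
have h2 : `|dot (jm (f x)) (jm y *m Df y - jm x *m Df x)| <= m * (B * (K * (1 + Xc))) * `|y - x|.
  apply: le_trans (dot_le _ _) _; rewrite -/m norm_jm -!mulrA; apply: ler_wpM2l => //.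
  by apply: ler_pM => //; [exact: BP|rewrite mulrA; exact: turn_lip].
rewrite mulrDl mul1r mulrDl; have := normr_ge0 (y - x); lra.
Qed.

End Shadow.

Lemma periodic_sum (R : realType) (g : nat -> R) (N s : nat) : (forall l, g (l + N)%N = g l) ->
  \sum_(l < N) g (l + s)%N = \sum_(l < N) g l.
Proof.
move=> per; elim: s => [|s IH]; first by apply: eq_bigr => l _; rewrite addn0.
rewrite -IH; case: N per {IH} => [|N] per; first by rewrite !big_ord0.
rewrite big_ord_recr [RHS]big_ord_recl /= addrC; congr (_ + _).
  by rewrite addnC -[(0 + s)%N]/s -(per s) addSnnS.
by apply: eq_bigr => l _; rewrite /bump /= add1n addSnnS.
Qed.

Lemma ev_small (R : realType) (a b : R) : 0 < b -> exists N0 : nat, forall N, (N0 < N)%N -> a * N%:R^-1 < b.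
Proof.
move=> b0; exists (Num.trunc (a / b)) => N hN; have NR : 0 < N%:R :> R by rewrite ltr0n (leq_ltn_trans _ hN).
rewrite ltr_pdivrMr // mulrC -ltr_pdivrMr //; apply: lt_le_trans (truncnS_gt _) _.
by rewrite ler_nat.
Qed.

Lemma average_le (R : realType) (N : nat) (u v : nat -> R) (c : R) : (0 < N)%N ->
  (forall l, (l < N)%N -> `|u l - v l| <= c) ->
  `|N%:R^-1 * \sum_(l < N) u l - N%:R^-1 * \sum_(l < N) v l| <= c.
Proof.
move=> N0 h; have NR : 0 < N%:R :> R by rewrite ltr0n.
rewrite -mulrBr -sumrB normrM gtr0_norm ?invr_gt0 // mulrC ler_pdivrMr //.
apply: le_trans (ler_norm_sum _ _ _) _.
apply: (@le_trans _ _ (\sum_(l < N) c)); first by apply: ler_sum => l _; exact: h.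
by rewrite sumr_const card_ord mulr_natr.
Qed.

(** Here [A] is the action of an orbit of winding [k] at squared radius [rho0], and [u] its position
    across the core. For [k >= 2] the action is at least about [2 p rho - m0], hence about [p rho].
    For [k = 1] the speed is near [p], which is possible only for [u] near 0 or 1: near 0 the action
    is about [p rho], and near 1 it would be negative, because [m0] exceeds [p rho0] by the margin
    in [3 / 2 * eta]. *)
Lemma rigid_arith (R : realType) (p rho rho0 eta m0 u a A k : R) : 2 <= p <= 4 -> 0 < eta -> 50 * eta <= rho ->
  m0 = p * (rho + 3 / 2 * eta) -> `|rho0 - rho| <= eta / 2 -> 0 <= u <= 1 -> a * eta = 6 * (m0 * (u * (1 - u))) ->
  k = 1 \/ 2 <= k -> `|a - p * k| <= 1 / 2 -> `|A - (p * k * rho0 - m0 * smoothstep u)| <= eta / 4 ->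
  0 < A -> rho < A.
Proof.
move=> /andP[p2 p4] e0 er m0E /[!ler_norml]/andP[q1 q2] /andP[u0 u1] aE hk /andP[a1 a2] /andP[A1 A2] A0.
have rp : 0 < rho by lra.
have m1 : 100 * eta <= m0 by rewrite m0E; nra.
have m00 : 0 < m0 by lra.
have pr : p * (rho - eta / 2) <= p * rho0 by rewrite ler_wpM2l //; lra.
have pr2 : p * rho0 <= p * (rho + eta / 2) by rewrite ler_wpM2l //; lra.
have s01 : 0 <= smoothstep u <= 1 by apply: smoothstep01; rewrite u0.
case: hk => hk; last first.
  have h1 : m0 * smoothstep u <= m0 by apply: ler_piMr; [exact: ltW|case/andP: s01].
  have r00 : 0 <= p * rho0 by nra.
  have h2 : 2 * (p * rho0) <= p * k * rho0 by rewrite mulrAC mulrC ler_wpM2l.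
  have hA : 2 * (p * rho0) - m0 - eta / 4 <= A by lra.
  rewrite m0E in hA; have p3 : 2 * (rho - 5 / 2 * eta) <= p * (rho - 5 / 2 * eta) by rewrite ler_wpM2r //; lra.
  lra.
rewrite hk mulr1 in a1 a2 A1 A2.
have a5 : a <= 5 by lra.
have y1 : m0 * (u * (1 - u)) <= 5 / 6 * eta.
  have : a * eta <= 5 * eta by rewrite ler_pM2r.
  rewrite aE; lra.
pose y := u * (1 - u); rewrite -/y in y1; have y0 : 0 <= y by rewrite mulr_ge0 // subr_ge0.
have y2 : y <= 1 / 120.
  have : 100 * eta * y <= m0 * y by rewrite ler_wpM2r.
  move=> h; have : 100 * eta * y <= 5 / 6 * eta by lra.
  rewrite mulrAC ler_pM2r //; lra.
have small v : 0 <= v <= 1 / 2 -> v * (1 - v) = y -> m0 * smoothstep v <= eta / 12.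
  move=> /andP[v0 v1] vy; have v2 : v <= 2 * y by rewrite -vy; nra.
  have h1 : smoothstep v <= 3 * v ^+ 2.
    rewrite /smoothstep; have : 0 <= v ^+ 3 by exact: exprn_ge0.
    lra.
  have h2 : v ^+ 2 <= 4 * y ^+ 2.
    have -> : 4 * y ^+ 2 = (2 * y) ^+ 2 by ring.
    by apply: lerXn2r; rewrite ?nnegrE // mulr_ge0.
  have h3 : m0 * smoothstep v <= m0 * (12 * y ^+ 2) by rewrite ler_pM2l //; lra.
  have -> : eta / 12 = 10 * eta * (1 / 120) by lra.
  have h4 : m0 * (12 * y ^+ 2) = 12 * (m0 * y) * y by ring.
  have h5 : 12 * (m0 * y) * y <= 10 * eta * y by rewrite ler_wpM2r //; lra.
  have h6 : 10 * eta * y <= 10 * eta * (1 / 120) by rewrite ler_pM2l // mulr_gt0.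
  lra.
have [uh|uh] := leP u (1 / 2).
  have h := small u; rewrite u0 uh in h; have {}h := h isT erefl.
  have hA : p * (rho - eta / 2) - eta / 3 <= A by lra.
  have p3 : 2 * (rho - eta / 2) <= p * (rho - eta / 2) by rewrite ler_wpM2r //; lra.
  lra.
have h : m0 * smoothstep (1 - u) <= eta / 12.
  by apply: small; [apply/andP; split; lra|rewrite /y; ring].
have e1 : smoothstep u = 1 - smoothstep (1 - u) by rewrite /smoothstep; ring.
rewrite e1 mulrBr mulr1 in A2.
have hA : A <= p * (rho + eta / 2) - p * (rho + 3 / 2 * eta) + eta / 3 by rewrite -m0E; lra.
have p3 : 2 * eta <= p * eta by rewrite ler_pM2r.
lra.
Qed.

Lemma near_arith (R : realType) (s s1 s2 h c1 c2 c3 d : R) : 0 <= d -> 0 <= c1 -> 0 <= c2 -> 0 <= c3 ->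
  s <= s1 + s2 -> s1 <= c1 * d -> s2 <= c2 * d -> h <= (c2 + c3) * d ->
  2^-1 * s + h <= (c1 + 2 * c2 + c3 + 1) * d.
Proof.
move=> d0 h1 h2 h3; have := mulr_ge0 h1 d0; have := mulr_ge0 h2 d0; have := mulr_ge0 h3 d0.
rewrite !mulrDl mul1r; lra.
Qed.

Lemma large_odd (n1 n2 n3 n4 n5 n6 : nat) : exists N, [/\ odd N, (4 < N)%N &
  [/\ (n1 < N)%N, (n2 < N)%N & [/\ (n3 < N)%N, (n4 < N)%N & (n5 < N)%N /\ (n6 < N)%N]]].
Proof.
exists (n1 + n2 + n3 + n4 + n5 + n6 + 2).*2.+1; split; first by rewrite /= odd_double.
  by lia.
by split; [lia|lia|split; [lia|lia|split; lia]].
Qed.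

Lemma scale_double_eq0 (R : realType) (m : nat) (c : R) (u : 'rV[R]_m) : c != 0 -> c *: (u + u) = 0 -> u = 0.
Proof.
move=> c0 /eqP; rewrite scaler_eq0 (negbTE c0) /= -mulr2n -scaler_nat scaler_eq0 pnatr_eq0 /=.
by move/eqP.
Qed.

Lemma half_cos_lt (R : realType) (u q s c : R) : 0 <= 1 - u -> s / 2 <= q -> (2 - 2 * u) * q < (1 - c) * s -> 0 < s -> c < u.
Proof.
move=> u1 sq h s0; have h1 := ler_wpM2l u1 sq.
have : (1 - u) * s < (1 - c) * s by lra.
by rewrite ltr_pM2r //; lra.
Qed.

Lemma half_dist (R : realType) (a q k e : R) : `|2 * a - 2 * q * k| < e -> `|a - q * k| <= e / 2.
Proof. by move=> /ltW; rewrite !ler_norml => /andP[h1 h2]; apply/andP; split; lra. Qed.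

Lemma half_le (R : realType) (e : R) : 0 < e -> e / 2 <= e.
Proof. lra. Qed.

Lemma collar_upper (R : realType) (q s eta : R) : q - s <= eta / 2 -> 0 < eta -> q <= s + eta + 1.
Proof. lra. Qed.

Lemma one_add_le2 (R : realType) (x e : R) : x <= e -> e <= 1 -> 1 + x <= 2.
Proof. lra. Qed.

Lemma quarter_sum (R : realType) (x y z : R) : x <= z / 4 -> y <= z / 4 -> x + y <= z / 2.
Proof. lra. Qed.

Lemma pos_sum (R : realType) (p q c z : R) : - c <= q -> c <= z / 2 -> z <= p -> 0 < z -> 0 < p + q.
Proof. lra. Qed.

Lemma near_half (R : realType) (q s eta : R) : - (eta / 2) <= q - s -> 50 * eta <= s -> 0 < eta -> s / 2 <= q.
Proof. lra. Qed.

Lemma multiple_bound (R : realType) (a q M e k : R) : - (e / 2) <= a - q -> a <= M -> e <= 1 -> 2 * (k + 1) <= q -> 0 <= k -> k < M + 1.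
Proof. lra. Qed.

Section Rigidity.
Variables (R : realType) (n : nat).
Local Notation V := 'rV[R]_(n * 2).
Variables (j0 : 'I_n) (mu : 'I_n -> R) (C : R).
Hypotheses (n1 : (1 < n)%N) (C0 : 0 < C) (mu0 : forall j, 0 < mu j <= 1) (muj0 : mu j0 = 1).
Local Notation D := (plane_scale mu).
Variables (r eta K : R) (f : V -> V) (Df : V -> 'M[R]_(n * 2)).
Hypotheses (r0 : 0 < r) (e0 : 0 < eta) (K0 : 0 < K) (cm : collar_map r eta K f Df).
Hypotheses (rC : 18 * C <= r ^+ 2) (er : 50 * eta <= r ^+ 2).
Hypothesis fC : forall x, collar r eta x -> n2 (D (f x)) <= C.
Variables (sg : V -> R) (P : V -> V) (l B r1 : R).
Local Notation core z := (exists2 x, collar r (eta / 2) x & f x = z).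
Hypotheses (l0 : 0 < l) (qa : quad_approx l sg P) (sg01 : forall z, 0 <= sg z <= 1).
Hypothesis sf : forall x, collar r eta x -> sg (f x) = step_profile r eta (n2 x) /\
  P (f x) = hamiltonian_dir Df (step_slope r eta (n2 x)) x.
Hypothesis noncore : forall z, ~ core z -> P z = 0 /\ (sg z = 0 \/ sg z = 1).
Hypothesis seg : forall z w : V, (forall t : R, 0 <= t <= 1 -> ~ core (z + t *: (w - z))) -> sg z = sg w.
Hypothesis far : forall z : V, B < `|z| -> sg z = 0.
Hypotheses (r10 : 0 < r1 <= C) (center : forall z, n2 z <= r1 -> sg z = 1).

(** A little more than [pi r ^+ 2], so that an orbit of winding 1 at the outer side of the core has
    negative action. *)
Let m0 : R := pi * (r ^+ 2 + 3 / 2 * eta).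
Let H (z : V) := m0 * (1 - sg z).
Let gH (z : V) := (- m0) *: P z.
Let w (a : R) := - m0 * step_slope r eta a.
Let M := m0 * (2 / eta).
Let Xc := r ^+ 2 + eta + 1.
Let m : R := (n * 2)%:R.
Let X kap (z : V) := gH z + dbarrier mu C kap z.
Let T kap (z : V) := 2^-1 * dot (X kap z) z - (H z + barrier mu C kap z).

Let pi24 : 2 <= (pi : R) <= 4.
Proof. by rewrite pi_ge2 /=; have /andP[_ h] := pihalf_02 R; lra. Qed.

Let m0_big : 100 * eta <= m0 /\ 18 * C < m0.
Proof. have /andP[p2 p4] := pi24; have ep := e0; have h1 := er; have h2 := rC; split; rewrite /m0; nra. Qed.

Let m00 : 0 < m0. Proof. by case: m0_big => h _; have ep := e0; lra. Qed.
Let M0 : 0 < M. Proof. by rewrite mulr_gt0 // divr_gt0. Qed.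
Let Xc0 : 1 < Xc. Proof. by rewrite /Xc; have ep := e0; have := sqr_ge0 r; lra. Qed.
Let mp : 0 <= m. Proof. exact: ler0n. Qed.

Let core_collar (x : V) : collar r (eta / 2) x -> collar r eta x.
Proof. by apply: collar_sub; have ep := e0; lra. Qed.

Let w_bound a : 0 <= w a <= M.
Proof.
have s := step_slope_le0 r a e0; have := prof_le (step_is_profile r e0) a; rewrite ler0_norm // => b.
have mm := m00; rewrite /w mulNr -mulrN mulr_ge0 ?oppr_ge0 ?(ltW mm) //=.
by rewrite /M ler_pM2l.
Qed.

Let gH_image x : collar r eta x -> gH (f x) = hamiltonian_dir Df (w (n2 x)) x.
Proof.
by move=> cx; rewrite /gH; case: (sf cx) => _ ->; rewrite /hamiltonian_dir scalerA /w; congr (_ *: _); ring.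
Qed.

Let X_image kap x : collar r eta x -> X kap (f x) = hamiltonian_dir Df (w (n2 x)) x.
Proof.
by move=> cx; rewrite /X gH_image //; case: (barrier_zero C0 kap (fC cx)) => _ ->; rewrite addr0.
Qed.

Let image_bound a x : 0 <= a <= M -> collar r eta x -> `|hamiltonian_dir Df a x| <= 2 * M * (K * Xc).
Proof.
move=> /andP[a0 a1] cx; rewrite /hamiltonian_dir normrZ norm_jm normrM normrN (ger0_norm a0) ger0_norm //.
apply: ler_pM; [by rewrite mulr_ge0|by []|by rewrite ler_pM2l|].
apply: le_trans (collar_deriv_le cm _ cx) _; rewrite norm_jm ler_pM2l //; exact: collar_bounded.
Qed.

Let MKX : 0 <= 2 * M * (K * Xc).
Proof. by apply: mulr_ge0; apply: mulr_ge0 => //; [exact: ltW|exact: ltW|have := Xc0; lra]. Qed.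

Let gH_bound z : `|gH z| <= 2 * M * (K * Xc).
Proof.
have [[x cx <-]|nz] := pselect (core z).
  by rewrite gH_image ?image_bound ?w_bound //; exact: core_collar.
by rewrite /gH; case: (noncore nz) => -> _; rewrite scaler0 normr0.
Qed.

Let H_quad : quad_approx (m0 * l) H gH.
Proof.
move=> x y; have -> : H y - H x - dot (gH x) (y - x) = - m0 * (sg y - sg x - dot (P x) (y - x)).
  by rewrite /H /gH dotZl; ring.
by rewrite normrM normrN (gtr0_norm m00) -mulrA ler_pM2l //; exact: qa.
Qed.

Let Lq := m0 * l + 200.
Let Lq0 : 0 < Lq. Proof. by rewrite /Lq addr_gt0 // mulr_gt0 // m00. Qed.
Let Lam := 6 * Lq * (m + 1).
Let Lam0 : 0 < Lam. Proof. by rewrite /Lam; apply: mulr_gt0; [exact: mulr_gt0|rewrite ltr_wpDl]. Qed.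

Let X_quad kap : 8 < kap < 9 -> quad_approx Lq (fun z => H z + barrier mu C kap z) (X kap).
Proof.
move=> /andP[k8 k9] x y; have k : 0 < kap <= 9 by apply/andP; split; lra.
have h1 := H_quad x y; have h2 := barrier_quad C0 mu0 k x y.
have -> : H y + barrier mu C kap y - (H x + barrier mu C kap x) - dot (X kap x) (y - x) =
  (H y - H x - dot (gH x) (y - x)) + (barrier mu C kap y - barrier mu C kap x - dot (dbarrier mu C kap x) (y - x)).
  by rewrite /X dotDl; ring.
by apply: le_trans (ler_normD _ _) _; rewrite /Lq mulrDl; lra.
Qed.

Let X_lip kap : 8 < kap < 9 -> forall u v, `|X kap v - X kap u| <= Lam * `|v - u|.
Proof. by move=> k; exact: quad_approx_norm_lip (X_quad k). Qed.

(** The ray from [z] away from the origin stays outside of the cylinder, hence off the core. *)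
Let outside z : C < n2 (D z) -> sg z = 0.
Proof.
move=> hz; have zn : 0 < `|z|.
  rewrite normr_gt0; apply/eqP => z0; move: hz; rewrite z0 (_ : D 0 = 0) /n2 ?dot0l; last first.
    by apply/rowP => i; rewrite !mxE mulr0.
  by move=> h; have := lt_trans h C0; rewrite ltxx.
pose s := `|B| / `|z| + 1; have s0 : 0 <= s by rewrite addr_ge0 // divr_ge0.
rewrite (seg (w := z + s *: z)).
  apply: far; rewrite -{1}[z]scale1r -scalerDl normrZ (ger0_norm (addr_ge0 ler01 s0)).
  have -> : (1 + s) * `|z| = `|B| + 2 * `|z| by rewrite /s; field; rewrite gt_eqF.
  by have := ler_norm B; lra.
move=> t /andP[t0 t1] [x cx fx]; have := fC (core_collar cx); rewrite fx.
rewrite [z + s *: z - z]addrC addKr plane_scaleD !plane_scaleZ.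
by have := n2_ray (D z) t0 s0; lra.
Qed.

(** Inside the region the Hamiltonian vanishes together with the barrier, as the region lies in the
    cylinder. Outside, [m0] outweighs the contribution of the barrier, which is at most [18 C]. *)
Let term_noncore kap z : 8 < kap < 9 -> ~ core z -> T kap z <= 0.
Proof.
move=> /andP[k8 k9] nz; have [Pz [sz|sz]] := noncore nz.
  have k : 0 < kap < 9 by apply/andP; split; lra.
  have := barrier_virial mu C0 z k; rewrite /T /X /gH Pz scaler0 add0r /H sz; case: m0_big => _ mm.
  lra.
have zC : n2 (D z) <= C.
  by rewrite leNgt; apply/negP => /outside; rewrite sz => /eqP; rewrite oner_eq0.
rewrite /T /X /gH Pz scaler0 add0r /H sz; case: (barrier_zero C0 kap zC) => -> ->.
by rewrite dot0l; lra.
Qed.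

Let term_image kap x : collar r eta x -> T kap (f x) = w (n2 x) * ldens f Df x - m0 * smoothstep (band r eta (n2 x)).
Proof.
move=> cx; rewrite /T X_image //; case: (barrier_zero C0 kap (fC cx)) => -> _.
rewrite /H; case: (sf cx) => -> _; rewrite /step_profile /hamiltonian_dir /ldens dotZl dot_jml (dotC (jm (f x))).
by rewrite addr0; field.
Qed.

Let term_near : exists2 LT, 0 < LT & forall kap x y, 8 < kap < 9 -> collar r eta x -> `|y - f x| <= 1 ->
  `|T kap y - T kap (f x)| <= LT * `|y - f x|.
Proof.
have [Bf Bf0 BfP] := collar_image_bounded e0 K0 cm.
pose X1 := 2 * M * (K * Xc); have X10 : 0 <= X1 by exact: MKX.
have Lp := Lam0; have Lqp := Lq0; have mp' := mp.
have t1 : 0 <= m * (Lam * (Bf + 1)) by apply: mulr_ge0 => //; apply: mulr_ge0; lra.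
have t2 : 0 <= m * X1 by apply: mulr_ge0.
have t3 : 0 <= Lq * m by apply: mulr_ge0 => //; exact: ltW.
exists (m * (Lam * (Bf + 1)) + 2 * (m * X1) + Lq * m + 1); first by lra.
move=> kap x y k cx hy; set p := f x; set d := `|y - p| in hy *; have d0 : 0 <= d by exact: normr_ge0.
have xX : `|X kap p| <= X1 by rewrite X_image // image_bound // w_bound.
have yB : `|y| <= Bf + 1.
  have : `|y| <= `|y - p| + `|p| by rewrite -{1}(subrK p y) ler_normD.
  by have := BfP _ cx; rewrite -/p -/d; lra.
have -> : T kap y - T kap p = 2^-1 * (dot (X kap y - X kap p) y + dot (X kap p) (y - p)) -
    ((H y + barrier mu C kap y) - (H p + barrier mu C kap p)) by rewrite /T dotBl dotBr; ring.
have a1 : `|dot (X kap y - X kap p) y| <= m * (Lam * (Bf + 1)) * d.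
  apply: le_trans (dot_le _ _) _; rewrite -/m; apply: (@le_trans _ _ (m * ((Lam * d) * (Bf + 1)))).
    apply: ler_wpM2l => //; apply: ler_pM => //; exact: X_lip.
  by rewrite le_eqVlt; apply/orP; left; apply/eqP; ring.
have a2 : `|dot (X kap p) (y - p)| <= m * X1 * d.
  apply: le_trans (dot_le _ _) _; rewrite -/m; apply: (@le_trans _ _ (m * (X1 * d))); last by rewrite mulrA.
  by apply: ler_wpM2l => //; exact: ler_wpM2r.
have a3 : `|(H y + barrier mu C kap y) - (H p + barrier mu C kap p)| <= (m * X1 + Lq * m) * d.
  have q := X_quad k p y; have nn : Lq * n2 (y - p) <= Lq * m * d.
    rewrite -mulrA ler_pM2l //; apply: le_trans (n2_le _) _; rewrite -/m -/d; apply: ler_wpM2l => //.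
    by rewrite expr2; apply: ler_piMl.
  rewrite mulrDl -[X in `|X|](subrK (dot (X kap p) (y - p))); apply: le_trans (ler_normD _ _) _; lra.
apply: le_trans (ler_normB _ _) _; rewrite normrM (ger0_norm (_ : 0 <= 2^-1)) ?invr_ge0 //.
by apply: (near_arith d0 t1 t2 t3 _ a1 a2 a3); exact: ler_normD.
Qed.

(** A loop of positive action meets the core and therefore shadows a Hopf orbit; as it closes up,
    the angle [2 a] is near some [2 pi k]. An orbit with [k = 0] is too slow to close up unless it
    rests. For [k >= 1], [rigid_arith] puts the action above [r ^+ 2 >= 18 C]. *)
Theorem no_surrounding_sphere : False.
Proof.
have ep := e0; have Kp := K0; have Xp := Xc0; have Mp := M0; have mp' := mp; have mm := m00; have rr := er.
have Xp0 : 0 < Xc := lt_trans ltr01 Xp.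
have r2 : 0 < r ^+ 2 by lra.
have m1 : 1 <= m by rewrite ler1n muln_gt0 (ltnW n1).
have [E E0 shadowP] := shadow e0 K0 cm Lam0 M0.
have [LT LT0 LTP] := term_near.
have [cl cl0 clP] := ldens_lip e0 K0 cm.
have [d d0 dP] := collar_open e0 K0 cm.
(* The constant of [loop_average] depends on the winding number. Since [a <= M], only windings up to
   [Kmax] occur, and [cmax] serves them all. *)
have /choice [cav cavP] : forall k : nat, exists c : R, 0 < c /\ forall (x : V) N, collar r eta x -> (0 < N)%N ->
    `|N%:R^-1 * \sum_(i < N) ldens f Df (rot (2 * pi * k.+1%:R / N%:R * i%:R) x) - n2 x| <= c / N%:R.
  by move=> k; have [c c0 cP] := loop_average n1 e0 K0 cm k; exists c.
pose Kmax := (Num.trunc (M + 1)).+1; pose cmax := \sum_(k < Kmax) cav k.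
have cmaxP k : (k < Kmax)%N -> cav k <= cmax.
  move=> hk; rewrite /cmax (bigD1 (Ordinal hk)) //= lerDl; apply: sumr_ge0 => i _.
  by case: (cavP i) => /ltW.
have cmax0 : 0 < cmax by apply: lt_le_trans (cmaxP 0%N isT); case: (cavP 0%N).
pose kap0 := r ^+ 2 / 2 / (m * (m * K) ^+ 2).
have mK0 : 0 < m * (m * K) ^+ 2 by rewrite mulr_gt0 ?exprn_gt0 ?mulr_gt0 //; lra.
have kap00 : 0 < kap0 by rewrite !divr_gt0.
pose kq := m * (K * (1 + Xc)) * (K * Xc).
have kq0 : 0 < kq by rewrite !mulr_gt0 //; lra.
pose C2 := 4 * M * cl * Xc + Xc + 1; have C20 : 0 < C2.
  by rewrite /C2; repeat first [assumption | done | apply: addr_gt0 | apply: mulr_gt0].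
have [e [ep0 e1 eC eq]] : exists e : R, [/\ 0 < e, e <= 1, C2 * e <= eta / 8 & 4 * kq * Xc * e <= kap0 / 4].
  pose c3 := 4 * kq * Xc; have c30 : 0 < c3 by rewrite !mulr_gt0 //; lra.
  exists (Num.min 1 (Num.min (eta / 8 / C2) (kap0 / 4 / c3))); split.
  - by rewrite !lt_min ltr01 !divr_gt0.
  - by rewrite ge_min lexx.
  - by rewrite mulrC -ler_pdivlMr // ge_min; apply/orP; right; rewrite ge_min lexx.
  - by rewrite mulrC -ler_pdivlMr // ge_min; apply/orP; right; rewrite ge_min lexx orbT.
have [c c1 cosP] := @cos_near1 R e ep0.
have [N1 N1P] := ev_small Lam ltr01.
have [N2 N2P] := ev_small E ltr01.
have [N3 N3P] := ev_small E d0.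
have [N4 N4P] := @ev_small R (LT * E + M * cmax) (eta / 8) (ltac:(lra)).
have [N5 N5P] := @ev_small R (m * (K * E) ^+ 2) ((1 - c) * r ^+ 2) (ltac:(by rewrite mulr_gt0 ?subr_gt0)).
have [N6 N6P] := @ev_small R (kq * (K * E)) (kap0 / 4) (ltac:(lra)).
have [N [oN N4' [M1 M2 [M3 M4 [M5 M6]]]]] := large_odd N1 N2 N3 N4 N5 N6.
have N0 : (0 < N)%N by exact: ltn_trans N4'.
have q1 := N1P N M1; have q2 := N2P N M2; have q3 := N3P N M3; have q4 := N4P N M4.
have q5 := N5P N M5; have q6 := N6P N M6.
have NR : 0 < N%:R :> R by rewrite ltr0n.
have q0 : 0 < N%:R^-1 :> R by rewrite invr_gt0.
have q01 : N%:R^-1 <= 1 :> R by rewrite invf_le1 // ler1n.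
have LN : Lam <= N%:R by move: q1; rewrite ltr_pdivrMr // mul1r => /ltW.
clear N1P N2P N3P N4P N5P N6P.
have lH0 : 0 < m0 * l by rewrite mulr_gt0.
have Hge z : 0 <= H z by rewrite /H mulr_ge0 ?(ltW mm) // subr_ge0; case/andP: (sg01 z).
have Hz z : n2 z <= r1 -> H z = 0 by move=> /center h; rewrite /H h subrr mulr0.
have [kap [z [k89 per rec /andP[A0 A18]]]] := closed_loop C0 mu0 muj0 lH0 H_quad Hge r10 Hz gH_bound oN N4'.
pose A := N%:R^-1 * \sum_(i < N) T kap (z i); rewrite -/A in A0 A18.
have Apos : ~ forall i, (i < N)%N -> T kap (z i) <= 0.
  move=> h; move: A0; rewrite ltNge /A pmulr_rle0 // => /negP; apply.
  by apply: sumr_le0 => i _; exact: h.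
have [l1 [x0 cx0 fx0]] : exists l1, core (z l1).
  by apply: contrapT => no; apply: Apos => i _; apply: term_noncore => // ci; apply: no; exists i.
pose y i := z (i + l1)%N.
have AE : A = N%:R^-1 * \sum_(i < N) T kap (y i).
  by rewrite /A (@periodic_sum R (fun i => T kap (z i)) N l1) // => i; rewrite per.
have cx0' := core_collar cx0.
pose a := w (n2 x0); have /andP[a0 aM] := w_bound (n2 x0); rewrite -/a in a0 aM.
have sh : forall i, (i <= N)%N -> `|y i - f (rot (2 * a / N%:R * i%:R) x0)| <= E / N%:R.
  apply: (shadowP (X kap)) => //; first exact: X_lip.
  - by rewrite ger0_norm.
  - by move=> u un cu; rewrite X_image // un.
  - by move=> i; rewrite /y addSn rec.
pose x i := rot (2 * a / N%:R * i%:R) x0.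
have cx i : collar r eta (x i) by apply: collar_n2 cx0'; rewrite n2_rot.
have x0X : `|x0| <= Xc by exact: collar_bounded.
have shN : `|x N - x0| <= K * E / N%:R.
  apply: le_trans (collar_inv_lip cm cx0' (cx N)) _; rewrite -mulrA ler_pM2l //.
  have := sh N (leqnn _); rewrite /y addnC per -/(x N) -fx0 distrC; exact.
have xN : x N = rot (2 * a) x0 by rewrite /x divfK // gt_eqF.
have n2x0 : r ^+ 2 / 2 <= n2 x0.
  by move: cx0; rewrite /collar /= ler_norml => /andP[h _]; exact: near_half h rr ep.
(* The orbit closes up to [O(1/N)], and the squared chord from [x0] to [rot (2 * a) x0] is
   [(2 - 2 cos (2 a)) n2 x0]. *)
have cos2a : c < cos (2 * a).
  have h1 : n2 (x N - x0) <= m * (K * E / N%:R) ^+ 2.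
    apply: le_trans (n2_le _) _; rewrite -/m; apply: ler_wpM2l => //.
    by apply: lerXn2r; rewrite ?nnegrE // divr_ge0 // mulr_ge0 // ltW.
  have h2 : m * (K * E / N%:R) ^+ 2 <= m * (K * E) ^+ 2 / N%:R.
    rewrite exprMn mulrA; apply: ler_wpM2l; first by rewrite mulr_ge0 ?sqr_ge0.
    by rewrite expr2; apply: ler_piMr => //; exact: ltW.
  have h3 := le_lt_trans (le_trans h1 h2) q5; rewrite xN n2_rotB1 in h3.
  have k1 : 0 <= 1 - cos (2 * a) by rewrite subr_ge0 cos_le1.
  by apply: half_cos_lt k1 n2x0 h3 _; rewrite exprn_gt0.
have [k kP] := cosP (2 * a) (mulr_ge0 (ler0n _ 2) a0) cos2a.
have near1 i : (i <= N)%N -> `|y i - f (x i)| <= 1.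
  by move=> h; apply: le_trans (sh i h) (ltW q2).
have turn s t i : (i <= N)%N -> `|s - t| <= e -> `|rot (s / N%:R * i%:R) x0 - rot (t / N%:R * i%:R) x0| <= 4 * e * Xc.
  move=> iN st; have iq : 0 <= (N%:R^-1 * i%:R : R) <= 1 by rewrite mulr_ge0 ?(ltW q0) //= mulrC ler_pdivrMr // mul1r ler_nat.
  have dst : `|s / N%:R * i%:R - t / N%:R * i%:R| <= e.
    rewrite -!mulrA -mulrBl normrM [X in _ * X]ger0_norm; last by case/andP: iq.
    by apply: le_trans st; apply: ler_piMr => //; case/andP: iq.
  apply: le_trans (rot_lipschitz _ _ _) _.
  have -> : 4 * e * Xc = 2 * e * 2 * Xc by ring.
  apply: ler_pM; [by rewrite !mulr_ge0 ?addr_ge0|by []| |exact: x0X].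
  apply: ler_pM; [by rewrite mulr_ge0|by rewrite addr_ge0|by rewrite ler_pM2l|exact: one_add_le2 dst e1].
case: k kP => [|k] kP.
  (* Winding 0: the loop stays near [f x0], so each velocity is a nonnegative multiple of a vector
     with positive component along [w0]. The velocities of a closed loop sum to zero under the
     trapezoidal rule; thus all vanish, and no term of the action is positive. *)
  rewrite mulr0 subr0 in kP; apply: Apos.
  pose w0 := jm x0 *m Df x0.
  have w0X : `|w0| <= K * Xc.
    by apply: le_trans (collar_deriv_le cm _ cx0') _; rewrite norm_jm ler_pM2l.
  have nw0 : kap0 <= n2 w0.
    rewrite /kap0 ler_pdivrMr //; apply: le_trans n2x0 _; apply: le_trans (n2_le _) _; rewrite -/m.
    have h1 := @symplectic_lower _ _ K (Df x0) (jm x0) K0 (fun u v => collar_symplectic cm u v cx0')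
      (fun v => collar_deriv_le cm v cx0'); rewrite norm_jm -/w0 -/m in h1.
    have -> : n2 w0 * (m * (m * K) ^+ 2) = m * ((m * K) ^+ 2 * n2 w0) by ring.
    apply: ler_wpM2l => //; apply: (@le_trans _ _ ((m * K * `|w0|) ^+ 2)).
      by apply: lerXn2r; rewrite ?nnegrE // !mulr_ge0 // ltW.
    by rewrite exprMn; apply: ler_wpM2l; [exact: sqr_ge0|exact: norm_sqr_le].
  have pos i : (i < N)%N -> exists2 xi, collar r eta xi & f xi = y i /\ 0 < dot (jm xi *m Df xi) w0.
    move=> iN; have iN' := ltnW iN.
    have cxi : collar r (eta / 2) (x i) by apply: collar_n2 cx0; rewrite n2_rot.
    have [xi cxi' fxi] := dP (x i) (y i) cxi (le_lt_trans (sh i iN') q3).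
    exists xi => //; split=> //.
    have h1 : `|xi - x i| <= K * (E / N%:R).
      by apply: le_trans (collar_inv_lip cm (cx i) cxi') _; rewrite ler_pM2l // fxi; exact: sh.
    have h2 : `|x i - x0| <= 4 * e * Xc.
      have := turn (2 * a) 0 i iN'; rewrite subr0 !mul0r rot0; apply; exact: ltW.
    have h3 : `|xi - x0| <= K * (E / N%:R) + 4 * e * Xc.
      by rewrite -(subrK (x i) xi) -addrA; apply: le_trans (ler_normD _ _) _; exact: lerD.
    have h4 := turn_lip K0 cm cx0' cxi'; rewrite -/w0 -/Xc in h4.
    have h5 : `|dot (jm xi *m Df xi - w0) w0| <= kq * (K * (E / N%:R) + 4 * e * Xc).
      apply: le_trans (dot_le _ _) _; rewrite -/m /kq.
      have -> : m * (K * (1 + Xc)) * (K * Xc) * (K * (E / N%:R) + 4 * e * Xc) =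
        m * (K * (1 + Xc) * (K * (E / N%:R) + 4 * e * Xc) * (K * Xc)) by ring.
      apply: ler_wpM2l => //; apply: ler_pM => //.
      apply: le_trans h4 _; apply: ler_wpM2l => //.
      by apply: mulr_ge0; [exact: ltW|apply: addr_ge0; [exact: ler01|exact: ltW]].
    have h6 : kq * (K * (E / N%:R) + 4 * e * Xc) <= kap0 / 2.
      have -> : kq * (K * (E / N%:R) + 4 * e * Xc) = kq * (K * E) / N%:R + 4 * kq * Xc * e by ring.
      exact: quarter_sum (ltW q6) eq.
    have -> : dot (jm xi *m Df xi) w0 = n2 w0 + dot (jm xi *m Df xi - w0) w0 by rewrite dotBl -/(n2 w0); ring.
    move: h5; rewrite ler_norml => /andP[h5 _]; exact: pos_sum h5 h6 nw0 kap00.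
  have sumX : \sum_(i < N) jm (X kap (y i)) = 0.
    have t1 : \sum_(i < N) (y i.+1 - y i) = 0.
      rewrite -(big_mkord xpredT (fun i => y i.+1 - y i)) telescope_sumr //.
      by rewrite /y addnC per add0n subrr.
    have t2 : \sum_(i < N) (y i.+1 - y i) = (2 * N%:R)^-1 *: (\sum_(i < N) jm (X kap (y i)) + \sum_(i < N) jm (X kap (y i.+1))).
      by rewrite -big_split /= scaler_sumr; apply: eq_bigr => i _; rewrite /y addSn rec jmD.
    have t3 : \sum_(i < N) jm (X kap (y i.+1)) = \sum_(i < N) jm (X kap (y i)).
      case: (N) per => [|N'] per'; first by rewrite !big_ord0.
      rewrite big_ord_recr [RHS]big_ord_recl /= addrC; congr (_ + _).
      by rewrite /y addnC per' add0n.
    rewrite t3 in t2; rewrite t2 in t1; apply: scale_double_eq0 t1.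
    by rewrite invr_eq0 mulf_eq0 !pnatr_eq0 (gtn_eqF N0).
  have jX i (xi : V) : collar r eta xi -> f xi = y i -> jm (X kap (y i)) = (2 * w (n2 xi)) *: (jm xi *m Df xi).
    by move=> c' <-; rewrite X_image // jm_hamiltonian.
  have all0 i : (i < N)%N -> dot (jm (X kap (y i))) w0 = 0.
    have ge i' : (i' < N)%N -> 0 <= dot (jm (X kap (y i'))) w0.
      move=> /pos [xi c' [f' p']]; rewrite (jX _ _ c' f') dotZl mulr_ge0 ?(ltW p') //.
      by rewrite mulr_ge0 //; case/andP: (w_bound (n2 xi)).
    move=> iN; have : \sum_(i < N) dot (jm (X kap (y i))) w0 = 0.
      by rewrite -dot_suml sumX dot0l.
    move/eqP; rewrite psumr_eq0 => [/allP h|j _]; last by apply: ge; exact: ltn_ord.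
    by have := h (Ordinal iN); rewrite mem_index_enum => /(_ isT) /= /eqP.
  have Ty i : (i < N)%N -> T kap (y i) <= 0.
    move=> iN; have [xi c' [f' p']] := pos i iN; have := all0 i iN.
    rewrite (jX _ _ c' f') dotZl => /eqP; rewrite mulf_eq0 (gt_eqF p') orbF mulf_eq0 pnatr_eq0 /= => /eqP wz.
    rewrite -f' term_image // wz mul0r sub0r oppr_le0 mulr_ge0 ?(ltW mm) //.
    by have /andP[] := smoothstep01 (ramp01 ((n2 xi - r ^+ 2 + eta / 2) / eta)).
  exfalso; move: A0; rewrite AE ltNge pmulr_rle0 // => /negP; apply.
  by apply: sumr_le0 => i _; exact: Ty.
(* The orbit with the exact total angle, to which [loop_average] applies; it is within [O(e)] of the
   shadowed one. *)
pose x' i := rot (2 * pi * k.+1%:R / N%:R * i%:R) x0.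
have cx' i : collar r eta (x' i) by apply: collar_n2 cx0'; rewrite n2_rot.
pose rho0 := n2 x0; pose h0 := m0 * smoothstep (band r eta rho0).
have pk : `|a - pi * k.+1%:R| <= e / 2.
  exact: half_dist kP.
have kK : (k < Kmax)%N.
  have /andP[p2 _] := pi24; rewrite -(ltr_nat R); apply: lt_trans (truncnS_gt (M + 1)).
  have kr : k.+1%:R = k%:R + 1 :> R by rewrite -natr1.
  move: pk; rewrite ler_norml => /andP[h1 h2].
  have h3 : 2 * (k%:R + 1) <= pi * k.+1%:R :> R by rewrite -kr ler_wpM2r.
  exact: multiple_bound h1 aM e1 h3 (ler0n R k).
have est1 : `|A - (a * (N%:R^-1 * \sum_(i < N) ldens f Df (x' i)) - h0)| <= LT * E / N%:R + M * cl * (4 * e * Xc).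
  have -> : a * (N%:R^-1 * \sum_(i < N) ldens f Df (x' i)) - h0 = N%:R^-1 * \sum_(i < N) (a * ldens f Df (x' i) - h0).
    rewrite sumrB sumr_const card_ord -mulr_sumr mulrBr mulrCA; congr (_ - _).
    by rewrite -[X in _ = _ * X]mulr_natl mulKf // gt_eqF.
  rewrite AE; apply: (@average_le R N (fun i => T kap (y i)) (fun i => a * ldens f Df (x' i) - h0)) => // i iN.
  have iN' := ltnW iN.
  have s1 := LTP kap (x i) (y i) k89 (cx i) (near1 i iN').
  have s1' : LT * `|y i - f (x i)| <= LT * E / N%:R by rewrite -mulrA ler_pM2l //; exact: sh.
  have s2 : T kap (f (x i)) = a * ldens f Df (x i) - h0 by rewrite term_image // /x n2_rot.
  have s3 : `|a * ldens f Df (x i) - a * ldens f Df (x' i)| <= M * cl * (4 * e * Xc).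
    rewrite -mulrBr normrM (ger0_norm a0) -mulrA; apply: ler_pM => //.
    apply: le_trans (clP _ _ (cx' i) (cx i)) _; rewrite ler_pM2l //.
    by apply: turn => //; apply: ltW; move: kP; rewrite mulrA.
  rewrite -(subrK (T kap (f (x i))) (T kap (y i))) -addrA; apply: le_trans (ler_normD _ _) _.
  apply: lerD; first exact: le_trans s1 s1'.
  by rewrite s2 opprB addrA subrK.
have est2 : `|a * (N%:R^-1 * \sum_(i < N) ldens f Df (x' i)) - a * rho0| <= M * cmax / N%:R.
  rewrite -mulrBr normrM (ger0_norm a0) -mulrA; apply: ler_pM => //.
  case: (cavP k) => _ h; apply: le_trans (h x0 N cx0' N0) _.
  by rewrite ler_wpM2r ?(ltW q0) //; exact: cmaxP.
have rho0X : 0 <= rho0 <= Xc.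
  rewrite n2_ge0 /=; move: cx0; rewrite /collar /= ler_norml => /andP[_ h]; exact: collar_upper h ep.
have est3 : `|a * rho0 - pi * k.+1%:R * rho0| <= e * Xc.
  rewrite -mulrBl normrM [X in _ * X]ger0_norm; last by case/andP: rho0X.
  apply: ler_pM; [exact: normr_ge0|by case/andP: rho0X| |by case/andP: rho0X].
    exact: le_trans pk (half_le ep0).
have est : `|A - (pi * k.+1%:R * rho0 - h0)| <= eta / 4.
  have -> : A - (pi * k.+1%:R * rho0 - h0) = (A - (a * (N%:R^-1 * \sum_(i < N) ldens f Df (x' i)) - h0)) +
    (a * (N%:R^-1 * \sum_(i < N) ldens f Df (x' i)) - a * rho0) + (a * rho0 - pi * k.+1%:R * rho0) by ring.
  have z1 : LT * E / N%:R + M * cmax / N%:R <= eta / 8 by rewrite -mulrDl ltW.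
  have z2 : M * cl * (4 * e * Xc) + e * Xc <= eta / 8.
    apply: le_trans eC; rewrite /C2 -subr_ge0.
    by rewrite [X in 0 <= X](_ : _ = e); [exact: ltW|ring].
  apply: le_trans (ler_normD _ _) _; apply: le_trans (lerD (ler_normD _ _) (lexx _)) _.
  apply: le_trans (lerD (lerD est1 est2) est3) _.
  have -> : eta / 4 = eta / 8 + eta / 8 by field.
  rewrite [leLHS](_ : _ = (LT * E / N%:R + M * cmax / N%:R) + (M * cl * (4 * e * Xc) + e * Xc)); first exact: lerD.
  by ring.
have := @rigid_arith R pi (r ^+ 2) rho0 eta m0 (band r eta rho0) a A k.+1%:R pi24 e0 er erefl.
have c0' : `|rho0 - r ^+ 2| <= eta / 2 by exact: cx0.
have b01 : 0 <= band r eta rho0 <= 1 by exact: ramp01.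
have aE : a * eta = 6 * (m0 * (band r eta rho0 * (1 - band r eta rho0))).
  by rewrite /a /w /step_slope -/rho0; field; rewrite gt_eqF.
have kk : k.+1%:R = 1 :> R \/ 2 <= k.+1%:R :> R.
  by case: (k) => [|k']; [left|right; rewrite (ler_nat R 2)].
have ph : `|a - pi * k.+1%:R| <= 1 / 2 by apply: le_trans pk _; rewrite ler_pM2r ?invr_gt0.
move=> /(_ c0' b01 aE kk ph est A0) rA; by have := lt_le_trans (lt_le_trans rA A18) rC; rewrite ltxx.
Qed.

End Rigidity.

(** * Smoothness and the isotopy of the boundary *)

Section CkAlgebra.
Variables (R : realType) (V : normedModType R).
Implicit Types (D : set V) (k : nat).

Lemma differentiable_near0 (W : normedModType R) (h : V -> W) (x : V) :
  (\forall y \near x, h y = 0) -> differentiable h x /\ forall v, 'd h x v = 0.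
Proof.
move=> h0; have hx : h x = 0 by exact: nbhs_singleton h0.
have exp : h \o shift x = cst (h x) + (\0 : {linear V -> W}) +o_ (0 : V) id.
  apply/eqaddoP => e e0; have h1 : \forall y \near (0 : V), h (y + x) = 0.
    have c : (y + x) @[y --> (0 : V)] --> x.
      by rewrite -[in X in _ --> X](add0r x); apply: cvgD; [exact: cvg_id|exact: cvg_cst].
    exact: c _ h0.
  apply: filterS h1 => y hy /=; rewrite /= !fctE /= hy hx addr0 subrr normr0 mulr_ge0 //; exact: ltW.
have c0 : continuous (\0 : {linear V -> W}) by move=> y; exact: cvg_cst.
have e0 := diff_unique c0 exp.
split; last by move=> v; rewrite e0.
by apply/diff_locallyP; rewrite e0.
Qed.

Lemma differentiable_near (W : normedModType R) (f g : V -> W) (x : V) : (\forall y \near x, f y = g y) ->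
  differentiable f x -> differentiable g x /\ forall v, 'D_v g x = 'D_v f x.
Proof.
move=> fg df; pose h := g - f; have h0 : \forall y \near x, h y = 0.
  by apply: filterS fg => y e; rewrite /h !fctE e subrr.
have [dh h1] := differentiable_near0 h0.
have gE : g = f + h by apply/funext => y; rewrite /h !fctE subrKC.
clearbody h.
have dg : differentiable g x by rewrite gE; exact: differentiableD.
split=> // v; have e := congr1 (fun q : V -> W => q v) (diffD df dh).
rewrite (deriveE v dg) (deriveE v df) -[RHS]addr0 -(h1 v).
by move: e; rewrite -gE.
Qed.

(** Openness of [D] makes equality on [D] a local property, so that directional derivatives agree as
    well. *)
Lemma Ck_ext (W : normedModType R) k D (f g : V -> W) : open D -> (forall x, D x -> f x = g x) ->
  Ck_on k D f -> Ck_on k D g.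
Proof.
move=> oD; elim: k f g => [|k IH] f g fg.
  move=> hf x Dx; have nb : \forall y \near x, f y = g y.
    by apply: filterS (open_nbhs_nbhs (conj oD Dx)) => y; exact: fg.
  rewrite /prop_for /continuous_at -fg //; apply: cvg_trans (hf x Dx).
  exact: near_eq_cvg.
move=> [df dfk]; have nb x : D x -> \forall y \near x, f y = g y.
  by move=> Dx; apply: filterS (open_nbhs_nbhs (conj oD Dx)) => y; exact: fg.
split=> [x Dx|v]; first by case: (differentiable_near (nb x Dx) (df x Dx)).
apply: IH (dfk v) => x Dx; by case: (differentiable_near (nb x Dx) (df x Dx)) => _ ->.
Qed.

Lemma Ck_sub (W : normedModType R) k D D' (f : V -> W) : D' `<=` D -> Ck_on k D f -> Ck_on k D' f.
Proof.
move=> DD; elim: k f => [|k IH] f; first by move=> h x /DD; exact: h.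
by move=> [h1 h2]; split=> [x /DD|v]; [exact: h1|exact: IH (h2 v)].
Qed.

Lemma Ck_mono (W : normedModType R) k D (f : V -> W) : Ck_on k.+1 D f -> Ck_on k D f.
Proof.
elim: k f => [|k IH] f [h1 h2]; first by move=> x Dx; exact: differentiable_continuous (h1 x Dx).
by split=> // v; exact: IH.
Qed.

Lemma Ck_cst (W : normedModType R) k D (w : W) : Ck_on k D (fun=> w).
Proof.
elim: k w => [|k IH] w; first by move=> x _; exact: cvg_cst.
split=> [x _|v]; first exact: (differentiable_cst w).
rewrite (_ : 'D_v (fun=> w) = fun=> 0) //; apply/funext => x; exact: derive_cst.
Qed.

Lemma Ck_lin (W : normedModType R) k D (f : {linear V -> W}) : continuous f -> Ck_on k D f.
Proof.
case: k => [|k] cf; first by move=> x _; exact: cf.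
split=> [x _|v]; first exact: linear_differentiable.
rewrite (_ : 'D_v f = fun=> f v); first exact: Ck_cst.
by apply/funext => x; rewrite deriveE ?diff_lin //; exact: linear_differentiable.
Qed.

Lemma Ck_add (W : normedModType R) k D (f g : V -> W) : open D -> Ck_on k D f -> Ck_on k D g ->
  Ck_on k D (fun x => f x + g x).
Proof.
move=> oD; elim: k f g => [|k IH] f g; first by move=> hf hg x Dx; apply: cvgD; [exact: hf|exact: hg].
move=> [f1 f2] [g1 g2]; split=> [x Dx|v]; first exact: (differentiableD (f1 x Dx) (g1 x Dx)).
apply: Ck_ext (IH _ _ (f2 v) (g2 v)) => // x Dx.
by rewrite -(deriveD (diff_derivable (f1 x Dx)) (diff_derivable (g1 x Dx))).
Qed.

Lemma Ck_mul k D (f g : V -> R) : open D -> Ck_on k D f -> Ck_on k D g -> Ck_on k D (fun x => f x * g x).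
Proof.
move=> oD; elim: k f g => [|k IH] f g; first by move=> hf hg x Dx; apply: cvgM; [exact: hf|exact: hg].
move=> hf hg; have [f1 f2] := hf; have [g1 g2] := hg.
split=> [x Dx|v]; first exact: (differentiableM (f1 x Dx) (g1 x Dx)).
have h1 := IH _ _ (Ck_mono hf) (g2 v); have h2 := IH _ _ (Ck_mono hg) (f2 v).
apply: Ck_ext (Ck_add oD h1 h2) => // x Dx.
by rewrite -/(f * g) (deriveM (diff_derivable (f1 x Dx)) (diff_derivable (g1 x Dx))).
Qed.

Lemma Ck_inv k D (f : V -> R) : open D -> (forall x, D x -> f x != 0) -> Ck_on k D f -> Ck_on k D (fun x => (f x)^-1).
Proof.
move=> oD nz; elim: k => [|k IH]; first by move=> hf x Dx; apply: cvgV; [exact: nz|exact: hf].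
move=> hf; have [f1 f2] := hf; have i1 := IH (Ck_mono hf).
split=> [x Dx|v]; first exact: (differentiableV (f1 x Dx) (nz x Dx)).
have h := Ck_mul oD (Ck_cst k D (-1 : R)) (Ck_mul oD (Ck_mul oD i1 i1) (f2 v)).
apply: Ck_ext h => // x Dx.
rewrite (deriveV (nz x Dx) (diff_derivable (f1 x Dx))) mulN1r -exprVn expr2 scaleNr; reflexivity.
Qed.

Lemma Ck_scalel (W : normedModType R) k D (f : V -> R) (w : W) : open D -> Ck_on k D f -> Ck_on k D (fun x => f x *: w).
Proof.
move=> oD; elim: k f => [|k IH] f; first by move=> hf x Dx; apply: cvgZr_tmp; exact: hf.
move=> [f1 f2]; split=> [x Dx|v]; first exact: (differentiableZl w (f1 x Dx)).
apply: Ck_ext (IH _ (f2 v)) => // x Dx.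
rewrite (deriveE v (f1 x Dx)) (deriveE v (differentiableZl w (f1 x Dx))) diffZl //; exact: f1.
Qed.

Lemma Ck_sum (W : normedModType R) (T : Type) (s : seq T) k D (F : T -> V -> W) : open D ->
  (forall i, Ck_on k D (F i)) -> Ck_on k D (fun x => \sum_(i <- s) F i x).
Proof.
move=> oD H; elim: s => [|i s IH].
  by apply: Ck_ext (Ck_cst k D 0) => // x _; rewrite big_nil.
by apply: Ck_ext (Ck_add oD (H i) IH) => // x _; rewrite big_cons.
Qed.

Lemma Ck_rV (q : nat) k D (f : V -> 'rV[R]_q) : open D -> (forall i, Ck_on k D (fun x => f x 0 i)) -> Ck_on k D f.
Proof.
move=> oD H; apply: Ck_ext (@Ck_sum 'rV[R]_q _ (index_enum 'I_q) k D (fun i x => f x 0 i *: delta_mx 0 i) oD _) => // [x _|i].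
  by rewrite -row_sum_delta.
exact: Ck_scalel.
Qed.

End CkAlgebra.

Lemma Ck_coord (R : realType) (q : nat) (k : nat) (D : set 'rV[R]_q) (i : 'I_q) : Ck_on k D (fun x : 'rV[R]_q => x 0 i).
Proof.
have @f : {linear 'rV[R]_q -> R}.
  by exists (fun N : 'rV[R]_q => N 0 i); do 2![eexists]; do ?[constructor];
    rewrite ?mxE // => ? *; rewrite ?mxE //; move=> ?; rewrite !mxE.
have : Ck_on k D f by apply: Ck_lin; exact: coord_continuous_rV.
exact.
Qed.

Lemma Ck_coord_snd (R : realType) (q : nat) (k : nat) (D : set (R^o * 'rV[R]_q)) (i : 'I_q) :
  Ck_on k D (fun p : R^o * 'rV[R]_q => p.2 0 i : R).
Proof.
have @f : {linear (R^o * 'rV[R]_q)%type -> R}.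
  by exists (fun p : R^o * 'rV[R]_q => p.2 0 i); do 2![eexists]; do ?[constructor];
    rewrite ?mxE // => ? *; rewrite ?mxE //; move=> ?; rewrite !mxE.
have : Ck_on k D f.
  by apply: Ck_lin => p; apply: (@continuous_comp _ _ _ snd (fun x : 'rV[R]_q => x 0 i)); [exact: cvg_snd|exact: coord_continuous_rV].
exact.
Qed.

Lemma Ck_fst (R : realType) (W : normedModType R) (k : nat) (D : set (R^o * W)) : Ck_on k D (fun p : R^o * W => p.1 : R).
Proof.
have @f : {linear (R^o * W)%type -> R}.
  by exists (fun p : R^o * W => p.1); do 2![eexists]; do ?[constructor].
have : Ck_on k D f by apply: Ck_lin => p; exact: cvg_fst.
exact.
Qed.

Lemma Ck_set0 (R : realType) (V W : normedModType R) (k : nat) (f : V -> W) : Ck_on k set0 f.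
Proof. by elim: k f => [|k IH] f; [move=> x|split=> [x|v]; [|exact: IH]]. Qed.

Lemma open_sublevel (R : realType) (V : normedModType R) (f : V -> R) (a : R) :
  Ck_on 0 [set: V] f -> open [set x | f x < a].
Proof.
move=> h; apply: (@open_comp _ _ f [set x | x < a]); last exact: open_lt.
by move=> x _; exact: h x I.
Qed.

(** * The model of the boundary: two concentric spheres *)

Section TwoSpheres.
Variables (R : realType) (d : nat) (s1 s2 : R).
Hypotheses (s10 : 0 < s1) (s12 : s1 < s2).
Local Notation E := 'rV[R]_d.+1.
Local Notation W := 'rV[R]_d.
Implicit Types (b e : bool) (w : W) (u : E).

Definition radius b := if b then s2 else s1.
Definition pole e : R := if e then 1 else -1.

Lemma radius_gt0 b : 0 < radius b.
Proof. by case: b => //=; exact: lt_trans s12. Qed.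

Lemma pole2 e : pole e * pole e = 1.
Proof. by case: e; rewrite /= ?mulr1 // mulrNN mulr1. Qed.

(* Stereographic projection of the sphere of radius [radius b] from the point [pole e * radius b] of the
   first axis, rescaled by the radius, and its inverse. *)
Definition stereo b e u : W := \row_k (u 0 (lift ord0 k) / (radius b - pole e * u 0 ord0)).
Definition unstereo b e w : E := \row_i
  (if unlift ord0 i is Some k then 2 * radius b * w 0 k / (n2 w + 1) else pole e * radius b * (n2 w - 1) / (n2 w + 1)).

Lemma n2_split u : n2 u = u 0 ord0 ^+ 2 + \sum_k u 0 (lift ord0 k) ^+ 2.
Proof. by rewrite /n2 /dot big_ord_recl expr2; congr (_ + _); apply: eq_bigr => k _; rewrite expr2. Qed.

Lemma n2_sumsq w : n2 w = \sum_k w 0 k ^+ 2.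
Proof. by apply: eq_bigr => k _; rewrite expr2. Qed.

Lemma unstereo0 b e w : unstereo b e w 0 ord0 = pole e * radius b * (n2 w - 1) / (n2 w + 1).
Proof. by rewrite mxE unlift_none. Qed.

Lemma unstereoS b e w k : unstereo b e w 0 (lift ord0 k) = 2 * radius b * w 0 k / (n2 w + 1).
Proof. by rewrite mxE liftK. Qed.

Lemma den_gt0 w : 0 < n2 w + 1.
Proof. by rewrite ltr_wpDl // n2_ge0. Qed.

Lemma n2_unstereo b e w : n2 (unstereo b e w) = radius b ^+ 2.
Proof.
rewrite n2_split unstereo0; under eq_bigr => k _ do rewrite unstereoS.
have D0 : n2 w + 1 != 0 by rewrite gt_eqF // den_gt0.
have -> : \sum_k (2 * radius b * w 0 k / (n2 w + 1)) ^+ 2 = (2 * radius b / (n2 w + 1)) ^+ 2 * n2 w.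
  by rewrite n2_sumsq mulr_sumr; apply: eq_bigr => k _; field.
move: (n2 w) D0 => q D0; have -> : (pole e * radius b * (q - 1) / (q + 1)) ^+ 2 = (pole e * pole e) * (radius b * (q - 1) / (q + 1)) ^+ 2 by field.
by rewrite pole2; field.
Qed.

Lemma stereo_den b e w : radius b - pole e * unstereo b e w 0 ord0 = 2 * radius b / (n2 w + 1).
Proof.
have D0 : n2 w + 1 != 0 by rewrite gt_eqF // den_gt0.
rewrite unstereo0 [pole e * _](_ : _ = (pole e * pole e) * (radius b * (n2 w - 1) / (n2 w + 1))); last by field.
by rewrite pole2; field.
Qed.

Lemma unstereoK b e w : stereo b e (unstereo b e w) = w.
Proof.
apply/rowP => k; rewrite mxE stereo_den unstereoS.
have D0 : n2 w + 1 != 0 by rewrite gt_eqF // den_gt0.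
have r0 : radius b != 0 by rewrite gt_eqF // radius_gt0.
by field; rewrite D0 r0.
Qed.

Lemma stereoK b e u : n2 u = radius b ^+ 2 -> pole e * u 0 ord0 < radius b -> unstereo b e (stereo b e u) = u.
Proof.
move=> nu pu; set t := radius b - pole e * u 0 ord0; have t0 : 0 < t by rewrite subr_gt0.
have tn : t != 0 by rewrite gt_eqF.
have r0 := radius_gt0 b; have rn : radius b != 0 by rewrite gt_eqF.
have q1 : n2 (stereo b e u) = (radius b + pole e * u 0 ord0) / t.
  rewrite n2_sumsq (eq_bigr (fun k => t^-1 ^+ 2 * u 0 (lift ord0 k) ^+ 2)) => [|k _]; last first.
    by rewrite mxE -/t exprMn mulrC.
  rewrite -mulr_sumr; have -> : \sum_k u 0 (lift ord0 k) ^+ 2 = t * (radius b + pole e * u 0 ord0).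
    have := nu; rewrite n2_split /t => h.
    have -> : (radius b - pole e * u 0 ord0) * (radius b + pole e * u 0 ord0) = radius b ^+ 2 - (pole e * pole e) * u 0 ord0 ^+ 2 by ring.
    rewrite pole2 -h; ring.
  by field.
have q2 : n2 (stereo b e u) + 1 = 2 * radius b / t by rewrite q1 /t; field; rewrite -/t.
apply/rowP => i; rewrite mxE q2; case: unliftP => [k ->|->].
  by rewrite mxE -/t; field; rewrite tn rn.
rewrite q1; have -> : pole e * radius b * ((radius b + pole e * u 0 ord0) / t - 1) = radius b * (2 * (pole e * pole e) * u 0 ord0) / t.
  by rewrite /t; field; rewrite -/t.
by rewrite pole2; field; rewrite tn rn.
Qed.

Definition on_spheres : pred E := fun u => (n2 u == s1 ^+ 2) || (n2 u == s2 ^+ 2).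
(** The parameter manifold of the isotopy carries both boundary components at once, with the
    topology induced from the ambient space. *)
Definition two_spheres := initial_topology (fun x : {u : E | on_spheres u} => val x).
Definition emb (x : two_spheres) : E := val (x : {u : E | on_spheres u}).

Lemma emb_inj : injective emb. Proof. exact: val_inj. Qed.

Lemma emb_continuous : continuous emb.
Proof. exact: (@initial_continuous _ _ (fun x : {u : E | on_spheres u} => val x)). Qed.

Lemma emb_open (A : set two_spheres) : open A -> exists2 B : set E, open B & emb @^-1` B = A.
Proof. by move=> [B oB BA]; exists B. Qed.

Lemma emb_sphere (x : two_spheres) : n2 (emb x) = s1 ^+ 2 \/ n2 (emb x) = s2 ^+ 2.
Proof. by have /orP[/eqP h|/eqP h] := valP (x : {u : E | on_spheres u}); [left|right]. Qed.

Lemma continuous_into (T : topologicalType) (g : T -> two_spheres) (t : T) :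
  {for t, continuous (emb \o g)} -> {for t, continuous g}.
Proof.
move=> h A; rewrite nbhsE => -[B [oB Bt] BA].
have [B' oB' B'B] := emb_open oB.
have nB : nbhs (emb (g t)) B' by apply: open_nbhs_nbhs; split=> //; have := Bt; rewrite -B'B.
have h' : nbhs t ((emb \o g) @^-1` B') by exact: h nB.
suff : nbhs t (g @^-1` A) by [].
by apply: filterS h' => y hy; apply: BA; rewrite -B'B.
Qed.

Lemma two_spheres_hausdorff : hausdorff_space two_spheres.
Proof.
move=> x y cl; apply: emb_inj; apply: (@norm_hausdorff R E) => A B nA nB.
have [z [za zb]] := cl _ _ (emb_continuous nA) (emb_continuous nB).
by exists (emb z).
Qed.

Lemma two_spheres_compact : compact [set: two_spheres].
Proof.
move=> F FF _; pose G := emb @ F; have GF : ProperFilter G by exact: fmap_proper_filter.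
pose S : set E := [set u | n2 u = s1 ^+ 2] `|` [set u | n2 u = s2 ^+ 2].
have cS : compact S.
  apply: bounded_closed_compact; last first.
    apply: closedU; apply: (@closed_comp _ _ (@n2 R d.+1) [set _]) => [u _|]; try exact: n2_continuous; exact: closed_eq.
  exists (s1 ^+ 2 + s2 ^+ 2 + 1); split; first exact: num_real.
  move=> M hM u hu; apply: ltW; apply: le_lt_trans hM.
  have nn := norm_sqr_le u; have n0 := normr_ge0 u; have a1 := sqr_ge0 s1; have a2 := sqr_ge0 s2.
  by case: hu => /= e; rewrite e in nn; nra.
have GS : G S.
  have : F (emb @^-1` S) by apply: filterS filterT => x _; case: (emb_sphere x); [left|right].
  exact.
have [p [Sp cp]] := cS G GF GS.
have [q qp] : exists q, emb q = p.
  have hp : on_spheres p by case: Sp => e; have {}e : n2 p = _ := e; rewrite /on_spheres e eqxx ?orbT.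
  by exists (exist _ p hp : {u : E | on_spheres u}).
exists q; split=> // A B FA; rewrite nbhsE => -[B' [oB' B'q] B'B].
have [B2 oB2 e2] := emb_open oB'.
have n2' : nbhs p B2 by rewrite -qp; apply: open_nbhs_nbhs; split=> //; have := B'q; rewrite -e2.
have GA : G (emb @` A).
  by suff : F (emb @^-1` (emb @` A)) by []; apply: filterS FA => x Ax; exists x.
have [z [[x Ax xz] zB]] := cp _ _ GA n2'.
by exists x; split=> //; apply: B'B; rewrite -e2 /= xz.
Qed.

(** A level between the spheres, so that each chart domain meets only one of them. *)
Let mid := (s1 ^+ 2 + s2 ^+ 2) / 2.
Let sq12 : s1 ^+ 2 < s2 ^+ 2.
Proof. by have a := s10; have b := s12; nra. Qed.

Definition stereo_dom (i : bool * bool) : set E :=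
  [set u | (if i.1 then mid < n2 u else n2 u < mid) /\ pole i.2 * u 0 ord0 < radius i.1].

Lemma stereo_dom_radius i (x : two_spheres) : stereo_dom i (emb x) -> n2 (emb x) = radius i.1 ^+ 2.
Proof.
have s := sq12; case: i => [[] e] [/= h _]; case: (emb_sphere x) => k; rewrite k /mid in h *; lra.
Qed.

Lemma radius_dom i u : n2 u = radius i.1 ^+ 2 -> pole i.2 * u 0 ord0 < radius i.1 -> stereo_dom i u.
Proof. by have s := sq12; case: i => [[] e] /= h k; split=> //=; rewrite h /mid /=; lra. Qed.

Lemma stereo_dom_open i : open (stereo_dom i).
Proof.
apply: openI; last first.
  apply: open_sublevel; apply: Ck_mul; [exact: openT|exact: Ck_cst|exact: Ck_coord].
case: i.1; [apply: (@open_comp _ _ (@n2 R d.+1) [set x | mid < x]); last exact: open_gt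
  |apply: (@open_comp _ _ (@n2 R d.+1) [set x | x < mid]); last exact: open_lt];
  by move=> u _; exact: n2_continuous.
Qed.

Lemma unstereo_on i w : on_spheres (unstereo i.1 i.2 w).
Proof. by rewrite /on_spheres n2_unstereo; case: i.1; rewrite eqxx ?orbT. Qed.

Definition param_at i w : two_spheres := exist _ (unstereo i.1 i.2 w) (unstereo_on i w) : {u : E | on_spheres u}.

Lemma emb_param i w : emb (param_at i w) = unstereo i.1 i.2 w. Proof. by []. Qed.

Lemma param_dom i w : stereo_dom i (emb (param_at i w)).
Proof.
apply: radius_dom; first exact: n2_unstereo.
rewrite emb_param -subr_gt0 stereo_den divr_gt0 ?den_gt0 //.
by rewrite mulr_gt0 // radius_gt0.
Qed.

Definition chart_at i (x : two_spheres) : W := stereo i.1 i.2 (emb x).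

Lemma chart_atK i x : stereo_dom i (emb x) -> param_at i (chart_at i x) = x.
Proof. by move=> h; apply: emb_inj; rewrite emb_param stereoK ?(stereo_dom_radius h) //; case: h. Qed.

Lemma chart_image i : chart_at i @` [set x | stereo_dom i (emb x)] = setT.
Proof.
apply/seteqP; split=> // w _; exists (param_at i w); first exact: param_dom.
by rewrite /chart_at emb_param unstereoK.
Qed.

Lemma Ck_unstereo (V : normedModType R) k (D : set V) (g : V -> W) i j : open D ->
  (forall l, Ck_on k D (fun x => g x 0 l)) -> Ck_on k D (fun x => unstereo i.1 i.2 (g x) 0 j).
Proof.
move=> oD hg; have cn : Ck_on k D (fun x => n2 (g x)).
  by apply: Ck_sum => // l; exact: Ck_mul.
have ci : Ck_on k D (fun x => (n2 (g x) + 1)^-1).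
  apply: Ck_inv => // [x _|]; first by rewrite gt_eqF // den_gt0.
  by apply: Ck_add => //; exact: Ck_cst.
case: (unliftP ord0 j) => [l ->|->].
  rewrite (_ : (fun x => _) = fun x => (2 * radius i.1 * g x 0 l) * (n2 (g x) + 1)^-1).
    by apply: Ck_mul => //; apply: Ck_mul => //; exact: Ck_cst.
  by apply/funext => x; rewrite unstereoS.
rewrite (_ : (fun x => _) = fun x => (pole i.2 * radius i.1 * (n2 (g x) + -1)) * (n2 (g x) + 1)^-1).
  apply: Ck_mul => //; apply: Ck_mul => //; first exact: Ck_cst.
  by apply: Ck_add => //; exact: Ck_cst.
by apply/funext => x; rewrite unstereo0.
Qed.

Lemma Ck_stereo (V : normedModType R) k (D : set V) (g : V -> E) i : open D ->
  (forall l, Ck_on k D (fun x => g x 0 l)) -> (forall x, D x -> pole i.2 * g x 0 ord0 < radius i.1) ->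
  Ck_on k D (fun x => stereo i.1 i.2 (g x)).
Proof.
move=> oD hg hD; apply: Ck_rV => // l.
rewrite (_ : (fun x => _) = fun x => g x 0 (lift ord0 l) * (radius i.1 + (- pole i.2) * g x 0 ord0)^-1); last first.
  by apply/funext => x; rewrite mxE mulNr.
apply: Ck_mul => //; apply: Ck_inv => // [x Dx|]; first by rewrite gt_eqF // mulNr subr_gt0 hD.
by apply: Ck_add => //; [exact: Ck_cst|apply: Ck_mul => //; exact: Ck_cst].
Qed.

Lemma stereo_continuous i u : pole i.2 * u 0 ord0 < radius i.1 -> {for u, continuous (stereo i.1 i.2)}.
Proof.
move=> hu; pose D : set E := [set v | pole i.2 * v 0 ord0 < radius i.1].
have oD : open D.
  apply: open_sublevel; apply: Ck_mul; [exact: openT|exact: Ck_cst|exact: Ck_coord].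
exact: (@Ck_stereo E 0 D id i oD (fun l => Ck_coord 0 D l) (fun x Dx => Dx) u hu).
Qed.

Lemma unstereo_continuous i : continuous (unstereo i.1 i.2).
Proof.
move=> w; have h : Ck_on 0 setT (unstereo i.1 i.2).
  by apply: Ck_rV => [|j]; [exact: openT|apply: (@Ck_unstereo W 0 setT id i j openT) => l; exact: Ck_coord].
exact: h w I.
Qed.

(** Charts of different spheres do not overlap; on one sphere the transition is a composition of
    rational maps with nonvanishing denominators. *)
Lemma transition_smooth_at i j :
  smooth_on (chart_at i @` ([set x | stereo_dom i (emb x)] `&` [set x | stereo_dom j (emb x)])) (chart_at j \o param_at i).
Proof.
move=> k; have [ij|ij] := eqVneq i.1 j.1; last first.
  rewrite (_ : _ @` _ = set0); first exact: Ck_set0.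
  apply/seteqP; split=> // w [x [hi hj] _]; have s := sq12.
  have := stereo_dom_radius hi; rewrite (stereo_dom_radius hj) => e; move: ij e.
  by case: i.1; case: j.1 => //= _ e; lra.
pose D : set W := [set w | pole j.2 * unstereo i.1 i.2 w 0 ord0 < radius j.1].
have oD : open D.
  apply: open_sublevel; apply: Ck_mul; [exact: openT|exact: Ck_cst|].
  by apply: (@Ck_unstereo W 0 setT id i ord0 openT) => l; exact: Ck_coord.
apply: (@Ck_sub _ _ _ _ D).
  by move=> w [x [hi [_ hj]] <-]; rewrite /D /= -emb_param chart_atK.
apply: (@Ck_stereo W k D (unstereo i.1 i.2) j oD) => // l.
by apply: (@Ck_unstereo W k D id i l oD) => q; exact: Ck_coord.
Qed.

Definition spheres_manifold : closed_manifold R d.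
Proof.
refine (@ClosedManifold R d two_spheres (bool * bool)%type (fun i => [set x | stereo_dom i (emb x)]) chart_at param_at
  two_spheres_hausdorff two_spheres_compact _ _ _ chart_atK _ _ transition_smooth_at).
- apply/seteqP; split=> // x _; pose b := mid < n2 (emb x).
  pose e := emb x 0 ord0 <= 0.
  exists (b, e) => //; have s := sq12.
  have rb : n2 (emb x) = radius b ^+ 2.
    by rewrite /b; case: (emb_sphere x) => ->; rewrite /mid /=; case: ltP => h //=; lra.
  apply: radius_dom => //; have r0 := radius_gt0 b.
  suff : pole e * emb x 0 ord0 < radius b by [].
  rewrite /e /pole; have [h|h] := leP (emb x 0 ord0) 0; first by rewrite mul1r; exact: le_lt_trans r0.
  by rewrite mulN1r; apply: lt_trans r0; rewrite oppr_lt0.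
- move=> i; apply: (@open_comp _ _ emb (stereo_dom i)); last exact: stereo_dom_open.
  by move=> x _; exact: emb_continuous.
- by move=> i; rewrite chart_image; exact: openT.
- move=> i x hx; apply: (@continuous_comp _ _ _ emb (stereo i.1 i.2)); first exact: emb_continuous.
  by apply: stereo_continuous; case: hx.
- by move=> i u _; apply: continuous_into; exact: unstereo_continuous.
Defined.

Section Isotopy.
Variable lam : R -> E.
Hypothesis lam_gt0 : forall (e : R) i, 0 < lam e 0 i.
Hypothesis lam_Ck : forall k i, Ck_on k [set: R^o * W] (fun p : R^o * W => lam p.1 0 i : R).

Definition stretch (e : R) u : E := \row_i (lam e 0 i * u 0 i).
Definition shrink (e : R) u : E := \row_i ((lam e 0 i)^-1 * u 0 i).

Lemma stretchK (e : R) u : shrink e (stretch e u) = u.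
Proof. by apply/rowP => i; rewrite !mxE mulKf // gt_eqF. Qed.

Lemma shrinkK (e : R) u : stretch e (shrink e u) = u.
Proof. by apply/rowP => i; rewrite !mxE mulVKf // gt_eqF. Qed.

Lemma stretch_continuous (e : R) : continuous (stretch e).
Proof.
move=> u; have h : Ck_on 0 setT (stretch e).
  apply: Ck_rV => [|i]; first exact: openT.
  rewrite (_ : (fun x => _) = fun x : E => lam e 0 i * x 0 i); last by apply/funext => x; rewrite mxE.
  by apply: Ck_mul; [exact: openT|exact: Ck_cst|exact: Ck_coord].
exact: h u I.
Qed.

Lemma shrink_continuous (e : R) : continuous (shrink e).
Proof.
move=> u; have h : Ck_on 0 setT (shrink e).
  apply: Ck_rV => [|i]; first exact: openT.
  rewrite (_ : (fun x => _) = fun x : E => (lam e 0 i)^-1 * x 0 i); last by apply/funext => x; rewrite mxE.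
  by apply: Ck_mul; [exact: openT|exact: Ck_cst|exact: Ck_coord].
exact: h u I.
Qed.

(** In a chart the map has the left inverse [stereo] after [shrink], differentiable near the image;
    hence its differential is injective. *)
Theorem spheres_isotopy : smooth_isotopy (fun (e : R) (x : spheres_manifold) => stretch e (emb x)).
Proof.
split=> [i k|e e01].
  apply: (@Ck_sub _ _ _ _ setT) => //; apply: Ck_rV => [|j]; first exact: openT.
  rewrite (_ : (fun x => _) = fun p : R^o * W => lam p.1 0 j * unstereo i.1 i.2 p.2 0 j); last first.
    by apply/funext => p; rewrite mxE.
  apply: Ck_mul; [exact: openT|exact: lam_Ck|].
  apply: (@Ck_unstereo _ k setT (fun p : R^o * W => p.2) i j openT) => l; exact: Ck_coord_snd.
have sm i k : Ck_on k [set: W] ((fun x : spheres_manifold => stretch e (emb x)) \o param_at i).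
  apply: Ck_rV => [|j]; first exact: openT.
  rewrite (_ : (fun x => _) = fun w : W => lam e 0 j * unstereo i.1 i.2 w 0 j); last first.
    by apply/funext => p; rewrite mxE.
  apply: Ck_mul; [exact: openT|exact: Ck_cst|].
  by apply: (@Ck_unstereo _ k setT id i j openT) => l; exact: Ck_coord.
split.
- by move=> i k; apply: Ck_sub (sm i k).
- move=> i w v _ dv; set f := (X in 'd X w v = 0) in dv.
  have [df _] := sm i 1%N; have {df} dfw : differentiable f w by exact: df w I.
  pose D : set E := [set u | pole i.2 * shrink e u 0 ord0 < radius i.1].
  have oD : open D.
    apply: open_sublevel; apply: Ck_mul; [exact: openT|exact: Ck_cst|].
    rewrite (_ : (fun x => _) = fun x : E => (lam e 0 ord0)^-1 * x 0 ord0); last by apply/funext => x; rewrite mxE.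
    by apply: Ck_mul; [exact: openT|exact: Ck_cst|exact: Ck_coord].
  pose g u := stereo i.1 i.2 (shrink e u).
  have cg : Ck_on 1 D g.
    apply: (@Ck_stereo E 1 D (shrink e) i oD) => // l.
    rewrite (_ : (fun x => _) = fun x : E => (lam e 0 l)^-1 * x 0 l); last by apply/funext => x; rewrite mxE.
    by apply: Ck_mul => //; [exact: Ck_cst|exact: Ck_coord].
  have dgf : differentiable g (f w).
    case: cg => h _; apply: h; rewrite /D /f /= stretchK; by case: (param_dom i w).
  have gf : g \o f = id.
    by apply/funext => x; rewrite /g /f /= stretchK emb_param unstereoK.
  have := diff_comp dfw dgf; rewrite gf => e2; have := congr1 (fun q : W -> W => q v) e2.
  by rewrite /= dv linear0 -deriveE ?derive_id.
- split.
  + apply: continuous_subspaceT => x; apply: (@continuous_comp _ _ _ emb (stretch e)); [exact: emb_continuous|exact: stretch_continuous].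
  + by move=> x y _ _ /(congr1 (shrink e)); rewrite !stretchK => /emb_inj.
  + move=> A /emb_open [B oB BA]; exists (shrink e @^-1` B).
      by apply: (@open_comp _ _ (shrink e) B) => // u _; exact: shrink_continuous.
    apply/seteqP; split=> [_ [x [_ Ax] <-]|_ [[x _ <-] Bx]].
      by split; [exists x|rewrite /= stretchK; move: Ax; rewrite -BA].
    by exists x => //; split=> //; rewrite -BA /=; move: Bx; rewrite /= stretchK.
Qed.

End Isotopy.

End TwoSpheres.

(** * The capacity of ellipsoidal shells *)

Section BallBump.
Variables (R : realType) (m : nat).
Local Notation E := 'rV[R]_m.

Definition ball_bump (s t : R) (x : E) : R := ramp ((t - n2 x) / (t - s)).

Lemma ball_bump01 s t x : 0 <= ball_bump s t x <= 1.
Proof. exact: ramp01. Qed.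

Lemma ball_bump1 (s t : R) x : s < t -> n2 x <= s -> ball_bump s t x = 1.
Proof. by move=> st h; rewrite /ball_bump ramp_eq1 // ler_pdivlMr ?subr_gt0 // mul1r lerB. Qed.

Lemma ball_bump0 (s t : R) x : s < t -> t <= n2 x -> ball_bump s t x = 0.
Proof. by move=> st h; rewrite /ball_bump ramp_eq0 // mulr_le0_ge0 ?subr_le0 // invr_ge0 subr_ge0 ltW. Qed.

Lemma ball_bump_homo (s t s' t' : R) x : s < t -> t <= s' -> s' < t' -> ball_bump s t x <= ball_bump s' t' x.
Proof.
move=> st ts st'; have [h|h] := leP (n2 x) s'.
  by rewrite (ball_bump1 st' h); case/andP: (ball_bump01 s t x).
by rewrite (ball_bump0 st (ltW (le_lt_trans ts h))); case/andP: (ball_bump01 s' t' x).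
Qed.

Lemma ball_bump_near (s t : R) (x y : E) : 0 < t -> s < t -> `|y - x| <= 1 -> n2 x < t ->
  `|ball_bump s t y - ball_bump s t x| <= m%:R * (2 * t + 3) / (t - s) * `|y - x|.
Proof.
move=> t0 st d1 xt; have u0 : 0 < t - s by rewrite subr_gt0.
apply: le_trans (ramp_lip _ _) _.
rewrite -mulrBl normrM (gtr0_norm (_ : 0 < (t - s)^-1)) ?invr_gt0 //.
rewrite mulrAC; apply: ler_wpM2r; first by rewrite invr_ge0 ltW.
have -> : t - n2 y - (t - n2 x) = - (n2 y - n2 x) by ring.
rewrite normrN; apply: le_trans (n2_diff_le x y) _.
apply: ler_wpM2r; first exact: normr_ge0.
apply: ler_wpM2l; first exact: ler0n.
have x0 := normr_ge0 x; have hx : `|x| <= t + 1.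
  have h := le_lt_trans (norm_sqr_le x) xt.
  by rewrite leNgt; apply/negP => h2; nra.
have hy : `|y| <= `|x| + 1.
  by rewrite -(subrK x y) addrC; apply: le_trans (ler_normD _ _) _; rewrite lerD2l.
lra.
Qed.

Lemma ball_bump_lip_cs (s t : R) : 0 < t -> s < t -> lip_cs (ball_bump s t).
Proof.
move=> t0 st; pose c := m%:R * (2 * t + 3) / (t - s); have u0 : 0 < t - s by rewrite subr_gt0.
have c0 : 0 <= c by rewrite /c; apply: mulr_ge0; [apply: mulr_ge0; [exact: ler0n|lra]|rewrite invr_ge0 ltW].
apply: (@lip_csI R m _ (c + 1) (t + 1)) => [x y|x hx].
  have d0 := normr_ge0 (y - x).
  have [d1|d1] := leP (`|y - x|) 1; last first.
    apply: le_trans (_ : 1 <= _).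
      rewrite ler_norml; have /andP[a1 a2] := ball_bump01 s t x; have /andP[a3 a4] := ball_bump01 s t y.
      by apply/andP; split; lra.
    by apply: le_trans (ltW d1) _; apply: ler_peMl => //; rewrite lerDr.
  apply: le_trans (_ : c * `|y - x| <= _); last by apply: ler_wpM2r => //; rewrite lerDl.
  have [h|h] := ltP (n2 x) t; first exact: ball_bump_near.
  have [h'|h'] := ltP (n2 y) t.
    by rewrite (distrC (ball_bump s t y)) (distrC y); apply: ball_bump_near => //; rewrite distrC.
  by rewrite !ball_bump0 // subrr normr0 mulr_ge0.
apply: ball_bump0 => //; apply: le_trans (norm_sqr_le x); apply: ltW; have x0 := normr_ge0 x; nra.
Qed.

(** Pigeonhole: the increments [I (g j.+1) - I (g j)] for [j < J] add up to at most
    [I (ball_bump 4 5)], so one of them is below [d]. The function [g j.+1 - g j] is 1 between the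
    levels [2 j + 1] and [2 j + 2]. *)
Lemma thin_annulus (I : (E -> R) -> R) (d : R) : inv_int I -> 0 < d ->
  exists (be al : R) (w : E -> R), [/\ 1 <= be, be < al <= 3, lip_cs w, forall x, 0 <= w x &
    (forall x, be <= n2 x <= al -> w x = 1) /\ I w < d].
Proof.
move=> hI d0; have cs45 : lip_cs (ball_bump 4 5) by apply: ball_bump_lip_cs; lra.
pose T := I (ball_bump 4 5); have T0 : 0 <= T.
  by apply: inv_int_ge0 => // x; case/andP: (ball_bump01 4 5 x).
pose J := (Num.trunc (T / d)).+1; have J0 : 0 < J%:R :> R by rewrite ltr0n.
have TJ : T < d * J%:R by rewrite mulrC -ltr_pdivrMr //; exact: truncnS_gt.
pose c (i : nat) : R := 1 + i%:R / J%:R.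
have c_lt i : c i < c i.+1 by rewrite /c ltrD2l ltr_pM2r ?invr_gt0 // ltr_nat.
have c1 i : 1 <= c i by rewrite /c lerDl divr_ge0 // ler0n.
have c4 i : (i <= J.*2.+1)%N -> c i <= 4.
  move=> h; have : i%:R / J%:R <= 3 :> R; last by rewrite /c => h2; lra.
  rewrite ler_pdivrMr // -natrM ler_nat; apply: leq_trans h _.
  by rewrite -muln2 /J; lia.
pose g i : E -> R := ball_bump (c i.*2) (c i.*2.+1).
have gcs i : lip_cs (g i) by apply: ball_bump_lip_cs => //; exact: lt_le_trans (c1 _).
have [j [jJ hj]] : exists j, (j < J)%N /\ I (g j.+1) - I (g j) < d.
  apply: contrapT => N; have hN j : (j < J)%N -> d <= I (g j.+1) - I (g j).
    by move=> h; rewrite leNgt; apply/negP => h2; apply: N; exists j.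
  have := telescope_sumr (fun j => I (g j)) (leq0n J) => e.
  have h1 : d * J%:R <= I (g J) - I (g 0%N).
    rewrite -e big_mkord mulr_natr -[X in _ *+ X](card_ord J) -sumr_const.
    by apply: ler_sum => j _; apply: hN.
  have h2 : I (g J) <= T.
    by apply: inv_int_le => // x; apply: ball_bump_homo => //; [exact: c4|lra].
  have h3 : 0 <= I (g 0%N) by apply: inv_int_ge0 => // x; case/andP: (ball_bump01 (c 0.*2) (c 0.*2.+1) x).
  lra.
exists (c j.*2.+1), (c j.*2.+2), (fun x => g j.+1 x - g j x); split=> //.
- apply/andP; split=> //; have : (j.*2.+2)%:R / J%:R <= 2 :> R; last by rewrite /c => h2; lra.
  by rewrite ler_pdivrMr // -natrM ler_nat; move: jJ; rewrite -muln2; lia.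
- exact: lip_csB.
- by move=> x; rewrite subr_ge0; apply: ball_bump_homo => //; rewrite ?doubleS //; exact: ltW.
split; last by rewrite inv_intB.
move=> x /andP[h1 h2]; rewrite /g doubleS ball_bump1 // ball_bump0 ?subr0 //.
Qed.

End BallBump.

Section Embeddings.
Variables (R : realType) (n : nat).
Local Notation V := 'rV[R]_(n * 2).
Variables (I : (V -> R) -> R) (hI : inv_int I) (I1 : 1 <= I (plateau 1)).

Lemma of_xyE (x : 'I_n -> R) j b : of_xy x x 0 (mxvec_index j b) = x j.
Proof. by rewrite /of_xy mxvecE mxE if_same. Qed.

Lemma plane_scaleM (a b : 'I_n -> R) (v : V) : plane_scale a (plane_scale b v) = plane_scale (fun j => a j * b j) v.
Proof. by apply: xy_ext => j; rewrite ?xc_plane ?yc_plane ?xc_plane ?yc_plane mulrA. Qed.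

Lemma plane_scale1 (a : 'I_n -> R) (v : V) : (forall j, a j = 1) -> plane_scale a v = v.
Proof. by move=> a1; apply: xy_ext => j; rewrite ?xc_plane ?yc_plane a1 mul1r. Qed.

Lemma matrix_id (A : 'M[R]_(n * 2)) : (forall u : V, u *m A = u) -> A = 1%:M.
Proof. by move=> h; apply/row_matrixP => i; rewrite !rowE h mulmx1. Qed.

(* Exchanging two symplectic planes is symplectic and conjugates the scaling to its inverse. *)
Lemma swap_scale_int (g : 'I_n -> R) (i j : 'I_n) : (forall k, g k * g (tperm i j k) = 1) ->
  forall phi : V -> R, lip_cs phi -> lip_cs (fun x => phi (plane_scale g x)) /\ I (fun x => phi (plane_scale g x)) = I phi.
Proof.
move=> g1 phi cphi; pose t := tperm i j.
pose S (v : V) : V := of_xy (fun k => xc (t k) v) (fun k => yc (t k) v).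
have xS k v : xc k (S v) = xc (t k) v by exact: xc_of_xy.
have yS k v : yc k (S v) = yc (t k) v by exact: yc_of_xy.
have [As hS] : exists A : 'M[R]_(n * 2), forall u, S u = u *m A.
  apply: linear_as_matrix => [u v|a u]; apply: xy_ext => k.
  - by rewrite xcD !xS xcD.
  - by rewrite ycD !yS ycD.
  - by rewrite xcZ !xS xcZ.
  - by rewrite ycZ !yS ycZ.
have [Ag hg] : exists A : 'M[R]_(n * 2), forall u, plane_scale g u = u *m A.
  by apply: linear_as_matrix => [u v|a u]; [exact: plane_scaleD|exact: plane_scaleZ].
have sS u v : dot (jm (u *m As)) (v *m As) = dot (jm u) v.
  rewrite -!hS -!omega_dot /omega_st [RHS](reindex_inj (@perm_inj _ t)) /=.
  by apply: eq_bigr => k _; rewrite !xS !yS.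
have [uS vS] := vol_scale_symplectic hI I1 sS.
have gSg (u : V) : u *m ((Ag *m As) *m (Ag *m As)) = u.
  rewrite !mulmxA -!hS -!hg; apply: xy_ext => k.
    by rewrite xS xc_plane xS xc_plane /t tpermK mulrA [_ * g k]mulrC g1 mul1r.
  by rewrite yS yc_plane yS yc_plane /t tpermK mulrA [_ * g k]mulrC g1 mul1r.
have e1 := matrix_id gSg; have [u1 _] := mulmx1_unit e1.
have ug : Ag \in unitmx by move: u1; rewrite unitmx_mul => /andP[].
have d2 : vol_scale I Ag * vol_scale I Ag = 1.
  have := vol_scaleM hI I1 u1 u1; rewrite e1 vol_scale1 // vol_scaleM // vS mulr1 => <-.
  by [].
have d0 := vol_scale_ge0 hI I1 ug.
have d1 : vol_scale I Ag = 1 by move: (vol_scale I Ag) d2 d0 => d d2 d0; nra.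
rewrite (_ : (fun x => phi (plane_scale g x)) = fun x => phi (x *m Ag)); last by apply/funext => x; rewrite hg.
by split; [exact: lip_cs_mulmx|rewrite vol_scaleP // d1 mul1r].
Qed.

Lemma collar_map_sub (r eta eta' K : R) (f : V -> V) (Df : V -> 'M[R]_(n * 2)) : eta' <= eta ->
  collar_map r eta K f Df -> collar_map r eta' K f Df.
Proof.
move=> ee [h1 h2 h3 h4 h5 h6]; have s (x : V) : collar r eta' x -> collar r eta x by exact: collar_sub.
split=> [x y /s cx /s cy|x y v /s cx /s cy|x v /s cx|x u v /s cx|x y /s cx /s cy|x y /s cx /s cy].
- exact: h1.
- exact: h2.
- exact: h3.
- exact: h4.
- exact: h5.
- exact: h6.
Qed.

(** The translated bump lives on a ball of radius 1/20 whose centre has norm 7/10: inside the unit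
    ball and disjoint from the ball of squared radius 1/5 that carries [phi]. *)
Lemma disjoint_bump (phi psi v' : V -> R) (c x : V) : n2 c = 49 / 100 -> 
  (forall y, 0 <= phi y <= 1) -> (forall y, 1 / 5 <= n2 y -> phi y = 0) ->
  (forall y, 0 <= v' y <= 1) -> (forall y, 1 / 400 < n2 y -> v' y = 0) ->
  phi x + v' (x + c) <= 1 /\ (1 < n2 x -> phi x + v' (x + c) = 0).
Proof.
move=> nc p01 p0 v01 v0; have [h|h] := ltP (1 / 400) (n2 (x + c)).
  rewrite (v0 _ h) addr0; split; first by case/andP: (p01 x).
  by move=> hx; apply: p0; lra.
have h1 : n2 c <= 2 * n2 (x + c) + 2 * n2 x.
  by rewrite -[X in n2 X <= _](_ : (x + c) + (- x) = c) ?[n2 x in _ + _]n2N -?(n2N x); [exact: n2D_le|rewrite addrC addKr].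
have h2 : n2 x <= 2 * n2 (x + c) + 2 * n2 c.
  by rewrite -[X in n2 X <= _](_ : (x + c) + (- c) = x) -?(n2N c); [exact: n2D_le|rewrite addrK].
rewrite p0 ?add0r; last by lra.
by split=> [|hx]; [case/andP: (v01 (x + c))|exfalso; lra].
Qed.

Variables (g : 'I_n -> R) (be al : R) (w v : V -> R).
Hypothesis g_int : forall phi : V -> R, lip_cs phi ->
  lip_cs (fun x => phi (plane_scale g x)) /\ I (fun x => phi (plane_scale g x)) = I phi.
Hypotheses (n1 : (1 < n)%N) (be1 : 1 <= be) (beal : be < al).
Hypotheses (wcs : lip_cs w) (w0 : forall x, 0 <= w x) (w1 : forall x, be <= n2 x <= al -> w x = 1).
Hypotheses (vcs : lip_cs v) (v01 : forall x, 0 <= v x <= 1) (v0 : forall x, 1 / 100 < n2 x -> v x = 0).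
Hypothesis wv : I w < I v.

Definition shell : set V := [set z | be < n2 (plane_scale g z) < al].

Let n2_scaleZ a z : n2 (plane_scale g (a *: z)) = a ^+ 2 * n2 (plane_scale g z).
Proof. by rewrite plane_scaleZ n2Z. Qed.

(* The ball bounded by the sphere has at most the volume of the shell if the sphere does not surround the hole,
   and at least the volume of the hole if it does. *)
Lemma sphere_dichotomy (r : R) : 0 < r -> sphere_embeds r shell ->
  r ^+ 2 < 1 / 90 \/ 1 / 17 < r ^+ 2 /\
  exists eta K f Df sg P l B,
  [/\ [/\ 0 < eta, 50 * eta <= r ^+ 2, 0 < K & collar_map r eta K f Df],
      forall x, collar r eta x -> n2 (plane_scale g (f x)) < al,
      [/\ 0 < l, quad_approx l sg P, forall z, 0 <= sg z <= 1 & forall x, collar r eta x ->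
        sg (f x) = step_profile r eta (n2 x) /\ P (f x) = hamiltonian_dir Df (step_slope r eta (n2 x)) x],
      forall z, ~ (exists2 x, collar r (eta / 2) x & f x = z) -> P z = 0 /\ (sg z = 0 \/ sg z = 1) &
      [/\ forall z z' : V, (forall t : R, 0 <= t <= 1 -> ~ (exists2 x, collar r (eta / 2) x & f x = z + t *: (z' - z))) ->
            sg z = sg z',
          forall z : V, B < `|z| -> sg z = 0 & forall z, n2 (plane_scale g z) <= be -> sg z = 1]].
Proof.
move=> r0 /(collar_exists r0) [eta1 [K [f [Df [e10 _ K0 cm1 fU1]]]]].
have r2 : 0 < r ^+ 2 by rewrite exprn_gt0.
(* Rigidity asks for [50 * eta <= r ^+ 2]; this also leaves room between the thresholds 1/90 and
   1/17 and the radii 1/100 and 1/16 of the test functions. *)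
pose eta := Num.min eta1 (r ^+ 2 / 50).
have e1 : eta <= eta1 by rewrite ge_min lexx.
have e50 : 50 * eta <= r ^+ 2.
  have : eta <= r ^+ 2 / 50 by rewrite ge_min lexx orbT.
  lra.
have e0 : 0 < eta by rewrite lt_min e10 /= divr_gt0.
clearbody eta; have cm := collar_map_sub e1 cm1.
have fU x : collar r eta x -> shell (f x) by move=> cx; apply: fU1; exact: collar_sub cx.
have er : eta <= r ^+ 2 / 2 by lra.
have [sg [P [l [B [[l0 qa] sg01 sf [nc seg far] [scs lower upper]]]]]] :=
  sphere_inside hI I1 n1 r0 e0 er K0 cm (step_is_profile r e0).
pose core z := exists2 x, collar r (eta / 2) x & f x = z.
have coreU z : core z -> shell z by move=> [x cx <-]; apply: fU; apply: collar_sub cx; lra.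
have hole z : n2 (plane_scale g z) <= be -> sg z = sg 0.
  move=> hz; apply/esym; apply: seg => t /andP[t0 t1] /coreU.
  rewrite /shell /= add0r subr0 n2_scaleZ => /andP[h _]; have q0 := n2_ge0 (plane_scale g z).
  suff : t ^+ 2 * n2 (plane_scale g z) <= be by rewrite leNgt h.
  by apply: le_trans hz; apply: ler_piMl => //; rewrite expr_le1.
have outside z : al <= n2 (plane_scale g z) -> sg z = 0.
  move=> hz; have zn : 0 < `|z|.
    rewrite normr_gt0; apply/eqP => z0; move: hz.
    by rewrite z0 -(scale0r (0 : V)) n2_scaleZ expr0n mul0r => h; have := be1; have := beal; lra.
  pose s := `|B| / `|z| + 1; have s0 : 0 <= s by rewrite addr_ge0 // divr_ge0.
  rewrite (seg z (z + s *: z)).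
    apply: far; rewrite -{1}[z]scale1r -scalerDl normrZ (ger0_norm (addr_ge0 ler01 s0)).
    have -> : (1 + s) * `|z| = `|B| + 2 * `|z| by rewrite /s; field; rewrite gt_eqF.
    by apply: le_lt_trans (ler_norm B) _; rewrite ltrDl mulr_gt0.
  move=> t /andP[t0 t1]; rewrite [z + s *: z - z]addrC addKr => /coreU.
  rewrite /shell /= plane_scaleD !plane_scaleZ => /andP[_ h].
  by have := n2_ray (plane_scale g z) t0 s0; rewrite leNgt (lt_le_trans h hz).
have zhole : n2 (plane_scale g 0) <= be.
  by rewrite -(scale0r (0 : V)) n2_scaleZ expr0n mul0r; have := be1; lra.
have [_ [sg00|sg01']] : P 0 = 0 /\ (sg 0 = 0 \/ sg 0 = 1).
  by apply: nc => /coreU /andP[h _]; have := lt_le_trans h zhole; rewrite ltxx.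
  (* The region misses the hole, so it lies in the shell and has volume at most [I w < I v]. A ball
     with [r ^+ 2 >= 1 / 90] would contain the support of [v]. *)
  left; rewrite ltNge; apply/negP => rb.
  have h1 : I v <= I sg.
    apply: lower => // [x|x hx]; first by case/andP: (v01 x).
    by rewrite v0 //; lra.
  have [wgcs wgI] := g_int wcs.
  have h2 : I sg <= I w.
    rewrite -wgI; apply: inv_int_le => // z; have /andP[_ s1] := sg01 z.
    have [k1|k1] := leP (n2 (plane_scale g z)) be; first by rewrite (hole z k1) sg00.
    have [k2|k2] := leP al (n2 (plane_scale g z)); first by rewrite outside.
    by rewrite w1 // !ltW.
  by have := le_lt_trans (le_trans h1 h2) wv; rewrite ltxx.
have hole1 z : n2 (plane_scale g z) <= be -> sg z = 1 by move=> /hole ->.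
right; split; last by exists eta, K, f, Df, sg, P, l, B; split=> // x /fU /andP[].
(* The region contains the hole, which has room for [phi] and a disjoint bump [b]. A ball with
   [r ^+ 2 <= 1 / 17] has at most the volume of [phi] alone. *)
rewrite ltNge; apply/negP => rb.
have n0 : (0 < n)%N by exact: ltnW.
have q0 : 0 < 1 / 400 :> R by lra.
have [b [bcs b0 b01 bout]] := small_bump hI I1 n0 q0.
pose phi := @ball_bump R (n * 2) (1 / 16) (1 / 5).
have q15 : 1 / 16 < 1 / 5 :> R by lra.
have pcs : lip_cs phi by apply: ball_bump_lip_cs => //; lra.
have i0 : 'I_(n * 2) by apply: (@Ordinal _ 0); rewrite muln_gt0 n0.
pose c : V := (7 / 10) *: delta_mx 0 i0.
have nc2 : n2 c = 49 / 100 by rewrite n2Z /n2 dot_delta mxE !eqxx mulr1; field.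
pose psi x := phi x + b (x + c).
have bc := lip_cs_tr c bcs; have psics : lip_cs psi by exact: lip_csD.
have psiP x : psi x <= 1 /\ (1 < n2 x -> psi x = 0).
  apply: (@disjoint_bump phi psi b c x) => // y; first exact: ball_bump01.
  by move=> h; exact: ball_bump0.
have [pgcs pgI] := g_int psics.
have k1 : I psi <= I sg.
  rewrite -pgI; apply: inv_int_le => // z; have /andP[s0 _] := sg01 z.
  have [h|h] := leP (n2 (plane_scale g z)) be; first by rewrite hole1 //; case: (psiP (plane_scale g z)).
  by case: (psiP (plane_scale g z)) => _ ->; rewrite ?s0 //; exact: le_lt_trans h.
have k2 : I sg <= I phi.
  apply: upper => // [x|x hx]; first by case/andP: (ball_bump01 (1 / 16) (1 / 5) x).
  by rewrite /phi ball_bump1 //; lra.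
have k3 : I psi = I phi + I b by rewrite /psi inv_intD // inv_int_tr.
lra.
Qed.

Lemma embedded_radius (r : R) : 0 < r -> sphere_embeds r shell -> r ^+ 2 < 1 / 90 \/ 1 / 17 < r ^+ 2.
Proof. by move=> r0 /(sphere_dichotomy r0) [|[]]; [left|right]. Qed.

(** Rigidity excludes the second alternative, since [18 C <= 18 / 400 < 1 / 17 < r ^+ 2]. *)
Lemma embedded_radius_flat (r C : R) (j0 : 'I_n) (mu : 'I_n -> R) : 0 < r -> sphere_embeds r shell ->
  0 < C <= 1 / 400 -> (forall j, 0 < mu j <= 1) -> mu j0 = 1 ->
  (forall z, n2 (plane_scale g z) < al -> n2 (plane_scale mu z) <= C) ->
  (exists2 r1, 0 < r1 & forall z, n2 z <= r1 -> n2 (plane_scale g z) <= be) -> r ^+ 2 < 1 / 90.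
Proof.
move=> r0 hr /andP[C0 C4] mu0 muj0 muC [r1 r10 hr1].
case: (sphere_dichotomy r0 hr) => // -[r17 [eta [K [f [Df [sg [P [l [B
  [[e0 e50 K0 cm] fal [l0 qa sg01 sf] nc [seg far hole1]]]]]]]]]]]; exfalso.
have rC : 18 * C <= r ^+ 2 by lra.
have fC x : collar r eta x -> n2 (plane_scale mu (f x)) <= C by move=> /fal; exact: muC.
pose r2 := Num.min r1 C; have r20 : 0 < r2 <= C by rewrite lt_min r10 C0 ge_min lexx orbT.
have cen z : n2 z <= r2 -> sg z = 1.
  by move=> h; apply: hole1; apply: hr1; apply: le_trans h _; rewrite ge_min lexx.
exact: (@no_surrounding_sphere R n j0 mu C n1 C0 mu0 muj0 r eta K f Df r0 e0 K0 cm rC e50 fC sg P l B r2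
  l0 qa sg01 sf nc seg far r20 cen).
Qed.

End Embeddings.

(** Closures and frontiers of level sets are computed by moving along rays. *)
Lemma nbhs_scale (R : realType) (V : normedModType R) (z : V) (B : set V) : nbhs z B ->
  exists2 d : R, 0 < d & forall t : R, `|t - 1| < d -> B (t *: z).
Proof.
move=> /nbhs_ballP [e /= e0 eB]; have z0 : 0 < `|z| + 1 by rewrite ltr_wpDl.
exists (e / (`|z| + 1)); first by rewrite divr_gt0.
move=> t; rewrite ltr_pdivlMr // => h; apply: eB; rewrite -ball_normE /=.
rewrite -{1}[z]scale1r -scalerBl normrZ distrC; apply: le_lt_trans h.
by apply: ler_wpM2l => //; rewrite lerDl.
Qed.

Section Shell.
Variables (R : realType) (n : nat).
Local Notation V := 'rV[R]_(n * 2).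
Variables (g : 'I_n -> R) (be al : R).
Hypotheses (g0 : forall j, 0 < g j) (be0 : 0 < be) (beal : be < al).
Local Notation N z := (n2 (plane_scale g z)).

Lemma level_scale (a : R) (z : V) : N (a *: z) = a ^+ 2 * N z.
Proof. by rewrite plane_scaleZ n2Z. Qed.

Lemma level_continuous : continuous (fun z : V => N z).
Proof.
have [A hA] : exists A : 'M[R]_(n * 2), forall u, plane_scale g u = u *m A.
  by apply: linear_as_matrix => [u v|a u]; [exact: plane_scaleD|exact: plane_scaleZ].
rewrite (_ : (fun z => _) = fun z : V => n2 (z *m A)); last by apply/funext => z; rewrite hA.
by apply: ct_comp; [exact: mulmx_continuous|exact: n2_continuous].
Qed.

Lemma open_level_lt c : open [set z : V | N z < c].
Proof. by apply: (@open_comp _ _ (fun z : V => N z) [set x | x < c]) => [z _|]; [exact: level_continuous|exact: open_lt]. Qed.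

Lemma open_level_gt c : open [set z : V | c < N z].
Proof. by apply: (@open_comp _ _ (fun z : V => N z) [set x | c < x]) => [z _|]; [exact: level_continuous|exact: open_gt]. Qed.

Lemma closed_level_le c : closed [set z : V | N z <= c].
Proof. by apply: (@closed_comp _ _ (fun z : V => N z) [set x | x <= c]) => [z _|]; [exact: level_continuous|exact: closed_le]. Qed.

Lemma closed_level_ge c : closed [set z : V | c <= N z].
Proof. by apply: (@closed_comp _ _ (fun z : V => N z) [set x | c <= x]) => [z _|]; [exact: level_continuous|exact: closed_ge]. Qed.

Lemma closure_level_lt c : 0 < c -> closure [set z : V | N z < c] = [set z | N z <= c].
Proof.
move=> c0; apply/seteqP; split=> [z h|z /= h B /nbhs_scale [d d0 hd]].
  rewrite ((closure_id _).1 (@closed_level_le c)); apply: closure_subset h => y /=; exact: ltW.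
pose s := Num.min (d / 2) (1 / 2); have s0 : 0 < s by rewrite lt_min; apply/andP; split; lra.
have sd : s < d by rewrite gt_min; apply/orP; left; lra.
have s1 : s <= 1 / 2 by rewrite ge_min lexx orbT.
exists ((1 - s) *: z); split; last by apply: hd; rewrite addrAC subrr add0r normrN gtr0_norm.
have N0 := n2_ge0 (plane_scale g z).
rewrite /= level_scale; move: h N0; move: (n2 _) => q h q0.
have : (1 - s) ^+ 2 * q <= (1 - s) ^+ 2 * c by rewrite ler_wpM2l // sqr_ge0.
move=> h2; apply: le_lt_trans h2 _; rewrite gtr_pMl //.
by have : s * s <= 1 / 2 * s; [rewrite ler_wpM2r // ltW|lra].
Qed.

Lemma shell_open : open (shell g be al).
Proof.
rewrite (_ : shell _ _ _ = [set z | be < N z] `&` [set z | N z < al]); last first.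
  by apply/seteqP; split=> z; [move=> /andP[]|move=> [h1 h2]; apply/andP].
by apply: openI; [exact: open_level_gt|exact: open_level_lt].
Qed.

Lemma frontier_shell : frontier (shell g be al) = [set z | N z = be \/ N z = al].
Proof.
have a0 : 0 < al by exact: lt_trans beal.
rewrite /frontier ((interior_id _).1 shell_open); apply/seteqP; split=> [z [h nz]|z hz].
  have h1 : be <= N z.
    suff : [set z | be <= N z] z by [].
    by rewrite ((closure_id _).1 (@closed_level_ge be)); apply: closure_subset h => y /andP[/ltW].
  have h2 : N z <= al.
    suff : [set z | N z <= al] z by [].
    by rewrite ((closure_id _).1 (@closed_level_le al)); apply: closure_subset h => y /andP[_ /ltW].
  have [e|k1] := eqVneq (N z) be; first by left.
  have [e|k2] := eqVneq (N z) al; first by right.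
  by case: nz; rewrite /shell /= !lt_neqAle h1 h2 k2 eq_sym k1.
split; last by rewrite /shell /= => /andP[h1 h2]; case: hz => e; [move: h1|move: h2]; rewrite e ltxx.
move=> B /nbhs_scale [d d0 hd].
(* Prevents the rescaled point from crossing the other boundary component. *)
pose q := (al - be) / (4 * al); have q0 : 0 < q by rewrite divr_gt0 ?subr_gt0 // mulr_gt0.
pose s := Num.min (d / 2) (Num.min (1 / 2) q).
have s0 : 0 < s by rewrite !lt_min q0 andbT; apply/andP; split; lra.
have sd : s < d by rewrite gt_min; apply/orP; left; lra.
have s1 : s <= 1 / 2 by rewrite !ge_min lexx orbT.
have sq : 4 * (s * al) <= al - be.
  have : s <= q by rewrite !ge_min lexx !orbT.
  by rewrite /q ler_pdivlMr ?mulr_gt0 // => h; lra.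
case: hz => e.
  exists ((1 + s) *: z); split; last by apply: hd; rewrite addrAC subrr add0r gtr0_norm.
  have e' : N ((1 + s) *: z) = (1 + s) ^+ 2 * be by rewrite level_scale e.
  have sb : s * be <= s * al by rewrite ler_wpM2l ?ltW.
  have sb0 : 0 < s * be by rewrite mulr_gt0.
  have ssb : s * (s * be) <= 1 / 2 * (s * be) by rewrite ler_wpM2r // ltW.
  have ssb0 : 0 < s * (s * be) by rewrite mulr_gt0.
  rewrite /shell /= e' (_ : (1 + s) ^+ 2 * be = be + 2 * (s * be) + s * (s * be)); last by ring.
  by apply/andP; split; lra.
exists ((1 - s) *: z); split; last by apply: hd; rewrite addrAC subrr add0r normrN gtr0_norm.
have e' : N ((1 - s) *: z) = (1 - s) ^+ 2 * al by rewrite level_scale e.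
have sa0 : 0 < s * al by rewrite mulr_gt0.
have ssa : s * (s * al) <= 1 / 2 * (s * al) by rewrite ler_wpM2r // ltW.
have ssa0 : 0 < s * (s * al) by rewrite mulr_gt0.
rewrite /shell /= e' (_ : (1 - s) ^+ 2 * al = al - 2 * (s * al) + s * (s * al)); last by ring.
by apply/andP; split; lra.
Qed.

Lemma scale_ellipsoid (a : R) : 0 < a -> scale_set a (ellipsoid (fun j => (g j)^-1)) = [set z : V | N z < a ^+ 2].
Proof.
move=> a0; have a2 : 0 < a ^+ 2 by rewrite exprn_gt0.
have eE z : ellipsoid (fun j => (g j)^-1) z <-> N z < 1.
  rewrite /ellipsoid /= n2_xy (_ : \sum_j _ = \sum_j (xc j (plane_scale g z) ^+ 2 + yc j (plane_scale g z) ^+ 2)) //.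
  by apply: eq_bigr => j _; rewrite xc_plane yc_plane !exprMn -mulrDr exprVn invrK mulrC.
apply/seteqP; split=> [_ [z /eE h <-]|z /= h]; first by rewrite /= level_scale gtr_pMr.
exists (a^-1 *: z); last by rewrite scalerA divff ?gt_eqF // scale1r.
by apply/eE; rewrite level_scale exprVn mulrC ltr_pdivrMr // mul1r.
Qed.

Lemma shell_ellipsoidal : ellipsoidal_shell (shell g be al).
Proof.
have a0 : 0 < al by exact: lt_trans beal.
exists (fun j => (g j)^-1), (Num.sqrt al), (Num.sqrt be).
split=> [j||]; first by rewrite invr_gt0.
  by rewrite sqrtr_gt0 be0 ltr_sqrt.
rewrite !scale_ellipsoid ?sqrtr_gt0 // !sqr_sqrtr ?ltW // closure_level_lt //.
apply/seteqP; split=> [z /andP[h1 h2]|z [h1 h2]]; first by split=> //=; apply/negP; rewrite -ltNge.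
by apply/andP; split=> //; rewrite ltNge; apply/negP.
Qed.

End Shell.

Lemma spheres_family (R : realType) (m : nat) (s1 s2 : R) (lam : R -> 'rV[R]_m) : (0 < m)%N -> 0 < s1 -> s1 < s2 ->
  (forall (e : R) i, 0 < lam e 0 i) ->
  (forall k i, Ck_on k [set: R^o * 'rV[R]_m.-1] (fun p : R^o * 'rV[R]_m.-1 => lam p.1 0 i : R)) ->
  exists (M : closed_manifold R m.-1) (F : R -> M -> 'rV[R]_m), smooth_isotopy F /\
    forall e : R, range (F e) =
      [set z | n2 (\row_i ((lam e 0 i)^-1 * z 0 i)) = s1 ^+ 2 \/ n2 (\row_i ((lam e 0 i)^-1 * z 0 i)) = s2 ^+ 2].
Proof.
case: m lam => // d lam _ s10 s12 l0 lC.
exists (spheres_manifold d s10 s12), (fun e x => stretch lam e (emb x)); split; first exact: spheres_isotopy.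
move=> e; apply/seteqP; split=> [_ [x _ <-]|z hz].
  have := stretchK l0 e (emb x); rewrite /= /shrink => ->; exact: emb_sphere.
have hs : on_spheres s1 s2 (shrink lam e z).
  by rewrite /on_spheres; case: hz => h; apply/orP; [left|right]; apply/eqP.
exists (exist (fun u => on_spheres s1 s2 u) _ hs : {u : 'rV[R]_d.+1 | on_spheres s1 s2 u}) => //.
exact: shrinkK.
Qed.

Section Axis.
Variables (R : realType) (n : nat).
Local Notation V := 'rV[R]_(n * 2).
Implicit Types (i j k : 'I_n) (p : R).

(** These factors multiply the coordinates inside [n2], so the half axes of the ellipsoid are
    proportional to their inverses: [1 / p] in plane [i] and [p] in plane [j]. *)
Definition axis i j p k : R := if k == i then p else if k == j then p^-1 else 1.

Lemma axis_gt0 i j p k : 0 < p -> 0 < axis i j p k.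
Proof. by move=> p0; rewrite /axis; case: ifP => // _; case: ifP => // _; rewrite invr_gt0. Qed.

Lemma axis_inv i j p k : i != j -> p != 0 -> axis j i p k = (axis i j p k)^-1.
Proof.
move=> ij p0; rewrite /axis; have [->|_] := eqVneq k i; first by rewrite (negbTE ij).
by case: ifP => // _; rewrite ?invrK ?invr1.
Qed.

Lemma axis_swap i j p k : i != j -> p != 0 -> axis i j p k * axis i j p (tperm i j k) = 1.
Proof.
move=> ij p0; rewrite /axis; case: tpermP => [->|->|/eqP ki /eqP kj].
- by rewrite eqxx (eq_sym j) (negbTE ij) eqxx divff.
- by rewrite eqxx (eq_sym j) (negbTE ij) eqxx mulVf.
- by rewrite (negbTE ki) (negbTE kj) mulr1.
Qed.

(** Division by [p] brings the factors into the form of the cylinder estimate: at most 1, with value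
    1 in plane [i]. *)
Lemma axis_norm i j p : 1 <= p -> [/\ forall k, 0 < p^-1 * axis i j p k <= 1, p^-1 * axis i j p i = 1 &
  forall z : V, n2 (plane_scale (axis i j p) z) = p ^+ 2 * n2 (plane_scale (fun k => p^-1 * axis i j p k) z)].
Proof.
move=> p1; have p0 : 0 < p by exact: lt_le_trans p1.
have pn : p != 0 by rewrite gt_eqF.
have ip : p^-1 <= 1 by rewrite invf_le1.
split=> [k||z].
- rewrite mulr_gt0 ?invr_gt0 ?axis_gt0 //= mulrC ler_pdivrMr // mul1r /axis.
  by case: ifP => // _; case: ifP => // _; exact: le_trans ip p1.
- by rewrite /axis eqxx mulVf.
- rewrite -n2Z -plane_scaleZ; congr n2; apply: xy_ext => k; rewrite ?xc_plane ?yc_plane ?xcZ ?ycZ; by field.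
Qed.

Lemma axis_level i j p (z : V) : i != j -> 1 <= p ->
  n2 (plane_scale (axis i j p) z) <= p ^+ 2 * n2 z /\ n2 z <= p ^+ 2 * n2 (plane_scale (axis i j p) z).
Proof.
have up i' j' (z' : V) : 1 <= p -> n2 (plane_scale (axis i' j' p) z') <= p ^+ 2 * n2 z'.
  move=> p1; have [mu0 _ ->] := axis_norm i' j' p1; apply: ler_wpM2l; first exact: sqr_ge0.
  exact: n2_plane_le.
move=> ij p1; split; first exact: up.
have p0 : p != 0 by rewrite gt_eqF // (lt_le_trans _ p1).
have := up j i (plane_scale (axis i j p) z) p1; rewrite plane_scaleM plane_scale1 // => k.
by rewrite axis_inv // mulVf // gt_eqF // axis_gt0 // (lt_le_trans _ p1).
Qed.

(** The square keeps the ratio at least 1 for every real parameter, so positivity and smoothness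
    hold without restriction to the interval. The factor 20 makes the shell flat enough at
    [1 / 2]. *)
Definition ratio (e : R) : R := 1 + (20 * e) ^+ 2.

Lemma ratio_ge1 e : 1 <= ratio e.
Proof. by rewrite lerDl sqr_ge0. Qed.

Lemma ratio_gt0 e : 0 < ratio e.
Proof. exact: lt_le_trans ltr01 (ratio_ge1 e). Qed.

Lemma ratio_neq0 e : ratio e != 0.
Proof. by rewrite gt_eqF // ratio_gt0. Qed.

Lemma ratio_half : 40 <= ratio (1 / 2).
Proof. by rewrite /ratio; lra. Qed.

Lemma axis_smooth (W : normedModType R) i j q l :
  Ck_on q [set: R^o * W] (fun x : R^o * W => axis i j (ratio x.1) l : R).
Proof.
have hl : Ck_on q [set: R^o * W] (fun x : R^o * W => 20 * (x.1 : R) : R).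
  by apply: Ck_mul; [exact: openT|exact: Ck_cst|exact: Ck_fst].
have hr : Ck_on q [set: R^o * W] (fun x : R^o * W => ratio x.1 : R).
  by apply: Ck_add; [exact: openT|exact: Ck_cst|apply: Ck_mul; [exact: openT|exact: hl|exact: hl]].
rewrite /axis; case: (l == i) => //; case: (l == j); last exact: Ck_cst.
by apply: Ck_inv => //; [exact: openT|move=> x _; exact: ratio_neq0].
Qed.

End Axis.

Section Capacity.
Variables (R : realType) (n : nat).
Local Notation V := 'rV[R]_(n * 2).

Lemma open_sphere_embeds (r : R) (U : set V) : open U -> sphere r `<=` U -> sphere_embeds r U.
Proof.
move=> oU rU; have d_id (x v : V) : 'd (fun x : V => x) x v = v by rewrite -deriveE ?derive_id.
exists U, (fun x => x); split=> //; split=> //.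
- by move=> k; apply: Ck_rV => // i; exact: Ck_coord.
- by move=> x v _; rewrite d_id.
- split=> //; first by apply: continuous_subspaceT => x; exact: cvg_id.
  by move=> A oA; exists A => //; rewrite !image_id.
- by rewrite image_id.
- by move=> x u v _; rewrite !d_id.
Qed.

Lemma capacity_ge (r : R) (U : set V) : 0 < r -> sphere_embeds r U -> ((pi * r ^+ 2)%:E <= spherical_capacity U)%E.
Proof. by move=> r0 h; apply: ereal_sup_ubound; right; exists r. Qed.

Lemma capacity_le (M : R) (U : set V) : 0 <= M -> (forall r : R, 0 < r -> sphere_embeds r U -> pi * r ^+ 2 <= M) ->
  (spherical_capacity U <= M%:E)%E.
Proof.
move=> M0 h; apply: ge_ereal_sup => _ [->|[r [r0 hr] <-]]; rewrite lee_fin //; exact: h.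
Qed.

End Capacity.

(** The image of the interval would be connected, yet the value [c], which is not attained, splits
    it into two nonempty parts that are open and closed in it. *)
Lemma gap_not_continuous (R : realType) (G : R -> \bar R) (c e1 e2 : R) :
  (forall e, 0 < e < 1 -> (G e < c%:E)%E \/ (c%:E < G e)%E) -> 0 < e1 < 1 -> 0 < e2 < 1 ->
  (G e1 < c%:E)%E -> (c%:E < G e2)%E -> ~ {within `]0, 1[%classic, continuous G}.
Proof.
move=> gap he1 he2 h1 h2 cG; pose A : set R := `]0, 1[%classic.
have cA : connected A by apply/connected_intervalP; exact: interval_is_interval.
have inA e : 0 < e < 1 -> A e by move=> h; rewrite /A /= in_itv.
have C := connected_continuous_connected cA cG.
pose B := G @` A `&` [set y | (y < c%:E)%E].
have BE : B = G @` A.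
  apply: C; first by exists (G e1); split=> //; exists e1 => //; exact: inA.
    by exists [set y | (y < c%:E)%E] => //; exact: open_ereal_lt_ereal.
  exists [set y | (y <= c%:E)%E]; first exact: closed_ereal_ge_ereal.
  apply/seteqP; split=> [y [h3 h4]|y [[e Ae <-] h4]]; split=> //=; first exact: ltW.
    by exists e.
  case: (gap e); first by move: Ae; rewrite /A /= in_itv.
    by [].
  by move=> /lt_le_trans /(_ h4); rewrite ltxx.
have : (G @` A) (G e2) by exists e2 => //; exact: inA.
by rewrite -BE => -[_ /= /lt_trans /(_ h2)]; rewrite ltxx.
Qed.

(** For [p = 1 + t * t] the round sphere fits if [p ^+ 4 < al / be], and [t] is chosen with
    [al / be = 1 + 15 t]; the left side exceeds 1 only to second order in [t]. *)
Lemma quartic_lt (R : realType) (t : R) : 0 < t -> t <= 2 / 15 -> (1 + t * t) ^+ 2 * (1 + t * t) ^+ 2 < 1 + 15 * t.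
Proof.
move=> t0 t1; have h : t * t <= 2 / 15 * t by rewrite ler_wpM2r // ltW.
have h0 : 0 <= t * t by rewrite mulr_ge0 ?ltW.
move: (t * t) h h0 => u h h0; have u1 : u <= 1 by lra.
have k : u * u <= 1 * u by rewrite ler_wpM2r.
have a : (1 + u) ^+ 2 <= 1 + 3 * u by rewrite (_ : _ ^+ 2 = 1 + 2 * u + u * u); [lra|ring].
apply: (@le_lt_trans _ _ ((1 + 3 * u) * (1 + 3 * u))); first by apply: ler_pM; rewrite ?sqr_ge0.
rewrite (_ : _ * _ = 1 + 6 * u + 9 * (u * u)); [lra|ring].
Qed.

Lemma flat_bound (R : realType) (p q al : R) : 40 <= p -> al <= 3 -> p ^+ 2 * q < al -> q <= 1 / 400.
Proof.
move=> p40 al3 h; rewrite leNgt; apply/negP => hq.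
have a : 40 * p <= p * p by rewrite ler_wpM2r // (le_trans _ p40).
have p2 : 0 <= p ^+ 2 - 1600 by lra.
have q0 : 0 <= q by lra.
have := mulr_ge0 p2 q0; lra.
Qed.

Lemma mid_between (R : realType) (x y : R) : x < y -> x < (x + y) / 2 < y.
Proof. by move=> xy; apply/andP; split; lra. Qed.

(* The radius of the round sphere in a shell with almost equal axes. *)
Lemma round_radius (R : realType) (be al : R) : 0 < be -> be < al -> al <= 3 * be -> exists2 e : R, 0 < e < 1 &
  exists2 r : R, 0 < r & [/\ be < r ^+ 2, ratio e ^+ 2 * be < r ^+ 2 & ratio e ^+ 2 * r ^+ 2 < al].
Proof.
move=> be0 beal al3; pose t := (al / be - 1) / 15.
have k1 : 1 < al / be by rewrite ltr_pdivlMr // mul1r.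
have k2 : al / be <= 3 by rewrite ler_pdivrMr.
have t0 : 0 < t by rewrite /t; lra.
have t1 : t <= 2 / 15 by rewrite /t; lra.
have aE : al = be * (1 + 15 * t) by rewrite /t; field; rewrite gt_eqF.
exists (t / 20); first by clear -t0 t1; apply/andP; split; lra.
have pE : ratio (t / 20) = 1 + t * t by rewrite /ratio; field.
have p1 := ratio_ge1 (t / 20); set p := ratio (t / 20) in pE p1 *.
have p2 : 1 <= p ^+ 2 by exact: exprn_ege1.
have p0 : 0 < p ^+ 2 by exact: lt_le_trans p2.
have h : p ^+ 2 * be < al / p ^+ 2.
  by rewrite ltr_pdivlMr // mulrC mulrA aE mulrC ltr_pM2l // pE; exact: quartic_lt.
have /andP[m1 m2] := mid_between h; set q := (_ + _) / 2 in m1 m2.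
have pb : be <= p ^+ 2 * be by apply: ler_peMl => //; exact: ltW.
have bq : be < q by exact: le_lt_trans pb m1.
have q0 : 0 < q by exact: lt_trans bq.
exists (Num.sqrt q); first by rewrite sqrtr_gt0.
by rewrite sqr_sqrtr ?ltW //; split=> //; rewrite mulrC -ltr_pdivlMr.
Qed.

Lemma shell_family_jump (R : realType) (n : nat) (j0 j1 : 'I_n) : (1 < n)%N -> j0 != j1 -> exists be al : R,
  [/\ 0 < be, be < al &
    ~ {within `]0, 1[%classic, continuous (fun e : R => spherical_capacity (shell (axis j0 j1 (ratio e)) be al))}].
Proof.
move=> n1 j01; have [I hI I1] := @inv_int_exists R (n * 2).
have q0 : 0 < 1 / 100 :> R by lra.
have [v [vcs v0 v01 vout]] := small_bump hI I1 (ltnW n1) q0.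
have [be [al [w [be1 /andP[beal al3] wcs w0 [w1 wv]]]]] := thin_annulus hI v0.
have be0 : 0 < be by exact: lt_le_trans be1.
exists be, al; split=> //; pose U (e : R) := shell (axis j0 j1 (ratio e)) be al.
have p0 : 0 < pi :> R by exact: pi_gt0.
have M0 : 0 <= pi / 90 :> R by rewrite divr_ge0 // ltW.
have small (r : R) : r ^+ 2 < 1 / 90 -> pi * r ^+ 2 <= pi / 90.
  by move=> h; rewrite ler_wpM2l ?ltW //; move: h; rewrite div1r.
have Mc : ((pi / 90)%:E < (pi / 40 : R)%:E)%E by rewrite lte_fin; clear -p0; lra.
have big (r : R) : 1 / 17 < r ^+ 2 -> ((pi / 40 : R)%:E < (pi * r ^+ 2)%:E)%E.
  by move=> h; rewrite lte_fin ltr_pM2l //; clear -h; lra.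
have half : 0 < (1 / 2 : R) < 1 by apply/andP; split; clear; lra.
have c400 : 0 < (1 / 400 : R) <= 1 / 400 by rewrite lexx andbT; clear; lra.
have g_int (e : R) := swap_scale_int hI I1 (fun k => axis_swap k j01 (ratio_neq0 e)).
have b1 : 1 < (17 : R) by rewrite ltr1n.
have i17 : 1 / 17 < 1 :> R by rewrite ltr_pdivrMr // mul1r.
have al3b : al <= 3 * be by apply: le_trans al3 _; rewrite -[leLHS]mulr1 ler_wpM2l.
have [e2 he2 [r r0 [rbe rlow rup]]] := round_radius be0 beal al3b.
apply: (@gap_not_continuous _ _ (pi / 40) (1 / 2) e2) => //.
- move=> e _; have [[r' [r'0 hr r17]]|no] := pselect (exists r : R, [/\ 0 < r, sphere_embeds r (U e) & 1 / 17 < r ^+ 2]).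
    by right; apply: lt_le_trans (capacity_ge r'0 hr); exact: big.
  left; apply: le_lt_trans Mc; apply: capacity_le => // r' r'0 hr; apply: small.
  case: (embedded_radius hI I1 (g_int e) n1 be1 beal wcs w0 w1 vcs v01 vout wv r'0 hr) => // h.
  by case: no; exists r'.
- apply: le_lt_trans Mc; apply: capacity_le => // r' r'0 hr; apply: small.
  have [mu0 muj0 muE] := @axis_norm R n j0 j1 _ (@ratio_ge1 R (1 / 2)).
  have h40 := @ratio_half R.
  have sq0 : 0 < ratio (1 / 2) ^+ 2 :> R by rewrite exprn_gt0 // ratio_gt0.
  apply: (embedded_radius_flat hI I1 (g_int (1 / 2)) n1 be1 beal wcs w0 w1 vcs v01 vout wv r'0 hr c400 mu0 muj0).
    by move=> z; rewrite muE; exact: flat_bound h40 al3.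
  exists (ratio (1 / 2) ^+ 2)^-1; first by rewrite invr_gt0.
  move=> z hz; rewrite muE; apply: le_trans be1.
  rewrite -[leRHS](divff (lt0r_neq0 sq0)) ler_pM2l //; exact: le_trans (n2_plane_le mu0 z) hz.
- have emb : sphere_embeds r (U e2).
    apply: open_sphere_embeds => [|z]; first exact: shell_open.
    rewrite /sphere /= -n2_xy => zr; have [k1 k2] := axis_level z j01 (ratio_ge1 e2); rewrite zr in k1 k2.
    have p2 : 0 < ratio e2 ^+ 2 by rewrite exprn_gt0 // ratio_gt0.
    apply/andP; split; last exact: le_lt_trans k1 rup.
    by rewrite -(ltr_pM2l p2); exact: lt_le_trans rlow k2.
  by apply: lt_le_trans (capacity_ge r0 emb); apply: big; exact: lt_trans i17 (le_lt_trans be1 rbe).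
Qed.

Theorem theorem1p1 (R : realType) (n : nat) (hn : (2 <= n)%N) :
  exists U : R -> set 'rV[R]_(n * 2),
    [/\ forall e : R, 0 < e < 1 -> ellipsoidal_shell (U e),
        smooth_domain_family U &
        ~ {within `]0, 1[%classic,
             continuous (fun e : R => spherical_capacity (U e))}].
Proof.
pose j0 : 'I_n := Ordinal (ltnW hn); pose j1 : 'I_n := Ordinal hn.
have j01 : j0 != j1 by [].
have [be [al [be0 beal jump]]] := @shell_family_jump R n j0 j1 hn j01.
pose p := @ratio R; have p0 := @ratio_gt0 R.
have a0 : 0 < al by exact: lt_trans beal.
exists (fun e => shell (axis j0 j1 (p e)) be al); split=> // [e _|].
  by apply: shell_ellipsoidal => // j; exact: axis_gt0.
(* [axis j1 j0] is inverse to [axis j0 j1], so [lam] maps the round spheres onto the boundary of the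
   shell. *)
pose lam (e : R) : 'rV[R]_(n * 2) := of_xy (axis j1 j0 (p e)) (axis j1 j0 (p e)).
have s10 : 0 < Num.sqrt be by rewrite sqrtr_gt0.
have s12 : Num.sqrt be < Num.sqrt al by rewrite ltr_sqrt.
have n20 : (0 < n * 2)%N by rewrite muln_gt0 (ltnW hn).
have l0 (e : R) i : 0 < lam e 0 i by case/mxvec_indexP: i => j b; rewrite of_xyE axis_gt0.
have lC k i : Ck_on k [set: R^o * 'rV[R]_(n * 2).-1] (fun q : R^o * 'rV[R]_(n * 2).-1 => lam q.1 0 i : R).
  case/mxvec_indexP: i => j b; rewrite (_ : (fun q => _) = fun q : R^o * 'rV[R]_(n * 2).-1 => axis j1 j0 (ratio q.1) j : R).
    exact: axis_smooth.
  by apply/funext => q; rewrite of_xyE.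
have [M [F [iso rF]]] := spheres_family n20 s10 s12 l0 lC.
exists M, F; split=> // e _; rewrite rF frontier_shell // ?sqr_sqrtr ?ltW //.
have E (z : 'rV[R]_(n * 2)) : \row_i ((lam e 0 i)^-1 * z 0 i) = plane_scale (axis j0 j1 (p e)) z.
  apply/rowP => i; rewrite !mxE; case/mxvec_indexP: i => j b.
  by rewrite !of_xyE axis_inv ?invrK // gt_eqF.
by apply/seteqP; split=> z; rewrite /= E.
Qed.
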